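(* Let $\theta$ be irrational, $h=h^*\in C^\infty(\mathbb T^2_\theta)$, $k=e^h$, $a=a^*\in C^\infty(\mathbb T^2_\theta)$, $j\in\mathbb R$, and let $T$ be a smooth function on $(0,\infty)$. Then $$\delta_a\,\varphi_0\Big(k^j\sum_{l=1}^2T(\mathbf y)(\nabla_lk)\,\nabla_lk\Big)=\varphi_0\Big(\delta_a(k)\,k^j\,\mathrm I(T;j)(\mathbf y)\Big(\sum_l\nabla_l^2k\Big)\Big)+\varphi_0\Big(\delta_a(k)\,k^{j-1}\sum_{l}\mathrm{II}(T;j)(\mathbf y_1,\mathbf y_2)(\nabla_lk\cdot\nabla_lk)\Big),$$ where $\mathrm I(T;j)(u)=-T(u)-u^jT(u^{-1})$ and $\mathrm{II}=\sum_{\beta=1}^4\mathrm{II}^{(\beta)}$ with $$\mathrm{II}^{(1)}(T;j)(u,v)=T(u)\frac{(uv)^j-1}{uv-1},$$ $$\mathrm{II}^{(2)}(T;j)(u,v)=\frac{u^{j-1}(T(u^{-1})-T(v))}{u^{-1}-v}-\frac{u(uv)^{j-1}(T(v^{-1})-T(u))}{v^{-1}-u},$$ $$\mathrm{II}^{(3)}(T;j)(u,v)=-\frac{(u^j-1)T(v)}{u-1}+\frac{v(T(uv)-T(v))}{uv-v}-\frac{T(uv)-T(u)}{uv-u},$$ $$\mathrm{II}^{(4)}(T;j)(u,v)=-\frac{(u^j-1)v^jT(v^{-1})}{u-1}-\frac{(uv)^jT((uv)^{-1})-u^jT(u^{-1})}{uv-u}+\frac{v\big((uv)^jT((uv)^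{-1})-v^jT(v^{-1})\big)}{uv-v}.$$
   Context: $C^\infty(\mathbb T^2_\theta)$ is the smooth noncommutative two-torus with canonical trace $\varphi_0$ and basic derivations $\nabla_1,\nabla_2$ (components of the flat connection $\nabla$). Variation: $k_\varepsilon=e^{h+\varepsilon a}$, $\delta_a=\frac{d}{d\varepsilon}|_{\varepsilon=0}$; on the left side both $k$ and the modular operator depend on $\varepsilon$. Modular operator: $\mathbf y(\rho)=k^{-1}\rho k$; $\mathbf y_1,\mathbf y_2$ act on the first, second factor of a product. Functional calculus: if $K(e^{x_1},\dots,e^{x_n})=\int_{\mathbb R^n}\beta(\xi)e^{-i\sum x_j\xi_j}d\xi$, then $K(\mathbf y_1,\dots,\mathbf y_n)(\rho_1\cdots\rho_n)=\int\beta(\xi)\,\mathbf y^{-i\xi_1}(\rho_1)\cdots\mathbf y^{-i\xi_n}(\rho_n)d\xi$, with $\mathbf y^{-i\xi}(\rho)=k^{i\xi}\rho k^{-i\xi}$. For $K$ smooth on $(0,\infty)^n$, one first replaces $K(e^{x_1},\dots,e^{x_n})$ by a Schwartz function agreeing with it near $[-2\|h\|,2\|h\|]^n$; the result is independent of this choice. Quotients in the $\mathrm{II}^{(\beta)}$ are extended smoothly where a denominator vanishes. *)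

(* Defs.v *)
From HB Require Import structures.
From mathcomp Require Import all_boot all_order all_algebra.
From mathcomp Require Import all_classical all_reals all_analysis.
From mathcomp Require Import complex.

Set Implicit Arguments.
Unset Strict Implicit.
Unset Printing Implicit Defensive.

Import Order.TTheory GRing.Theory Num.Theory.
Import numFieldNormedType.Exports.

Local Open Scope classical_set_scope.
Local Open Scope ring_scope.
Local Open Scope complex_scope.

(** * Analysis of complex-valued functions *)

(* The library's limits, derivatives and integrals used here are real-valued;
   they are applied to the real and imaginary parts separately. *)
Definition by_parts (R : realType) (X : Type) (L : (X -> R) -> R)
    (f : X -> R[i]) : R[i] :=
  L (fun x => complex.Re (f x)) +i* L (fun x => complex.Im (f x)).

Definition clim (R : realType) (u : nat -> R[i]) : R[i] :=
  by_parts (fun v : nat -> R => limn v) u.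

Definition cderive (R : realType) (f : R -> R[i]) (x : R) : R[i] :=
  by_parts (fun g : R -> R => derive1 g x) f.

Definition is_cderive (R : realType) (f : R -> R[i]) (x : R) (l : R[i]) : Prop :=
  is_derive x (1 : R) (fun t => complex.Re (f t)) (complex.Re l) /\
  is_derive x (1 : R) (fun t => complex.Im (f t)) (complex.Im l).

Definition cint1 (R : realType) (f : R -> R[i]) : R[i] :=
  by_parts (fun g : R -> R => \int[lebesgue_measure]_x g x) f.

Definition cint2 (R : realType) (f : R * R -> R[i]) : R[i] :=
  by_parts (fun g : R * R -> R =>
    \int[(lebesgue_measure \x lebesgue_measure)%E]_z g z) f.

(* e^{it} *)
Definition expi (R : realType) (t : R) : R[i] := cos t +i* sin t.

Definition iter_derive (R : realType) (V : normedModType R) (f : V -> R)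
    (vs : seq V) : V -> R :=
  foldr (fun v g => 'D_v g) f vs.

(* C^oo on an open set A; used with V = R and V = R * R. *)
Definition smooth_on (R : realType) (V : normedModType R) (A : set V)
    (f : V -> R[i]) : Prop :=
  forall (vs : seq V) (x : V), A x ->
    differentiable (iter_derive (fun y => complex.Re (f y)) vs) x /\
    differentiable (iter_derive (fun y => complex.Im (f y)) vs) x.

Definition schwartz (R : realType) (V : normedModType R) (f : V -> R[i]) : Prop :=
  smooth_on setT f /\
  forall (p : nat) (vs : seq V), exists M : R, forall x : V,
    `|x| ^+ p * `|iter_derive (fun y => complex.Re (f y)) vs x| <= M /\
    `|x| ^+ p * `|iter_derive (fun y => complex.Im (f y)) vs x| <= M.

(** * The smooth noncommutative two-torus *)

(* A family a : int * int -> R[i] stands for \sum_(m, n) a (m, n) U^m V^n,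
   where U, V are unitaries with V U = e^{2 pi i theta} U V. *)
Notation nctorus R := (int * int -> R[i]) (only parsing).

(* C^oo(T^2_theta): rapidly decreasing coefficients. The operations below are
   total functions on all families; the infinite sums defining them converge
   absolutely on rapidly decreasing ones. *)
Definition nc_smooth (R : realType) (a : nctorus R) : Prop :=
  forall p : nat, exists M : R, forall m n : int,
    (1 + `|m| + `|n|)%:~R ^+ p * complex.Re `|a (m, n)| <= M.

(* Sum over Z^2, as a limit of sums over the boxes [-N, N]^2. *)
Definition sumZ2 (R : realType) (f : int * int -> R[i]) : R[i] :=
  clim (fun N : nat => \sum_(m < N.*2.+1) \sum_(n < N.*2.+1)
    f (m%:Z - N%:Z, n%:Z - N%:Z)).

(* V^n U^m = nc_phase theta (n * m) U^m V^n *)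
Definition nc_phase (R : realType) (theta : R) (q : int) : R[i] :=
  expi (2 * pi * theta * q%:~R).

Definition nc_mul (R : realType) (theta : R) (a b : nctorus R) : nctorus R :=
  fun r => sumZ2 (fun m =>
    nc_phase theta (m.2 * (r.1 - m.1)) * a m * b (r.1 - m.1, r.2 - m.2)).

Notation "a **[ theta ] b" := (nc_mul theta a b)
  (at level 40, left associativity, format "a  **[ theta ]  b") : ring_scope.

Definition nc_one (R : realType) : nctorus R :=
  fun r => if r == (0, 0) then 1 else 0.

(* (c U^m V^n)^* = conj(c) V^(-n) U^(-m) *)
Definition nc_star (R : realType) (theta : R) (a : nctorus R) : nctorus R :=
  fun r => nc_phase theta (r.1 * r.2) * (a (- r.1, - r.2))^*.

(* canonical trace *)
Definition phi0 (R : realType) (a : nctorus R) : R[i] := a (0, 0).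

(* Normalized by nabla_1 U = i U, nabla_2 V = i V (so nabla_l is the analogue of
   d/dx_l, and commutes with the involution). *)
Definition nabla (R : realType) (l : 'I_2) (a : nctorus R) : nctorus R :=
  fun r => 'i * (if l == ord0 then r.1 else r.2)%:~R * a r.

(* Exponential series, summed coefficientwise. *)
Definition nc_exp (R : realType) (theta : R) (a : nctorus R) : nctorus R :=
  fun r => clim (fun N => \sum_(n < N)
    (n`!%:R)^-1 * iter n (nc_mul theta a) (nc_one R) r).

(* k^z for k = e^h *)
Definition nc_pow (R : realType) (theta : R) (h : nctorus R) (z : R[i]) :
    nctorus R :=
  nc_exp theta (z *: h).

(* C*-norm: the operator norm of left multiplication on the L^2-space of phi0,
   in which the smooth elements are dense. *)
Definition nc_norm2 (R : realType) (theta : R) (a : nctorus R) : R :=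
  Num.sqrt (complex.Re (phi0 (nc_star theta a **[theta] a))).

Definition nc_norm (R : realType) (theta : R) (a : nctorus R) : R :=
  sup [set nc_norm2 theta (a **[theta] x) |
        x in [set x : nctorus R | nc_smooth x /\ nc_norm2 theta x <= 1]].

(** * Modular functional calculus for k = e^h *)

(* y^(-i xi) (rho) = k^(i xi) rho k^(-i xi) *)
Definition ymod (R : realType) (theta : R) (h : nctorus R) (xi : R)
    (rho : nctorus R) : nctorus R :=
  nc_pow theta h (0 +i* xi) **[theta] rho **[theta] nc_pow theta h (0 +i* (- xi)).

(* r is a value of K(y)(rho): f is a Schwartz function agreeing with
   x |-> K (e^x) on a neighbourhood of [-2 |h|, 2 |h|], f is the Fourier integral
   of beta, and the torus-valued integral is taken coefficientwise. *)
Definition fcalc1_spec (R : realType) (theta : R) (h : nctorus R)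
    (K : R -> R[i]) (rho r : nctorus R) : Prop :=
  exists (f beta : R -> R[i]),
    [/\ schwartz f, schwartz beta,
        exists2 e : R, 0 < e & forall x : R,
          `|x| < 2 * nc_norm theta h + e -> f x = K (expR x),
        forall x : R, f x = cint1 (fun xi => beta xi * expi (- (x * xi))) &
        r = fun p => cint1 (fun xi => beta xi * ymod theta h xi rho p)].

Definition fcalc2_spec (R : realType) (theta : R) (h : nctorus R)
    (K : R -> R -> R[i]) (rho1 rho2 r : nctorus R) : Prop :=
  exists (f beta : R * R -> R[i]),
    [/\ schwartz f, schwartz beta,
        exists2 e : R, 0 < e & forall x : R * R,
          `|x.1| < 2 * nc_norm theta h + e ->
          `|x.2| < 2 * nc_norm theta h + e -> f x = K (expR x.1) (expR x.2),
        forall x : R * R, f x =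
          cint2 (fun xi => beta xi * expi (- (x.1 * xi.1 + x.2 * xi.2))) &
        r = fun p => cint2 (fun xi => beta xi *
          (ymod theta h xi.1 rho1 **[theta] ymod theta h xi.2 rho2) p)].

(* K(y)(rho) and K(y_1, y_2)(rho1 rho2): the value does not depend on the choice
   of f and beta. *)
Definition fcalc1 (R : realType) (theta : R) (h : nctorus R)
    (K : R -> R[i]) (rho : nctorus R) : nctorus R :=
  xget (0 : nctorus R) [set r | fcalc1_spec theta h K rho r].

Definition fcalc2 (R : realType) (theta : R) (h : nctorus R)
    (K : R -> R -> R[i]) (rho1 rho2 : nctorus R) : nctorus R :=
  xget (0 : nctorus R) [set r | fcalc2_spec theta h K rho1 rho2 r].

(* delta_a F, at the point h, for a functional F of h; k depends on h as e^h. *)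
Definition is_variation (R : realType) (h a : nctorus R)
    (F : nctorus R -> R[i]) (l : R[i]) : Prop :=
  is_cderive (fun eps : R => F (h + eps%:C *: a)) 0 l.

(* delta_a(k), coefficientwise *)
Definition delta_k (R : realType) (theta : R) (h a : nctorus R) : nctorus R :=
  fun p => cderive (fun eps : R => nc_exp theta (h + eps%:C *: a) p) 0.

(** * The functions I and II *)

Definition cpow (R : realType) (j u : R) : R[i] := (u `^ j)%:C.

(* The quotient (g x - g y) / (x - y), extended to x = y by its limit there,
   g' x; for smooth g this is the smooth extension. *)
Definition dquot (R : realType) (g : R -> R[i]) (x y : R) : R[i] :=
  if x == y then cderive g x else (g x - g y) / (x - y)%:C.

(* u^j T(u^-1) *)
Definition twist (R : realType) (T : R -> R[i]) (j u : R) : R[i] :=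
  cpow j u * T u^-1.

Definition Ifun (R : realType) (T : R -> R[i]) (j u : R) : R[i] :=
  - T u - cpow j u * T u^-1.

(* (uv)^j - 1 and u^j - 1 are read as differences of values of cpow j,
   since 1 `^ j = 1. *)
Definition II1 (R : realType) (T : R -> R[i]) (j u v : R) : R[i] :=
  T u * dquot (cpow j) (u * v) 1.

Definition II2 (R : realType) (T : R -> R[i]) (j u v : R) : R[i] :=
  cpow (j - 1) u * dquot T u^-1 v
  - u%:C * cpow (j - 1) (u * v) * dquot T v^-1 u.

Definition II3 (R : realType) (T : R -> R[i]) (j u v : R) : R[i] :=
  - (dquot (cpow j) u 1 * T v)
  + v%:C * dquot T (u * v) v
  - dquot T (u * v) u.

Definition II4 (R : realType) (T : R -> R[i]) (j u v : R) : R[i] :=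
  - (dquot (cpow j) u 1 * cpow j v * T v^-1)
  - dquot (twist T j) (u * v) u
  + v%:C * dquot (twist T j) (u * v) v.

Definition IIfun (R : realType) (T : R -> R[i]) (j u v : R) : R[i] :=
  II1 T j u v + II2 T j u v + II3 T j u v + II4 T j u v.

(* Main.v *)
Require Import Defs.
From HB Require Import structures.
From mathcomp Require Import all_boot all_order all_algebra.
From mathcomp Require Import all_classical all_reals all_analysis.
From mathcomp Require Import complex.
From mathcomp Require Import ring lra zify measurable_realfun.

Set Implicit Arguments.
Unset Strict Implicit.
Unset Printing Implicit Defensive.

Import Order.TTheory GRing.Theory Num.Theory.
Import numFieldNormedType.Exports.

Local Open Scope classical_set_scope.
Local Open Scope ring_scope.
Local Open Scope complex_scope.

(* Expanding T in a Fourier integral turns the functional into an integral over xi of traces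
   phi0 (k^(j + i xi) nabla_l k k^(- i xi) nabla_l k). Their variations and derivatives are given by
   Duhamel's formula, and integration by parts isolates delta_a(k). All terms then have the form
   phi0 (f (x0, x1, x2) (a, b, b')), where x0, x1, x2 stand for h in the three gaps between a, b, b'
   and f is a product of divided differences of exponentials, so that it suffices to compare the
   functions f. To make sense of f, replace e^(z h) in the gaps by Bernstein approximations
   supported on finite grids: the traces are limits of finite sums over grid points. Three different
   radii are used for the three gaps, so that the grids are disjoint and the functions f have to be
   compared at distinct points only, where the identity is rational in k and T.
   The same argument shows that K(y)(rho) does not depend on the choices in its definition. *)

(** * Complex numbers *)

(** The obstacle is growth in $\xi$. The amplitudes are Schwartz functions, which absorb polynomial
    but not exponential growth, whereas the power series only bounds $k^{i\xi}$ by
    $\exp(|\xi|\,\|h\|)$ in the norms of the smooth algebra. Better bounds come from the $L^2$ side: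
    for $c\ge\|h\|$ the elements $(c\pm h)/2c$ are positive and commute, so the approximations of
    $e^{zh}$ have operator norm at most $e^{c|\mathrm{Re}\,z|}$, whatever the imaginary part of $z$.
    A Duhamel factor then costs only one power of $|\xi|$. This is why the estimates are made on
    traces, with three gaps closed up by cyclicity; values of the functional calculus are treated
    coefficientwise, a coefficient being itself a trace. The radii can be chosen as close to $\|h\|$
    as desired, so that differences of grid points stay where the Schwartz function agrees with the
    symbol. That such a representation of the symbols exists follows from Fourier inversion for
    smooth functions of compact support. The diagonal values of the quotients in II enter only
    there, through the smoothness of the symbol. *)

Section Complex.
Context {R : realType}.
Implicit Types (z w : R[i]) (x y : R) (u v : nat -> R[i]).

(** The norm on [R[i]] takes values in [R[i]]; limits and integrals need it as an element of [R]. *)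
Definition cabs (z : R[i]) : R := complex.Re `|z|.

Lemma cabsE z : `|z| = (cabs z)%:C.
Proof. by case: z. Qed.

Lemma cabs_ge0 z : 0 <= cabs z.
Proof. by case: z => a b; rewrite /cabs /= sqrtr_ge0. Qed.

Lemma cabsM z w : cabs (z * w) = cabs z * cabs w.
Proof. by apply: complexI; rewrite rmorphM -!cabsE normrM. Qed.

Lemma cabsD z w : cabs (z + w) <= cabs z + cabs w.
Proof. by rewrite -lecR rmorphD -!cabsE ler_normD. Qed.

Lemma cabsN z : cabs (- z) = cabs z.
Proof. by rewrite /cabs normrN. Qed.

Lemma cabsB z w : cabs (z - w) <= cabs z + cabs w.
Proof. by rewrite -(cabsN w) cabsD. Qed.

Lemma cabs0 : cabs 0 = 0 :> R.
Proof. by rewrite /cabs normr0. Qed.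

Lemma cabs1 : cabs 1 = 1 :> R.
Proof. by rewrite /cabs normr1. Qed.

Lemma cabs0_eq0 z : cabs z = 0 -> z = 0.
Proof. by move=> z0; apply/eqP; rewrite -normr_eq0 cabsE z0. Qed.

Lemma cabs_le0 z : cabs z <= 0 -> z = 0.
Proof. by move=> z0; apply: cabs0_eq0; apply/eqP; rewrite eq_le z0 cabs_ge0. Qed.

Lemma cabsX z n : cabs (z ^+ n) = cabs z ^+ n.
Proof. by elim: n => [|n IH]; rewrite ?expr0 ?cabs1// !exprS cabsM IH. Qed.

Lemma cabs_real x : cabs x%:C = `|x|.
Proof. by rewrite /cabs /= expr0n /= addr0 sqrtr_sqr. Qed.

Lemma cabs_nat n : cabs n%:R = n%:R :> R.
Proof.
by rewrite (_ : n%:R = (n%:R : R)%:C) ?cabs_real ?ger0_norm ?ler0n// rmorph_nat.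
Qed.

Lemma cabsV z : cabs z^-1 = (cabs z)^-1.
Proof. by apply: complexI; rewrite fmorphV -!cabsE normfV. Qed.

Lemma cabs_conj z : cabs (z^*)%C = cabs z.
Proof. by case: z => a b; rewrite /cabs /= sqrrN. Qed.

Lemma cabs_sqr z : cabs z ^+ 2 = complex.Re z ^+ 2 + complex.Im z ^+ 2.
Proof. by case: z => a b; rewrite /cabs /= sqr_sqrtr// addr_ge0 ?sqr_ge0. Qed.

Lemma Re_le_cabs z : `|complex.Re z| <= cabs z.
Proof.
rewrite -(@ler_pXn2r _ 2) ?nnegrE ?cabs_ge0// cabs_sqr real_normK ?num_real//.
by rewrite lerDl sqr_ge0.
Qed.

Lemma Im_le_cabs z : `|complex.Im z| <= cabs z.
Proof.
rewrite -(@ler_pXn2r _ 2) ?nnegrE ?cabs_ge0// cabs_sqr real_normK ?num_real//.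
by rewrite lerDr sqr_ge0.
Qed.

Lemma cabs_le_ReIm z : cabs z <= `|complex.Re z| + `|complex.Im z|.
Proof.
rewrite -(@ler_pXn2r _ 2) ?nnegrE ?cabs_ge0 ?addr_ge0// cabs_sqr sqrrD.
rewrite !real_normK ?num_real// -addrA lerD2l lerDr.
by rewrite mulrn_wge0// mulr_ge0.
Qed.

Lemma cabs_sum (I : Type) (s : seq I) (P : pred I) (f : I -> R[i]) :
  cabs (\sum_(i <- s | P i) f i) <= \sum_(i <- s | P i) cabs (f i).
Proof.
elim/big_ind2: _ => [|z x w y zx wy|//]; first by rewrite cabs0.
exact: le_trans (cabsD _ _) (lerD zx wy).
Qed.

Lemma Re_add z w : complex.Re (z + w) = complex.Re z + complex.Re w.
Proof. by case: z; case: w. Qed.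
Lemma Im_add z w : complex.Im (z + w) = complex.Im z + complex.Im w.
Proof. by case: z; case: w. Qed.
Lemma Re_opp z : complex.Re (- z) = - complex.Re z.
Proof. by case: z. Qed.
Lemma Im_opp z : complex.Im (- z) = - complex.Im z.
Proof. by case: z. Qed.
Lemma Re_mul z w :
  complex.Re (z * w) = complex.Re z * complex.Re w - complex.Im z * complex.Im w.
Proof. by case: z; case: w. Qed.
Lemma Im_mul z w :
  complex.Im (z * w) = complex.Re z * complex.Im w + complex.Im z * complex.Re w.
Proof. by case: z; case: w. Qed.
Lemma Re_sum (I : Type) (s : seq I) (P : pred I) (f : I -> R[i]) :
  complex.Re (\sum_(i <- s | P i) f i) = \sum_(i <- s | P i) complex.Re (f i).
Proof. by elim/big_ind2: _ => // ? ? ? ? <- <-; rewrite Re_add. Qed.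
Lemma Im_sum (I : Type) (s : seq I) (P : pred I) (f : I -> R[i]) :
  complex.Im (\sum_(i <- s | P i) f i) = \sum_(i <- s | P i) complex.Im (f i).
Proof. by elim/big_ind2: _ => // ? ? ? ? <- <-; rewrite Im_add. Qed.
Lemma complex_eq z w :
  complex.Re z = complex.Re w -> complex.Im z = complex.Im w -> z = w.
Proof. by case: z; case: w => /= a b c d -> ->. Qed.
Lemma Re_real x z : complex.Re (x%:C * z) = x * complex.Re z.
Proof. by rewrite Re_mul /= mul0r subr0. Qed.
Lemma Im_real x z : complex.Im (x%:C * z) = x * complex.Im z.
Proof. by rewrite Im_mul /= mul0r addr0. Qed.

(** Convergence by parts, so that the limit is the value of [clim]. *)
Definition ccvg (u : nat -> R[i]) (l : R[i]) : Prop :=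
  (complex.Re (u n) @[n --> \oo] --> complex.Re l) /\
  (complex.Im (u n) @[n --> \oo] --> complex.Im l).

Lemma ccvg_clim u l : ccvg u l -> clim u = l.
Proof.
move=> [ur ui]; rewrite /clim /by_parts.
by rewrite (cvg_lim _ ur)// (cvg_lim _ ui)//; case: l {ur ui}.
Qed.

Lemma ccvg_unique u l l' : ccvg u l -> ccvg u l' -> l = l'.
Proof. by move=> /ccvg_clim <- /ccvg_clim <-. Qed.

Lemma ccvg_eq u v l : u =1 v -> ccvg u l -> ccvg v l.
Proof. by move=> /funext ->. Qed.

Lemma ccvgD u v l k : ccvg u l -> ccvg v k -> ccvg (fun n => u n + v n) (l + k).
Proof.
move=> [ur ui] [vr vi]; split; rewrite ?Re_add ?Im_add.
- by under eq_fun do rewrite Re_add; exact: cvgD.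
- by under eq_fun do rewrite Im_add; exact: cvgD.
Qed.

Lemma ccvgM u v l k : ccvg u l -> ccvg v k -> ccvg (fun n => u n * v n) (l * k).
Proof.
move=> [ur ui] [vr vi]; split; rewrite ?Re_mul ?Im_mul.
- under eq_fun do rewrite Re_mul; apply: cvgB; exact: cvgM.
- under eq_fun do rewrite Im_mul; apply: cvgD; exact: cvgM.
Qed.

Lemma ccvg_cst l : ccvg (fun=> l) l.
Proof. by split; exact: cvg_cst. Qed.

Lemma ccvgMl z u l : ccvg u l -> ccvg (fun n => z * u n) (z * l).
Proof. by move=> ul; apply: ccvgM => //; exact: ccvg_cst. Qed.

Lemma ccvgB u v l k : ccvg u l -> ccvg v k -> ccvg (fun n => u n - v n) (l - k).
Proof.
move=> ul vk; rewrite -(mulN1r k); apply: ccvg_eq (ccvgD ul (ccvgMl (-1) vk)) => n.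
by rewrite mulN1r.
Qed.

Lemma ccvg_cabs u l : ccvg u l -> cabs (u n) @[n --> \oo] --> cabs l.
Proof.
move=> [ur ui].
have E z : cabs z = Num.sqrt (complex.Re z ^+ 2 + complex.Im z ^+ 2).
  by rewrite -cabs_sqr sqrtr_sqr ger0_norm ?cabs_ge0.
rewrite E; under eq_fun do rewrite E.
apply: continuous_cvg; first exact: sqrt_continuous.
by apply: cvgD; under eq_fun do rewrite expr2; rewrite expr2; apply: cvgM.
Qed.

Lemma ccvg_le u l M : ccvg u l -> (forall n, cabs (u n) <= M) -> cabs l <= M.
Proof.
move=> /ccvg_cabs ul uM; rewrite -(cvg_lim _ ul)//.
by apply: limr_le; [exact: cvgP ul | exact: nearW].
Qed.

Lemma ccvg_squeeze u l (e : nat -> R) :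
  (forall n, cabs (u n - l) <= e n) -> e n @[n --> \oo] --> 0 -> ccvg u l.
Proof.
move=> ue e0.
have sq (a : nat -> R) : (forall n, `|a n| <= e n) -> a n @[n --> \oo] --> 0.
  move=> ae; apply/norm_cvg0P.
  apply: (@squeeze_cvgr _ _ _ _ (fun=> 0) e) => //; last exact: cvg_cst.
  by apply: nearW => n; rewrite ae normr_ge0.
split.
- apply/subr_cvg0; apply: sq => n.
  by rewrite -Re_opp -Re_add (le_trans (Re_le_cabs _)).
- apply/subr_cvg0; apply: sq => n.
  by rewrite -Im_opp -Im_add (le_trans (Im_le_cabs _)).
Qed.

End Complex.

(** * Sums over Z^2 *)

Section Sums.
Context {R : realType}.
Local Notation Z2 := (int * int)%type.
Implicit Types (u v : Z2 -> R) (f g : Z2 -> R[i]) (s t : seq Z2) (M : R).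

(** Summability of nonnegative families is expressed by a bound on all finite subsums without
    repetition: no order of summation enters, and reindexing is harmless. *)
Definition sbnd u M : Prop := forall s, uniq s -> \sum_(m <- s) u m <= M.

Lemma sbnd_ge0 u M : sbnd u M -> 0 <= M.
Proof. by move=> /(_ [::] isT); rewrite big_nil. Qed.

Lemma sbnd_le u v M : (forall m, u m <= v m) -> sbnd v M -> sbnd u M.
Proof. by move=> uv vM s us; apply: le_trans (vM s us); exact: ler_sum. Qed.

Lemma sbnd_pt u M m : sbnd u M -> u m <= M.
Proof. by move=> /(_ [:: m] isT); rewrite big_seq1. Qed.

Lemma sbndD u v M M' : sbnd u M -> sbnd v M' -> sbnd (fun m => u m + v m) (M + M').
Proof. by move=> uM vM s us; rewrite big_split/=; apply: lerD; [exact: uM|exact: vM]. Qed.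

Lemma sbndM u M c : 0 <= c -> sbnd u M -> sbnd (fun m => c * u m) (c * M).
Proof. by move=> c0 uM s us; rewrite -mulr_sumr ler_wpM2l// uM. Qed.

Lemma sbnd_inj u M (h : Z2 -> Z2) : injective h -> sbnd u M -> sbnd (u \o h) M.
Proof.
move=> hi uM s us; have := uM (map h s); rewrite map_inj_uniq// => /(_ us).
by rewrite big_map.
Qed.

Lemma sum_sub_le u s t : (forall m, 0 <= u m) -> uniq s -> {subset s <= t} ->
  uniq t -> \sum_(m <- s) u m <= \sum_(m <- t) u m.
Proof.
move=> u0 us st ut.
have -> : \sum_(m <- s) u m = \sum_(m <- t | m \in s) u m.
  rewrite -[RHS]big_filter; apply: perm_big; apply: uniq_perm; rewrite ?filter_uniq//.
  by move=> m; rewrite mem_filter; case: (boolP (m \in s)) => // /st ->.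
by rewrite [leRHS](bigID (mem s))/= lerDl sumr_ge0.
Qed.

Definition boxs (N : nat) : seq Z2 :=
  [seq (m%:Z - N%:Z, n%:Z - N%:Z) | m <- iota 0 N.*2.+1, n <- iota 0 N.*2.+1].

Arguments boxs : simpl never.

Lemma boxs_uniq N : uniq (boxs N).
Proof.
apply: allpairs_uniq; rewrite ?iota_uniq// => -[a b] [c d] _ _ /= [].
by move=> /addIr[->] /addIr[->].
Qed.

Lemma mem_boxs N (m : Z2) : (m \in boxs N) = (`|m.1| <= N%:Z) && (`|m.2| <= N%:Z).
Proof.
have mem1 (a : int) : `|a| <= N%:Z ->
    exists2 k, (k \in iota 0 N.*2.+1) & a = k%:Z - N%:Z.
  rewrite ler_norml => /andP[a1 a2].
  exists (absz (a + N%:Z)%R); rewrite ?mem_iota/=; lia.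
case: m => m1 m2 /=; apply/allpairsP/andP => [[[a b] []]|[/mem1[a ha ->] /mem1[b hb ->]]].
  rewrite !mem_iota => /= ha hb [-> ->].
  by split; rewrite ler_norml; lia.
by exists (a, b).
Qed.

Lemma sumZ2E f :
  sumZ2 f = clim (fun N => \sum_(m <- boxs N) f m).
Proof.
congr clim; apply/funext => N; rewrite big_allpairs_dep.
rewrite -[LHS](big_mkord xpredT (fun m => \sum_(n < N.*2.+1) f (m%:Z - N%:Z, n%:Z - N%:Z))).
rewrite /index_iota subn0; apply: eq_bigr => m _.
by rewrite -[LHS](big_mkord xpredT (fun n => f (m%:Z - N%:Z, n%:Z - N%:Z))) /index_iota subn0.
Qed.

Lemma sub_boxs N K : (N <= K)%N -> {subset boxs N <= boxs K}.
Proof. by move=> NK m; rewrite !mem_boxs; lia. Qed.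

Lemma boxs_ex s : exists N, {subset s <= boxs N}.
Proof.
elim: s => [|m s [N IH]]; first by exists 0%N.
exists (N + `|m.1| + `|m.2|)%N => k; rewrite inE => /predU1P[->|/IH].
  by rewrite mem_boxs; lia.
by apply: sub_boxs; lia.
Qed.

Lemma box_cvg_ge0 u M : (forall m, 0 <= u m) -> sbnd u M ->
  cvgn (fun N => \sum_(m <- boxs N) u m).
Proof.
move=> u0 uM; apply: nondecreasing_is_cvgn.
  by move=> N K NK; apply: sum_sub_le => //; [exact: boxs_uniq|exact: sub_boxs|exact: boxs_uniq].
by exists M => _ [N _ <-]; exact/uM/boxs_uniq.
Qed.

Lemma box_cvg u M : sbnd (fun m => `|u m|) M ->
  cvgn (fun N => \sum_(m <- boxs N) u m).
Proof.
move=> uM.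
have c1 : cvgn (fun N => \sum_(m <- boxs N) (u m + `|u m|)).
  apply: (@box_cvg_ge0 _ (M + M)) => [m|]; first by have := ler_norm (- u m); rewrite normrN; lra.
  by apply: sbnd_le (sbndD uM uM) => m; rewrite lerD2r ler_norm.
have c2 := box_cvg_ge0 (fun m => normr_ge0 (u m)) uM.
have -> : (fun N => \sum_(m <- boxs N) u m) =
    (fun N => \sum_(m <- boxs N) (u m + `|u m|)) - (fun N => \sum_(m <- boxs N) `|u m|).
  by apply/funext => N; rewrite !fctE -sumrB; apply: eq_bigr => m _; rewrite addrK.
exact: is_cvgB.
Qed.

Lemma sumZ2_cvg f M : sbnd (fun m => cabs (f m)) M ->
  ccvg (fun N => \sum_(m <- boxs N) f m) (sumZ2 f).
Proof.
move=> fM; rewrite sumZ2E.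
have [cr ci] : cvgn (fun N => \sum_(m <- boxs N) complex.Re (f m)) /\
           cvgn (fun N => \sum_(m <- boxs N) complex.Im (f m)).
  by split; apply: box_cvg; apply: sbnd_le fM => m; [exact: Re_le_cabs|exact: Im_le_cabs].
have c : ccvg (fun N => \sum_(m <- boxs N) f m)
  (limn (fun N => \sum_(m <- boxs N) complex.Re (f m)) +i*
   limn (fun N => \sum_(m <- boxs N) complex.Im (f m))).
  split => /=.
  - by under eq_fun do rewrite Re_sum; exact: cr.
  - by under eq_fun do rewrite Im_sum; exact: ci.
by rewrite (ccvg_clim c).
Qed.

Lemma sumZ2_le f M : sbnd (fun m => cabs (f m)) M -> cabs (sumZ2 f) <= M.
Proof.
move=> fM; apply: (ccvg_le (sumZ2_cvg fM)) => N.
exact: le_trans (cabs_sum _ _ _) (fM _ (boxs_uniq N)).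
Qed.

Lemma sumZ2D f g M M' : sbnd (fun m => cabs (f m)) M -> sbnd (fun m => cabs (g m)) M' ->
  sumZ2 (fun m => f m + g m) = sumZ2 f + sumZ2 g.
Proof.
move=> fM gM; rewrite [LHS]sumZ2E; apply: ccvg_clim.
apply: ccvg_eq (ccvgD (sumZ2_cvg fM) (sumZ2_cvg gM)) => N.
by rewrite big_split.
Qed.

Lemma sumZ2Z (c : R[i]) f M : sbnd (fun m => cabs (f m)) M ->
  sumZ2 (fun m => c * f m) = c * sumZ2 f.
Proof.
move=> fM; rewrite [LHS]sumZ2E; apply: ccvg_clim.
apply: ccvg_eq (ccvgMl c (sumZ2_cvg fM)) => N.
by rewrite mulr_sumr.
Qed.

Lemma sumZ2_pt f m0 : (forall m, m != m0 -> f m = 0) -> sumZ2 f = f m0.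
Proof.
move=> f0; rewrite sumZ2E; apply: ccvg_clim.
have [K /(_ m0)] := boxs_ex [:: m0]; rewrite mem_head => /(_ isT) Km0.
have E : \forall N \near \oo, \sum_(m <- boxs N) f m = f m0.
  near=> N.
  have hN : m0 \in boxs N by apply: sub_boxs Km0; near: N; exact: nbhs_infty_ge.
  rewrite (perm_big _ (perm_to_rem hN)) big_cons -[RHS]addr0; congr (_ + _).
  rewrite big_seq big1// => m.
  by rewrite mem_rem_uniq ?boxs_uniq// inE => /andP[mm _]; exact: f0.
by split; apply: cvg_near_cst; apply: filterS E => N ->.
Unshelve. all: end_near. Qed.

End Sums.

(** * Weighted summability on the lattice and rapid decay *)

Section Weights.
Context {R : realType}.
Local Notation Z2 := (int * int)%type.
Implicit Types (m n : Z2) (a b : nctorus R) (p : nat) (M : R).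

Definition wgt m : R := (1 + `|m.1| + `|m.2|)%:~R.

Lemma wgt_ge1 m : 1 <= wgt m.
Proof. by rewrite /wgt -[leLHS]/(1%:~R) ler_int; lia. Qed.

Lemma wgt_gt0 m : 0 < wgt m.
Proof. exact: lt_le_trans ltr01 (wgt_ge1 m). Qed.

Lemma wgtX_ge1 m p : 1 <= wgt m ^+ p.
Proof. by rewrite exprn_ege1// wgt_ge1. Qed.

Lemma wgtX_ge0 m p : 0 <= wgt m ^+ p.
Proof. exact: le_trans ler01 (wgtX_ge1 m p). Qed.

(** Submultiplicativity of the weight makes each weighted $\ell^1$ space closed under twisted
    convolution, which fails to be visible for the supremum bounds in [nc_smooth]. *)
Lemma wgtD m n : wgt (m + n) <= wgt m * wgt n.
Proof.
rewrite /wgt -intrM ler_int; case: m n => [a b] [c d] /=.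
have := ler_normD a c; have := ler_normD b d.
have := mulr_ge0 (normr_ge0 a) (normr_ge0 c).
have := mulr_ge0 (normr_ge0 a) (normr_ge0 d).
have := mulr_ge0 (normr_ge0 b) (normr_ge0 c).
have := mulr_ge0 (normr_ge0 b) (normr_ge0 d).
rewrite !mulrDl !mulrDr; lia.
Qed.

Lemma wgtN m : wgt (- m) = wgt m.
Proof. by rewrite /wgt /= !normrN. Qed.

Definition wabs p a m : R := wgt m ^+ p * cabs (a m).

Lemma wabs_ge0 p a m : 0 <= wabs p a m.
Proof. by rewrite mulr_ge0 ?cabs_ge0 ?wgtX_ge0. Qed.

Lemma cabs_wabs p a m : cabs (a m) <= wabs p a m.
Proof. by rewrite ler_peMl ?cabs_ge0 ?wgtX_ge1. Qed.

Lemma wabs_mono p q a m : (p <= q)%N -> wabs p a m <= wabs q a m.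
Proof.
by move=> pq; rewrite ler_wpM2r ?cabs_ge0// ler_weXn2l// wgt_ge1.
Qed.

Definition smth a : Prop := forall p, exists M, sbnd (wabs p a) M.

(** Telescoping with $1/(n+1)^2\le 1/n-1/(n+1)$. At [n = 0] the right side is 2, because
    [0^-1 = 0]. *)
Lemma inv_sq_sum (n : nat) : \sum_(0 <= k < n) ((1 + k%:R) ^+ 2)^-1 <= 2 - n%:R^-1 :> R.
Proof.
elim: n => [|[|n] IH]; first by rewrite big_nil invr0; lra.
  by rewrite big_nat1 addr0 expr1n invr1; lra.
rewrite big_nat_recr//=.
have n1 : 0 < n.+1%:R :> R by [].
apply: le_trans (lerD IH (lexx _)) _.
have H (a b c : R) : c <= a - b -> 2 - a + c <= 2 - b by lra.
apply: H.
rewrite -(natr1 n.+1); move: (n.+1%:R : R) n1 => x x0.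
have -> : x^-1 - (x + 1)^-1 = (x * (x + 1))^-1 by field; rewrite !gt_eqF// ltr_wpDr.
by rewrite lef_pV2 ?posrE ?exprn_gt0 ?mulr_gt0 ?ltr_wpDr ?ltr_wpDl//; nra.
Qed.

Lemma inv_sq_box N : \sum_(k <- iota 0 N.*2.+1) ((1 + `|k%:Z - N%:Z|)%:~R ^+ 2)^-1 <= 4 :> R.
Proof.
have ub (n : nat) : \sum_(0 <= k < n) ((1 + k%:R) ^+ 2)^-1 <= 2 :> R.
  by apply: le_trans (inv_sq_sum n) _; rewrite gerBl invr_ge0.
have -> : iota 0 N.*2.+1 = index_iota 0 N.*2.+1 by rewrite /index_iota subn0.
rewrite (@big_cat_nat _ _ _ N)//=; last by lia.
rewrite (_ : 4 = 2 + 2 :> R); last by lra.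
apply: lerD; last first.
  rewrite -{1}(add0n N) big_addn (_ : N.*2.+1 - N = N.+1)%N; last by lia.
  apply: le_trans (ub N.+1); apply: ler_sum => k _.
  by rewrite PoszD addrK/= intrD -pmulrn.
rewrite big_nat_rev/=; apply: le_trans (ub N); apply: ler_sum_nat => k /andP[_ kN].
have -> : `|(0 + N - k.+1)%N%:Z - N%:Z| = k.+1%:Z by lia.
rewrite intrD -pmulrn lef_pV2 ?posrE ?exprn_gt0 ?ltr_wpDr//.
by rewrite lerXn2r ?nnegrE ?addr_ge0// lerD2l ler_nat.
Qed.

(** Since $(1+|m|)(1+|n|)\le(1+|m|+|n|)^2$, the sum is at most the square of the one-dimensional sum
    of $(1+|m|)^{-2}$, hence $4\cdot4$. *)
Lemma wgt_summable : sbnd (fun m => (wgt m ^+ 4)^-1) 16.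
Proof.
move=> s us; have [N sN] := boxs_ex s.
have w0 m : 0 <= (wgt m ^+ 4)^-1 by rewrite invr_ge0 exprn_ge0// ltW// wgt_gt0.
apply: le_trans (sum_sub_le w0 us sN (boxs_uniq N)) _.
rewrite /boxs big_allpairs_dep.
pose e (k : nat) : R := ((1 + `|k%:Z - N%:Z|)%:~R ^+ 2)^-1.
have e0 k : 0 <= e k by rewrite invr_ge0 sqr_ge0.
apply: (@le_trans _ _ (\sum_(i <- iota 0 N.*2.+1) e i * \sum_(j <- iota 0 N.*2.+1) e j)).
  apply: ler_sum => i _; rewrite mulr_sumr; apply: ler_sum => j _.
  rewrite /e -invfM lef_pV2 ?posrE ?mulr_gt0 ?exprn_gt0 ?wgt_gt0 ?ltr0z//; try lia.
  have w4 (x : R) : x ^+ 4 = (x ^+ 2) ^+ 2 by rewrite -exprM.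
  rewrite -exprMn w4 lerXn2r ?nnegrE ?sqr_ge0//.
  rewrite /wgt/= -intrM -rmorphXn/= ler_int expr2 !mulrDl !mulrDr.
  set x := `|_ - _|; set y := `|_ - _|.
  have := @normr_ge0 _ _ (i%:Z - N%:Z); have := @normr_ge0 _ _ (j%:Z - N%:Z).
  rewrite -/x -/y => y0 x0.
  have := mulr_ge0 x0 x0; have := mulr_ge0 x0 y0; have := mulr_ge0 y0 y0.
  rewrite ?mul1r ?mulr1 (mulrC y x); lia.
rewrite -mulr_suml (_ : 16 = 4 * 4); last by lra.
by apply: ler_pM; rewrite ?sumr_ge0// inv_sq_box.
Qed.

(** From left to right, four powers of the weight are spent on [wgt_summable]. *)
Lemma smthP a : nc_smooth a <-> smth a.
Proof.
split=> [sa p|sa p]; last first.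
  by have [M aM] := sa p; exists M => m n; exact: sbnd_pt (m, n) aM.
have [M aM] := sa (p + 4)%N; exists (M * 16).
have M0 : 0 <= M by apply: le_trans (aM 0 0); rewrite mulr_ge0 ?cabs_ge0// exprn_ge0 ?ler0z.
apply: sbnd_le (sbndM M0 wgt_summable) => -[m n].
rewrite ler_pdivlMr ?exprn_gt0 ?wgt_gt0// mulrAC -exprD; exact: aM.
Qed.

Definition nu p a : R := sup [set \sum_(m <- s) wabs p a m | s in [set s : seq Z2 | uniq s]].

Lemma nu_le p a M : sbnd (wabs p a) M -> nu p a <= M.
Proof.
move=> aM; apply: ge_sup; last by move=> _ [s us <-]; exact: aM.
by exists 0, [::] => //; rewrite big_nil.
Qed.

Lemma nu_sbnd p a : smth a -> sbnd (wabs p a) (nu p a).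
Proof.
move=> /(_ p)[M aM] s us; apply: ub_le_sup; last by exists s.
by exists M => _ [t ut <-]; exact: aM.
Qed.

Lemma nu_ge0 p a : smth a -> 0 <= nu p a.
Proof. by move=> /(nu_sbnd p)/sbnd_ge0. Qed.

Lemma smth0 : smth 0.
Proof.
by move=> p; exists 0 => s _; rewrite big1// => m _; rewrite /wabs cabs0 mulr0.
Qed.

Lemma wabsD p a b m : wabs p (a + b) m <= wabs p a m + wabs p b m.
Proof. by rewrite -mulrDr ler_wpM2l ?wgtX_ge0// cabsD. Qed.

Lemma smthD a b : smth a -> smth b -> smth (a + b).
Proof.
move=> sa sb p; have [M aM] := sa p; have [M' bM] := sb p.
by exists (M + M'); apply: sbnd_le (sbndD aM bM) => m; exact: wabsD.
Qed.

Lemma wabsZ p c a m : wabs p (c *: a) m = cabs c * wabs p a m.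
Proof. by rewrite /wabs cabsM mulrCA. Qed.

Lemma smthZ c a : smth a -> smth (c *: a).
Proof.
move=> sa p; have [M aM] := sa p.
by exists (cabs c * M); apply: sbnd_le (sbndM (cabs_ge0 c) aM) => m; rewrite wabsZ.
Qed.

Lemma smthN a : smth a -> smth (- a).
Proof.
move=> sa p; have [M aM] := sa p; exists M; apply: sbnd_le aM => m.
by rewrite /wabs cabsN.
Qed.

End Weights.

(** * The algebra of smooth elements *)

(* nc_smooth is replaced by the equivalent smth, weighted summability, which is multiplicative. *)
Record storus (R : realType) (theta : R) :=
  MkSt { sv :> nctorus R ; svP : `[< smth sv >] }.

Section Torus.
Context {R : realType}.
Local Notation Z2 := (int * int)%type.
Implicit Types (m n r : Z2) (p : nat) (M : R).

Lemma expiD (x y : R) : expi (x + y) = expi x * expi y.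
Proof.
apply: complex_eq; rewrite ?Re_mul ?Im_mul /expi/= ?cosD ?sinD//.
by rewrite addrC.
Qed.

Lemma expi0 : expi (0 : R) = 1.
Proof. by rewrite /expi cos0 sin0. Qed.

Lemma expiN (x : R) : expi (- x) = conjc (expi x).
Proof. by rewrite /expi cosN sinN. Qed.

Lemma cabs_expi (x : R) : cabs (expi x) = 1.
Proof.
apply/eqP; rewrite -(@eqrXn2 _ 2) ?cabs_ge0// cabs_sqr /expi/= cos2Dsin2 expr1n//.
Qed.

Variable theta : R.
Local Notation St := (storus theta).
Local Notation ph := (nc_phase theta).

Lemma phD x y : ph (x + y) = ph x * ph y.
Proof. by rewrite /nc_phase intrD mulrDr expiD. Qed.

Lemma ph0 : ph 0 = 1.
Proof. by rewrite /nc_phase mulr0 expi0. Qed.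

Lemma phN x : ph (- x) = conjc (ph x).
Proof. by rewrite /nc_phase mulrNz mulrN expiN. Qed.

Lemma cabs_ph x : cabs (ph x) = 1.
Proof. exact: cabs_expi. Qed.

Definition mterm (a b : nctorus R) r m : R[i] :=
  ph (m.2 * (r.1 - m.1)) * a m * b (r - m).

Lemma nc_mulE a b r : nc_mul theta a b r = sumZ2 (mterm a b r).
Proof. by []. Qed.

Lemma cabs_mterm a b r m : cabs (mterm a b r m) = cabs (a m) * cabs (b (r - m)).
Proof. by rewrite /mterm !cabsM cabs_ph mul1r. Qed.

Lemma sbnd_mterm a b r M M' : sbnd (fun m => cabs (a m)) M ->
  (forall m, cabs (b m) <= M') -> sbnd (fun m => cabs (mterm a b r m)) (M' * M).
Proof.
move=> aM bM; have M0 : 0 <= M' := le_trans (cabs_ge0 _) (bM 0).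
apply: sbnd_le (sbndM M0 aM) => m.
by rewrite cabs_mterm mulrC ler_wpM2r ?cabs_ge0.
Qed.

Lemma sbnd_mtermr a b r M M' : (forall m, cabs (a m) <= M') ->
  sbnd (fun m => cabs (b m)) M -> sbnd (fun m => cabs (mterm a b r m)) (M' * M).
Proof.
move=> aM bM; have M0 : 0 <= M' := le_trans (cabs_ge0 _) (aM 0).
have bM' : sbnd (fun m => cabs (b (r - m))) M.
  apply: (@sbnd_inj _ _ _ (fun m => r - m)) bM => m n /addrI/oppr_inj//.
apply: sbnd_le (sbndM M0 bM') => m.
by rewrite cabs_mterm ler_wpM2r ?cabs_ge0.
Qed.

Lemma sbnd_wabs0 p a M : sbnd (wabs p a) M -> sbnd (fun m => cabs (a m)) M.
Proof. by apply: sbnd_le => m; exact: cabs_wabs. Qed.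

Lemma cabs_bnd p a M : sbnd (wabs p a) M -> forall m, cabs (a m) <= M.
Proof. by move=> /sbnd_wabs0 aM m; exact: sbnd_pt m aM. Qed.

Lemma mul_cvg p a b M M' r : sbnd (wabs p a) M -> sbnd (wabs p b) M' ->
  ccvg (fun N => \sum_(m <- boxs N) mterm a b r m) (nc_mul theta a b r).
Proof.
by move=> aM bM; apply: sumZ2_cvg (sbnd_mterm r (sbnd_wabs0 aM) (cabs_bnd bM)).
Qed.

(** For the truncated convolutions the estimate is an exchange of two finite sums; it survives the
    limit because only finite subsums have to be bounded. *)
Lemma mul_sbnd p a b M M' : sbnd (wabs p a) M -> sbnd (wabs p b) M' ->
  sbnd (wabs p (nc_mul theta a b)) (M * M').
Proof.
move=> aM bM s us.
have cv : (fun N => \sum_(r <- s) (@wgt R r ^+ p * cabs (\sum_(m <- boxs N) mterm a b r m)))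
    @ \oo --> \sum_(r <- s) wabs p (nc_mul theta a b) r.
  elim: s {us} => [|r s IH].
    by rewrite big_nil; under eq_fun do rewrite big_nil; exact: cvg_cst.
  rewrite big_cons; under eq_fun do rewrite big_cons; apply: cvgD => //.
  apply: cvgM; first exact: cvg_cst.
  exact: ccvg_cabs (mul_cvg r aM bM).
rewrite -(cvg_lim _ cv)//; apply: limr_le; first by apply/cvg_ex; eexists; exact: cv.
apply: nearW => N.
apply: (@le_trans _ _ (\sum_(r <- s) \sum_(m <- boxs N) wabs p a m * wabs p b (r - m))).
  apply: ler_sum => r _; rewrite (le_trans (ler_wpM2l (wgtX_ge0 r p) (cabs_sum _ _ _)))//.
  rewrite mulr_sumr; apply: ler_sum => m _; rewrite cabs_mterm /wabs mulrACA.
  rewrite ler_wpM2r ?mulr_ge0 ?cabs_ge0// -exprMn lerXn2r ?nnegrE ?mulr_ge0 ?(ltW (wgt_gt0 _))//.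
  by rewrite -[X in wgt X](subrK m) addrC; exact: wgtD.
rewrite exchange_big/=.
apply: (@le_trans _ _ (\sum_(m <- boxs N) wabs p a m * M')).
  apply: ler_sum => m _; rewrite -mulr_sumr ler_wpM2l ?wabs_ge0//.
  apply: (@sbnd_inj _ _ _ (fun r => r - m) _ bM) => // x y /addIr//.
by rewrite -mulr_suml ler_wpM2r ?(sbnd_ge0 bM)// aM ?boxs_uniq.
Qed.

Lemma smth_mul a b : smth a -> smth b -> smth (nc_mul theta a b).
Proof.
move=> sa sb p; have [M aM] := sa p; have [M' bM] := sb p.
by exists (M * M'); exact: mul_sbnd.
Qed.

Definition delta m : nctorus R := fun r => if r == m then 1 else 0.

Lemma smth_delta m : smth (delta m).
Proof.
move=> p; exists (@wgt R m ^+ p) => s us.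
apply: (@le_trans _ _ (\sum_(k <- s) if k == m then @wgt R m ^+ p else 0)).
  apply: ler_sum => k _; rewrite /wabs /delta; case: eqP => [->|_].
    by rewrite cabs1 mulr1.
  by rewrite cabs0 mulr0.
rewrite -big_mkcond/= big_const_seq iter_addr_0 -mulr_natr.
apply: ler_piMr; rewrite ?wgtX_ge0// -[leRHS]/(1%:R) ler_nat.
by rewrite (eq_count (a2 := pred1 m))// count_uniq_mem// leq_b1.
Qed.

HB.instance Definition _ := [isSub for @sv R theta].
HB.instance Definition _ := [Choice of St by <:].

Lemma smP (a : St) : smth a.
Proof. by case: a => a /= /asboolP. Qed.

Definition mkS a (sa : smth a) : St := MkSt theta (introT (asboolP _) sa).

Lemma st_eq (a b : St) : (forall m, sv a m = sv b m) -> a = b.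
Proof. by move=> ab; apply: val_inj; apply/funext. Qed.

Definition addS (a b : St) := mkS (smthD (smP a) (smP b)).
Definition oppS (a : St) := mkS (smthN (smP a)).
Definition zeroS := mkS (@smth0 R).
Definition scaleS c (a : St) := mkS (smthZ c (smP a)).

Program Definition st_zmod := @GRing.isZmodule.Build St zeroS oppS addS _ _ _ _.
Next Obligation. by move=> a b c; apply: st_eq => m; exact: addrA. Qed.
Next Obligation. by move=> a b; apply: st_eq => m; exact: addrC. Qed.
Next Obligation. by move=> a; apply: st_eq => m; exact: add0r. Qed.
Next Obligation. by move=> a; apply: st_eq => m; exact: addNr. Qed.
HB.instance Definition _ := st_zmod.

Program Definition st_lmod :=
  @GRing.Zmodule_isLmodule.Build R[i] St scaleS _ _ _ _.
Next Obligation. by move=> a b v; apply: st_eq => m /=; exact: mulrA. Qed.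
Next Obligation. by move=> v; apply: st_eq => m; exact: mul1r. Qed.
Next Obligation. by move=> a u v; apply: st_eq => m; exact: mulrDr. Qed.
Next Obligation. by move=> v a b; apply: st_eq => m; exact: mulrDl. Qed.
HB.instance Definition _ := st_lmod.

Lemma svD (a b : St) m : sv (a + b) m = sv a m + sv b m.
Proof. by []. Qed.
Lemma svN (a : St) m : sv (- a) m = - sv a m.
Proof. by []. Qed.
Lemma svB (a b : St) m : sv (a - b) m = sv a m - sv b m.
Proof. by []. Qed.
Lemma svZ c (a : St) m : sv (c *: a) m = c * sv a m.
Proof. by []. Qed.
Lemma sv0 m : sv 0 m = 0.
Proof. by []. Qed.
Lemma sv_sum (I : Type) (s : seq I) (P : pred I) (f : I -> St) m :
  sv (\sum_(i <- s | P i) f i) m = \sum_(i <- s | P i) sv (f i) m.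
Proof. by elim/big_ind2: _ => // a x b y <- <-. Qed.

Definition snu p (a : St) : R := nu p (sv a).

Lemma snu_ge0 p a : 0 <= snu p a.
Proof. exact: nu_ge0 (smP a). Qed.

Lemma snuP p a : sbnd (wabs p (sv a)) (snu p a).
Proof. exact: nu_sbnd (smP a). Qed.

Lemma snuD p a b : snu p (a + b) <= snu p a + snu p b.
Proof.
apply: nu_le; apply: sbnd_le (sbndD (snuP p a) (snuP p b)) => m; exact: wabsD.
Qed.

Lemma snuZle p c a : snu p (c *: a) <= cabs c * snu p a.
Proof.
apply: nu_le; apply: sbnd_le (sbndM (cabs_ge0 c) (snuP p a)) => m.
by rewrite -wabsZ.
Qed.

Lemma snuN p a : snu p (- a) = snu p a.
Proof.
have le b : snu p (- b) <= snu p b.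
  by apply: nu_le; apply: sbnd_le (snuP p b) => m; rewrite /wabs cabsN.
by apply/le_anti; rewrite le -{1}(opprK a) le.
Qed.

Lemma snuB p a b : snu p (a - b) <= snu p a + snu p b.
Proof. by rewrite -(snuN p b) snuD. Qed.

Lemma snu0 p : snu p 0 = 0.
Proof.
apply/le_anti; rewrite snu_ge0 andbT; apply: nu_le => s _.
by rewrite big1// => m _; rewrite /wabs cabs0 mulr0.
Qed.

Lemma snu_sum p (I : Type) (s : seq I) (P : pred I) (f : I -> St) :
  snu p (\sum_(i <- s | P i) f i) <= \sum_(i <- s | P i) snu p (f i).
Proof.
elim/big_ind2: _ => [|z x w y zx wy|//]; first by rewrite snu0.
exact: le_trans (snuD _ _ _) (lerD zx wy).
Qed.

Lemma cabs_sv p a m : cabs (sv a m) <= snu p a.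
Proof. exact: cabs_bnd (snuP p a) m. Qed.

Definition dl m : St := mkS (smth_delta m).

Definition trnc N (a : St) : St := \sum_(m <- boxs N) sv a m *: dl m.

Lemma sv_trnc N a m : sv (trnc N a) m = if m \in boxs N then sv a m else 0.
Proof.
rewrite /trnc sv_sum.
case: ifP => mN.
  rewrite (perm_big _ (perm_to_rem mN)) big_cons -[RHS]addr0; congr (_ + _).
    by rewrite svZ /dl/= /delta eqxx mulr1.
  rewrite big_seq big1// => k; rewrite mem_rem_uniq ?boxs_uniq// inE => /andP[km _].
  by rewrite svZ /= /delta eq_sym (negbTE km) mulr0.
rewrite big_seq big1// => k kN; rewrite svZ /= /delta.
by case: eqP mN => [->|]; rewrite ?kN ?mulr0.
Qed.

(** Outside the box of size [N] the weight is at least $N+1$, so one more power of it buys the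
    factor $1/(N+1)$. *)
Lemma snu_tail p N a : snu p (a - trnc N a) <= snu p.+1 a / N.+1%:R.
Proof.
apply: nu_le; have N0 : 0 <= N.+1%:R^-1 :> R by rewrite invr_ge0.
rewrite mulrC; apply: sbnd_le (sbndM N0 (snuP p.+1 a)) => m.
rewrite /wabs svB sv_trnc; case: ifPn => mN.
  by rewrite subrr cabs0 mulr0 !mulr_ge0 ?cabs_ge0 ?wgtX_ge0.
rewrite subr0 exprS !mulrA ler_wpM2r ?cabs_ge0// ler_peMl ?wgtX_ge0//.
rewrite ler_pdivlMl// mulr1 /wgt pmulrn ler_int.
by move: mN; rewrite mem_boxs; lia.
Qed.

Lemma tail_cvg p a : snu p (a - trnc N a) @[N --> \oo] --> 0.
Proof.
apply: (@squeeze_cvgr _ _ _ _ (fun=> 0) (fun N => snu p.+1 a / N.+1%:R)).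
- by apply: nearW => N; rewrite snu_ge0 snu_tail.
- exact: cvg_cst.
- rewrite -(mulr0 (snu p.+1 a)); apply: cvgM; first exact: cvg_cst.
  exact: cvg_harmonic.
Qed.

(** Finite combinations of monomials are dense for every seminorm. Identities in the torus are
    reduced by this to monomials, where only phases have to be compared. *)
Lemma st_ext (L : St -> R[i]) p C :
  (forall c a b, L (c *: a + b) = c * L a + L b) ->
  (forall a, cabs (L a) <= C * snu p a) ->
  (forall m, L (dl m) = 0) -> forall a, L a = 0.
Proof.
move=> Ll LC Ld a.
have L0 : L 0 = 0 by have := Ll (-1) 0 0; rewrite scaleN1r addNr mulN1r addNr.
have LD x y : L (x + y) = L x + L y by rewrite -{1}(scale1r x) Ll mul1r.
have LZ c x : L (c *: x) = c * L x by rewrite -{1}(addr0 (c *: x)) Ll L0 addr0.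
have Lt N : L (trnc N a) = 0.
  rewrite /trnc; elim: (boxs N) => [|m s IH]; first by rewrite big_nil L0.
  by rewrite big_cons LD LZ Ld mulr0 add0r IH.
apply: cabs_le0.
have C0 : (fun N => C * snu p (a - trnc N a)) @ \oo --> (0 : R).
  rewrite -(mulr0 C); apply: cvgM; first exact: cvg_cst.
  exact: tail_cvg.
rewrite -(cvg_lim _ C0)//; apply: limr_ge; first by apply/cvg_ex; eexists; exact: C0.
apply: nearW => N; apply: le_trans (LC _).
by have := LD (a - trnc N a) (trnc N a); rewrite subrK Lt addr0 => <-.
Qed.

Definition mulS (a b : St) : St := mkS (smth_mul (smP a) (smP b)).

Lemma sv_mul a b m : sv (mulS a b) m = nc_mul theta (sv a) (sv b) m.
Proof. by []. Qed.

Lemma snuM_mulS p a b : snu p (mulS a b) <= snu p a * snu p b.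
Proof. by apply: nu_le; apply: mul_sbnd; exact: snuP. Qed.

Lemma mulS_linl c (a b d : St) : mulS (c *: a + b) d = c *: mulS a d + mulS b d.
Proof.
apply: st_eq => m; rewrite svD svZ !sv_mul !nc_mulE.
have sb x := sbnd_mterm m (sbnd_wabs0 (snuP 0 x)) (cabs_sv 0 d).
rewrite -(sumZ2Z c (sb a)) -(sumZ2D (M := cabs c * (snu 0 d * snu 0 a)) _ (sb b)).
  by congr sumZ2; apply/funext => k; rewrite /mterm svD svZ; ring.
by apply: sbnd_le (sbndM (cabs_ge0 c) (sb a)) => k; rewrite cabsM.
Qed.

Lemma mulS_linr c (a b d : St) : mulS d (c *: a + b) = c *: mulS d a + mulS d b.
Proof.
apply: st_eq => m; rewrite svD svZ !sv_mul !nc_mulE.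
have sb x := sbnd_mterm m (sbnd_wabs0 (snuP 0 d)) (cabs_sv 0 x).
rewrite -(sumZ2Z c (sb a)) -(sumZ2D (M := cabs c * (snu 0 a * snu 0 d)) _ (sb b)).
  by congr sumZ2; apply/funext => k; rewrite /mterm svD svZ; ring.
by apply: sbnd_le (sbndM (cabs_ge0 c) (sb a)) => k; rewrite cabsM.
Qed.

Lemma mulS_dl m n : mulS (dl m) (dl n) = ph (m.2 * n.1) *: dl (m + n).
Proof.
apply: st_eq => r; rewrite svZ sv_mul nc_mulE (sumZ2_pt (m0 := m)); last first.
  by move=> k km; rewrite /mterm /= /delta (negbTE km) mulr0 mul0r.
rewrite /mterm/= /delta eqxx mulr1 (subr_eq r n m) (addrC n m).
by case: eqP => [->|_]; rewrite ?mulr0//= [m.1 + _]addrC addrK.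
Qed.

Lemma mulS_Zl c a x : mulS (c *: a) x = c *: mulS a x.
Proof.
have m0 : mulS 0 x = 0.
  by have := mulS_linl (-1) 0 0 x; rewrite !scaleN1r !addNr.
by rewrite -{1}(addr0 (c *: a)) mulS_linl m0 addr0.
Qed.

Lemma mulS_Zr c a x : mulS x (c *: a) = c *: mulS x a.
Proof.
have m0 : mulS x 0 = 0.
  by have := mulS_linr (-1) 0 0 x; rewrite !scaleN1r !addNr.
by rewrite -{1}(addr0 (c *: a)) mulS_linr m0 addr0.
Qed.

(* Multilinear continuous identities are checked on monomials. *)
Lemma mulS_assoc : associative mulS.
Proof.
move=> a b d; apply: st_eq => r; apply/eqP; rewrite -subr_eq0; apply/eqP.
have le3 x y z : cabs (sv (mulS x (mulS y z)) r - sv (mulS (mulS x y) z) r) <=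
    2 * (snu 0 x * snu 0 y * snu 0 z).
  apply: le_trans (cabsB _ _) _; rewrite mulr2n mulrDl !mul1r; apply: lerD.
    apply: le_trans (cabs_sv 0 _ _) _; apply: le_trans (snuM_mulS _ _ _) _.
    by rewrite -mulrA ler_wpM2l ?snu_ge0// snuM_mulS.
  apply: le_trans (cabs_sv 0 _ _) _; apply: le_trans (snuM_mulS _ _ _) _.
  by rewrite ler_wpM2r ?snu_ge0// snuM_mulS.
apply: (@st_ext (fun d => sv (mulS a (mulS b d)) r - sv (mulS (mulS a b) d) r)
  0%N (2 * (snu 0 a * snu 0 b))) => [c x y|x|m]; last first.
- apply: (@st_ext (fun b => sv (mulS a (mulS b (dl m))) r - sv (mulS (mulS a b) (dl m)) r)
    0%N (2 * (snu 0 a * snu 0 (dl m)))) => [c x y|x|n]; last first.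
  + apply: (@st_ext (fun a => sv (mulS a (mulS (dl n) (dl m))) r -
        sv (mulS (mulS a (dl n)) (dl m)) r)
      0%N (2 * (snu 0 (dl n) * snu 0 (dl m)))) => [c x y|x|k]; last first.
    * rewrite !mulS_dl mulS_Zl mulS_Zr !mulS_dl !svZ addrA !mulrA -!phD.
      apply/eqP; rewrite subr_eq0; apply/eqP; congr (ph _ * _).
      by rewrite /=; ring.
    * by apply: le_trans (le3 _ _ _) _; rewrite -!mulrA ler_wpM2l// mulrCA mulrA [leRHS]mulrA mulrAC.
    * by rewrite !mulS_linl !svD !svZ; ring.
  + by apply: le_trans (le3 _ _ _) _; rewrite -!mulrA ler_wpM2l// [X in _ * X]mulrC.
  + by rewrite !(mulS_linl, mulS_linr) !svD !svZ; ring.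
- by apply: le_trans (le3 _ _ _) _; rewrite -!mulrA.
- by rewrite !(mulS_linl, mulS_linr) !svD !svZ; ring.
Qed.

Definition oneS : St := dl (0, 0).

Lemma mulS_1l : left_id oneS mulS.
Proof.
move=> a; apply: st_eq => r; rewrite sv_mul nc_mulE (sumZ2_pt (m0 := (0, 0))).
  by rewrite /mterm/= /delta eqxx mul0r ph0 !mul1r subr0.
by move=> k km; rewrite /mterm /= /delta (negbTE km) mulr0 mul0r.
Qed.

Lemma mulS_1r : right_id oneS mulS.
Proof.
move=> a; apply: st_eq => r; rewrite sv_mul nc_mulE (sumZ2_pt (m0 := r)).
  by rewrite /mterm/= /delta !subrr eqxx mulr1 mulr0 ph0 mul1r.
move=> k km; rewrite /mterm /= /delta.
by case: eqP => [/eqP|]; rewrite ?mulr0// subr_eq0 eq_sym (negbTE km).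
Qed.

Lemma mulS_Dl : left_distributive mulS +%R.
Proof. by move=> a b c; rewrite -{1}(scale1r a) mulS_linl scale1r. Qed.
Lemma mulS_Dr : right_distributive mulS +%R.
Proof. by move=> a b c; rewrite -{1}(scale1r b) mulS_linr scale1r. Qed.

Lemma oneS_neq0 : oneS != 0.
Proof.
apply/eqP => /(congr1 (fun a => sv a (0, 0))); rewrite sv0 /oneS/= /delta eqxx => /eqP.
by rewrite oner_eq0.
Qed.

HB.instance Definition _ := GRing.Zmodule_isNzRing.Build St
  mulS_assoc mulS_1l mulS_1r mulS_Dl mulS_Dr oneS_neq0.

Fact st_scalerAl c (a b : St) : c *: (a * b) = (c *: a) * b.
Proof. by rewrite [RHS]mulS_Zl. Qed.
Fact st_scalerAr c (a b : St) : c *: (a * b) = a * (c *: b).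
Proof. by rewrite [RHS]mulS_Zr. Qed.
HB.instance Definition _ := GRing.Lmodule_isLalgebra.Build R[i] St st_scalerAl.
HB.instance Definition _ := GRing.Lalgebra_isAlgebra.Build R[i] St st_scalerAr.

Lemma snuM p (a b : St) : snu p (a * b) <= snu p a * snu p b.
Proof. exact: snuM_mulS. Qed.

Lemma svM (a b : St) : sv (a * b) = nc_mul theta (sv a) (sv b).
Proof. by []. Qed.

Lemma sv1 : sv 1 = @nc_one R.
Proof. by []. Qed.

Lemma snu1 p : snu p 1 <= 1.
Proof.
apply: nu_le => s us.
apply: (@le_trans _ _ (\sum_(k <- s) if k == (0, 0) :> Z2 then 1 else 0)).
  apply: ler_sum => k _; rewrite /wabs /= /delta; case: eqP => [->|_].
    by rewrite cabs1 mulr1 /wgt/= !normr0 !addr0 expr1n.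
  by rewrite cabs0 mulr0.
rewrite -big_mkcond/= big_const_seq iter_addr_0.
by rewrite (eq_count (a2 := pred1 (0, 0)))// count_uniq_mem// -[leRHS]/(1%:R) ler_nat leq_b1.
Qed.

Lemma snuX p (a : St) (n : nat) : snu p (a ^+ n) <= snu p a ^+ n.
Proof.
elim: n => [|n IH]; first by rewrite !expr0 snu1.
by rewrite !exprS; apply: le_trans (snuM _ _ _) _; rewrite ler_wpM2l ?snu_ge0.
Qed.

Lemma snu_mono p q (a : St) : (p <= q)%N -> snu p a <= snu q a.
Proof. by move=> pq; apply: nu_le; apply: sbnd_le (snuP q a) => m; exact: wabs_mono. Qed.

Lemma wabs_star p (a : nctorus R) m : wabs p (nc_star theta a) m = wabs p a (- m).
Proof. by rewrite /wabs wgtN /nc_star cabsM cabs_ph mul1r cabs_conj. Qed.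

Lemma smth_star a : smth a -> smth (nc_star theta a).
Proof.
move=> sa p; have [M aM] := sa p; exists M.
apply: sbnd_le (sbnd_inj (@oppr_inj Z2) aM) => m; by rewrite wabs_star.
Qed.

Definition starS (a : St) : St := mkS (smth_star (smP a)).

Lemma sv_star a m : sv (starS a) m = ph (m.1 * m.2) * conjc (sv a (- m)).
Proof. by []. Qed.

Lemma snu_star p a : snu p (starS a) <= snu p a.
Proof.
apply: nu_le; apply: sbnd_le (sbnd_inj (@oppr_inj Z2) (snuP p a)) => m.
by rewrite -[leRHS]/(wabs p (sv a) (- m)) -wabs_star.
Qed.

Lemma starD a b : starS (a + b) = starS a + starS b.
Proof. by apply: st_eq => m; rewrite svD !sv_star svD rmorphD mulrDr. Qed.

Lemma starZ c a : starS (c *: a) = conjc c *: starS a.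
Proof. by apply: st_eq => m; rewrite svZ !sv_star svZ rmorphM mulrCA. Qed.

Lemma star_dl m : starS (dl m) = ph (m.1 * m.2) *: dl (- m).
Proof.
apply: st_eq => r; rewrite svZ sv_star /= /delta eqr_oppLR.
case: eqP => [->|_]; last by rewrite rmorph0 !mulr0.
by rewrite rmorph1 /= mulrNN.
Qed.

Lemma starM a b : starS (a * b) = starS b * starS a.
Proof.
(* The involution is antilinear; after conjugation the difference is linear in each factor and
   [st_ext] applies. *)
apply: st_eq => r; apply/eqP; rewrite -subr_eq0 -conjC_eq0; apply/eqP.
have lin c x y : starS (c *: x + y) = conjc c *: starS x + starS y by rewrite starD starZ.
have le x y : cabs (conjc (sv (starS (x * y)) r - sv (starS y * starS x) r)) <=
    2 * snu 0 x * snu 0 y.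
  rewrite cabs_conj mulr2n !mulrDl !mul1r; apply: le_trans (cabsB _ _) _; apply: lerD.
    apply: le_trans (cabs_sv 0 _ _) _; apply: le_trans (snu_star _ _) _; exact: snuM.
  apply: le_trans (cabs_sv 0 _ _) _; apply: le_trans (snuM _ _ _) _.
  by rewrite mulrC ler_pM ?snu_ge0 ?snu_star.
apply: (@st_ext (fun a => conjc (sv (starS (a * b)) r - sv (starS b * starS a) r))
  0%N (2 * snu 0 b)) => [c x y|x|m]; last first.
- apply: (@st_ext (fun b => conjc (sv (starS (dl m * b)) r - sv (starS b * starS (dl m)) r))
    0%N (2 * snu 0 (dl m))) => [c x y|x|n]; last first.
  + rewrite !star_dl -!scalerAl -!scalerAr ![dl _ * dl _]mulS_dl !starZ !star_dl.
    have -> : - (m + n) = - n - m by rewrite opprD addrC.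
    rewrite !svZ !mulrA.

    rewrite -phN -!phD.
    set A := (X in ph X * _ - _); set B := (X in _ - ph X * _).
    rewrite (_ : A = B) ?subrr ?rmorph0// /A /B /=; ring.
  + by rewrite le.
  + rewrite mulrDr -scalerAr !lin mulrDl -scalerAl !svD !svZ.
    by rewrite -[in RHS](conjcK c) -rmorphM -rmorphD; congr conjc; rewrite ?conjcK; ring.
- by rewrite mulrAC le.
- rewrite mulrDl -scalerAl !lin mulrDr -scalerAr !svD !svZ.
  by rewrite -[in RHS](conjcK c) -rmorphM -rmorphD; congr conjc; rewrite ?conjcK; ring.
Qed.

Definition tr (a : St) : R[i] := sv a (0, 0).

Lemma trD a b : tr (a + b) = tr a + tr b. Proof. by []. Qed.
Lemma trZ c a : tr (c *: a) = c * tr a. Proof. by []. Qed.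
Lemma tr_le a : cabs (tr a) <= snu 0 a. Proof. exact: cabs_sv. Qed.

Lemma tr_dl m : tr (dl m) = if m == (0, 0) then 1 else 0.
Proof. by rewrite /tr/= /delta eq_sym. Qed.

(** On monomials both sides vanish unless $n=-m$, and then the two phases coincide. *)
Lemma trM a b : tr (a * b) = tr (b * a).
Proof.
apply/eqP; rewrite -subr_eq0; apply/eqP.
have le x y : cabs (tr (x * y) - tr (y * x)) <= 2 * snu 0 x * snu 0 y.
  rewrite mulr2n !mulrDl !mul1r; apply: le_trans (cabsB _ _) _; apply: lerD.
    exact: le_trans (tr_le _) (snuM _ _ _).
  by rewrite mulrC; exact: le_trans (tr_le _) (snuM _ _ _).
apply: (@st_ext (fun a => tr (a * b) - tr (b * a)) 0%N (2 * snu 0 b))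
  => [c x y|x|m]; last first.
- apply: (@st_ext (fun b => tr (dl m * b) - tr (b * dl m)) 0%N (2 * snu 0 (dl m)))
    => [c x y|x|n]; last first.
  + rewrite ![dl _ * dl _]mulS_dl !trZ !tr_dl [n + m]addrC.
    have [mn|_] := eqVneq (m + n) (0, 0); last by rewrite !mulr0 subrr.
    have -> : n = - m by apply/eqP; rewrite -addr_eq0 addrC; apply/eqP.
    by rewrite /= !mulrN !mulNr mulrC subrr.
  + by rewrite le.
  + by rewrite mulrDr mulrDl -scalerAl -scalerAr !trD !trZ; ring.
- by rewrite mulrAC le.
- by rewrite mulrDr mulrDl -scalerAl -scalerAr !trD !trZ; ring.
Qed.

Lemma tr_star a : tr (starS a) = conjc (tr a).
Proof. by rewrite /tr sv_star mul0r ph0 mul1r oppr0. Qed.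

Lemma wabs_nabla p l (a : nctorus R) m : wabs p (nabla l a) m <= wabs p.+1 a m.
Proof.
rewrite /wabs /nabla !cabsM exprSr -!mulrA ler_wpM2l ?wgtX_ge0// mulrA ler_wpM2r ?cabs_ge0//.
have -> : cabs 'i = 1 :> R by rewrite /cabs/= expr0n expr1n add0r sqrtr1.
rewrite mul1r.
rewrite (_ : (if l == ord0 then m.1 else m.2)%:~R =
  ((if l == ord0 then m.1 else m.2)%:~R : R)%:C); last by rewrite rmorph_int.
rewrite cabs_real -intr_norm /wgt ler_int; case: ifP; lia.
Qed.

Lemma smth_nabla l (a : nctorus R) : smth a -> smth (nabla l a).
Proof.
move=> sa p; have [M aM] := sa p.+1; exists M.
by apply: sbnd_le aM => m; exact: wabs_nabla.
Qed.

Definition nab l (a : St) : St := mkS (smth_nabla l (smP a)).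

Definition frq (l : 'I_2) m : R[i] := 'i * (if l == ord0 then m.1 else m.2)%:~R.

Lemma sv_nab l a m : sv (nab l a) m = frq l m * sv a m.
Proof. by []. Qed.

Lemma frqD l m n : frq l (m + n) = frq l m + frq l n.
Proof. by rewrite /frq -mulrDr -intrD; case: ifP. Qed.

Lemma snu_nab p l a : snu p (nab l a) <= snu p.+1 a.
Proof. by apply: nu_le; apply: sbnd_le (snuP p.+1 a) => m; exact: wabs_nabla. Qed.

Lemma nabD l a b : nab l (a + b) = nab l a + nab l b.
Proof. by apply: st_eq => m; rewrite svD !sv_nab svD mulrDr. Qed.

Lemma nabZ l c a : nab l (c *: a) = c *: nab l a.
Proof. by apply: st_eq => m; rewrite svZ !sv_nab svZ mulrCA. Qed.

Lemma nab_dl l m : nab l (dl m) = frq l m *: dl m.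
Proof.
apply: st_eq => r; rewrite svZ sv_nab /= /delta.
by case: eqP => [->//|]; rewrite !mulr0.
Qed.

(** A derivation loses one power of the weight, so the density argument runs in the seminorm of
    index 1. *)
Lemma nabM l a b : nab l (a * b) = nab l a * b + a * nab l b.
Proof.
apply: st_eq => r; apply/eqP; rewrite -subr_eq0; apply/eqP.
have le x y : cabs (sv (nab l (x * y)) r - sv (nab l x * y + x * nab l y) r) <=
    3 * snu 1 x * snu 1 y.
  have M x' y' : snu 0 x' <= snu 1 x -> snu 0 y' <= snu 1 y ->
      cabs (sv (x' * y') r) <= snu 1 x * snu 1 y.
    move=> h1 h2; apply: le_trans (cabs_sv 0 _ _) (le_trans (snuM _ _ _) _).
    by rewrite ler_pM ?snu_ge0.
  have H1 : cabs (sv (nab l (x * y)) r) <= snu 1 x * snu 1 y.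
    by apply: le_trans (cabs_sv 0 _ _) (le_trans (snu_nab _ _ _) (snuM _ _ _)).
  have H2 : cabs (sv (nab l x * y) r) <= snu 1 x * snu 1 y.
    by apply: M; [exact: snu_nab|exact: snu_mono].
  have H3 : cabs (sv (x * nab l y) r) <= snu 1 x * snu 1 y.
    by apply: M; [exact: snu_mono|exact: snu_nab].
  rewrite svD; have := cabsB (sv (nab l (x * y)) r) (sv (nab l x * y) r + sv (x * nab l y) r).
  have := cabsD (sv (nab l x * y) r) (sv (x * nab l y) r).
  lra.
apply: (@st_ext (fun a => sv (nab l (a * b)) r - sv (nab l a * b + a * nab l b) r)
  1%N (3 * snu 1 b)) => [c x y|x|m]; last first.
- apply: (@st_ext (fun b => sv (nab l (dl m * b)) r -
    sv (nab l (dl m) * b + dl m * nab l b) r) 1%N (3 * snu 1 (dl m))) => [c x y|x|n]; last first.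
  + rewrite !nab_dl -scalerAl -scalerAr ![dl _ * dl _]mulS_dl nabZ nab_dl frqD.
    by rewrite !svD !svZ; ring.
  + by rewrite le.
  + by rewrite !(mulrDr, nabD, mulrDl, nabZ) -!(scalerAl, scalerAr) !(svD, nabZ, svZ); ring.
- by rewrite mulrAC le.
- by rewrite !(mulrDr, nabD, mulrDl, nabZ) -!(scalerAl, scalerAr) !(svD, nabZ, svZ); ring.
Qed.

Lemma tr_nab l a : tr (nab l a) = 0.
Proof. by rewrite /tr sv_nab /frq/= if_same mulr0 mul0r. Qed.

End Torus.

#[global] Opaque mulS.

(** * Exponentials and their derivatives *)

Section Limits.
Context {R : realType} {theta : R}.
Local Notation St := (storus theta).
Implicit Types (X : nat -> St) (a b y : St) (p N K n : nat) (z s : R[i]).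

Lemma cauchy_real (u e : nat -> R) : (forall N K, (N <= K)%N -> `|u K - u N| <= e N) ->
  e @ \oo --> 0 -> cvgn u.
Proof.
move=> ue e0; apply/cauchy_cvgP/cauchy_exP => eps eps0.
have /cvgrPdist_lt/(_ _ eps0)[N _ /(_ N (leqnn _))] := e0.
rewrite sub0r normrN => /(le_lt_trans (ler_norm _)) eN.
exists (u N); exists N => // K /= NK; rewrite /ball/= distrC.
exact: le_lt_trans (ue _ _ NK) eN.
Qed.

Lemma cauchy_complex (u : nat -> R[i]) (e : nat -> R) :
  (forall N K, (N <= K)%N -> cabs (u K - u N) <= e N) -> e @ \oo --> 0 ->
  ccvg u (clim u).
Proof.
move=> ue e0; split; rewrite /clim /by_parts/=.
  apply: (@cauchy_real _ e) => // N K NK; apply: le_trans (ue _ _ NK).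
  by rewrite -Re_opp -Re_add Re_le_cabs.
apply: (@cauchy_real _ e) => // N K NK; apply: le_trans (ue _ _ NK).
by rewrite -Im_opp -Im_add Im_le_cabs.
Qed.

Lemma sbnd_lim p (Y : nat -> nctorus R) (y : nctorus R) B :
  (forall r, ccvg (fun N => Y N r) (y r)) -> (forall N, sbnd (wabs p (Y N)) B) ->
  sbnd (wabs p y) B.
Proof.
move=> Yy YB s us.
have cv : (fun N => \sum_(r <- s) wabs p (Y N) r) @ \oo --> \sum_(r <- s) wabs p y r.
  elim: s {us} => [|r s IH].
    by rewrite big_nil; under eq_fun do rewrite big_nil; exact: cvg_cst.
  rewrite big_cons; under eq_fun do rewrite big_cons; apply: cvgD => //.
  by apply: cvgM; [exact: cvg_cst|exact: ccvg_cabs].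
rewrite -(cvg_lim _ cv)//; apply: limr_le; first by apply/cvg_ex; eexists; exact: cv.
by apply: nearW => N; exact: YB.
Qed.

Lemma snu_lim p (Y : nat -> St) y B :
  (forall r, ccvg (fun N => sv (Y N) r) (sv y r)) -> (forall N, snu p (Y N) <= B) ->
  snu p y <= B.
Proof.
move=> Yy YB; apply: nu_le; apply: sbnd_lim Yy _ => N s us.
by apply: le_trans (YB N); exact: snuP.
Qed.

Lemma ccvg_shift (u : nat -> R[i]) N l : ccvg u l -> ccvg (fun n => u (n + N)%N) l.
Proof. by move=> [ur ui]; split; rewrite (cvg_shiftn N (fun n => _ (u n))). Qed.

(** The limit is formed coefficientwise, as in [nc_exp]; the bounds on differences pass to it by the
    Fatou property [sbnd_lim], which also makes it smooth. *)
Lemma st_complete (Y : nat -> St) (e : nat -> nat -> R) :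
  (forall p N K, (N <= K)%N -> snu p (Y K - Y N) <= e p N) ->
  (forall p, e p @ \oo --> 0) ->
  let y := (fun r => clim (fun N => sv (Y N) r)) in
  [/\ smth y, (forall r, ccvg (fun N => sv (Y N) r) (y r)) &
      forall p N, sbnd (wabs p (y - sv (Y N))) (e p N)].
Proof.
move=> Ye e0 y.
have yr r : ccvg (fun N => sv (Y N) r) (y r).
  apply: (@cauchy_complex _ (e 0%N)) => // N K NK.
  by rewrite -svB; apply: le_trans (cabs_sv 0 _ _) (Ye _ _ _ NK).
have yB p N : sbnd (wabs p (y - sv (Y N))) (e p N).
  apply: (@sbnd_lim p (fun K => sv (Y (K + N)%N) - sv (Y N))) => [r|K].
    by apply: ccvgB; [exact: ccvg_shift (yr r)|exact: ccvg_cst].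
  move=> s us; apply: le_trans (Ye p N (K + N)%N (leq_addl _ _)).
  exact: (snuP p (Y (K + N)%N - Y N)).
split=> // p; exists (e p 0%N + snu p (Y 0%N)).
apply: sbnd_le (sbndD (yB p 0%N) (snuP p (Y 0%N))) => m.
by rewrite -{1}(subrK (sv (Y 0%N)) y) wabsD.
Qed.

Lemma snu_cvg_ccvg (Y : nat -> St) y r : snu 0 (Y N - y) @[N --> \oo] --> 0 ->
  ccvg (fun N => sv (Y N) r) (sv y r).
Proof. by move=> Yy; apply: ccvg_squeeze Yy => N; rewrite -svB cabs_sv. Qed.

Lemma snu_cvgM p (Y : nat -> St) y a b : snu p (Y N - y) @[N --> \oo] --> 0 ->
  snu p (a * Y N * b - a * y * b) @[N --> \oo] --> 0.
Proof.
move=> Yy; apply: (@squeeze_cvgr _ _ _ _ (fun=> 0)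
    (fun N => snu p a * snu p (Y N - y) * snu p b)).
- apply: nearW => N; rewrite snu_ge0/= -mulrBl -mulrBr.
  by apply: le_trans (snuM _ _ _) _; rewrite ler_wpM2r ?snu_ge0// snuM.
- exact: cvg_cst.
- rewrite -(mul0r (snu p b)) -(mulr0 (snu p a)).
  by apply: cvgM; [apply: cvgM => //; exact: cvg_cst|exact: cvg_cst].
Qed.

Definition toS (y : nctorus R) : St :=
  if pselect (smth y) is left h then mkS theta h else 0.

Lemma toSE (y : nctorus R) : smth y -> sv (toS y) = y.
Proof. by rewrite /toS; case: pselect. Qed.

(** Geometric growth in each seminorm. The exponent [n.+1] absorbs the constant: with exponent [n]
    the zeroth term would have to be at most 1. *)
Definition egrow (X : nat -> St) : Prop :=
  forall p, exists M, forall n, snu p (X n) <= M ^+ n.+1.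

Definition psn (X : nat -> St) z N : St :=
  \sum_(n < N) (n`!%:R)^-1 *: (z ^+ n *: X n).

(** Exponential generating functions $\sum_n z^nX_n/n!$. They cover both $e^{zh}$ and its derivative
    in $h$, and $d/dz$ is the shift of [X]. *)
Definition PS X z : St := toS (fun r => clim (fun N => sv (psn X z N) r)).

Lemma egrow_ge0 X p M : (forall n, snu p (X n) <= M ^+ n.+1) -> 0 <= M.
Proof. by move=> /(_ 0%N); rewrite expr1; apply: le_trans; exact: snu_ge0. Qed.

Lemma psn_term_le p X z (k B : R) n : snu p (X n) <= k * B ^+ n ->
  snu p ((n`!%:R)^-1 *: (z ^+ n *: X n)) <= k * exp_coeff (cabs z * B) n.
Proof.
move=> XB; apply: le_trans (snuZle _ _ _) _.
rewrite cabsV cabs_nat /exp_coeff/= mulrA mulrC; rewrite ler_wpM2r ?invr_ge0//.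
apply: le_trans (snuZle _ _ _) _; rewrite cabsX exprMn mulrCA.
by rewrite ler_wpM2l// exprn_ge0 ?cabs_ge0.
Qed.

Lemma series_exp_le (x : R) N : 0 <= x -> series (exp_coeff x) N <= expR x.
Proof.
move=> x0; apply: nondecreasing_cvgn_le; last exact: is_cvg_series_exp_coeff.
apply/nondecreasing_seqP => n; rewrite !seriesEord/= big_ord_recr/= lerDl.
exact: exp_coeff_ge0.
Qed.

Lemma psn_le p X z (k B : R) N : 0 <= k -> 0 <= B ->
  (forall n, snu p (X n) <= k * B ^+ n) ->
  snu p (psn X z N) <= k * expR (cabs z * B).
Proof.
move=> k0 B0 XB; apply: le_trans (snu_sum _ _ _ _) _.
apply: (@le_trans _ _ (k * series (exp_coeff (cabs z * B)) N)); last first.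
  by rewrite ler_wpM2l// series_exp_le// mulr_ge0 ?cabs_ge0.
by rewrite seriesEord/= mulr_sumr; apply: ler_sum => n _; exact: psn_term_le.
Qed.

Lemma PS_spec X z : egrow X ->
  [/\ forall r, ccvg (fun N => sv (psn X z N) r) (sv (PS X z) r) &
      forall p, snu p (psn X z N - PS X z) @[N --> \oo] --> 0].
Proof.
move=> /choice[M XM].
have M0 p : 0 <= M p := egrow_ge0 (XM p).
pose e p N := M p * (expR (cabs z * M p) - series (exp_coeff (cabs z * M p)) N).
have XM' p n : snu p (X n) <= M p * M p ^+ n by rewrite -exprS.
have Ye p N K : (N <= K)%N -> snu p (psn X z K - psn X z N) <= e p N.
  move=> NK; rewrite /psn -!(big_mkord xpredT (fun n => (n`!%:R)^-1 *: (z ^+ n *: X n))).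
  rewrite (@big_cat_nat _ _ _ N)//= [X in X - _]addrC addrK.
  apply: le_trans (snu_sum _ _ _ _) _.
  apply: (@le_trans _ _ (\sum_(N <= n < K) M p * exp_coeff (cabs z * M p) n)).
    by apply: ler_sum => n _; exact: psn_term_le.
  rewrite -mulr_sumr ler_wpM2l// lerBrDl.
  apply: le_trans (series_exp_le K _); last by rewrite mulr_ge0 ?cabs_ge0.
  by rewrite !seriesEnat/= -big_cat_nat.
have e0 p : e p @ \oo --> 0.
  rewrite -(mulr0 (M p)) -(subrr (expR (cabs z * M p))).
  apply: cvgM; first exact: cvg_cst.
  apply: cvgB; first exact: cvg_cst.
  exact: is_cvg_series_exp_coeff.
have [sy yr yB] := st_complete Ye e0.
have PE : sv (PS X z) = (fun r => clim (fun N => sv (psn X z N) r)) := toSE sy.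
split=> [r|p]; first by rewrite PE.
apply: (@squeeze_cvgr _ _ _ _ (fun=> 0) (e p)) => //; last exact: cvg_cst.
apply: nearW => N; rewrite snu_ge0/= -snuN opprB; apply: nu_le.
by rewrite -[X in wabs p X]/(sv (PS X z) - sv (psn X z N)) PE.
Qed.

#[global] Opaque PS.

Lemma PS_ext X (Y : nat -> St) z : X =1 Y -> PS X z = PS Y z.
Proof. by move=> /funext ->. Qed.

Lemma PS_ccvg X z r : egrow X -> ccvg (fun N => sv (psn X z N) r) (sv (PS X z) r).
Proof. by move=> /(PS_spec z)[]. Qed.

Lemma PS_le p X z (k B : R) : egrow X -> 0 <= k -> 0 <= B ->
  (forall n, snu p (X n) <= k * B ^+ n) ->
  snu p (PS X z) <= k * expR (cabs z * B).
Proof.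
move=> gX k0 B0 XB; apply: snu_lim (fun r => PS_ccvg z r gX) _ => N.
exact: psn_le.
Qed.

Lemma PS_eqlim X z y : egrow X -> (forall r, ccvg (fun N => sv (psn X z N) r) (sv y r)) ->
  PS X z = y.
Proof.
by move=> gX Xy; apply: st_eq => r; exact: ccvg_unique (PS_ccvg z r gX) (Xy r).
Qed.

Lemma psn_mul X z N a b :
  psn (fun n => a * X n * b) z N = a * psn X z N * b.
Proof.
rewrite /psn mulr_sumr mulr_suml; apply: eq_bigr => n _.
by rewrite -!(scalerAr, scalerAl).
Qed.

Lemma egrow_mul X a b : egrow X -> egrow (fun n => a * X n * b).
Proof.
move=> gX p; have [M XM] := gX p; have M0 := egrow_ge0 XM.
exists ((1 + snu p a * snu p b) * (M + 1)) => n.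
apply: le_trans (snuM _ _ _) _; apply: le_trans (ler_wpM2r (snu_ge0 _ _) (snuM _ _ _)) _.
rewrite mulrAC exprMn; apply: ler_pM; rewrite ?mulr_ge0 ?snu_ge0//.
  have ab0 : 0 <= snu p a * snu p b by rewrite mulr_ge0 ?snu_ge0.
  apply: (@le_trans _ _ (1 + snu p a * snu p b)); first by rewrite lerDr.
  by rewrite exprS ler_peMr ?addr_ge0// exprn_ege1// lerDl.
by apply: le_trans (XM n) _; rewrite lerXn2r ?nnegrE ?addr_ge0// lerDl.
Qed.

Lemma PS_mul X z a b : egrow X -> PS (fun n => a * X n * b) z = a * PS X z * b.
Proof.
move=> gX; apply: PS_eqlim => [|r]; first exact: egrow_mul.
have [_ /(_ 0%N)H] := PS_spec z gX; have := snu_cvg_ccvg r (snu_cvgM a b H).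
by apply: ccvg_eq => N; rewrite psn_mul.
Qed.

Lemma PS_lin X (Y : nat -> St) c z : egrow X -> egrow Y -> egrow (fun n => c *: X n + Y n) ->
  PS (fun n => c *: X n + Y n) z = c *: PS X z + PS Y z.
Proof.
move=> gX gY gXY; apply: PS_eqlim => // r; rewrite svD svZ.
apply: ccvg_eq (ccvgD (ccvgMl c (PS_ccvg z r gX)) (PS_ccvg z r gY)) => N.
rewrite -svZ -svD; congr sv; rewrite /psn scaler_sumr -big_split/=.
by apply: eq_bigr => n _; rewrite !scalerDr !scalerA; congr (_ *: _ + _); ring.
Qed.

Lemma egrowD X (Y : nat -> St) c : egrow X -> egrow Y -> egrow (fun n => c *: X n + Y n).
Proof.
move=> gX gY p; have [M XM] := gX p; have [M' YM] := gY p.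
have M0 := egrow_ge0 XM; have M'0 := egrow_ge0 YM.
exists ((1 + cabs c) * M + M') => n.
have c0 := cabs_ge0 c.
have sum2 (x y : R) : 0 <= x -> 0 <= y -> x ^+ n.+1 + y ^+ n.+1 <= (x + y) ^+ n.+1.
  move=> x0 y0; rewrite exprDn big_ord_recl big_ord_recr/= subn0 expr0 mulr1 bin0 mulr1n.
  rewrite subnn expr0 mul1r binn mulr1n lerD2l lerDr sumr_ge0// => i _.
  by rewrite mulrn_wge0// mulr_ge0// exprn_ge0.
apply: le_trans (sum2 _ _ _ _); rewrite ?mulr_ge0 ?addr_ge0//.
apply: le_trans (snuD _ _ _) _; apply: lerD => //.
apply: le_trans (snuZle _ _ _) _; rewrite exprMn; apply: ler_pM; rewrite ?snu_ge0//.
rewrite -[leLHS]expr1; apply: (@le_trans _ _ ((1 + cabs c) ^+ 1)).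
  by rewrite !expr1 lerDr.
by rewrite ler_weXn2l// lerDl.
Qed.

Lemma egrow_shift X : egrow X -> egrow (fun n => X n.+1).
Proof.
move=> gX p; have [M XM] := gX p; have M0 := egrow_ge0 XM.
exists ((M + 1) ^+ 2) => n; apply: le_trans (XM _) _; rewrite -exprM.
apply: (@le_trans _ _ ((M + 1) ^+ n.+2)).
  by rewrite lerXn2r ?nnegrE ?addr_ge0// lerDl.
by rewrite ler_weXn2l ?lerDr//; lia.
Qed.

Lemma sqr_le_exp4 n : (n%:R : R) ^+ 2 <= 4 ^+ n.
Proof.
rewrite -natrX -[4]/(4%:R) -natrX ler_nat.
have := ltn_expl n (ltnSn 1) => /ltnW h.
by rewrite (_ : 4 = 2 ^ 2)%N// -expnM mulnC expnM leq_exp2r.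
Qed.

(** The factor $n^2$ will be absorbed by $4^n$, so that the remainders again sum to an
    exponential. *)
Lemma pow_rem z t (B : R) n : cabs z + cabs t + 1 <= B ->
  cabs ((z + t) ^+ n - z ^+ n - t * (n%:R * z ^+ n.-1)) <= cabs t ^+ 2 * (n%:R ^+ 2 * B ^+ n).
Proof.
move=> zB; have z0 := cabs_ge0 z; have t0 := cabs_ge0 t.
have B1 : 1 <= B by lra.
have B0 : 0 <= B by lra.
elim: n => [|n IH].
  by rewrite !expr0 mul0r mulr0 subr0 subrr cabs0 mulr_ge0 ?sqr_ge0// mulr_ge0 ?sqr_ge0.
set r := (X in cabs X <= _) in IH.
have -> : (z + t) ^+ n.+1 - z ^+ n.+1 - t * (n.+1%:R * z ^+ n.+1.-1) =
    (z + t) * r + t ^+ 2 * (n%:R * z ^+ n.-1).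
  rewrite /r; case: n {IH r} => [|n]; first by rewrite /= !expr1 !expr0; ring.
  by rewrite /= !exprS -(natr1 n.+1); ring.
apply: le_trans (cabsD _ _) _; rewrite cabsM [X in _ + X]cabsM cabsX cabsM cabs_nat cabsX.
have h1 : cabs (z + t) * cabs r <= cabs t ^+ 2 * (n%:R ^+ 2 * B ^+ n.+1).
  rewrite [B ^+ n.+1]exprS [leRHS](_ : _ = B * (cabs t ^+ 2 * (n%:R ^+ 2 * B ^+ n))); last by ring.
  by apply: ler_pM; rewrite ?cabs_ge0//; have := cabsD z t; lra.
have h2 : cabs t ^+ 2 * (n%:R * cabs z ^+ n.-1) <= cabs t ^+ 2 * (n%:R * B ^+ n.+1).
  rewrite ler_wpM2l ?sqr_ge0// ler_wpM2l//.
  apply: (@le_trans _ _ (B ^+ n.-1)); first by rewrite lerXn2r ?nnegrE//; lra.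
  by rewrite ler_weXn2l//; lia.
apply: le_trans (lerD h1 h2) _; rewrite -mulrDr ler_wpM2l ?sqr_ge0// -mulrDl.
by rewrite ler_wpM2r ?exprn_ge0// -natr1; have := ler0n R n; nra.
Qed.

Lemma PS_der p X z (rho : R) : egrow X -> exists C, forall t, cabs t <= rho ->
  snu p (PS X (z + t) - PS X z - t *: PS (fun n => X n.+1) z) <= C * cabs t ^+ 2.
Proof.
move=> gX; have gX' := egrow_shift gX.
have [M XM] := gX p; have M0 := egrow_ge0 XM.
pose B := cabs z + `|rho| + 1.
have B0 : 0 <= B by rewrite !addr_ge0 ?cabs_ge0.
exists (M * expR (4 * B * M)) => t trho.
pose r n := (z + t) ^+ n - z ^+ n - t * (n%:R * z ^+ n.-1).
(* The derivative is truncated one term earlier, because differentiation lowers the degree by one;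
   then the three sums combine term by term. *)
pose Y N : St := psn X (z + t) N.+1 - psn X z N.+1 - t *: psn (fun n => X n.+1) z N.
have YE N : Y N = \sum_(n < N.+1) (n`!%:R)^-1 *: (r n *: X n).
  rewrite /Y; have -> : psn (fun n => X n.+1) z N = \sum_(n < N.+1) (n`!%:R)^-1 *: ((n%:R * z ^+ n.-1) *: X n).
    rewrite big_ord_recl mul0r scale0r scaler0 add0r; apply: eq_bigr => n _.
    rewrite !lift0 factS natrM !scalerA /=; congr (_ *: _).
    by rewrite invfM mulrACA mulVf ?mul1r ?pnatr_eq0.
  rewrite /psn scaler_sumr -!sumrB; apply: eq_bigr => n _.
  by rewrite !scalerBl !scalerBr !scalerA; congr (_ - _); congr (_ *: _); ring.
apply: (@snu_lim p Y) => [s|N].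
  rewrite !svB svZ; apply: ccvgB.
    have S x := ccvg_shift 1 (PS_ccvg x s gX).
    by apply: ccvgB; [move: (S (z + t))|move: (S z)]; apply: ccvg_eq => N; rewrite addn1.
  by apply: ccvgMl; exact: PS_ccvg.
rewrite YE; apply: le_trans (snu_sum _ _ _ _) _.
apply: (@le_trans _ _ (\sum_(n < N.+1) M * cabs t ^+ 2 * exp_coeff (4 * B * M) n)).
  apply: ler_sum => n _; apply: le_trans (snuZle _ _ _) _.
  rewrite cabsV cabs_nat /exp_coeff/= mulrA mulrC ler_wpM2r ?invr_ge0//.
  apply: le_trans (snuZle _ _ _) _.
  apply: (@le_trans _ _ ((cabs t ^+ 2 * (4 ^+ n * B ^+ n)) * M ^+ n.+1)); last first.
    by rewrite !exprMn [M ^+ n.+1]exprS le_eqVlt; apply/orP; left; apply/eqP; ring.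
  apply: ler_pM; rewrite ?cabs_ge0 ?snu_ge0//.
  apply: le_trans (@pow_rem z t B n _) _.
    by rewrite /B lerD2r lerD2l (le_trans trho)// ler_norm.
  by rewrite ler_wpM2l ?sqr_ge0// ler_wpM2r ?exprn_ge0// sqr_le_exp4.
rewrite -mulr_sumr mulrAC ler_wpM2r ?sqr_ge0// ler_wpM2l//.
have := @series_exp_le (4 * B * M) N.+1; rewrite seriesEord; apply.
by rewrite !mulr_ge0.
Qed.

(** Differentiability with quadratic remainder in every seminorm. All curves used here have it, it
    is stable under products and derivations, and it requires no topology on the algebra. *)
Definition sder (f : R -> St) (x : R) (f' : St) : Prop :=
  forall p, exists C, forall t : R, `|t| <= 1 ->
    snu p (f (x + t) - f x - t%:C *: f') <= C * t ^+ 2.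

Lemma sder_ge0 f x f' p : sder f x f' -> exists C, 0 <= C /\ forall t : R, `|t| <= 1 ->
    snu p (f (x + t) - f x - t%:C *: f') <= C * t ^+ 2.
Proof.
move=> /(_ p)[C fC]; exists `|C|; split=> // t t1; apply: le_trans (fC t t1) _.
by rewrite ler_wpM2r ?sqr_ge0// ler_norm.
Qed.

Lemma sder_cst a x : sder (fun=> a) x 0.
Proof. by move=> p; exists 0 => t _; rewrite scaler0 subr0 subrr snu0 mul0r. Qed.

Lemma sder_eq f g x f' : f =1 g -> sder f x f' -> sder g x f'.
Proof. by move=> /funext ->. Qed.

Lemma sderM f g x f' g' : sder f x f' -> sder g x g' ->
  sder (fun t => f t * g t) x (f' * g x + f x * g').
Proof.
move=> fx gx p; have [C [C0 fC]] := sder_ge0 p fx; have [D [D0 gD]] := sder_ge0 p gx.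
pose F := snu p f'; pose G := snu p (g x) + snu p g' + D.
exists (C * G + snu p (f x) * D + F * (snu p g' + D)) => t t1.
have t2 : t ^+ 2 <= `|t| by rewrite -real_normK ?num_real// expr2 ler_piMl.
have t0 : 0 <= t ^+ 2 := sqr_ge0 t.
have dg : snu p (g (x + t) - g x) <= `|t| * (snu p g' + D).
  rewrite -(subrK (t%:C *: g') (g (x + t) - g x)); apply: le_trans (snuD _ _ _) _.
  have := gD t t1; have := snuZle p t%:C g'; rewrite cabs_real => h1 h2.
  have : D * t ^+ 2 <= D * `|t| by rewrite ler_wpM2l.
  by rewrite mulrDr; lra.
have gB : snu p (g (x + t)) <= G.
  rewrite -(subrK (g x) (g (x + t))); apply: le_trans (snuD _ _ _) _.
  have : `|t| * (snu p g' + D) <= snu p g' + D by rewrite ler_piMl ?addr_ge0 ?snu_ge0.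
  by rewrite /G; lra.
have -> : f (x + t) * g (x + t) - f x * g x - t%:C *: (f' * g x + f x * g') =
   (f (x + t) - f x - t%:C *: f') * g (x + t) + f x * (g (x + t) - g x - t%:C *: g') +
   t%:C *: (f' * (g (x + t) - g x)).
  rewrite !(mulrBl, mulrBr, scalerDr, scalerBr) -!(scalerAl, scalerAr).
  by apply: st_eq => m; rewrite !(svD, svN, svZ); ring.
apply: le_trans (snuD _ _ _) _; apply: le_trans (lerD (snuD _ _ _) (snuZle _ _ _)) _.
rewrite cabs_real [leRHS]mulrDl [X in _ <= X + _]mulrDl; apply: lerD; first apply: lerD.
- apply: le_trans (snuM _ _ _) _; rewrite mulrAC.
  by apply: ler_pM; rewrite ?snu_ge0 ?fC.
- apply: le_trans (snuM _ _ _) _; rewrite -mulrA.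
  by rewrite ler_wpM2l ?snu_ge0 ?gD.
- have -> : F * (snu p g' + D) * t ^+ 2 = `|t| * (F * (`|t| * (snu p g' + D))).
    by rewrite -(real_normK (num_real t)); ring.
  rewrite ler_wpM2l//; apply: le_trans (snuM _ _ _) _.
  by rewrite ler_wpM2l ?snu_ge0.
Qed.

Lemma sder_nab l f x f' : sder f x f' -> sder (fun t => nab l (f t)) x (nab l f').
Proof.
move=> fx p; have [C fC] := fx p.+1; exists C => t t1.
apply: le_trans (fC t t1); apply: le_trans (snu_nab p l _).
by rewrite !nabD -nabZ -(scaleN1r (f x)) -(scaleN1r (_ *: f')) !nabZ !scaleN1r.
Qed.

Lemma is_derive_quad (g : R -> R) (x d C : R) :
  (forall t, `|t| <= 1 -> `|g (x + t) - g x - t * d| <= C * t ^+ 2) ->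
  is_derive x (1 : R) g d.
Proof.
move=> gC; have C0 : 0 <= C.
  have := gC 1; rewrite normr1 lexx => /(_ isT); rewrite expr1n mulr1.
  exact: le_trans.
have cv : h^-1 *: ((g \o shift x) (h *: (1 : R)) - g x) @[h --> 0^'] --> d.
  apply/cvgrPdist_le => e e0; near=> h.
  have h0 : h != 0 by near: h; exact: nbhs_dnbhs_neq.
  have h1 : `|h| <= 1 by near: h; apply: dnbhs0_le.
  have he : `|h| <= e / (C + 1) by near: h; apply: dnbhs0_le; rewrite divr_gt0// ltr_wpDl.
  rewrite /= {2}/GRing.scale/= mulr1 (addrC h) distrC.
  have -> : h^-1 *: (g (x + h) - g x) - d = h^-1 * (g (x + h) - g x - h * d).
    by rewrite /GRing.scale/=; field.
  rewrite normrM normfV ler_pdivrMl ?normr_gt0//; apply: le_trans (gC h h1) _.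
  rewrite -real_normK ?num_real// expr2 mulrCA ler_wpM2l//.
  move: he; rewrite ler_pdivlMr ?ltr_wpDl// mulrC; apply: le_trans.
  by rewrite ler_wpM2r// lerDl.
have dv : derivable g x 1 by apply/cvg_ex; exists d; exact: cv.
by apply: DeriveDef dv _; exact: (cvg_lim _ cv).
Unshelve. all: end_near. Qed.

Lemma sder_coef f x f' m : sder f x f' -> is_cderive (fun t => sv (f t) m) x (sv f' m).
Proof.
move=> /(_ 0%N)[C fC].
have H t : `|t| <= 1 -> cabs (sv (f (x + t)) m - sv (f x) m - t%:C * sv f' m) <= C * t ^+ 2.
  by move=> t1; apply: le_trans (fC t t1); apply: le_trans (cabs_sv _ _ m).
split; apply: (@is_derive_quad _ _ _ C) => t /H; apply: le_trans.
  by rewrite -Re_real -!Re_opp -!Re_add Re_le_cabs.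
by rewrite -Im_real -!Im_opp -!Im_add Im_le_cabs.
Qed.

Lemma sder_PS X (z s : R[i]) x : egrow X ->
  sder (fun t => PS X (z + t%:C * s)) x (s *: PS (fun n => X n.+1) (z + x%:C * s)).
Proof.
move=> gX p; have [C HC] := @PS_der p X (z + x%:C * s) (cabs s) gX.
exists (C * cabs s ^+ 2) => t t1.
have ts : cabs (t%:C * s) <= cabs s by rewrite cabsM cabs_real ler_piMl ?cabs_ge0.
have := HC _ ts; rewrite cabsM exprMn cabs_real real_normK ?num_real//.
rewrite rmorphD mulrDl addrA scalerA => /le_trans; apply.
by rewrite le_eqVlt; apply/orP; left; apply/eqP; ring.
Qed.

Section Exponential.
Variable h : St.

Lemma egrow_exp : egrow (fun n => h ^+ n).
Proof.
move=> p; exists (snu p h + 1) => n; apply: le_trans (snuX _ _ _) _.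
apply: (@le_trans _ _ ((snu p h + 1) ^+ n)).
  by rewrite lerXn2r ?nnegrE ?addr_ge0 ?snu_ge0// lerDl.
by rewrite ler_weXn2l// lerDr snu_ge0.
Qed.

Definition E z : St := PS (fun n => h ^+ n) z.

Lemma E_shiftl z : PS (fun n => h ^+ n.+1) z = h * E z.
Proof.
rewrite -[RHS]mulr1 -PS_mul; last exact: egrow_exp.
by apply: PS_ext => n; rewrite mulr1 exprS.
Qed.

Lemma E_comm z : h * E z = E z * h.
Proof.
rewrite -E_shiftl -[RHS](mul1r (_ * _)) mulrA -PS_mul; last exact: egrow_exp.
by apply: PS_ext => n; rewrite mul1r exprSr.
Qed.

Lemma PS_z0 X : egrow X -> PS X 0 = X 0%N.
Proof.
move=> gX; apply: PS_eqlim => // r.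
have /= := ccvg_cst (sv (X 0%N) r) => -[cr ci].
have H N : psn X 0 N.+1 = X 0%N.
  rewrite /psn big_ord_recl expr0 fact0 invr1 !scale1r big1 ?addr0// => i _.
  by rewrite lift0 exprS mul0r scale0r scaler0.
by split; rewrite -(cvg_shiftn 1); under eq_fun do rewrite addn1 H; exact: cvg_cst.
Qed.

Lemma E0 : E 0 = 1.
Proof. by rewrite /E PS_z0//; exact: egrow_exp. Qed.

Lemma sder_E z s x : sder (fun t => E (z + t%:C * s)) x (s *: (h * E (z + x%:C * s))).
Proof. by rewrite -E_shiftl; apply: sder_PS; exact: egrow_exp. Qed.

Lemma sder0_cst f : (forall x, sder f x 0) -> f 1 = f 0.
Proof.
move=> fx; apply: st_eq => m.
have H x := sder_coef m (fx x).
have c1 : forall x : R, is_derive x (1 : R) (fun t => complex.Re (sv (f t) m)) 0 by move=> x; case: (H x).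
have c2 : forall x : R, is_derive x (1 : R) (fun t => complex.Im (sv (f t) m)) 0 by move=> x; case: (H x).
by apply: complex_eq; [exact: (is_derive_0_is_cst 1 0 c1)|exact: (is_derive_0_is_cst 1 0 c2)].
Qed.

Lemma prod_der0 s (A B : St) : h * A = A * h ->
  (- s) *: (h * A) * B + A * (s *: (h * B)) = 0.
Proof. by move=> hA; rewrite -scalerAl -scalerAr mulrA -hA scaleNr addNr. Qed.

Lemma prod_der_duhamel s (A B D a : St) : h * A = A * h ->
  (- s) *: (h * A) * D + A * (s *: (h * D + a * B)) = s *: (A * a * B).
Proof.
move=> hA; rewrite -scalerAl -scalerAr mulrDr !mulrA -hA scalerDr scaleNr.
by rewrite addrA addNr add0r.
Qed.

(** The product $E(z+s-ts)\,E(ts)$ is constant in $t$; its values at $t=0$ and $t=1$ are the two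
    sides. *)
Lemma E_add z s : E (z + s) = E z * E s.
Proof.
have H x : sder (fun t => E (z + s + t%:C * (- s)) * E (0 + t%:C * s)) x 0.
  have := sderM (sder_E (z + s) (- s) x) (sder_E 0 s x).
  by rewrite (prod_der0 _ _ (E_comm _)).
have H2 := sder0_cst H.
rewrite -[LHS]mulr1 -E0.
have -> : z + s = z + s + (0 : R)%:C * - s by rewrite rmorph0 mul0r addr0.
have -> : 0 = 0 + (0 : R)%:C * s by rewrite rmorph0 mul0r addr0.
apply: etrans (esym H2) _.
have e1 : z + s + (1 : R)%:C * - s = z by rewrite rmorph1 mul1r addrK.
have e2 : 0 + (1 : R)%:C * s = s by rewrite rmorph1 mul1r add0r.
rewrite e1 e2; reflexivity.
Qed.

Lemma nc_expE z : nc_exp theta (z *: sv h) = sv (E z).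
Proof.
apply/funext => r; rewrite /nc_exp; apply: ccvg_clim.
apply: ccvg_eq (PS_ccvg z r egrow_exp) => N.
rewrite /psn sv_sum; apply: eq_bigr => n _; rewrite !svZ; congr (_ * _).
suff -> : iter n (nc_mul theta (z *: sv h)) (@nc_one R) = sv (z ^+ n *: h ^+ n) by [].
rewrite -exprZn; elim: (nat_of_ord n) => [|k IH]; first by rewrite expr0.
by rewrite iterS IH exprS.
Qed.

(** The derivative of $h^n$ in the direction [a], by the Leibniz rule. *)
Fixpoint Dn (a : St) n : St := if n is n'.+1 then h * Dn a n' + a * h ^+ n' else 0.

Lemma Dn_le a p n : snu p (Dn a n) <= n%:R * (snu p h + snu p a + 1) ^+ n.
Proof.
have h0 := snu_ge0 p h; have a0 := snu_ge0 p a.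
set M := snu p h + snu p a + 1; have M1 : 1 <= M by rewrite /M; lra.
elim: n => [|n IH]; first by rewrite /= snu0 mul0r.
rewrite -[Dn _ _]/(h * Dn a n + a * h ^+ n); apply: le_trans (snuD _ _ _) _.
rewrite -natr1 mulrDl mul1r; apply: lerD.
  apply: le_trans (snuM _ _ _) _; rewrite exprS mulrCA.
  by apply: ler_pM; rewrite ?snu_ge0// /M; lra.
apply: le_trans (snuM _ _ _) _; rewrite exprS; apply: ler_pM; rewrite ?snu_ge0//.
  by rewrite /M; lra.
by apply: le_trans (snuX _ _ _) _; rewrite lerXn2r ?nnegrE// /M; lra.
Qed.

Lemma natr_le_exp2 n : n%:R <= 2 ^+ n :> R.
Proof. by rewrite -[2]/(2%:R) -natrX ler_nat ltnW// ltn_expl. Qed.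

Lemma egrow_Dn a : egrow (Dn a).
Proof.
move=> p; have h0 := snu_ge0 p h; have a0 := snu_ge0 p a.
exists (2 * (snu p h + snu p a + 1)) => n; apply: le_trans (Dn_le _ _ _) _.
apply: (@le_trans _ _ ((2 * (snu p h + snu p a + 1)) ^+ n)).
  by rewrite exprMn ler_wpM2r ?natr_le_exp2// exprn_ge0// !addr_ge0.
by rewrite ler_weXn2l//; lra.
Qed.

Definition DE a z : St := PS (Dn a) z.

Lemma DE_shift a z : PS (fun n => Dn a n.+1) z = h * DE a z + a * E z.
Proof.
have gD := egrow_Dn a; have gE := egrow_exp.
have -> : h * DE a z + a * E z = 1 *: PS (fun n => h * Dn a n * 1) z + PS (fun n => a * h ^+ n * 1) z.
  by rewrite scale1r !PS_mul// !mulr1.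
rewrite -PS_lin; last first.
- exact: egrowD (egrow_mul _ _ gD) (egrow_mul _ _ gE).
- exact: egrow_mul.
- exact: egrow_mul.
by apply: PS_ext => n; rewrite scale1r !mulr1.
Qed.

Lemma DE0 a : DE a 0 = 0.
Proof. by rewrite /DE PS_z0//; exact: egrow_Dn. Qed.

Lemma sder_DE a z s x : sder (fun t => DE a (z + t%:C * s)) x
  (s *: (h * DE a (z + x%:C * s) + a * E (z + x%:C * s))).
Proof. by rewrite -DE_shift; apply: sder_PS; exact: egrow_Dn. Qed.

(** Variation of constants: in $z$ the function [DE] solves $D'=hD+aE$, and the integrating factor
    $E(s-xs)$ leaves only the source term. *)
Lemma duhamel_sder a s x : sder (fun t => E (s + t%:C * - s) * DE a (0 + t%:C * s)) x
  (s *: (E ((1 - x)%:C * s) * a * E (x%:C * s))).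
Proof.
have := sderM (sder_E s (- s) x) (sder_DE a 0 s x).
rewrite (prod_der_duhamel _ _ _ _ (E_comm _)) add0r.
by have -> : s + x%:C * - s = (1 - x)%:C * s by rewrite rmorphB rmorph1; ring.
Qed.

(** A derivation satisfies on powers of [h] the recursion of [Dn] with direction [nab l h]. Hence
    Duhamel's formula applies to $\nabla_lk$ as well as to $\delta_ak$. *)
Lemma nab_E l z : nab l (E z) = DE (nab l h) z.
Proof.
apply/esym; apply: PS_eqlim => [|r]; first exact: egrow_Dn.
rewrite sv_nab; apply: ccvg_eq (ccvgMl _ (PS_ccvg z r egrow_exp)) => N.
rewrite -sv_nab; congr sv; rewrite /psn.
have nab0 : nab l (0 : St) = 0 by apply: st_eq => m; rewrite sv_nab mulr0.
have nabs (s : seq 'I_N) (F : 'I_N -> St) : nab l (\sum_(i <- s) F i) = \sum_(i <- s) nab l (F i).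
  elim: s => [|i s IH]; first by rewrite !big_nil.
  by rewrite !big_cons nabD IH.
rewrite nabs; apply: eq_bigr => n _; rewrite !nabZ; congr (_ *: (_ *: _)).
elim: (nat_of_ord n) => [|k IH].
  by rewrite expr0; apply: st_eq => m; rewrite sv_nab sv1 /nc_one; case: eqP => [->|_];
    rewrite ?mulr0// /frq/= if_same mulr0 mul0r.
by rewrite exprS nabM IH addrC.
Qed.

End Exponential.

(** The first-order bound is part of the statement because the induction for the remainder uses
    it. *)
Lemma pow_pert_le p (h a : St) (e : R) n : `|e| <= 1 ->
  let M := snu p h + snu p a + 1 in
  snu p ((h + e%:C *: a) ^+ n - h ^+ n) <= `|e| * (n%:R * M ^+ n) /\
  snu p ((h + e%:C *: a) ^+ n - h ^+ n - e%:C *: Dn h a n) <= e ^+ 2 * (n%:R ^+ 2 * M ^+ n).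
Proof.
move=> e1 M; have h0 := snu_ge0 p h; have a0 := snu_ge0 p a.
have M1 : 1 <= M by rewrite /M; lra.
have M0 : 0 <= M by lra.
have e0 := normr_ge0 e.
have ea : snu p (e%:C *: a) <= `|e| * snu p a by rewrite -cabs_real snuZle.
have hM : snu p (h + e%:C *: a) <= M.
  apply: le_trans (snuD _ _ _) _; have : `|e| * snu p a <= snu p a by rewrite ler_piMl.
  by rewrite /M; lra.
elim: n => [|n [IH1 IH2]].
  by rewrite [Dn _ _ 0]/= !expr0 scaler0 subr0 subrr snu0 expr0n /= !mul0r !mulr0 lexx.
have hn : snu p (h ^+ n) <= M ^+ n.
  by apply: le_trans (snuX _ _ _) _; rewrite lerXn2r ?nnegrE// /M; lra.
set d := (h + e%:C *: a) ^+ n - h ^+ n in IH1 IH2.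
have dE : (h + e%:C *: a) ^+ n.+1 - h ^+ n.+1 = (h + e%:C *: a) * d + e%:C *: (a * h ^+ n).
  rewrite !exprS /d mulrBr -addrA; congr (_ + _).
  by rewrite mulrDl -scalerAl opprD subrK.
have n0 : 0 <= n%:R :> R by [].
split.
  rewrite dE; apply: le_trans (snuD _ _ _) _.
  have -> : n.+1%:R * M ^+ n.+1 = n%:R * M ^+ n.+1 + M ^+ n.+1 by rewrite -natr1; ring.
  rewrite [leRHS]mulrDr; apply: lerD.
    apply: le_trans (snuM _ _ _) _; rewrite exprS [leRHS](_ : _ = M * (`|e| * (n%:R * M ^+ n))); last by ring.
    by apply: ler_pM; rewrite ?snu_ge0.
  apply: le_trans (snuZle _ _ _) _; rewrite cabs_real ler_wpM2l// exprS.
  by apply: le_trans (snuM _ _ _) _; apply: ler_pM; rewrite ?snu_ge0// /M; lra.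
have rE : (h + e%:C *: a) ^+ n.+1 - h ^+ n.+1 - e%:C *: Dn h a n.+1 =
    h * (d - e%:C *: Dn h a n) + e%:C *: (a * d).
  rewrite dE -[Dn _ _ _.+1]/(h * Dn h a n + a * h ^+ n) (mulrDl h _ d).
  rewrite (mulrBr h d) -(scalerAl e%:C a d) -(scalerAr e%:C h (Dn h a n)).
  move: d (h ^+ n) (Dn h a n) {IH1 IH2 dE hn} => d hn Dn_.
  by apply: st_eq => m; rewrite !(svD, svN, svZ); ring.
rewrite rE; apply: le_trans (snuD _ _ _) _.
apply: (@le_trans _ _ (e ^+ 2 * (n%:R ^+ 2 * M ^+ n.+1) + e ^+ 2 * (n%:R * M ^+ n.+1))); last first.
  rewrite -mulrDr ler_wpM2l ?sqr_ge0// -mulrDl ler_wpM2r ?exprn_ge0// -natr1; nra.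
apply: lerD.
  apply: le_trans (snuM _ _ _) _; rewrite [M ^+ n.+1]exprS [leRHS](_ : _ = M * (e ^+ 2 * (n%:R ^+ 2 * M ^+ n))); last by ring.
  by apply: ler_pM; rewrite ?snu_ge0// /M; lra.
apply: le_trans (snuZle _ _ _) _; rewrite cabs_real.
apply: le_trans (ler_wpM2l e0 (snuM _ _ _)) _; rewrite [M ^+ n.+1]exprS.
have -> : e ^+ 2 * (n%:R * (M * M ^+ n)) = `|e| * (M * (`|e| * (n%:R * M ^+ n))).
  by rewrite -(real_normK (num_real e)); ring.
by rewrite ler_wpM2l//; apply: ler_pM; rewrite ?snu_ge0// /M; lra.
Qed.

Lemma sder_pert (h a : St) z : sder (fun e : R => E (h + e%:C *: a) z) 0 (DE h a z).
Proof.
move=> p; set M := snu p h + snu p a + 1.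
have h0 := snu_ge0 p h; have a0 := snu_ge0 p a.
have M0 : 0 <= M by rewrite /M; lra.
exists (expR (cabs z * (4 * M))) => e e1; rewrite add0r scale0r addr0.
have g1 := egrow_exp (h + e%:C *: a); have g2 := egrow_exp h; have g3 := egrow_Dn h a.
have -> : E (h + e%:C *: a) z - E h z - e%:C *: DE h a z =
  PS (fun n => (- e%:C) *: Dn h a n + (-1 *: h ^+ n + (h + e%:C *: a) ^+ n)) z.
  have g4 := egrowD (-1) g2 g1.
  rewrite PS_lin//; last exact: egrowD.
  rewrite PS_lin// /E /DE; move: (PS _ _) (PS _ _) (PS _ _) => x1 x2 x3.
  by apply: st_eq => m; rewrite !(svD, svN, svZ); ring.
rewrite mulrC; apply: PS_le => [|||n].
- by apply: egrowD => //; exact: egrowD.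
- exact: sqr_ge0.
- by rewrite mulr_ge0.
have [_] := pow_pert_le p h a n e1; rewrite -/M => H.
have -> : - e%:C *: Dn h a n + (-1 *: h ^+ n + (h + e%:C *: a) ^+ n) =
  (h + e%:C *: a) ^+ n - h ^+ n - e%:C *: Dn h a n.
  by apply: st_eq => m; rewrite !(svD, svN, svZ); ring.
apply: le_trans H _; rewrite ler_wpM2l ?sqr_ge0// exprMn ler_wpM2r ?exprn_ge0//.
exact: sqr_le_exp4.
Qed.

Lemma E_le p (h : St) z : snu p (E h z) <= expR (cabs z * snu p h).
Proof.
rewrite -[leRHS]mul1r; apply: PS_le => [||  |n]; rewrite ?snu_ge0//; first exact: egrow_exp.
by rewrite mul1r snuX.
Qed.

Lemma DE_le p (h a : St) z : snu p (DE h a z) <=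
  expR (cabs z * (2 * (snu p h + snu p a + 1))).
Proof.
have h0 := snu_ge0 p h; have a0 := snu_ge0 p a.
rewrite -[leRHS]mul1r; apply: PS_le => [|||n]; rewrite ?mulr_ge0 ?addr_ge0//.
  exact: egrow_Dn.
apply: le_trans (Dn_le _ _ _ _) _; rewrite mul1r exprMn ler_wpM2r ?natr_le_exp2//.
by rewrite exprn_ge0// !addr_ge0.
Qed.

End Limits.

#[global] Opaque E DE.

(** * Bernstein approximation of exponentials *)

Section ComplexExp.
Context {R : realType}.
Implicit Types (z w : R[i]) (x t : R).

Definition cexp z : R[i] := (expR (complex.Re z))%:C * expi (complex.Im z).

Arguments cexp : simpl never.

Lemma cexpD z w : cexp (z + w) = cexp z * cexp w.
Proof. by rewrite /cexp Re_add Im_add expRD expiD rmorphM; ring. Qed.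

Lemma Re_cexp z : complex.Re (cexp z) = expR (complex.Re z) * cos (complex.Im z).
Proof. by rewrite /cexp Re_real. Qed.

Lemma Im_cexp z : complex.Im (cexp z) = expR (complex.Re z) * sin (complex.Im z).
Proof. by rewrite /cexp Im_real. Qed.

Lemma cexp0 : cexp 0 = 1 :> R[i].
Proof. by rewrite /cexp /= expR0 expi0 mulr1. Qed.

Lemma cexpX z n : cexp z ^+ n = cexp (n%:R * z).
Proof.
elim: n => [|n IH]; first by rewrite mul0r expr0 cexp0.
by rewrite exprS IH -cexpD -natr1 mulrDl mul1r addrC.
Qed.

Lemma cabs_cexp z : cabs (cexp z) = expR (complex.Re z).
Proof. by rewrite /cexp cabsM cabs_expi mulr1 cabs_real ger0_norm ?expR_ge0. Qed.

Lemma cexp_real x : cexp x%:C = (expR x)%:C.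
Proof. by rewrite /cexp /= expi0 mulr1. Qed.

Lemma cexp_imag x : cexp (0 +i* x) = expi x.
Proof. by rewrite /cexp /= expR0 mul1r. Qed.

Lemma is_derive_lin (a b x : R) : is_derive x (1 : R) (fun t => a + t * b) b.
Proof.
apply: (@is_derive_quad R (fun t => a + t * b) x b 0) => t _.
by rewrite mul0r [X in `|X|](_ : _ = 0) ?normr0//; ring.
Qed.

Lemma is_derive_comp_lin (f : R -> R) (a b d t : R) : is_derive (a + t * b) (1 : R) f d ->
  is_derive t (1 : R) (fun s => f (a + s * b)) (b * d).
Proof.
move=> fd; rewrite mulrC.
exact: (@is_derive1_comp R f (fun s => a + s * b) t d b fd (is_derive_lin a b t)).
Qed.

Lemma is_derive_mulR (f g : R -> R) (a b t : R) : is_derive t (1 : R) f a ->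
  is_derive t (1 : R) g b -> is_derive t (1 : R) (fun s => f s * g s) (a * g t + f t * b).
Proof.
move=> fa gb; rewrite addrC [a * _]mulrC; exact: (@is_deriveM R R f g t 1 a b fa gb).
Qed.

Lemma is_cderive_cexp z w t :
  is_cderive (fun s : R => cexp (z + s%:C * w)) t (w * cexp (z + t%:C * w)).
Proof.
have Re_l s : complex.Re (z + s%:C * w) = complex.Re z + s * complex.Re w.
  by rewrite Re_add Re_real.
have Im_l s : complex.Im (z + s%:C * w) = complex.Im z + s * complex.Im w.
  by rewrite Im_add Im_real.
have E1 : is_derive t (1 : R) (fun s => expR (complex.Re (z + s%:C * w)))
    (complex.Re w * expR (complex.Re (z + t%:C * w))).
  under eq_fun do rewrite Re_l; rewrite Re_l.
  exact: is_derive_comp_lin.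
have C1 : is_derive t (1 : R) (fun s => cos (complex.Im (z + s%:C * w)))
    (complex.Im w * - sin (complex.Im (z + t%:C * w))).
  under eq_fun do rewrite Im_l; rewrite Im_l.
  exact: is_derive_comp_lin.
have S1 : is_derive t (1 : R) (fun s => sin (complex.Im (z + s%:C * w)))
    (complex.Im w * cos (complex.Im (z + t%:C * w))).
  under eq_fun do rewrite Im_l; rewrite Im_l.
  exact: is_derive_comp_lin.
split.
  under eq_fun do rewrite Re_cexp.
  rewrite Re_mul Re_cexp Im_cexp.
  by apply: (is_derive_eq (is_derive_mulR E1 C1)); ring.
under eq_fun do rewrite Im_cexp.
rewrite Im_mul Re_cexp Im_cexp.
by apply: (is_derive_eq (is_derive_mulR E1 S1)); ring.
Qed.

(** The mean value theorem is applied to real and imaginary parts separately, whence the factor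
    2. *)
Lemma cmvt (f f' : R -> R[i]) (K : R) : (forall t, is_cderive f t (f' t)) ->
  (forall t, 0 <= t <= 1 -> cabs (f' t) <= K) -> cabs (f 1 - f 0) <= 2 * K.
Proof.
move=> ff' f'K.
have mvt (g g' : R -> R) : (forall t, is_derive t (1 : R) g (g' t)) ->
    (forall t, 0 <= t <= 1 -> `|g' t| <= K) -> `|g 1 - g 0| <= K.
  move=> gg' g'K.
  have [|c c01 ->] := @MVT R g g' 0 1 ltr01 (fun t _ => gg' t).
    by apply: derivable_within_continuous => t _; case: (gg' t).
  rewrite subr0 mulr1 g'K//.
  by move: c01; rewrite in_itv/= => /andP[/ltW -> /ltW ->].
apply: le_trans (cabs_le_ReIm _) _; rewrite mulr2n mulrDl mul1r.
apply: lerD; rewrite ?Re_add ?Re_opp ?Im_add ?Im_opp.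
  apply: (mvt (fun t => complex.Re (f t)) (fun t => complex.Re (f' t))) => t.
    by case: (ff' t).
  by move=> /f'K; apply: le_trans; exact: Re_le_cabs.
apply: (mvt (fun t => complex.Im (f t)) (fun t => complex.Im (f' t))) => t.
  by case: (ff' t).
by move=> /f'K; apply: le_trans; exact: Im_le_cabs.
Qed.

Lemma cexp_taylor1 w : cabs (cexp w - 1) <= 2 * (cabs w * expR (cabs w)).
Proof.
have := @cmvt (fun t => cexp (0 + t%:C * w)) (fun t => w * cexp (0 + t%:C * w))
  (cabs w * expR (cabs w)).
rewrite rmorph1 rmorph0 mul1r mul0r addr0 add0r cexp0; apply=> t; first exact: is_cderive_cexp.
move=> /andP[t0 t1]; rewrite cabsM ler_wpM2l ?cabs_ge0// cabs_cexp ler_expR add0r Re_real.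
apply: le_trans (ler_norm _) _; rewrite normrM ger0_norm//.
by apply: le_trans (ler_pM t0 _ t1 (Re_le_cabs w)) _; rewrite ?mul1r.
Qed.

Lemma cexp_taylor2 w : cabs (cexp w - 1 - w) <= 4 * (cabs w ^+ 2 * expR (cabs w)).
Proof.
have := @cmvt (fun t => cexp (0 + t%:C * w) - t%:C * w) (fun t => w * cexp (0 + t%:C * w) - w)
  (2 * (cabs w ^+ 2 * expR (cabs w))).
rewrite rmorph1 rmorph0 mul1r mul0r addr0 add0r cexp0 subr0 (addrAC _ (- w)).
have -> : 4 = 2 * 2 :> R by ring.
rewrite -mulrA; apply=> t.
  have [e1 e2] := is_cderive_cexp 0 w t.
  split; rewrite ?Re_add ?Re_opp ?Im_add ?Im_opp.
    under eq_fun do rewrite Re_add Re_opp [X in _ - X]Re_real -[_ * complex.Re w]add0r.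
    by apply: is_deriveB => //; exact: is_derive_lin.
  under eq_fun do rewrite Im_add Im_opp [X in _ - X]Im_real -[_ * complex.Im w]add0r.
  by apply: is_deriveB => //; exact: is_derive_lin.
move=> /andP[t0 t1]; rewrite add0r.
have -> : w * cexp (t%:C * w) - w = w * (cexp (t%:C * w) - 1) by ring.
rewrite cabsM.
have tw : cabs (t%:C * w) <= cabs w by rewrite cabsM cabs_real ger0_norm// ler_piMl ?cabs_ge0.
rewrite expr2 -mulrA mulrCA ler_wpM2l ?cabs_ge0//.
apply: le_trans (cexp_taylor1 _) _; rewrite ler_wpM2l//.
by apply: ler_pM; rewrite ?cabs_ge0 ?expR_ge0 ?ler_expR.
Qed.

End ComplexExp.

(** * The $L^2$-norm of the trace, operator norm and Bernstein approximation *)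

Section L2.
Context {R : realType} {theta : R}.
Local Notation St := (storus theta).
Local Notation Z2 := (int * int)%type.
Implicit Types (x y h a b : St) (c : R[i]).

Definition ip x y : R[i] := tr (starS x * y).
Definition n2 x : R := complex.Re (ip x x).
Definition l2 x : R := Num.sqrt (n2 x).

Lemma l2E x : nc_norm2 theta (sv x) = l2 x.
Proof. by []. Qed.

Lemma conjcM (z w : R[i]) : conjc (z * w) = conjc z * conjc w.
Proof. by case: z w => u v [u' v']; apply: complex_eq => /=; ring. Qed.

Lemma starK x : starS (starS x) = x.
Proof.
apply: st_eq => m; rewrite !sv_star opprK conjcM conjcK mulrA [(- m).1 * _]mulrNN.
by rewrite -phN -phD subrr ph0 mul1r.
Qed.

Lemma ipC x y : ip y x = conjc (ip x y).
Proof. by rewrite /ip -tr_star starM starK. Qed.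

Lemma ipDl x y a : ip (x + y) a = ip x a + ip y a.
Proof. by rewrite /ip starD mulrDl trD. Qed.
Lemma ipDr x y a : ip a (x + y) = ip a x + ip a y.
Proof. by rewrite /ip mulrDr trD. Qed.
Lemma ipZl c x a : ip (c *: x) a = conjc c * ip x a.
Proof. by rewrite /ip starZ -scalerAl trZ. Qed.
Lemma ipZr c x a : ip a (c *: x) = c * ip a x.
Proof. by rewrite /ip -scalerAr trZ. Qed.

(** The phase of the involution cancels that of the product, which leaves the sum of the squares of
    the coefficients: Parseval. *)
Lemma ip_cvg x : ccvg (fun N => \sum_(m <- boxs N) ((cabs (sv x (- m)) ^+ 2)%:C)) (ip x x).
Proof.
have := @mul_cvg _ theta 0 (sv (starS x)) (sv x) _ _ (0, 0) (snuP 0 _) (snuP 0 _).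
apply: ccvg_eq => N; apply: eq_bigr => m _; rewrite /mterm sv_star.
have -> : (0, 0) - m = - m by rewrite add0r.
rewrite [((0 : int), (0 : int)).1]/= sub0r !mulrA -phD.
have -> : m.2 * - m.1 + m.1 * m.2 = 0 by ring.
rewrite ph0 mul1r.
rewrite mulrC; case: (sv x (- m)) => u v; rewrite cabs_sqr /=.
by apply: complex_eq => /=; ring.
Qed.

Lemma ip_self x : ip x x = (n2 x)%:C.
Proof.
apply: complex_eq => //=; have [_ ci] := ip_cvg x.
move: ci; under eq_fun do rewrite Im_sum big1//.
by move=> ci; rewrite -(cvg_lim _ ci)// lim_cst.
Qed.

Lemma n2_cvg x : \sum_(m <- boxs N) (cabs (sv x (- m)) ^+ 2) @[N --> \oo] --> n2 x.
Proof. by have [+ _] := ip_cvg x; under eq_fun do rewrite Re_sum. Qed.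

Lemma n2_coef x m : cabs (sv x m) ^+ 2 <= n2 x.
Proof.
have [K Km] := boxs_ex [:: - m].
have le N : (K <= N)%N -> cabs (sv x m) ^+ 2 <= \sum_(m <- boxs N) (cabs (sv x (- m)) ^+ 2).
  move=> KN; rewrite (perm_big _ (perm_to_rem (sub_boxs KN (Km (- m) (mem_head _ _))))).
  by rewrite big_cons opprK lerDl sumr_ge0// => i _; exact: sqr_ge0.
rewrite -(cvg_lim _ (@n2_cvg x))//; apply: limr_ge; first by apply/cvg_ex; eexists; exact: n2_cvg.
by exists K.
Qed.

Lemma n2_ge0 x : 0 <= n2 x.
Proof. exact: le_trans (sqr_ge0 _) (n2_coef x 0). Qed.

Lemma n2_le x : n2 x <= snu 0 x ^+ 2.
Proof.
rewrite -(cvg_lim _ (@n2_cvg x))//; apply: limr_le; first by apply/cvg_ex; eexists; exact: n2_cvg.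
apply: nearW => N; apply: (@le_trans _ _ (\sum_(m <- boxs N) snu 0 x * cabs (sv x (- m)))).
  by apply: ler_sum => m _; rewrite expr2 ler_wpM2r ?cabs_ge0// cabs_sv.
rewrite -mulr_sumr expr2 ler_wpM2l ?snu_ge0//.
have /(_ _ (boxs_uniq N)) := sbnd_inj (@oppr_inj Z2) (sbnd_wabs0 (snuP 0 x)).
exact.
Qed.

Lemma l2_ge0 x : 0 <= l2 x. Proof. exact: sqrtr_ge0. Qed.

Lemma l2_sqr x : l2 x ^+ 2 = n2 x.
Proof. by rewrite sqr_sqrtr// n2_ge0. Qed.

Lemma l2_coef x m : cabs (sv x m) <= l2 x.
Proof. by rewrite -(@ler_pXn2r _ 2) ?nnegrE ?cabs_ge0 ?l2_ge0// l2_sqr n2_coef. Qed.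

Lemma l2_le x : l2 x <= snu 0 x.
Proof. by rewrite -(@ler_pXn2r _ 2) ?nnegrE ?snu_ge0 ?l2_ge0// l2_sqr n2_le. Qed.

Lemma tr_l2 x : cabs (tr x) <= l2 x. Proof. exact: l2_coef. Qed.

Lemma l2_eq0 x : l2 x = 0 -> x = 0.
Proof.
move=> x0; apply: st_eq => m; apply: cabs_le0.
by apply: le_trans (l2_coef x m) _; rewrite x0.
Qed.

Lemma l2Z c x : l2 (c *: x) = cabs c * l2 x.
Proof.
rewrite /l2 /n2 ipZl ipZr ip_self mulrA.
have -> : conjc c * c = (cabs c ^+ 2)%:C.
  by rewrite cabs_sqr; case: c => u v; apply: complex_eq => /=; ring.
by rewrite -rmorphM/= sqrtrM ?sqr_ge0// sqrtr_sqr ger0_norm ?cabs_ge0.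
Qed.

Lemma l20 : l2 (0 : St) = 0.
Proof. by rewrite -(scale0r 0) l2Z cabs0 mul0r. Qed.

Definition rip x y : R := complex.Re (ip x y).

Lemma ripC x y : rip x y = rip y x.
Proof. by rewrite /rip ipC; case: (ip y x). Qed.

Lemma n2D x y : n2 (x + y) = n2 x + n2 y + 2 * rip x y.
Proof. by rewrite /n2 ipDl !ipDr !Re_add -!/(rip _ _) (ripC y x); ring. Qed.

(** Cauchy-Schwarz, from the positivity of [n2] at $\|y\|x-\|x\|y$. The resulting inequality carries
    the factor $\|x\|\|y\|$, so vanishing norms are treated first. *)
Lemma rip_le x y : rip x y <= l2 x * l2 y.
Proof.
have [x0|x0] := eqVneq (l2 x) 0.
  rewrite x0 mul0r (l2_eq0 x0) /rip -(scale0r 0) ipZl Re_mul /=.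
  by rewrite !(mul0r, oppr0, subr0).
have [y0|y0] := eqVneq (l2 y) 0.
  rewrite y0 mulr0 (l2_eq0 y0) /rip -(scale0r 0) ipZr Re_mul /=.
  by rewrite !(mul0r, oppr0, subr0).
have lx : 0 < l2 x by rewrite lt_neqAle eq_sym x0 l2_ge0.
have ly : 0 < l2 y by rewrite lt_neqAle eq_sym y0 l2_ge0.
have := n2_ge0 ((l2 y)%:C *: x + (- l2 x)%:C *: y).
rewrite n2D -!l2_sqr !l2Z !cabs_real normrN !ger0_norm ?l2_ge0// /rip ipZl ipZr.
rewrite mulrA Re_mul /= !(mul0r, mulr0, oppr0, subr0, addr0) => H.
have : 0 <= 2 * (l2 x * l2 y) * (l2 x * l2 y - complex.Re (ip x y)) by move: H; lra.
by rewrite pmulr_rge0 ?subr_ge0// !mulr_gt0.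
Qed.

Lemma l2D x y : l2 (x + y) <= l2 x + l2 y.
Proof.
rewrite -(@ler_pXn2r _ 2) ?nnegrE ?addr_ge0 ?l2_ge0// l2_sqr n2D -!l2_sqr sqrrD.
by have := rip_le x y; rewrite mulr2n; lra.
Qed.

Lemma l2_sum (I : Type) (s : seq I) (f : I -> St) :
  l2 (\sum_(i <- s) f i) <= \sum_(i <- s) l2 (f i).
Proof.
elim: s => [|i s IH]; first by rewrite !big_nil l20.
by rewrite !big_cons; apply: le_trans (l2D _ _) _; rewrite lerD2l.
Qed.

Lemma l2_dl m x : l2 (dl theta m * x) = l2 x.
Proof.
rewrite /l2 /n2 /ip starM mulrA -(mulrA (starS x)) star_dl -scalerAl.
rewrite [dl _ _ * dl _ _]mulS_dl scalerA -phD addNr.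
have -> : m.1 * m.2 + (- m).2 * m.1 = 0 by rewrite mulNr mulrC addrN.
have -> : dl theta 0 = 1 by [].
by rewrite ph0 scale1r mulr1.
Qed.

(** Monomials act isometrically, so a truncation of [h] acts with norm at most its $\ell^1$ norm;
    the tail contributes an error that tends to 0 for fixed [x]. *)
Lemma l2_mul h x : l2 (h * x) <= snu 0 h * l2 x.
Proof.
have H N : l2 (h * x) <= snu 0 h * l2 x + snu 0 (h - trnc N h) * snu 0 x.
  rewrite -{1}(subrK (trnc N h) h) mulrDl addrC; apply: le_trans (l2D _ _) _.
  apply: lerD; last by apply: le_trans (l2_le _) (snuM _ _ _).
  rewrite /trnc mulr_suml; apply: le_trans (l2_sum _ _) _.
  under eq_bigr do rewrite -scalerAl l2Z l2_dl.
  rewrite -mulr_suml ler_wpM2r ?l2_ge0//.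
  exact: (sbnd_wabs0 (snuP 0 h)) (boxs_uniq N).
have cv : (fun N => snu 0 h * l2 x + snu 0 (h - trnc N h) * snu 0 x) @ \oo --> snu 0 h * l2 x.
  rewrite -[X in _ --> X]addr0 -(mul0r (snu 0 x)); apply: cvgD; first exact: cvg_cst.
  by apply: cvgM; [exact: tail_cvg|exact: cvg_cst].
rewrite -(cvg_lim _ cv)//; apply: limr_ge; first by apply/cvg_ex; eexists; exact: cv.
exact: nearW.
Qed.

Lemma nc_norm_ub h : ubound [set nc_norm2 theta (nc_mul theta (sv h) x) |
  x in [set x : nctorus R | nc_smooth x /\ nc_norm2 theta x <= 1]] (snu 0 h).
Proof.
move=> _ [x [/smthP sx x1] <-].
have := l2_mul h (mkS theta sx); rewrite -!l2E => /le_trans; apply.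
by rewrite ler_piMr ?snu_ge0.
Qed.

Lemma nc_norm_le h : nc_norm theta (sv h) <= snu 0 h.
Proof.
apply: ge_sup; last exact: nc_norm_ub.
exists (nc_norm2 theta (nc_mul theta (sv h) (sv (0 : St)))), (sv (0 : St)) => //.
by split; [apply/smthP; exact: smP|rewrite l2E l20].
Qed.

Lemma l2_nc_norm h x : l2 (h * x) <= nc_norm theta (sv h) * l2 x.
Proof.
have [x0|x0] := eqVneq (l2 x) 0.
  by rewrite (l2_eq0 x0) mulr0 l20 mulr0.
have lx : 0 < l2 x by rewrite lt_neqAle eq_sym x0 l2_ge0.
have cx : cabs (((l2 x)^-1)%:C) = (l2 x)^-1 by rewrite cabs_real ger0_norm ?invr_ge0 ?l2_ge0.
have : l2 (h * (((l2 x)^-1)%:C *: x)) <= nc_norm theta (sv h).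
  apply: ub_le_sup; first by exists (snu 0 h); exact: nc_norm_ub.
  exists (sv (((l2 x)^-1)%:C *: x)) => //; split; first by apply/smthP; exact: smP.
  by rewrite l2E l2Z cx mulVf.
by rewrite -scalerAr l2Z cx ler_pdivrMl// mulrC.
Qed.

Lemma nc_norm_ge0 h : 0 <= nc_norm theta (sv h).
Proof.
have := l2_nc_norm h 1; have := l2_ge0 (h * 1); have := l2_ge0 1.
rewrite le_eqVlt => /predU1P[/esym/l2_eq0/eqP|l1 h1 h2]; first by rewrite oner_eq0.
by rewrite -(pmulr_lge0 _ l1) (le_trans h1).
Qed.

Section Bernstein.
Variables (h : St) (c : R).
Hypotheses (sa_h : starS h = h) (c_gt0 : 0 < c) (hc : forall x, l2 (h * x) <= c * l2 x).

(* e^(z h) is the limit of (P e^(z c / N) + Q e^(- z c / N))^N with P, Q = (c +- h) / 2c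
   positive and P + Q = 1; expanding the power writes e^(z h) as an average of the scalars
   e^(z x) over the points x of a grid in [-c, c], with l2-bounds uniform in N. *)
Definition Pc : St := ((2 * c)^-1)%:C *: (c%:C *: 1 + h).
Definition Qc : St := ((2 * c)^-1)%:C *: (c%:C *: 1 - h).

Lemma ip_h x y : ip (h * x) y = ip x (h * y).
Proof. by rewrite /ip starM sa_h mulrA. Qed.

Lemma conjc_real (r : R) : conjc r%:C = r%:C :> R[i].
Proof. by apply: complex_eq => //=; rewrite oppr0. Qed.

(** Self-adjointness cancels the mixed terms, so the inner product is real, and by [PQ_ge0] it is
    nonnegative. This positivity of $PQ$ takes the place of a spectral theorem. *)
Lemma ip_PQ x : ip (Pc * x) (Qc * x) = (((2 * c)^-1) ^+ 2 * (c ^+ 2 * n2 x - n2 (h * x)))%:C.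
Proof.
rewrite /Pc /Qc; set rhs := (X in _ = X); set r := ((2 * c)^-1)%:C.
rewrite -!scalerAl ipZl ipZr !mulrDl mulNr -!scalerAl !mul1r.
rewrite -[- (h * x)]scaleN1r !(ipDl, ipDr, ipZl, ipZr) ip_h !ip_self.
rewrite !conjc_real /rhs /r [RHS]rmorphM rmorphXn rmorphB rmorphM rmorphXn; ring.
Qed.

Lemma PQ_ge0 x : 0 <= c ^+ 2 * n2 x - n2 (h * x).
Proof.
rewrite subr_ge0 -!l2_sqr -exprMn lerXn2r ?nnegrE ?l2_ge0 ?hc//.
by rewrite mulr_ge0 ?l2_ge0// ltW.
Qed.

Lemma PQ_add : Pc + Qc = 1.
Proof.
rewrite /Pc /Qc -scalerDr addrACA subrr addr0 -scalerDl scalerA -rmorphD -rmorphM/=.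
have -> : (2 * c)^-1 * (c + c) = 1 :> R by field; rewrite gt_eqF.
by rewrite rmorph1 scale1r.
Qed.

Lemma PQ_comm : GRing.comm Pc Qc.
Proof.
have -> : Qc = 1 - Pc by apply/eqP; rewrite eq_sym subr_eq addrC PQ_add.
by rewrite /GRing.comm mulrBr mulrBl mulr1 mul1r.
Qed.

Definition Vc (w : R[i]) : St := cexp w *: Pc + cexp (- w) *: Qc.

Lemma Vc_approx w : snu 0 (Vc w - 1 - (c^-1)%:C * w *: h) <=
  8 * (cabs w ^+ 2 * expR (cabs w)) * (snu 0 Pc + snu 0 Qc).
Proof.
pose r1 := cexp w - 1 - w; pose r2 := cexp (- w) - 1 - (- w).
have -> : Vc w - 1 - (c^-1)%:C * w *: h = r1 *: Pc + r2 *: Qc.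
  rewrite -{1}PQ_add /Vc /r1 /r2 /Pc /Qc.
  have cn : c%:C != 0 :> R[i] by rewrite eq_complex/= negb_and gt_eqF.
  apply: st_eq => m; rewrite !(svD, svN, svZ) !fmorphV rmorphM rmorph_nat/=.
  by field.
have b1 : cabs r1 <= 4 * (cabs w ^+ 2 * expR (cabs w)) by exact: cexp_taylor2.
have b2 : cabs r2 <= 4 * (cabs w ^+ 2 * expR (cabs w)) by rewrite -(cabsN w); exact: cexp_taylor2.
apply: le_trans (snuD _ _ _) _; rewrite mulrDr.
have K0 : 0 <= cabs w ^+ 2 * expR (cabs w) by rewrite mulr_ge0 ?sqr_ge0 ?expR_ge0.
apply: lerD; apply: le_trans (snuZle _ _ _) _; rewrite ler_wpM2r ?snu_ge0//; lra.
Qed.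

#[local] Opaque Pc Qc.

(** Expand $\|uPx+vQx\|^2$. As $\langle Px,Qx\rangle\ge0$, each of $|u|^2$, $|v|^2$ and
    $\mathrm{Re}(\bar uv)$ may be replaced by $M^2$, which leaves $M^2\|Px+Qx\|^2=M^2\|x\|^2$. *)
Lemma l2_uPvQ (u v : R[i]) (M : R) x : cabs u <= M -> cabs v <= M ->
  l2 ((u *: Pc + v *: Qc) * x) <= M * l2 x.
Proof.
move=> uM vM; have M0 : 0 <= M := le_trans (cabs_ge0 _) uM.
rewrite -(@ler_pXn2r _ 2) ?nnegrE ?mulr_ge0 ?l2_ge0// exprMn l2_sqr.
have Ex : n2 x = n2 (Pc * x) + n2 (Qc * x) + 2 * rip (Pc * x) (Qc * x).
  by rewrite -n2D -mulrDl PQ_add mul1r.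
rewrite [l2 x ^+ 2]l2_sqr Ex (mulrDl (u *: Pc)) -(scalerAl u Pc x) -(scalerAl v Qc x).
rewrite /rip; have := ip_PQ x.
set D := (2 * c)^-1 ^+ 2 * _.
have D0 : 0 <= D by rewrite mulr_ge0 ?sqr_ge0 ?PQ_ge0.
move: (Pc * x) (Qc * x) D D0 {Ex} => X Y D D0 XY.
rewrite n2D -!l2_sqr (l2Z u X) (l2Z v Y) XY /rip (ipZl u) (ipZr v) mulrA XY.
move: (l2 X) (l2 Y) => lX lY.
rewrite (exprMn _ _ lX) (exprMn _ _ lY) [conjc u * v * _]mulrC Re_real /=.
have uv : complex.Re (conjc u * v) <= M ^+ 2.
  apply: le_trans (ler_norm _) _; apply: le_trans (Re_le_cabs _) _.
  by rewrite cabsM cabs_conj expr2; apply: ler_pM; rewrite ?cabs_ge0.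
have u2 : cabs u ^+ 2 <= M ^+ 2 by rewrite lerXn2r ?nnegrE ?cabs_ge0.
have v2 : cabs v ^+ 2 <= M ^+ 2 by rewrite lerXn2r ?nnegrE ?cabs_ge0.
have := ler_wpM2r (sqr_ge0 lX) u2; have := ler_wpM2r (sqr_ge0 lY) v2.
have := ler_wpM2l D0 uv; lra.
Qed.

Definition Wc (N : nat) (z : R[i]) : St := Vc ((c / N%:R)%:C * z) ^+ N.

Lemma l2_Vc w x : l2 (Vc w * x) <= expR `|complex.Re w| * l2 x.
Proof.
apply: l2_uPvQ; rewrite cabs_cexp ler_expR ?ler_norm//.
by rewrite Re_opp (le_trans (ler_norm _))// normrN.
Qed.

(** The bound depends neither on [N] nor on the imaginary part of [z]; the latter makes the
    integrals over $\xi$ converge. *)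
Lemma l2_Wc N z x : (0 < N)%N -> l2 (Wc N z * x) <= expR (c * `|complex.Re z|) * l2 x.
Proof.
move=> N0; rewrite /Wc; set w := _ * z.
have H k : l2 (Vc w ^+ k * x) <= expR `|complex.Re w| ^+ k * l2 x.
  elim: k => [|k IH]; first by rewrite !expr0 !mul1r.
  rewrite !exprS -!mulrA; apply: le_trans (l2_Vc _ _) _.
  by rewrite ler_wpM2l ?expR_ge0.
apply: le_trans (H N) _; rewrite -expRM_natl /w Re_real normrM.
rewrite (ger0_norm (divr_ge0 (ltW c_gt0) (ler0n _ _))).
have -> // : N%:R * (c / N%:R * `|complex.Re z|) = c * `|complex.Re z|.
by field; rewrite pnatr_eq0 -lt0n.
Qed.

Definition gridc N k : R := c - 2 * c * k%:R / N%:R.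
Definition Bc N k : St := (Pc ^+ (N - k) * Qc ^+ k) *+ 'C(N, k).

(** A term with [N - k] factors $P$ and [k] factors $Q$ carries the exponent $(N-2k)cz/N$, that is
    [z] times the grid point. *)
Lemma Wc_sum N z : (0 < N)%N ->
  Wc N z = \sum_(k < N.+1) cexp (z * (gridc N k)%:C) *: Bc N k.
Proof.
move=> N0; rewrite /Wc /Vc exprDn_comm; last first.
  rewrite /GRing.comm -(scalerAl _ Pc) -(scalerAr _ Pc) -(scalerAl _ Qc) -(scalerAr _ Qc).
  by rewrite (PQ_comm : Pc * Qc = Qc * Pc) !scalerA mulrC.
apply: eq_bigr => k _; rewrite /Bc; move: Pc Qc => P Q.
rewrite (exprZn _ P) (exprZn _ Q) -(scalerAl _ (P ^+ _)) -(scalerAr _ (P ^+ _)) scalerA scalerMnr.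
congr (_ *: _); rewrite !cexpX -cexpD; congr cexp.
have kN : (k <= N)%N by rewrite -ltnS.
have Nn : N%:R != 0 :> R[i] by rewrite pnatr_eq0 -lt0n.
rewrite /gridc natrB// !(rmorphB, rmorphM, fmorphV, rmorph_nat)/=.
by field.
Qed.

Lemma gridc_le N k : (k <= N)%N -> (0 < N)%N -> `|gridc N k| <= c.
Proof.
move=> kN N0; have Nn : 0 < N%:R :> R by rewrite ltr0n.
have kn : 0 <= (k%:R / N%:R : R) <= 1.
  by rewrite divr_ge0//= ler_pdivrMr// mul1r ler_nat.
rewrite /gridc -mulrA ler_norml.
have : 0 <= c * (k%:R / N%:R) <= c.
  move/andP: kn => [k0 k1]; apply/andP; split; first by rewrite mulr_ge0// ltW.
  by rewrite ler_piMr// ltW.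
by move=> /andP[]; rewrite -!mulrA; lra.
Qed.

Lemma E_approx z : exists C, forall t : R, 0 <= t <= 1 ->
  snu 0 (E h (t%:C * z) - 1 - (t%:C * z) *: h) <= C * t ^+ 2.
Proof.
have [C HC] := sder_E h 0 z 0 0.
exists C => t /andP[t0 t1].
have := HC t; rewrite ger0_norm// => /(_ t1).
rewrite !add0r rmorph0 mul0r E0 mulr1 scalerA; exact.
Qed.

Lemma expr_diff_le (A B : St) (M : R) n : snu 0 A <= M -> snu 0 B <= M -> 1 <= M ->
  snu 0 (A ^+ n - B ^+ n) <= n%:R * (snu 0 (A - B) * M ^+ n).
Proof.
move=> AM BM M1; have M0 : 0 <= M by lra.
elim: n => [|n IH]; first by rewrite !expr0 subrr snu0 mul0r.
have -> : A ^+ n.+1 - B ^+ n.+1 = A * (A ^+ n - B ^+ n) + (A - B) * B ^+ n.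
  by rewrite !exprS mulrBr mulrBl addrA subrK.
apply: le_trans (snuD _ _ _) _; rewrite -natr1 (mulrDl n%:R) mul1r; apply: lerD.
  apply: le_trans (snuM _ _ _) _; rewrite [M ^+ n.+1]exprS.
  rewrite [leRHS](_ : _ = M * (n%:R * (snu 0 (A - B) * M ^+ n))); last by ring.
  by apply: ler_pM; rewrite ?snu_ge0.
apply: le_trans (snuM _ _ _) _; rewrite ler_wpM2l ?snu_ge0//.
apply: le_trans (snuX _ _ _) _; apply: (@le_trans _ _ (M ^+ n)).
  by rewrite lerXn2r ?nnegrE ?snu_ge0.
by rewrite ler_weXn2l.
Qed.

Lemma E_pow z n : E h z ^+ n = E h (n%:R * z).
Proof.
elim: n => [|n IH]; first by rewrite mul0r E0 expr0.
by rewrite exprS IH -natr1 mulrDl mul1r addrC E_add.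
Qed.

(** With $N=n+1$, both one-step factors equal $1+(z/N)h$ up to $O(N^{-2})$; their $N$-th powers
    therefore differ by $O(N^{-1})$. *)
Lemma Wc_cvg z : snu 0 (Wc n.+1 z - E h z) @[n --> \oo] --> 0.
Proof.
have [C HC] := E_approx z.
pose K1 := 8 * (cabs (c%:C * z) ^+ 2 * expR (cabs (c%:C * z))) * (snu 0 Pc + snu 0 Qc).
pose L := snu 0 (z *: h).
pose K := `|C| + K1.
have K10 : 0 <= K1.
  rewrite /K1 mulr_ge0 ?addr_ge0 ?snu_ge0// mulr_ge0// mulr_ge0 ?expR_ge0//.
  exact: sqr_ge0.
have L0 : 0 <= L by exact: snu_ge0.
have K0 : 0 <= K by rewrite addr_ge0.
have lin (n : nat) : (n.+1%:R^-1)%:C * z *: h = (n.+1%:R^-1)%:C *: (z *: h) by rewrite scalerA.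
have t01 (n : nat) : 0 <= (n.+1%:R^-1 : R) <= 1 by rewrite invr_ge0 ler0n invf_le1// ler1n.
have aE (n : nat) : snu 0 (E h ((n.+1%:R^-1)%:C * z) - 1 - (n.+1%:R^-1)%:C * z *: h) <= K * n.+1%:R^-1 ^+ 2.
  apply: le_trans (HC _ (t01 n)) _; rewrite ler_wpM2r ?sqr_ge0//.
  by apply: le_trans (ler_norm _) _; rewrite lerDl.
have aV (n : nat) : snu 0 (Vc ((c / n.+1%:R)%:C * z) - 1 - (n.+1%:R^-1)%:C * z *: h) <= K * n.+1%:R^-1 ^+ 2.
  have /andP[n0 n1] := t01 n.
  have := Vc_approx ((c / n.+1%:R)%:C * z).
  have -> : (c^-1)%:C * ((c / n.+1%:R)%:C * z) = (n.+1%:R^-1)%:C * z.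
    rewrite mulrA -rmorphM/=; congr (_%:C * _); rewrite mulrA mulVf ?mul1r// gt_eqF//.
  move/le_trans; apply.
  have E1 : cabs ((c / n.+1%:R)%:C * z) = n.+1%:R^-1 * cabs (c%:C * z).
    by rewrite !cabsM !cabs_real normrM (ger0_norm n0) mulrAC [LHS]mulrC mulrA.
  rewrite E1 [leRHS]mulrC.
  apply: (@le_trans _ _ (n.+1%:R^-1 ^+ 2 * K1)); last by rewrite ler_wpM2l ?sqr_ge0// lerDr.
  rewrite /K1; set A := cabs (c%:C * z); set S := snu 0 Pc + snu 0 Qc.
  have A0 : 0 <= A by exact: cabs_ge0.
  have S0 : 0 <= S by rewrite addr_ge0 ?snu_ge0.
  rewrite [leLHS](_ : _ = n.+1%:R^-1 ^+ 2 * (8 * (A ^+ 2 * expR (n.+1%:R^-1 * A)) * S)); last by ring.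
  rewrite ler_wpM2l ?sqr_ge0// ler_wpM2r// ler_wpM2l// ler_wpM2l ?sqr_ge0// ler_expR.
  by rewrite ler_piMl.
(* The bound on one step is an exponential of a multiple of $1/N$, so that its $N$-th power does not
   depend on $N$. *)
have nrm (n : nat) X : snu 0 (X - 1 - (n.+1%:R^-1)%:C * z *: h) <= K * n.+1%:R^-1 ^+ 2 ->
    snu 0 X <= expR ((L + K) / n.+1%:R).
  have /andP[n0 n1] := t01 n.
  move=> HX; apply: le_trans (expR_ge1Dx _).
  rewrite -(subrK ((n.+1%:R^-1)%:C * z *: h) X) -(subrK 1 (X - _)) -addrA.
  rewrite (addrAC X) (addrC (1 : St)) addrA.
  apply: le_trans (snuD _ _ _) _; rewrite [leRHS]addrC; apply: lerD; last exact: snu1.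
  apply: le_trans (snuD _ _ _) _; rewrite mulrDl [leRHS]addrC; apply: lerD.
    by apply: le_trans HX _; rewrite ler_wpM2l// expr2 ler_piMl.
  by rewrite lin; apply: le_trans (snuZle _ _ _) _; rewrite cabs_real (ger0_norm n0) mulrC.
apply: (@squeeze_cvgr _ _ _ _ (fun=> 0) (fun n : nat => 2 * K * expR (L + K) / n.+1%:R)).
- apply: nearW => n; rewrite snu_ge0/=.
  have /andP[n0 n1] := t01 n.
  have -> : E h z = E h ((n.+1%:R^-1)%:C * z) ^+ n.+1.
    rewrite E_pow mulrA [X in X * z](_ : _ = 1) ?mul1r//.
    by rewrite -[n.+1%:R in LHS](rmorph_nat (real_complex R)) -rmorphM/= mulfV// pnatr_eq0.
  apply: le_trans (expr_diff_le n.+1 (nrm _ _ (aV n)) (nrm _ _ (aE n)) _) _.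
    by apply: le_trans (expR_ge1Dx _); rewrite lerDl divr_ge0// addr_ge0.
  rewrite -expRM_natl.
  have -> : n.+1%:R * ((L + K) / n.+1%:R) = L + K by field; rewrite addrC natr1 pnatr_eq0.
  have {aV} := aV n; have {aE} := aE n; set A := Vc _; set B := E h _ => aE aV.
  have AB : snu 0 (A - B) <= 2 * K * n.+1%:R^-1 ^+ 2.
    have -> : A - B = (A - 1 - (n.+1%:R^-1)%:C * z *: h) - (B - 1 - (n.+1%:R^-1)%:C * z *: h).
      by apply: st_eq => m; rewrite !(svD, svN); ring.
    by apply: le_trans (snuB _ _ _) _; rewrite -mulrA mulr_natl mulr2n lerD.
  apply: (@le_trans _ _ (n.+1%:R * (2 * K * n.+1%:R^-1 ^+ 2 * expR (L + K)))).
    by rewrite ler_wpM2l// ler_wpM2r ?expR_ge0.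
  rewrite le_eqVlt; apply/orP; left; apply/eqP.
  by field; rewrite addrC natr1 pnatr_eq0.
- exact: cvg_cst.
- rewrite -(mulr0 (2 * K * expR (L + K))); apply: cvgM; first exact: cvg_cst.
  exact: cvg_harmonic.
Qed.

End Bernstein.

End L2.

(** * Integrals of complex-valued functions *)

Section ComplexIntegral.
Context {R : realType} d (T : measurableType d) (mu : {measure set T -> \bar R}).
Implicit Types (f g : T -> R[i]) (u : T -> R) (D : set T) (z : R[i]).

Definition cI D f : R[i] := by_parts (fun g : T -> R => \int[mu]_(x in D) g x) f.

Definition cmeas D f : Prop :=
  measurable_fun D (fun x => complex.Re (f x)) /\ measurable_fun D (fun x => complex.Im (f x)).

Definition cintg D f : Prop :=
  mu.-integrable D (EFin \o (fun x => complex.Re (f x))) /\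
  mu.-integrable D (EFin \o (fun x => complex.Im (f x))).

Lemma cintg_cmeas D f : cintg D f -> cmeas D f.
Proof. by move=> [fr fi]; split; apply/measurable_EFinP; [case/integrableP: fr|case/integrableP: fi]. Qed.

Lemma cmeas_cst D z : cmeas D (fun=> z).
Proof. by split; exact: measurable_cst. Qed.

Lemma cmeasD D f g : cmeas D f -> cmeas D g -> cmeas D (fun x => f x + g x).
Proof.
move=> [fr fi] [gr gi]; split.
- by under eq_fun do rewrite Re_add; exact: measurable_funD.
- by under eq_fun do rewrite Im_add; exact: measurable_funD.
Qed.

Lemma cmeasM D f g : cmeas D f -> cmeas D g -> cmeas D (fun x => f x * g x).
Proof.
move=> [fr fi] [gr gi]; split.
- by under eq_fun do rewrite Re_mul; apply: measurable_funB; exact: measurable_funM.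
- by under eq_fun do rewrite Im_mul; apply: measurable_funD; exact: measurable_funM.
Qed.

Lemma cmeas_sum D (I : Type) (s : seq I) (f : I -> T -> R[i]) :
  (forall i, cmeas D (f i)) -> cmeas D (fun x => \sum_(i <- s) f i x).
Proof.
move=> fm; elim: s => [|i s IH].
  by under eq_fun do rewrite big_nil; exact: cmeas_cst.
by under eq_fun do rewrite big_cons; exact: cmeasD.
Qed.

Lemma cmeas_lim D (f : nat -> T -> R[i]) (l : T -> R[i]) : (forall n, cmeas D (f n)) ->
  (forall x, D x -> ccvg (f ^~ x) (l x)) -> cmeas D l.
Proof.
move=> fm fl; split.
- apply: (@measurable_fun_cvg _ _ _ _ (fun n x => complex.Re (f n x))) => [n|x Dx].
    by case: (fm n).
  by case: (fl x Dx).
- apply: (@measurable_fun_cvg _ _ _ _ (fun n x => complex.Im (f n x))) => [n|x Dx].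
    by case: (fm n).
  by case: (fl x Dx).
Qed.

Lemma intg_dom D (u g : T -> R) : measurable D -> measurable_fun D u ->
  (forall x, D x -> `|u x| <= g x) -> mu.-integrable D (EFin \o g) ->
  mu.-integrable D (EFin \o u).
Proof.
move=> mD mu_ ug; apply: le_integrable => //; first exact/measurable_EFinP.
move=> x Dx /=; rewrite lee_fin; apply: le_trans (ug x Dx) _; exact: ler_norm.
Qed.

Lemma cintg_dom D f (g : T -> R) : measurable D -> cmeas D f ->
  (forall x, D x -> cabs (f x) <= g x) -> mu.-integrable D (EFin \o g) -> cintg D f.
Proof.
move=> mD [fr fi] fg ig; split; apply: intg_dom ig => // x Dx.
- exact: le_trans (Re_le_cabs _) (fg x Dx).
- exact: le_trans (Im_le_cabs _) (fg x Dx).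
Qed.

Lemma cI_eq D f g : {in D, f =1 g} -> cI D f = cI D g.
Proof.
move=> fg; rewrite /cI /by_parts; congr (_ +i* _); apply: eq_Rintegral => x xD; by rewrite fg.
Qed.

(** The factor 2 comes from estimating real and imaginary parts separately; it reappears in every
    bound of the form [Q]. *)
Lemma cI_le D f (g : T -> R) : measurable D -> cmeas D f ->
  (forall x, D x -> cabs (f x) <= g x) -> mu.-integrable D (EFin \o g) ->
  cabs (cI D f) <= 2 * \int[mu]_(x in D) g x.
Proof.
move=> mD mf fg ig; have [fr fi] := cintg_dom mD mf fg ig.
apply: le_trans (cabs_le_ReIm _) _; rewrite mulr_natl mulr2n /cI /by_parts /=.
have H u : mu.-integrable D (EFin \o u) -> (forall x, D x -> `|u x| <= g x) ->
    `|\int[mu]_(x in D) u x| <= \int[mu]_(x in D) g x.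
  move=> iu ug; apply: le_trans (le_normr_Rintegral mD iu) _.
  by apply: le_Rintegral => //; exact: integrable_norm.
apply: lerD; apply: H => // x Dx.
- exact: le_trans (Re_le_cabs _) (fg x Dx).
- exact: le_trans (Im_le_cabs _) (fg x Dx).
Qed.

Lemma cintgD D f g : measurable D -> cintg D f -> cintg D g -> cintg D (fun x => f x + g x).
Proof.
move=> mD [fr fi] [gr gi]; split.
- rewrite (_ : _ \o _ = (EFin \o (fun x => complex.Re (f x))) \+
    (EFin \o (fun x => complex.Re (g x))))%E; first exact: integrableD.
  by apply/funext => x /=; rewrite Re_add EFinD.
- rewrite (_ : _ \o _ = (EFin \o (fun x => complex.Im (f x))) \+
    (EFin \o (fun x => complex.Im (g x))))%E; first exact: integrableD.
  by apply/funext => x /=; rewrite Im_add EFinD.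
Qed.

Lemma intgZl D u (r : R) : measurable D -> mu.-integrable D (EFin \o u) ->
  mu.-integrable D (EFin \o (fun x => r * u x)).
Proof.
move=> mD iu; rewrite (_ : _ \o _ = fun x => r%:E * (EFin \o u) x)%E; first exact: integrableZl.
by apply/funext => x /=; rewrite EFinM.
Qed.

Lemma intgB D u (v : T -> R) : measurable D -> mu.-integrable D (EFin \o u) ->
  mu.-integrable D (EFin \o v) -> mu.-integrable D (EFin \o (fun x => u x - v x)).
Proof.
move=> mD iu iv; rewrite (_ : _ \o _ = (EFin \o u) \- (EFin \o v))%E; first exact: integrableB.
by apply/funext => x /=; rewrite EFinB.
Qed.

Lemma intgD D u (v : T -> R) : measurable D -> mu.-integrable D (EFin \o u) ->
  mu.-integrable D (EFin \o v) -> mu.-integrable D (EFin \o (fun x => u x + v x)).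
Proof.
move=> mD iu iv; rewrite (_ : _ \o _ = (EFin \o u) \+ (EFin \o v))%E; first exact: integrableD.
by apply/funext => x /=; rewrite EFinD.
Qed.

Lemma cintgZ D f z : measurable D -> cintg D f -> cintg D (fun x => z * f x).
Proof.
move=> mD [fr fi]; split.
- by under eq_fun do rewrite Re_mul; apply: intgB => //; exact: intgZl.
- by under eq_fun do rewrite Im_mul; apply: intgD => //; exact: intgZl.
Qed.

Lemma cI_D D f g : measurable D -> cintg D f -> cintg D g ->
  cI D (fun x => f x + g x) = cI D f + cI D g.
Proof.
move=> mD [fr fi] [gr gi]; apply: complex_eq; rewrite /cI /by_parts /=.
- by under eq_Rintegral do rewrite Re_add; exact: RintegralD.
- by under eq_Rintegral do rewrite Im_add; exact: RintegralD.
Qed.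

Lemma cI_Z D f z : measurable D -> cintg D f -> cI D (fun x => z * f x) = z * cI D f.
Proof.
move=> mD [fr fi]; apply: complex_eq; rewrite ?Re_mul ?Im_mul /cI /by_parts /=.
- under eq_Rintegral do rewrite Re_mul.
  by rewrite RintegralB ?RintegralZl//; exact: intgZl.
- under eq_Rintegral do rewrite Im_mul.
  by rewrite RintegralD ?RintegralZl//; exact: intgZl.
Qed.

Lemma cintg0 D : cintg D (fun=> 0).
Proof. by split; exact: integrable0. Qed.

Lemma cI0 D : cI D (fun=> 0) = 0.
Proof.
rewrite /cI /by_parts /=; apply: complex_eq => /=;
by rewrite /Rintegral integral0.
Qed.

Lemma cintg_sum D (I : Type) (s : seq I) (f : I -> T -> R[i]) : measurable D ->
  (forall i, cintg D (f i)) -> cintg D (fun x => \sum_(i <- s) f i x).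
Proof.
move=> mD fi; elim: s => [|i s IH].
  by under eq_fun do rewrite big_nil; exact: cintg0.
by under eq_fun do rewrite big_cons; exact: cintgD.
Qed.

Lemma cI_sum D (I : Type) (s : seq I) (f : I -> T -> R[i]) : measurable D ->
  (forall i, cintg D (f i)) -> cI D (fun x => \sum_(i <- s) f i x) = \sum_(i <- s) cI D (f i).
Proof.
move=> mD fi; elim: s => [|i s IH].
  by under eq_fun do rewrite big_nil; rewrite cI0 big_nil.
under eq_fun do rewrite big_cons; rewrite big_cons -IH cI_D//.
exact: cintg_sum.
Qed.

Lemma cI_dct D (f : nat -> T -> R[i]) (l : T -> R[i]) (g : T -> R) : measurable D ->
  (forall n, cmeas D (f n)) -> (forall x, D x -> ccvg (f ^~ x) (l x)) ->
  (forall n x, D x -> cabs (f n x) <= g x) -> mu.-integrable D (EFin \o g) ->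
  ccvg (fun n => cI D (f n)) (cI D l).
Proof.
move=> mD mf fl fg ig.
have il : cintg D l.
  apply: cintg_dom ig => //; first exact: cmeas_lim mf fl.
  by move=> x Dx; apply: ccvg_le (fl x Dx) _ => n; exact: fg.
have H (u : nat -> T -> R) (v : T -> R) : (forall n, measurable_fun D (u n)) ->
    (forall x, D x -> u n x @[n --> \oo] --> v x) ->
    (forall n x, D x -> `|u n x| <= g x) -> mu.-integrable D (EFin \o v) ->
    \int[mu]_(x in D) u n x @[n --> \oo] --> \int[mu]_(x in D) v x.
  move=> mu_ uv ug iv; apply: fine_cvg; rewrite fineK; last exact: integrable_fin_num.
  apply: (@dominated_cvg _ _ _ mu _ mD (fun n x => (u n x)%:E) _ (EFin \o g)) => //=.
  - by move=> n; exact/measurable_EFinP.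
  - by move=> x Dx; apply: cvg_EFin; [exact: nearW|exact: uv].
case: il => il1 il2; split; rewrite /cI /by_parts /=; apply: H => //.
- by move=> n; case: (mf n).
- by move=> x Dx; case: (fl x Dx).
- by move=> n x Dx; apply: le_trans (fg n x Dx); exact: Re_le_cabs.
- by move=> n; case: (mf n).
- by move=> x Dx; case: (fl x Dx).
- by move=> n x Dx; apply: le_trans (fg n x Dx); exact: Im_le_cabs.
Qed.

End ComplexIntegral.

(** * Integrals over the unit interval and divided differences of exponentials *)

Section UnitIntegral.
Context {R : realType}.
Local Notation leb := (@lebesgue_measure R).
Local Notation I01 := (`[0, 1]%classic : set R).

Lemma is_cderive_cont (f : R -> R[i]) t l : is_cderive f t l ->
  {for t, continuous (fun s => complex.Re (f s))} /\
  {for t, continuous (fun s => complex.Im (f s))}.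
Proof.
by move=> [[d1 _] [d2 _]]; split; apply: differentiable_continuous; exact/derivable1_diffP.
Qed.

Definition cdiff (f : R -> R[i]) : Prop := forall t, exists l, is_cderive f t l.

Lemma cdiff_cont f : cdiff f -> continuous (fun s => complex.Re (f s)) /\
  continuous (fun s => complex.Im (f s)).
Proof. by move=> df; split=> t; have [l /is_cderive_cont[]] := df t. Qed.

Lemma cdiff_cmeas D f : measurable D -> cdiff f -> @cmeas R _ (measurableTypeR R) D f.
Proof.
move=> mD /cdiff_cont[cr ci]; split.
- apply: (measurable_funS measurableT) => //; exact: continuous_measurable_fun.
- apply: (measurable_funS measurableT) => //; exact: continuous_measurable_fun.
Qed.

Lemma int01_cst (b : R) : \int[leb]_(x in I01) b = b.
Proof. by rewrite Rintegral_cst//= lebesgue_measure_itv/= lte01 oppr0 adde0 mulr1. Qed.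

Lemma intg01_cst (b : R) : leb.-integrable I01 (EFin \o (fun=> b)).
Proof.
apply: continuous_compact_integrable; first exact: segment_compact.
by apply: continuous_subspaceT => x; exact: cvg_cst.
Qed.

Lemma FTC01 (F f : R -> R) : (forall t, is_derive t (1 : R) F (f t)) -> continuous f ->
  \int[leb]_(x in I01) f x = F 1 - F 0.
Proof.
move=> Ff cf; rewrite /Rintegral.
rewrite (@continuous_FTC2 R f F 0 1)//=.
- exact: continuous_subspaceT.
- split=> [x _|  |]; first by case: (Ff x).
  + apply: cvg_at_right_filter; apply: differentiable_continuous.
    by apply/derivable1_diffP; case: (Ff 0).
  + apply: cvg_at_left_filter; apply: differentiable_continuous.
    by apply/derivable1_diffP; case: (Ff 1).
- by move=> x _; rewrite derive1E; case: (Ff x).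
Qed.

Lemma cFTC01 (F f : R -> R[i]) : (forall t, is_cderive F t (f t)) -> cdiff f ->
  cI leb I01 f = F 1 - F 0.
Proof.
move=> Ff /cdiff_cont[cr ci]; rewrite /cI /by_parts; apply: complex_eq => /=.
- rewrite Re_add Re_opp; apply: (FTC01 (F := fun t => complex.Re (F t))) => // t.
  by case: (Ff t).
- rewrite Im_add Im_opp; apply: (FTC01 (F := fun t => complex.Im (F t))) => // t.
  by case: (Ff t).
Qed.

(* The divided difference of t |-> cexp (s * t) at x and y, in the form that also covers x = y. *)
Definition ddx (s : R[i]) (x y : R) : R[i] :=
  cI leb I01 (fun t => s * cexp (s * ((t * x + (1 - t) * y)%:C))).

Lemma ddx_arg s (x y t : R) : s * ((t * x + (1 - t) * y)%:C) = s * y%:C + t%:C * (s * (x - y)%:C).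
Proof. by rewrite !(rmorphD, rmorphB, rmorphM, rmorph1)/=; ring. Qed.

Lemma is_cderiveZ z (f : R -> R[i]) t l : is_cderive f t l -> is_cderive (fun s => z * f s) t (z * l).
Proof.
move=> [fr fi]; split; rewrite ?Re_mul ?Im_mul.
- under eq_fun do rewrite Re_mul.
  by apply: is_deriveB; rewrite -/(GRing.scale _ _); exact: is_deriveZ.
- under eq_fun do rewrite Im_mul.
  by apply: is_deriveD; exact: is_deriveZ.
Qed.

Lemma cdiff_cexp z w : cdiff (fun t => cexp (z + t%:C * w)).
Proof. by move=> t; eexists; exact: is_cderive_cexp. Qed.

Lemma cdiffZ z f : cdiff f -> cdiff (fun t => z * f t).
Proof. by move=> df t; have [l fl] := df t; exists (z * l); exact: is_cderiveZ. Qed.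

Lemma ddx_cdiff s x y : cdiff (fun t => s * cexp (s * ((t * x + (1 - t) * y)%:C))).
Proof. by under eq_fun do rewrite ddx_arg; apply: cdiffZ; exact: cdiff_cexp. Qed.

Lemma ddxE s (x y : R) : x != y ->
  ddx s x y = (cexp (s * x%:C) - cexp (s * y%:C)) / (x - y)%:C.
Proof.
move=> xy; have xy0 : (x - y)%:C != 0 :> R[i] by rewrite eq_complex/= negb_and subr_eq0 xy.
apply: (mulIf xy0); rewrite divfK//.
have H t : is_cderive (fun t => cexp (s * y%:C + t%:C * (s * (x - y)%:C))) t
    ((x - y)%:C * (s * cexp (s * ((t * x + (1 - t) * y)%:C)))).
  by rewrite ddx_arg mulrA [(x - y)%:C * s]mulrC; exact: is_cderive_cexp.
rewrite mulrC -cI_Z//; last first.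
  apply: (@cintg_dom _ _ _ _ _ _ (fun=> cabs s * expR (`|complex.Re s| * (`|x| + `|y|)))) => //.
  - by apply: cdiff_cmeas => //; exact: ddx_cdiff.
  - move=> t /=; rewrite in_itv/= => /andP[t0 t1].
    rewrite cabsM ler_wpM2l ?cabs_ge0// cabs_cexp ler_expR mulrC Re_real.
    apply: le_trans (ler_norm _) _; rewrite normrM mulrC ler_wpM2l//.
    apply: le_trans (ler_normD _ _) _; rewrite !normrM (ger0_norm t0).
    rewrite (ger0_norm (_ : 0 <= 1 - t)) ?subr_ge0//.
    by apply: lerD; rewrite ler_piMl// gerBl.
  - exact: intg01_cst.
rewrite (cFTC01 H); last by apply: cdiffZ; exact: ddx_cdiff.
rewrite rmorph1 rmorph0 mul1r mul0r addr0; congr (cexp _ - _).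
by rewrite rmorphB; ring.
Qed.

Lemma ddx_le s (x y c : R) : `|x| <= c -> `|y| <= c ->
  forall t, I01 t -> cabs (s * cexp (s * ((t * x + (1 - t) * y)%:C))) <=
    cabs s * expR (c * `|complex.Re s|).
Proof.
move=> xc yc t /=; rewrite in_itv/= => /andP[t0 t1].
rewrite cabsM ler_wpM2l ?cabs_ge0// cabs_cexp ler_expR mulrC Re_real.
apply: le_trans (ler_norm _) _; rewrite normrM ler_wpM2r//.
apply: le_trans (ler_normD _ _) _; rewrite !normrM (ger0_norm t0).
rewrite (ger0_norm (_ : 0 <= 1 - t)) ?subr_ge0//.
have := ler_wpM2l t0 xc; have t1' : 0 <= 1 - t by rewrite subr_ge0.
by have := ler_wpM2l t1' yc; lra.
Qed.

End UnitIntegral.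

(** * Functional calculus under the trace *)

Section Grid.
Context {R : realType} {theta : R}.
Local Notation St := (storus theta).
Local Notation leb := (@lebesgue_measure R).
Local Notation I01 := (`[0, 1]%classic : set R).
Implicit Types (f g : R -> R -> R -> R[i]) (z s : R[i]) (v w : R[i]).

Lemma sder_mulc (f : R -> St) (x : R) (f' X Y : St) : sder f x f' ->
  sder (fun t => X * f t * Y) x (X * f' * Y).
Proof.
move=> fx; have := sderM (sderM (sder_cst X x) fx) (sder_cst Y x).
by rewrite mul0r add0r mulr0 addr0.
Qed.

Lemma sder_tr (f : R -> St) (x : R) (f' : St) : sder f x f' ->
  is_cderive (fun t => tr (f t)) x (tr f').
Proof. exact: sder_coef. Qed.

(** The integral over the unit interval of [duhamel_sder], under the trace. A factor [DE] becomes an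
    average in which its exponent [s] is shared between the gaps on its two sides. *)
Lemma duhamel_tr (h X a Y : St) s :
  let F t := s * tr (X * (E h ((1 - t)%:C * s) * a * E h (t%:C * s)) * Y) in
  cdiff F /\ tr (X * DE h a s * Y) = cI leb I01 F.
Proof.
have dF : cdiff (fun t => s * tr (X * (E h ((1 - t)%:C * s) * a * E h (t%:C * s)) * Y)).
  apply: cdiffZ => t; eexists; apply: sder_tr; apply: sder_mulc.
  have H1 := sder_E h s (- s) t; have H2 := sder_E h 0 s t.
  have := sderM (sderM H1 (sder_cst a t)) H2; apply: sder_eq => u.
  have -> : s + u%:C * - s = (1 - u)%:C * s by rewrite rmorphB rmorph1; ring.
  by rewrite add0r.
pose F t := tr (X * (E h (s + t%:C * - s) * DE h a (0 + t%:C * s)) * Y).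
have F1 : F 1 = tr (X * DE h a s * Y).
  have e1 : E h (s + 1%:C * - s) * DE h a (0 + 1%:C * s) = DE h a s.
    transitivity (E h 0 * DE h a s); last by rewrite E0 mul1r.
    have -> : s + 1%:C * - s = 0 by rewrite rmorph1; ring.
    by have -> : 0 + 1%:C * s = s by rewrite rmorph1; ring.
  exact (congr1 (fun Z : St => tr (X * Z * Y)) e1).
have F0 : F 0 = 0.
  have e0 : E h (s + 0%:C * - s) * DE h a (0 + 0%:C * s) = 0.
    have -> : 0 + 0%:C * s = 0 by rewrite rmorph0; ring.
    by rewrite DE0 mulr0.
  have /(congr1 (fun Z : St => tr (X * Z * Y))) := e0.
  by rewrite mulr0 mul0r.
split; first exact: dF.
apply: esym; apply: (etrans (cFTC01 (F := F) _ dF)); last by rewrite F1 F0 subr0.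
move=> t; have := sder_tr (sder_mulc X Y (duhamel_sder h a s t)).
by rewrite -scalerAr -scalerAl trZ.
Qed.

Variables (h : St).
Hypothesis sa_h : starS h = h.
Variables (c0 c1 c2 : R).
Hypotheses (c0p : 0 < c0) (c1p : 0 < c1) (c2p : 0 < c2).
Hypotheses (hc0 : forall x, l2 (h * x) <= c0 * l2 x).
Hypotheses (hc1 : forall x, l2 (h * x) <= c1 * l2 x).
Hypotheses (hc2 : forall x, l2 (h * x) <= c2 * l2 x).

(* A joint functional calculus for the three copies of h in tr (a * _ * b * _ * b' * _):
   ell evaluates f on the grids, Q says that f has the value v, with B a bound of f. *)
Definition ell (a b b' : St) n f : R[i] :=
  let N := n.*2.+1 in
  \sum_(i < N.+1) \sum_(j < N.+1) \sum_(k < N.+1)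
    f (gridc c0 N i) (gridc c1 N j) (gridc c2 N k) *
    tr (a * Bc h c0 N i * b * Bc h c1 N j * b' * Bc h c2 N k).

Definition inbox (x0 x1 x2 : R) : Prop := [/\ `|x0| <= c0, `|x1| <= c1 & `|x2| <= c2].

Definition Q (a b b' : St) f v (B : R) : Prop :=
  [/\ forall x0 x1 x2, inbox x0 x1 x2 -> cabs (f x0 x1 x2) <= B,
      forall n, cabs (ell a b b' n f) <= snu 0 a * snu 0 b * snu 0 b' * B &
      ccvg (ell a b b' ^~ f) v].

Definition exp3 z0 z1 z2 : R -> R -> R -> R[i] := fun x0 x1 x2 =>
  cexp (z0 * x0%:C) * cexp (z1 * x1%:C) * cexp (z2 * x2%:C).

Definition B3 z0 z1 z2 : R := expR (c0 * `|complex.Re z0|) * expR (c1 * `|complex.Re z1|) *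
  expR (c2 * `|complex.Re z2|).

Lemma B3_ge0 z0 z1 z2 : 0 <= B3 z0 z1 z2.
Proof. by rewrite !mulr_ge0 ?expR_ge0. Qed.

Lemma tr_sum (I : Type) (r : seq I) (F : I -> St) : tr (\sum_(i <- r) F i) = \sum_(i <- r) tr (F i).
Proof. exact: sv_sum. Qed.

(** An exponential is a product of functions of the three coordinates, so the triple sum reassembles
    to one Bernstein approximation per gap. *)
Lemma ell_exp3 a b b' n z0 z1 z2 : ell a b b' n (exp3 z0 z1 z2) =
  tr (a * Wc h c0 n.*2.+1 z0 * b * Wc h c1 n.*2.+1 z1 * b' * Wc h c2 n.*2.+1 z2).
Proof.
rewrite /ell (Wc_sum h c0p)// (Wc_sum h c1p)// (Wc_sum h c2p)//.
set N := n.*2.+1; move: (Bc h c0 N) (Bc h c1 N) (Bc h c2 N) => B0 B1 B2.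
set S0 := (X in a * X); set S1 := (X in _ * X * b'); set S2 := (X in _ * b' * X).
have L X Y (c : nat -> R[i]) (B : nat -> St) : tr (X * (\sum_(k < N.+1) c k *: B k) * Y) =
    \sum_(k < N.+1) c k * tr (X * B k * Y).
  rewrite mulr_sumr mulr_suml tr_sum; apply: eq_bigr => k _.
  by rewrite -scalerAr -scalerAl trZ.
have LS (w0 w1 : R[i]) (c G : nat -> R[i]) : w0 * (w1 * \sum_(k < N.+1) c k * G k) =
    \sum_(k < N.+1) w0 * (w1 * (c k * G k)) by rewrite !mulr_sumr.
have -> : a * S0 * b * S1 * b' * S2 = a * S0 * (b * S1 * b' * S2) by rewrite !mulrA.
rewrite /S0 (L a _ (fun k => cexp (z0 * (gridc c0 N k)%:C)) B0); apply: eq_bigr => i _.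
have -> : a * B0 i * (b * S1 * b' * S2) = (a * B0 i * b) * S1 * (b' * S2) by rewrite !mulrA.
rewrite /S1 (L _ _ (fun k => cexp (z1 * (gridc c1 N k)%:C)) B1) mulr_sumr; apply: eq_bigr => j _.
have -> : a * B0 i * b * B1 j * (b' * S2) = (a * B0 i * b * B1 j * b') * S2 * 1.
  by rewrite mulr1 !mulrA.
apply: (etrans (y := cexp (z0 * (gridc c0 N i)%:C) * (cexp (z1 * (gridc c1 N j)%:C) *
  \sum_(k < N.+1) cexp (z2 * (gridc c2 N k)%:C) * tr (a * B0 i * b * B1 j * b' * B2 k * 1)))).
  apply: (etrans _ (esym (LS _ _ (fun k => cexp (z2 * (gridc c2 N k)%:C))
    (fun k => tr (a * B0 i * b * B1 j * b' * B2 k * 1))))).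
  apply: eq_bigr => k _; rewrite mulr1.
  by move: (tr _) => v; rewrite /exp3 !mulrA.
exact: (congr1 (fun v => cexp (z0 * (gridc c0 N i)%:C) * (cexp (z1 * (gridc c1 N j)%:C) * v))
  (esym (L _ 1 (fun k => cexp (z2 * (gridc c2 N k)%:C)) B2))).
Qed.

Lemma cabs_exp3 z0 z1 z2 x0 x1 x2 : inbox x0 x1 x2 -> cabs (exp3 z0 z1 z2 x0 x1 x2) <= B3 z0 z1 z2.
Proof.
move=> [h0 h1 h2]; rewrite /B3.
have H z (x c : R) : `|x| <= c -> cabs (cexp (z * x%:C)) <= expR (c * `|complex.Re z|).
  move=> xc; rewrite cabs_cexp ler_expR mulrC Re_real.
  by apply: le_trans (ler_norm _) _; rewrite normrM ler_wpM2r.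
rewrite /exp3 cabsM [cabs (_ * _)]cabsM.
by apply: ler_pM; rewrite ?mulr_ge0 ?cabs_ge0 ?H//; apply: ler_pM; rewrite ?cabs_ge0 ?H.
Qed.

Lemma snu_cvg2 (X Y : nat -> St) (x y : St) : snu 0 (X n - x) @[n --> \oo] --> 0 ->
  snu 0 (Y n - y) @[n --> \oo] --> 0 -> snu 0 (X n * Y n - x * y) @[n --> \oo] --> 0.
Proof.
move=> Xx Yy.
apply: (@squeeze_cvgr _ _ _ _ (fun=> 0)
  (fun n => snu 0 (X n - x) * (snu 0 (Y n - y) + snu 0 y) + snu 0 x * snu 0 (Y n - y))).
- apply: nearW => n; rewrite snu_ge0/=.
  have -> : X n * Y n - x * y = (X n - x) * Y n + x * (Y n - y).
    by rewrite mulrBl mulrBr addrA subrK.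
  apply: le_trans (snuD _ _ _) _; apply: lerD; apply: le_trans (snuM _ _ _) _; rewrite ?ler_wpM2l ?snu_ge0//.
  by rewrite -{1}(subrK y (Y n)) snuD.
- exact: cvg_cst.
- rewrite (_ : 0 = 0 * (0 + snu 0 y) + snu 0 x * 0); last by rewrite mul0r mulr0 addr0.
  by apply: cvgD; apply: cvgM => //; [apply: cvgD => //|]; exact: cvg_cst.
Qed.

Lemma snu_cvg_cst (x : St) : snu 0 (x - x) @[n --> \oo] --> 0.
Proof. by rewrite subrr snu0; exact: cvg_cst. Qed.

(** Only odd [N] occur in [ell]: then $N-2k$ is odd, in particular never 0, and grids of different
    radii can avoid each other. *)
Lemma Wc_odd_cvg c z : 0 < c -> snu 0 (Wc h c n.*2.+1 z - E h z) @[n --> \oo] --> 0.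
Proof.
move=> cp; have H := Wc_cvg h cp z.
have D : n.*2 @[n --> \oo] --> \oo.
  by apply/cvgnyPge => A; near=> n; have : (A <= n)%N by [near: n; exact: nbhs_infty_ge]; lia.
exact: (cvg_comp _ _ D H).
Unshelve. all: end_near. Qed.

(** The bound goes through $|\mathrm{tr}\,x|\le\|x\|_2$ and the operator bounds of [l2_Wc];
    estimating the exponentials by [snu 0] would bring in growth in the imaginary parts. *)
Lemma Q_exp a b b' z0 z1 z2 :
  Q a b b' (exp3 z0 z1 z2) (tr (a * E h z0 * b * E h z1 * b' * E h z2)) (B3 z0 z1 z2).
Proof.
split=> [x0 x1 x2|n|]; first exact: cabs_exp3.
  rewrite ell_exp3; apply: le_trans (tr_l2 _) _.
  have L (c : R) (x y : St) z : 0 < c -> (forall x, l2 (h * x) <= c * l2 x) ->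
      l2 (x * (Wc h c n.*2.+1 z * y)) <= snu 0 x * expR (c * `|complex.Re z|) * l2 y.
    move=> cp hc; apply: le_trans (l2_mul _ _) _; rewrite -mulrA ler_wpM2l ?snu_ge0//.
    exact: l2_Wc.
  rewrite -[X in l2 X]mulr1 -!mulrA; apply: le_trans (L _ _ _ _ c0p hc0) _.
  apply: le_trans (ler_wpM2l _ (L _ _ _ _ c1p hc1)) _; first by rewrite mulr_ge0 ?snu_ge0 ?expR_ge0.
  rewrite [leRHS](_ : _ = snu 0 a * expR (c0 * `|complex.Re z0|) *
     (snu 0 b * expR (c1 * `|complex.Re z1|) * (snu 0 b' * expR (c2 * `|complex.Re z2|)))); last first.
    by rewrite /B3; ring.
  rewrite ler_wpM2l ?mulr_ge0 ?snu_ge0 ?expR_ge0// ler_wpM2l ?mulr_ge0 ?snu_ge0 ?expR_ge0//.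
  apply: le_trans (L _ _ _ _ c2p hc2) _.
  rewrite ler_piMr ?mulr_ge0 ?snu_ge0 ?expR_ge0//.
  by apply: le_trans (l2_le _) (snu1 _ _).
apply: (@ccvg_eq _ (fun n => tr (a * Wc h c0 n.*2.+1 z0 * b * Wc h c1 n.*2.+1 z1 * b' * Wc h c2 n.*2.+1 z2))).
  by move=> n; rewrite ell_exp3.
apply: snu_cvg_ccvg.
by do 2! (apply: snu_cvg2; [apply: snu_cvg2; last exact: snu_cvg_cst|exact: Wc_odd_cvg]);
  apply: snu_cvg2; [exact: snu_cvg_cst|exact: Wc_odd_cvg].
Qed.

Lemma ellD a b b' n f g : ell a b b' n (fun x0 x1 x2 => f x0 x1 x2 + g x0 x1 x2) =
  ell a b b' n f + ell a b b' n g.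
Proof.
rewrite /ell -big_split; apply: eq_bigr => i _; rewrite -big_split; apply: eq_bigr => j _.
by rewrite -big_split; apply: eq_bigr => k _; rewrite /= mulrDl.
Qed.

Lemma ellZ a b b' n z f : ell a b b' n (fun x0 x1 x2 => z * f x0 x1 x2) = z * ell a b b' n f.
Proof.
rewrite /ell mulr_sumr; apply: eq_bigr => i _; rewrite mulr_sumr; apply: eq_bigr => j _.
by rewrite mulr_sumr; apply: eq_bigr => k _; rewrite mulrA.
Qed.

Lemma QD a b b' f g v w B B' : Q a b b' f v B -> Q a b b' g w B' ->
  Q a b b' (fun x0 x1 x2 => f x0 x1 x2 + g x0 x1 x2) (v + w) (B + B').
Proof.
move=> [f1 f2 f3] [g1 g2 g3]; split=> [x0 x1 x2 hx|n|].
- exact: le_trans (cabsD _ _) (lerD (f1 _ _ _ hx) (g1 _ _ _ hx)).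
- by rewrite ellD mulrDr; apply: le_trans (cabsD _ _) (lerD (f2 n) (g2 n)).
- by apply: ccvg_eq (ccvgD f3 g3) => n; rewrite ellD.
Qed.

Lemma QZ a b b' f v B z : Q a b b' f v B ->
  Q a b b' (fun x0 x1 x2 => z * f x0 x1 x2) (z * v) (cabs z * B).
Proof.
move=> [f1 f2 f3]; split=> [x0 x1 x2 hx|n|].
- by rewrite cabsM ler_wpM2l ?cabs_ge0 ?f1.
- by rewrite ellZ cabsM mulrCA ler_wpM2l ?cabs_ge0.
- by apply: ccvg_eq (ccvgMl z f3) => n; rewrite ellZ.
Qed.

Lemma Q_bound a b b' f v B : Q a b b' f v B -> cabs v <= snu 0 a * snu 0 b * snu 0 b' * B.
Proof. by move=> [_ fB fv]; exact: ccvg_le fv fB. Qed.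

Lemma Q_ext a b b' f g v B : (forall x0 x1 x2, f x0 x1 x2 = g x0 x1 x2) ->
  Q a b b' f v B -> Q a b b' g v B.
Proof.
by move=> fg; rewrite (_ : f = g)//; apply/funext => x; apply/funext => y; apply/funext.
Qed.

(** [ell] is a finite sum, so it commutes with the integral, and the bound in [Q], uniform in [n],
    is the domination needed to pass to the limit. *)
Lemma Q_int d (T : measurableType d) (mu : {measure set T -> \bar R}) (D : set T)
    (F : T -> R -> R -> R -> R[i]) (V : T -> R[i]) (B : T -> R) a b b' : measurable D ->
  (forall t, D t -> Q a b b' (F t) (V t) (B t)) ->
  (forall x0 x1 x2, cmeas D (fun t => F t x0 x1 x2)) ->
  mu.-integrable D (EFin \o B) ->
  Q a b b' (fun x0 x1 x2 => cI mu D (fun t => F t x0 x1 x2)) (cI mu D V)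
    (2 * \int[mu]_(t in D) B t).
Proof.
move=> mD FQ mF iB.
have bxg n i j k : (i <= n.*2.+1)%N -> (j <= n.*2.+1)%N -> (k <= n.*2.+1)%N ->
    inbox (gridc c0 n.*2.+1 i) (gridc c1 n.*2.+1 j) (gridc c2 n.*2.+1 k).
  by move=> hi hj hk; split; exact: gridc_le.
have iF x0 x1 x2 : inbox x0 x1 x2 -> cintg mu D (fun t => F t x0 x1 x2).
  move=> hx; apply: cintg_dom iB => // t Dt; have [f1 _ _] := FQ t Dt; exact: f1.
have mell n : cmeas D (fun t => ell a b b' n (F t)).
  rewrite /ell; apply: cmeas_sum => i; apply: cmeas_sum => j; apply: cmeas_sum => k.
  by apply: cmeasM => //; exact: cmeas_cst.
have ellI n : ell a b b' n (fun x0 x1 x2 => cI mu D (fun t => F t x0 x1 x2)) =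
    cI mu D (fun t => ell a b b' n (F t)).
  have IE (i j k : 'I_(n.*2.+1.+1)) : cintg mu D (fun t => F t (gridc c0 n.*2.+1 i)
       (gridc c1 n.*2.+1 j) (gridc c2 n.*2.+1 k) *
       tr (a * Bc h c0 n.*2.+1 i * b * Bc h c1 n.*2.+1 j * b' * Bc h c2 n.*2.+1 k)).
    under eq_fun do rewrite mulrC; apply: cintgZ => //; apply: iF; apply: bxg; by rewrite -ltnS.
  rewrite /ell cI_sum//; last by move=> i; do 2! (apply: cintg_sum => // ?); exact: IE.
  apply: eq_bigr => i _; rewrite cI_sum//; last by move=> j; apply: cintg_sum => // ?; exact: IE.
  apply: eq_bigr => j _; rewrite cI_sum//.
  apply: eq_bigr => k _; rewrite mulrC -cI_Z//; last by apply: iF; apply: bxg; rewrite -ltnS.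
  by apply: cI_eq => t _; rewrite mulrC.
have A0 : 0 <= snu 0 a * snu 0 b * snu 0 b' by rewrite !mulr_ge0 ?snu_ge0.
split=> [x0 x1 x2 hx|n|].
- by apply: cI_le => // t Dt; have [f1 _ _] := FQ t Dt; exact: f1.
- rewrite ellI mulrCA -RintegralZl//; apply: cI_le => //; last exact: intgZl.
  by move=> t Dt; have [_ f2 _] := FQ t Dt; exact: f2.
- apply: (@ccvg_eq _ (fun n => cI mu D (fun t => ell a b b' n (F t)))).
    by move=> n; rewrite ellI.
  apply: (@cI_dct _ _ _ mu D _ _ (fun t => snu 0 a * snu 0 b * snu 0 b' * B t)) => //.
  + by move=> t Dt; have [_ _ f3] := FQ t Dt; exact: f3.
  + by move=> n t Dt; have [_ f2 _] := FQ t Dt; exact: f2.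
  + exact: intgZl.
Qed.

(* The three grids never meet, so only distinct arguments matter. *)
Hypothesis distinct_grid : forall n i j k, (i <= n.*2.+1)%N -> (j <= n.*2.+1)%N -> (k <= n.*2.+1)%N ->
  [/\ gridc c0 n.*2.+1 i != gridc c1 n.*2.+1 j, gridc c1 n.*2.+1 j != gridc c2 n.*2.+1 k &
      gridc c2 n.*2.+1 k != gridc c0 n.*2.+1 i].

(** Every equality of traces with different integral representations is obtained from this
    comparison of scalar functions on the grids. *)
Lemma Q_uniq a b b' f g v w B B' :
  (forall x0 x1 x2, inbox x0 x1 x2 -> x0 != x1 -> x1 != x2 -> x2 != x0 ->
     f x0 x1 x2 = g x0 x1 x2) ->
  Q a b b' f v B -> Q a b b' g w B' -> v = w.
Proof.
move=> fg [_ _ fv] [_ _ gw]; apply: (ccvg_unique fv); apply: ccvg_eq gw => n.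
rewrite /ell; apply: eq_bigr => i _; apply: eq_bigr => j _; apply: eq_bigr => k _.
have [hi hj hk] : [/\ (i <= n.*2.+1)%N, (j <= n.*2.+1)%N & (k <= n.*2.+1)%N].
  by split; rewrite -ltnS.
have [d1 d2 d3] := distinct_grid hi hj hk.
by rewrite fg//; split; exact: gridc_le.
Qed.

(** On the circle of the trace, [a] stands between the gaps 2 and 0, [b] between 0 and 1, [b']
    between 1 and 2. A factor [DE] at a letter contributes the divided difference in the coordinates
    of its two gaps. *)
Definition dd3 s0 s1 s2 z0 z1 z2 : R -> R -> R -> R[i] := fun x0 x1 x2 =>
  ddx s0 x0 x2 * ddx s1 x1 x0 * ddx s2 x2 x1 * exp3 z0 z1 z2 x0 x1 x2.

Lemma Q_le a b b' f v B B' : B <= B' -> Q a b b' f v B -> Q a b b' f v B'.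
Proof.
move=> BB [f1 f2 f3]; split=> // [x0 x1 x2 hx|n]; first exact: le_trans (f1 _ _ _ hx) BB.
by apply: le_trans (f2 n) _; rewrite ler_wpM2l// !mulr_ge0 ?snu_ge0.
Qed.

Lemma tr_assoc3 (P Y1 Y2 Y3 : St) : tr (P * Y1 * Y2 * Y3) = tr (P * (Y1 * Y2 * Y3)).
Proof. by rewrite !mulrA. Qed.

Lemma tr_assoc5 (P Y1 Y2 Y3 Y4 Y5 : St) :
  tr (P * Y1 * Y2 * Y3 * Y4 * Y5) = tr (1 * P * (Y1 * Y2 * Y3 * Y4 * Y5)).
Proof. by rewrite mul1r !mulrA. Qed.

Lemma tr_slot4 (P c : St) w u v z :
  tr (P * E h w * (E h u * c * E h v) * E h z) = tr (P * E h (w + u) * c * E h (v + z)).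
Proof. by rewrite (E_add h w) (E_add h v); move: (E h w) (E h u) (E h v) (E h z) => *; rewrite !mulrA. Qed.

Lemma tr_slot6 (P c Y2 Y3 : St) w u v z :
  tr (P * E h w * (E h u * c * E h v) * (E h z * Y2 * Y3)) =
  tr (P * E h (w + u) * c * E h (v + z) * Y2 * Y3).
Proof. by rewrite (E_add h w) (E_add h v); move: (E h w) (E h u) (E h v) (E h z) => *; rewrite !mulrA. Qed.

Lemma tr_slot_cyc (c Y1 Y2 Y3 : St) z0 z2 u v :
  tr (1 * (E h u * c * E h v) * (E h z0 * Y1 * Y2 * Y3 * E h z2)) =
  tr (c * E h (v + z0) * Y1 * Y2 * Y3 * E h (z2 + u)).
Proof.
rewrite (E_add h v) (E_add h z2); move: (E h u) (E h v) (E h z0) (E h z2) => X0 X1 X2 X3.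
transitivity (tr (X0 * (c * X1 * (X2 * Y1 * Y2 * Y3 * X3)))); first by rewrite mul1r !mulrA.
by rewrite trM !mulrA.
Qed.

Lemma Q_val a b b' f v w B : v = w -> Q a b b' f v B -> Q a b b' f w B.
Proof. by move=> ->. Qed.

(** One use of Duhamel's formula at a letter whose left and right gaps have the coordinates [pl] and
    [pr]. *)
Lemma Q_slot a b b' (pr pl : R -> R -> R -> R) g (V : R -> R[i]) s B :
  cdiff (fun t => s * V t) ->
  (forall t, I01 t -> Q a b b' (fun x0 x1 x2 =>
     cexp (t%:C * s * (pr x0 x1 x2)%:C) * cexp ((1 - t)%:C * s * (pl x0 x1 x2)%:C) * g x0 x1 x2)
     (V t) B) ->
  Q a b b' (fun x0 x1 x2 => ddx s (pr x0 x1 x2) (pl x0 x1 x2) * g x0 x1 x2)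
    (cI leb I01 (fun t => s * V t)) (2 * (cabs s * B)).
Proof.
move=> dV HQ; have E3 t (x y : R) : s * cexp (s * (t * x + (1 - t) * y)%:C) =
    s * (cexp (t%:C * s * x%:C) * cexp ((1 - t)%:C * s * y%:C)).
  rewrite -cexpD; congr (_ * cexp _).
  by rewrite !(rmorphD, rmorphB, rmorphM, rmorph1)/=; ring.
rewrite -(int01_cst (cabs s * B)).
apply: (@Q_ext _ _ _ (fun x0 x1 x2 => cI leb I01 (fun t => s * (
     cexp (t%:C * s * (pr x0 x1 x2)%:C) * cexp ((1 - t)%:C * s * (pl x0 x1 x2)%:C) * g x0 x1 x2)))).
  move=> x0 x1 x2; rewrite mulrC /ddx -cI_Z//.
    by apply: cI_eq => t _; rewrite E3; ring.
  apply: (@cintg_dom _ _ _ _ _ _ (fun=> cabs s * expR (`|complex.Re s| * (`|pr x0 x1 x2| + `|pl x0 x1 x2|)))) => //.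
  - by apply: cdiff_cmeas => //; exact: ddx_cdiff.
  - move=> t It; rewrite [`|_| * _]mulrC; apply: ddx_le => //.
      by rewrite lerDl.
    by rewrite lerDr.
  - exact: intg01_cst.
apply: Q_int => //.
- by move=> t It; apply: QZ; exact: HQ.
- move=> x0 x1 x2; rewrite (_ : (fun t => _) = (fun t : R =>
    (s * cexp (s * (t * pr x0 x1 x2 + (1 - t) * pl x0 x1 x2)%:C)) * g x0 x1 x2)); last first.
    by apply/funext => t; rewrite E3 -!mulrA.
  apply: cmeasM; last exact: cmeas_cst.
  by apply: cdiff_cmeas => //; exact: ddx_cdiff.
- exact: intg01_cst.
Qed.

(** [Q_slot] is applied to the three letters in turn, with cyclicity of the trace for the first
    letter. The constant 8 is the cube of its factor 2, and [M] bounds the real part of the total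
    exponent in each gap. *)
Lemma Q_duhamel (a b b' : St) (s0 s1 s2 z0 z1 z2 : R[i]) (M : R) :
  `|complex.Re s0| + `|complex.Re s1| + `|complex.Re z0| <= M ->
  `|complex.Re s1| + `|complex.Re s2| + `|complex.Re z1| <= M ->
  `|complex.Re s2| + `|complex.Re s0| + `|complex.Re z2| <= M ->
  Q a b b' (dd3 s0 s1 s2 z0 z1 z2)
    (tr (DE h a s0 * E h z0 * DE h b s1 * E h z1 * DE h b' s2 * E h z2))
    (8 * (cabs s0 * cabs s1 * cabs s2 * (expR (c0 * M) * expR (c1 * M) * expR (c2 * M)))).
Proof.
move=> M0 M1 M2; set B := expR _ * _ * _.
have RM (t : R) s : I01 t -> `|complex.Re (t%:C * s)| <= `|complex.Re s| /\ `|complex.Re ((1 - t)%:C * s)| <= `|complex.Re s|.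
  rewrite /= in_itv/= => /andP[t0 t1].
  have t1' : 0 <= 1 - t by rewrite subr_ge0.
  rewrite !Re_real !normrM (ger0_norm t0) (ger0_norm t1').
  by split; rewrite ler_piMl// gerBl.
pose f0 t0 t1 t2 := exp3 (z0 + (t0%:C * s0 + (1 - t1)%:C * s1))
  (z1 + (t1%:C * s1 + (1 - t2)%:C * s2)) (z2 + (t2%:C * s2 + (1 - t0)%:C * s0)).
have Q0 t0 t1 t2 : I01 t0 -> I01 t1 -> I01 t2 -> Q a b b' (f0 t0 t1 t2)
   (tr (a * E h (z0 + (t0%:C * s0 + (1 - t1)%:C * s1)) * b *
        E h (z1 + (t1%:C * s1 + (1 - t2)%:C * s2)) * b' *
        E h (z2 + (t2%:C * s2 + (1 - t0)%:C * s0)))) B.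
  move=> I0 I1 I2; apply: Q_le (Q_exp _ _ _ _ _ _).
  have Rn z s s' (t t' : R) : I01 t -> I01 t' -> `|complex.Re s| + `|complex.Re s'| + `|complex.Re z| <= M ->
      `|complex.Re (z + (t%:C * s + (1 - t')%:C * s'))| <= M.
    move=> It It' HM; rewrite !Re_add; apply: le_trans (ler_normD _ _) _.
    apply: le_trans HM; rewrite addrC lerD2r; apply: le_trans (ler_normD _ _) _.
    by apply: lerD; [case: (RM t s It)|case: (RM t' s' It')].
  rewrite /B3 /B; apply: ler_pM; rewrite ?mulr_ge0 ?expR_ge0//; last first.
    by rewrite ler_expR; apply: (ler_wpM2l (ltW c2p) (Rn _ _ _ _ _ I2 I0 M2)).
  apply: ler_pM; rewrite ?expR_ge0// ler_expR.
    by apply: (ler_wpM2l (ltW c0p) (Rn _ _ _ _ _ I0 I1 M0)).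
  by apply: (ler_wpM2l (ltW c1p) (Rn _ _ _ _ _ I1 I2 M1)).
have Q1 t0 t1 : I01 t0 -> I01 t1 -> Q a b b'
   (fun x0 x1 x2 => ddx s2 x2 x1 * exp3 (z0 + (t0%:C * s0 + (1 - t1)%:C * s1))
      (z1 + t1%:C * s1) (z2 + (1 - t0)%:C * s0) x0 x1 x2)
   (tr (a * E h (z0 + (t0%:C * s0 + (1 - t1)%:C * s1)) * b *
        E h (z1 + t1%:C * s1) * DE h b' s2 * E h (z2 + (1 - t0)%:C * s0))) (2 * (cabs s2 * B)).
  move=> I0 I1.
  have [D1 ->] := duhamel_tr h (a * E h (z0 + (t0%:C * s0 + (1 - t1)%:C * s1)) * b *
        E h (z1 + t1%:C * s1)) b' (E h (z2 + (1 - t0)%:C * s0)) s2.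
  apply: (@Q_slot _ _ _ (fun _ _ x => x) (fun _ x _ => x)) => // t2 I2.
  have := Q0 t0 t1 t2 I0 I1 I2.
  have -> : z1 + (t1%:C * s1 + (1 - t2)%:C * s2) = (z1 + t1%:C * s1) + (1 - t2)%:C * s2 by ring.
  have -> : z2 + (t2%:C * s2 + (1 - t0)%:C * s0) = t2%:C * s2 + (z2 + (1 - t0)%:C * s0) by ring.
  move=> HQ; apply: (Q_val (esym (tr_slot4 _ _ _ _ _ _))); move: HQ.
  apply: Q_ext => x0 x1 x2; rewrite /f0 /exp3 !mulrDl !cexpD; ring.
have Q2 t0 : I01 t0 -> Q a b b'
   (fun x0 x1 x2 => ddx s1 x1 x0 * (ddx s2 x2 x1 * exp3 (z0 + t0%:C * s0)
      z1 (z2 + (1 - t0)%:C * s0) x0 x1 x2))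
   (tr (a * E h (z0 + t0%:C * s0) * DE h b s1 * E h z1 * DE h b' s2 * E h (z2 + (1 - t0)%:C * s0)))
     (2 * (cabs s1 * (2 * (cabs s2 * B)))).
  move=> I0.
  have [D1 ->] : cdiff (fun t1 => s1 * tr (a * E h (z0 + t0%:C * s0) *
      (E h ((1 - t1)%:C * s1) * b * E h (t1%:C * s1)) * (E h z1 * DE h b' s2 * E h (z2 + (1 - t0)%:C * s0)))) /\
     tr (a * E h (z0 + t0%:C * s0) * DE h b s1 * E h z1 * DE h b' s2 * E h (z2 + (1 - t0)%:C * s0)) =
     cI leb I01 (fun t1 => s1 * tr (a * E h (z0 + t0%:C * s0) *
      (E h ((1 - t1)%:C * s1) * b * E h (t1%:C * s1)) * (E h z1 * DE h b' s2 * E h (z2 + (1 - t0)%:C * s0)))).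
    have [D1 D2] := duhamel_tr h (a * E h (z0 + t0%:C * s0)) b
       (E h z1 * DE h b' s2 * E h (z2 + (1 - t0)%:C * s0)) s1.
    by split; [exact: D1|rewrite -D2 -tr_assoc3].
  apply: (@Q_slot _ _ _ (fun _ x _ => x) (fun x _ _ => x)) => // t1 I1.
  have := Q1 t0 t1 I0 I1.
  have -> : z0 + (t0%:C * s0 + (1 - t1)%:C * s1) = (z0 + t0%:C * s0) + (1 - t1)%:C * s1 by ring.
  have -> : z1 + t1%:C * s1 = t1%:C * s1 + z1 by ring.
  move=> HQ; apply: (Q_val (esym (tr_slot6 _ _ _ _ _ _ _ _))); move: HQ.
  apply: Q_ext => x0 x1 x2; rewrite /exp3 !mulrDl !cexpD; ring.
apply: Q_le (_ : 2 * (cabs s0 * (2 * (cabs s1 * (2 * (cabs s2 * B))))) <= _) _.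
  by rewrite le_eqVlt; apply/orP; left; apply/eqP; ring.
have [D1 ->] : cdiff (fun t0 => s0 * tr (1 *
      (E h ((1 - t0)%:C * s0) * a * E h (t0%:C * s0)) * (E h z0 * DE h b s1 * E h z1 * DE h b' s2 * E h z2))) /\
     tr (DE h a s0 * E h z0 * DE h b s1 * E h z1 * DE h b' s2 * E h z2) =
     cI leb I01 (fun t0 => s0 * tr (1 *
      (E h ((1 - t0)%:C * s0) * a * E h (t0%:C * s0)) * (E h z0 * DE h b s1 * E h z1 * DE h b' s2 * E h z2))).
  have [D1 D2] := duhamel_tr h 1 a (E h z0 * DE h b s1 * E h z1 * DE h b' s2 * E h z2) s0.
  by split; [exact: D1|rewrite -D2 -tr_assoc5].
apply: (@Q_ext _ _ _ (fun x0 x1 x2 => ddx s0 x0 x2 * (ddx s1 x1 x0 * (ddx s2 x2 x1 * exp3 z0 z1 z2 x0 x1 x2)))).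
  by move=> x0 x1 x2; rewrite /dd3 !mulrA.
apply: (@Q_slot _ _ _ (fun x _ _ => x) (fun _ _ x => x)) => // t0 I0.
have := Q2 t0 I0.
have -> : z0 + t0%:C * s0 = t0%:C * s0 + z0 by ring.
move=> HQ; apply: (Q_val (esym (tr_slot_cyc _ _ _ _ _ _ _ _))); move: HQ.
apply: Q_ext => x0 x1 x2; rewrite /exp3 !mulrDl !cexpD; ring.
Qed.

End Grid.

(** * Smooth functions *)

Section SmoothClass.
Context {R : realType}.
Local Notation leb := (@lebesgue_measure R).

Lemma is_derive_line {V : normedModType R} (e x : V) (f : V -> R) l :
  is_derive x e f l <-> is_derive 0 (1 : R) (fun t : R => f (x + t *: e)) l.
Proof.
have E1 : (fun h : R => h^-1 *: ((f \o shift x) (h *: e) - f x)) =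
    (fun h : R => h^-1 *: (((fun t : R => f (x + t *: e)) \o shift 0) (h *: (1 : R)) -
       (fun t : R => f (x + t *: e)) 0)).
  apply/funext => h /=; rewrite scale0r !addr0 [x + _]addrC.
  by rewrite [h *: (1 : R)]mulr1.
split=> -[d1 d2]; split.
- by rewrite /derivable -E1.
- by rewrite -d2 /derive -E1.
- by rewrite /derivable E1.
- by rewrite -d2 /derive E1.
Qed.

Section Directional.
Context {V : normedModType R}.
Implicit Types (e x : V) (f g : V -> R).

Lemma is_derive_at e x f (s : R) l :
  is_derive (x + s *: e) e f l -> is_derive s (1 : R) (fun t : R => f (x + t *: e)) l.
Proof.
move=> /is_derive_line H; rewrite (is_derive_line (1 : R)).
rewrite (_ : (fun t : R => _) = (fun t : R => f (x + s *: e + t *: e)))//.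
by apply/funext => t /=; rewrite -addrA -scalerDl [t *: (1 : R)]mulr1.
Qed.

Lemma is_derive_prod e x f g a b : is_derive x e f a -> is_derive x e g b ->
  is_derive x e (fun y => f y * g y) (a * g x + f x * b).
Proof.
move=> fa gb; apply: (is_derive_eq (is_deriveM fa gb)).
by rewrite addrC [g x *: a]mulrC.
Qed.

Lemma is_derive_chain e x (gam : R -> R) g a b : is_derive (g x) (1 : R) gam a ->
  is_derive x e g b -> is_derive x e (fun y => gam (g y)) (a * b).
Proof.
move=> ga /is_derive_line gb; apply/is_derive_line.
by apply: (@is_derive1_comp _ gam (fun t : R => g (x + t *: e))); rewrite ?scale0r ?addr0.
Qed.

Lemma is_derive_inv e x f a : f x != 0 -> is_derive x e f a ->
  is_derive x e (fun y => (f y)^-1) (- a * ((f x)^-1 * (f x)^-1)).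
Proof.
move=> fx0 /is_derive_line fa; apply/is_derive_line.
apply: (is_derive_eq (is_deriveV _ fa)); rewrite scale0r addr0//.
by rewrite [_ *: _]mulrC -exprVn expr2 mulrN mulNr.
Qed.

(** Smoothness along one fixed direction. It is stable under products, inverses, composition and
    parameter integrals and suffices for integration by parts; the full differentiability asked by
    [schwartz] is recovered later from Fourier integrals. *)
Fixpoint Cn e (n : nat) (f : V -> R) : Prop :=
  continuous f /\
  if n is m.+1 then exists2 f1, (forall x, is_derive x e f (f1 x)) & Cn e m f1 else True.

Definition SM e f := forall n, Cn e n f.

Lemma Cn_cont e n f : Cn e n f -> continuous f.
Proof. by case: n => [|n] []. Qed.

Lemma Cn_pred e n f : Cn e n.+1 f -> Cn e n f.
Proof.
elim: n f => [|n IH] f [cf [f1 df f1n]]; first by [].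
by split=> //; exists f1 => //; exact: IH.
Qed.

Lemma SM_cont e f : SM e f -> continuous f.
Proof. by move=> /(_ 0%N) []. Qed.

Lemma SM_der e f : SM e f -> exists2 f1, (forall x, is_derive x e f (f1 x)) & SM e f1.
Proof.
move=> sf; have [_ [f1 df _]] := sf 1%N; exists f1 => // n.
have [_ [f2 df2 f2n]] := sf n.+1; suff -> : f1 = f2 by [].
apply/funext => x; have [_ <-] := df x; by have [_ <-] := df2 x.
Qed.

Lemma SM_intro e f f1 : continuous f -> (forall x, is_derive x e f (f1 x)) -> SM e f1 -> SM e f.
Proof. by move=> cf df sf [|n]; split=> //; exists f1. Qed.

Lemma SM_ext e f g : f =1 g -> SM e f -> SM e g.
Proof. by move=> /funext ->. Qed.

Lemma Cn_cst e n (c : R) : Cn e n (fun=> c).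
Proof.
elim: n c => [|n IH] c; split=> //; try by move=> x; exact: cvg_cst.
by exists (fun=> 0) => // x; exact: is_derive_cst.
Qed.

Lemma CnD e n f g : Cn e n f -> Cn e n g -> Cn e n (fun x => f x + g x).
Proof.
elim: n f g => [|n IH] f g [cf H1] [cg H2]; split=> //.
- by move=> x; apply: cvgD; [exact: cf|exact: cg].
- by move=> x; apply: cvgD; [exact: cf|exact: cg].
- case: H1 H2 => f1 df f1n [g1 dg g1n]; exists (fun x => f1 x + g1 x); last exact: IH.
  by move=> x; exact: is_deriveD.
Qed.

Lemma CnM e n f g : Cn e n f -> Cn e n g -> Cn e n (fun x => f x * g x).
Proof.
elim: n f g => [|n IH] f g.
  by move=> [cf H1] [cg H2]; split=> // x; apply: cvgM; [exact: cf|exact: cg].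
move=> F G; have F' := Cn_pred F; have G' := Cn_pred G.
case: F G => cf [f1 df f1n] [cg [g1 dg g1n]]; split.
  by move=> x; apply: cvgM; [exact: cf|exact: cg].
exists (fun x => f1 x * g x + f x * g1 x); last by apply: CnD; exact: IH.
by move=> x; exact: is_derive_prod.
Qed.

Lemma CnN e n f : Cn e n f -> Cn e n (fun x => - f x).
Proof.
by move=> /(CnM (Cn_cst e n (-1))); under eq_fun do rewrite mulN1r.
Qed.

Lemma Cn_inv e n f : (forall x, f x != 0) -> Cn e n f -> Cn e n (fun x => (f x)^-1).
Proof.
move=> f0; have C (g : V -> R) : continuous g -> (forall x, g x != 0) -> continuous (fun x => (g x)^-1).
  by move=> cg g0 x; apply: cvgV; [exact: g0|exact: cg].
elim: n => [|n IH]; first by move=> [cf _]; split=> //; exact: C.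
move=> F; have Fi := IH (Cn_pred F); case: F => cf [f1 df f1n]; split; first exact: C.
exists (fun x => - f1 x * ((f x)^-1 * (f x)^-1)); last by apply: CnM; [exact: CnN|exact: CnM].
by move=> x; exact: is_derive_inv.
Qed.

Lemma SM_cst e (c : R) : SM e (fun=> c). Proof. move=> n; exact: Cn_cst. Qed.

Lemma SMD e f g : SM e f -> SM e g -> SM e (fun x => f x + g x).
Proof. by move=> sf sg n; exact: CnD. Qed.

Lemma SMM e f g : SM e f -> SM e g -> SM e (fun x => f x * g x).
Proof. by move=> sf sg n; exact: CnM. Qed.

Lemma SMN e f : SM e f -> SM e (fun x => - f x).
Proof. by move=> sf n; exact: CnN. Qed.

Lemma SMB e f g : SM e f -> SM e g -> SM e (fun x => f x - g x).
Proof. by move=> sf sg; apply: SMD => //; exact: SMN. Qed.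

Lemma SM_inv e f : (forall x, f x != 0) -> SM e f -> SM e (fun x => (f x)^-1).
Proof. by move=> f0 sf n; exact: Cn_inv. Qed.

End Directional.

Lemma Cn_comp {V : normedModType R} (e : V) n (gam : R -> R) g :
  Cn (1 : R) n gam -> Cn e n g -> Cn e n (fun x => gam (g x)).
Proof.
elim: n gam g => [|n IH] gam g.
  move=> [cf _] [cg _]; split=> // x; apply: continuous_comp; [exact: cg|exact: cf].
move=> F G; have G' := Cn_pred G; case: F G => cf [f1 df f1n] [cg [g1 dg g1n]]; split.
  move=> x; apply: continuous_comp; [exact: cg|exact: cf].
exists (fun x => f1 (g x) * g1 x); last by apply: CnM => //; exact: IH.
by move=> x; exact: is_derive_chain.
Qed.

Lemma SM_comp {V : normedModType R} (e : V) (gam : R -> R) g :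
  SM (1 : R) gam -> SM e g -> SM e (fun x => gam (g x)).
Proof. by move=> sf sg n; exact: Cn_comp. Qed.

Lemma SM_id : SM (1 : R) (fun x : R => x).
Proof.
apply: (@SM_intro _ _ _ (fun=> 1)); last exact: SM_cst.
by move=> x; exact: cvg_id.
Qed.

Lemma SM_expR : SM (1 : R) (@expR R).
Proof.
move=> n; elim: n => [|n IH]; split=> //; try exact: continuous_expR.
by exists (@expR R) => // x; exact: is_derive_expR.
Qed.

(** * Integrals depending on a parameter *)

Section Parametric.
Context {V : normedModType R}.
Variables (a b : R).
Hypothesis ab : a < b.
Local Notation I := (`[a, b]%classic : set R).
Implicit Types (F : V * R -> R) (e : V).

Lemma tube_bound F (K : set V) : compact K -> continuous F ->
  exists C, forall x t, K x -> I t -> `|F (x, t)| <= C.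
Proof.
move=> cK cF.
have cKI : compact (K `*` I) by apply: compact_setX => //; exact: segment_compact.
have : bounded_set (F @` (K `*` I)).
  apply: compact_bounded; apply: continuous_compact => //.
  exact: continuous_subspaceT.
move=> [M [_ HM]]; exists (M + 1) => x t Kx It.
by apply: (HM (M + 1)); [rewrite ltrDl|exists (x, t)].
Qed.

Lemma slice_cont F x : continuous F -> continuous (fun t => F (x, t)).
Proof.
move=> cF t; apply: (@continuous_comp _ _ _ (fun t => (x, t)) F); last exact: cF.
exact: (cvg_pair (cvg_cst x) cvg_id).
Qed.

Lemma slice_intg F x : continuous F -> leb.-integrable I (EFin \o (fun t => F (x, t))).
Proof.
move=> cF; apply: continuous_compact_integrable; first exact: segment_compact.
by apply: continuous_subspaceT; exact: slice_cont.
Qed.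

(** Compactness of the interval makes the continuity in [x] uniform in [t]. *)
Lemma par_cont F : continuous F -> continuous (fun x => \int[leb]_(t in I) F (x, t)).
Proof.
move=> cF x; apply/cvgrPdist_le => /= eps eps0.
have ba : 0 < b - a by rewrite subr_gt0.
have : \forall y \near x, I `<=` (fun t => `|F (x, t) - F (y, t)| <= eps / (b - a)).
  have /compact_near_coveringP NC := @segment_compact R a b.
  apply: (NC V (nbhs x) (fun y t => `|F (x, t) - F (y, t)| <= eps / (b - a))).
  move=> t It; have d0 : 0 < eps / (b - a) / 2 by rewrite !divr_gt0.
  have c1 := cF (x, t); have c2 := @slice_cont F x cF t.
  move/cvgrPdist_le : c1 => /(_ _ d0) c1; move/cvgrPdist_le : c2 => /(_ _ d0) c2.
  have c3 : \forall t' \near t & y \near x, `|F (x, t) - F (y, t')| <= eps / (b - a) / 2.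
    case: c1 => -[/= U W] [Ux Wt] UW; exists (W, U) => //= -[t' y] [/= Wt' Uy].
    by apply: (UW (y, t')).
  have c4 : \forall t' \near t & y \near x, `|F (x, t) - F (x, t')| <= eps / (b - a) / 2.
    by exists ([set t' | `|F (x, t) - F (x, t')| <= eps / (b - a) / 2], setT) => //=;
      [split=> //; exact: filterT|move=> [t' y] []].
  apply: filterS2 c3 c4 => -[t' y] /= h1 h2.
  rewrite (_ : _ - _ = (F (x, t) - F (y, t')) - (F (x, t) - F (x, t'))); last by ring.
  by apply: le_trans (ler_normB _ _) _; rewrite (splitr (eps / (b - a))) lerD.
apply: filterS => y Hy.
rewrite -RintegralB//; [|exact: slice_intg|exact: slice_intg].
have iB : leb.-integrable I (EFin \o (fun t => F (x, t) - F (y, t))).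
  by apply: intgB => //; exact: slice_intg.
apply: le_trans (le_normr_Rintegral _ iB) _ => //.
apply: (@le_trans _ _ (\int[leb]_(t in I) (eps / (b - a)))).
  apply: le_Rintegral => //; first exact: integrable_norm.
    apply: continuous_compact_integrable; first exact: segment_compact.
    by apply: continuous_subspaceT => ?; exact: cvg_cst.
by rewrite Rintegral_cst//= lebesgue_measure_itv/= lte_fin ab -EFinB /= divfK ?gt_eqF.
Qed.

(** On the segment $x+se$, $|s|\le1$, the derivative is bounded by compactness, which supplies a
    constant dominating function. *)
Lemma par_derive F F1 e x : continuous F -> continuous F1 ->
  (forall z, is_derive z (e, 0 : R) F (F1 z)) ->
  is_derive x e (fun x => \int[leb]_(t in I) F (x, t)) (\int[leb]_(t in I) F1 (x, t)).
Proof.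
move=> cF cF1 dF; apply/is_derive_line.
pose f (s t : R) := F (x + s *: e, t).
have df s t : is_derive s (1 : R) (f ^~ t) (F1 (x + s *: e, t)).
  have := @is_derive_at _ (e, 0 : R) (x, t) F s (F1 (x + s *: e, t)).
  rewrite (_ : (x, t) + s *: (e, 0 : R) = (x + s *: e, t)); last first.
    by congr (_, _); rewrite /= scaler0 addr0.
  move=> /(_ (dF _)); rewrite (_ : (fun t0 : R => _) = f ^~ t)//.
  by apply/funext => u; rewrite /f; congr (F (_, _)); rewrite /= scaler0 addr0.
have D1 s t : partial1of2 f s t = F1 (x + s *: e, t).
  by rewrite partial1of2E; case: (df s t).
have [C HC] : exists C, forall s t, (`[-1, 1]%classic : set R) s -> I t ->
    `|F1 (x + s *: e, t)| <= C.
  have [|C HC] := @tube_bound F1 ((fun s : R => x + s *: e) @` `[-1, 1]) _ cF1.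
    apply: continuous_compact; last exact: segment_compact.
    apply: continuous_subspaceT => s; apply: cvgD; first exact: cvg_cst.
    by apply: cvgZr_tmp; exact: cvg_id.
  by exists C => s t Is It; apply: HC => //; exists s.
have HI : (`](-1), 1[%classic : set R) 0 by rewrite /= in_itv/= ltrN10 ltr01.
have sub s : (`](-1), 1[%classic : set R) s -> (`[-1, 1]%classic : set R) s.
  by rewrite /= !in_itv/= => /andP[/ltW-> /ltW->].
have A1 s : (`](-1), 1[%classic : set R) s -> leb.-integrable I (EFin \o f s).
  by move=> _; exact: slice_intg.
have A2 s t : (`](-1), 1[%classic : set R) s -> I t -> derivable (f ^~ t) s 1.
  by move=> _ _; case: (df s t).
have A3 t : 0 <= (fun _ : R => `|C|) t by rewrite normr_ge0.
have A4 : leb.-integrable I (EFin \o (fun _ : R => `|C|)).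
  apply: continuous_compact_integrable; first exact: segment_compact.
  by apply: continuous_subspaceT => ?; exact: cvg_cst.
have A5 s t : (`](-1), 1[%classic : set R) s -> I t -> `|partial1of2 f s t| <= (fun _ : R => `|C|) t.
  by move=> Is It; rewrite D1; apply: le_trans (HC _ _ (sub _ Is) It) (ler_norm _).
have mI : measurable I by [].
split.
- exact: (@derivable_under_integral _ _ _ leb f I mI 0 (-1) 1 HI A1 A2 _ A3 A4 A5).
- have := @differentiation_under_integral _ _ _ leb f I mI 0 (-1) 1 HI A1 A2 _ A3 A4 A5.
  rewrite derive1E /f => ->; apply: eq_Rintegral => t _.
  by rewrite D1 scale0r addr0.
Qed.

Lemma Cn_par F e n : Cn (e, 0 : R) n F -> Cn e n (fun x => \int[leb]_(t in I) F (x, t)).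
Proof.
elim: n F => [|n IH] F [cF H]; split=> //; try exact: par_cont.
case: H => F1 dF F1n; exists (fun x => \int[leb]_(t in I) F1 (x, t)); last exact: IH.
by move=> x; apply: par_derive => //; exact: Cn_cont F1n.
Qed.

Lemma SM_par F e : SM (e, 0 : R) F -> SM e (fun x => \int[leb]_(t in I) F (x, t)).
Proof. by move=> sF n; exact: Cn_par. Qed.

End Parametric.
End SmoothClass.

(** * Cut-off functions and divided differences *)

Section Bump.
Context {R : realType}.

(** The powers of $x^{-1}$ are included because the family $x^{-n}e^{-1/x}$ is closed under
    differentiation, which allows a single induction for smoothness. *)
Definition flat (n : nat) (x : R) : R := if 0 < x then x^-1 ^+ n * expR (- x^-1) else 0.

Lemma flat_ge0 n x : 0 <= flat n x.
Proof. by rewrite /flat; case: ifP => // x0; rewrite mulr_ge0 ?expR_ge0// exprn_ge0// invr_ge0 ltW. Qed.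

Lemma flat0_gt0 x : 0 < x -> 0 < flat 0 x.
Proof. by move=> x0; rewrite /flat x0 expr0 mul1r expR_gt0. Qed.

Lemma flat_le0 n x : x <= 0 -> flat n x = 0.
Proof. by rewrite /flat leNgt => /negbTE ->. Qed.

Lemma expR_ge_pow n (y : R) : 0 <= y -> y ^+ n.+1 <= n.+1%:R ^+ n.+1 * expR y.
Proof.
move=> y0; have n0 : (0 : R) < n.+1%:R by rewrite ltr0n.
have -> : expR y = expR (y / n.+1%:R) ^+ n.+1 by rewrite -expRM_natl mulrC divfK ?gt_eqF.
rewrite -exprMn; apply: lerXn2r; rewrite ?nnegrE//.
have := expR_ge1Dx (y / n.+1%:R); move: (expR _) => E HE.
by rewrite [leRHS]mulrC -ler_pdivrMr//; apply: le_trans HE; rewrite lerDr ler01.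
Qed.

(** Quadratic flatness gives the derivative 0 at the origin. *)
Lemma flat_quad n : exists C, forall x, flat n x <= C * x ^+ 2.
Proof.
exists (n.+2%:R ^+ n.+2) => x; rewrite /flat; case: ifP => x0; last first.
  by rewrite mulr_ge0 ?sqr_ge0// exprn_ge0.
have := @expR_ge_pow n.+1 x^-1; rewrite invr_ge0 (ltW x0) => /(_ erefl).
rewrite expRN; have := expR_gt0 x^-1; move: (expR _) (n.+2%:R ^+ _) => E C E0 HE.
rewrite ler_pdivrMr//.
have -> : x^-1 ^+ n = x^-1 ^+ n.+2 * x ^+ 2.
  by rewrite -addn2 exprD -mulrA -exprMn mulVf ?gt_eqF// expr1n mulr1.
by rewrite [leRHS]mulrAC; apply: ler_wpM2r => //; rewrite sqr_ge0.
Qed.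

Lemma is_derive_flat n x : is_derive x (1 : R) (flat n) (- n%:R * flat n.+1 x + flat n.+2 x).
Proof.
have [x0|x0|->] := ltgtP x 0.
- rewrite !(flat_le0 _ (ltW x0)) mulr0 addr0.
  apply: (@near_eq_is_derive _ _ _ (fun=> 0)).
    by near=> y; rewrite flat_le0// ltW//; near: y; exact: lt_nbhsl.
- apply: (@near_eq_is_derive _ _ _ (fun y : R => y^-1 ^+ n * expR (- y^-1) : R)).
    near=> y; rewrite /flat; have -> : 0 < y by near: y; exact: lt_nbhsr.
    by [].
  rewrite /flat x0; have xn0 : x != 0 by rewrite gt_eqF.
  have dV : is_derive x (1 : R) (fun y : R => y^-1) (- (x^-1 * x^-1)).
    apply: (is_derive_eq (is_derive_inv xn0 (is_derive_id _ _))).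
    by rewrite mulN1r.
  have dX : is_derive x (1 : R) (fun y : R => y^-1 ^+ n) (- n%:R * x^-1 ^+ n.+1).
    elim: n => [|n IH].
      by rewrite oppr0 mul0r; under eq_fun do rewrite expr0; exact: is_derive_cst.
    under eq_fun do rewrite exprS; apply: (is_derive_eq (is_derive_prod dV IH)).
    by rewrite !exprS -natr1; ring.
  have dE : is_derive x (1 : R) (fun y : R => expR (- y^-1)) (expR (- x^-1) * (x^-1 * x^-1)).
    apply: (is_derive_chain (is_derive_expR _)).
    by apply: (is_derive_eq (is_deriveN dV)); rewrite opprK.
  by apply: (is_derive_eq (is_derive_prod dX dE)); rewrite !exprS; ring.
- rewrite !(flat_le0 _ (lexx 0)) mulr0 addr0; have [C HC] := flat_quad n.
  apply: (@is_derive_quad _ _ _ _ C) => t _; rewrite add0r mulr0 (flat_le0 _ (lexx 0)) !subr0.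
  by rewrite ger0_norm ?flat_ge0.
Unshelve. all: by end_near. Qed.

Lemma is_derive_continuous (f f1 : R -> R) : (forall x, is_derive x (1 : R) f (f1 x)) -> continuous f.
Proof.
by move=> df x; apply: differentiable_continuous; apply/derivable1_diffP; case: (df x).
Qed.

Lemma SM_flat n : SM (1 : R) (flat n).
Proof.
move=> m; elim: m n => [|m IH] n; split=> //; try exact: is_derive_continuous (is_derive_flat n).
exists (fun x => - n%:R * flat n.+1 x + flat n.+2 x); first exact: is_derive_flat.
by apply: CnD; [apply: CnM; [exact: Cn_cst|]|].
Qed.

(** A function of $x^2$, so that the absolute value is not differentiated. The numbers $4M^2-x^2$
    and $x^2-M^2$ are never both nonpositive, which keeps the denominator positive. *)
Definition bump (M x : R) : R :=
  flat 0 (4 * M ^+ 2 - x * x) * (flat 0 (4 * M ^+ 2 - x * x) + flat 0 (x * x - M ^+ 2))^-1.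

Lemma SM_bump M : 0 < M -> SM (1 : R) (bump M).
Proof.
move=> M0; have S1 : SM (1 : R) (fun x => flat 0 (4 * M ^+ 2 - x * x)).
  by apply: SM_comp; [exact: SM_flat|apply: SMB; [exact: SM_cst|apply: SMM; exact: SM_id]].
have S2 : SM (1 : R) (fun x => flat 0 (x * x - M ^+ 2)).
  by apply: SM_comp; [exact: SM_flat|apply: SMB; [apply: SMM; exact: SM_id|exact: SM_cst]].
apply: SMM => //; apply: SM_inv; last exact: SMD.
move=> x; rewrite gt_eqF//; have [xM|xM] := ltP (x * x) (4 * M ^+ 2).
  by rewrite ltr_pwDl ?flat_ge0// flat0_gt0// subr_gt0.
rewrite ltr_wpDl ?flat_ge0// flat0_gt0// subr_gt0; apply: lt_le_trans xM.
by rewrite ltr_pMl ?exprn_gt0//; lra.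
Qed.

Lemma bump1 M x : 0 < M -> `|x| <= M -> bump M x = 1.
Proof.
move=> M0 xM; have x2 : x * x <= M ^+ 2.
  by rewrite -[x * x]ger0_norm -?expr2 ?sqr_ge0// normrX ler_sqr ?nnegrE// ltW.
have M2 : 0 < M ^+ 2 by rewrite exprn_gt0.
rewrite /bump (@flat_le0 _ (x * x - _)) ?subr_le0// addr0 mulfV// gt_eqF// flat0_gt0//.
by move: (x * x) (M ^+ 2) x2 M2 => X Y; lra.
Qed.

Lemma bump0 M x : 0 < M -> 2 * M <= `|x| -> bump M x = 0.
Proof.
move=> M0 xM; rewrite /bump flat_le0 ?mul0r// subr_le0.
rewrite -[x * x]ger0_norm -?expr2 ?sqr_ge0// normrX.
have -> : 4 * M ^+ 2 = (2 * M) ^+ 2 by ring.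
by rewrite ler_sqr ?nnegrE// mulr_ge0// ltW.
Qed.

Lemma bump_ge0 M x : 0 <= bump M x.
Proof. by rewrite /bump mulr_ge0 ?invr_ge0 ?addr_ge0 ?flat_ge0. Qed.

End Bump.

(** * Smooth divided differences *)

Section DividedDifference.
Context {R : realType}.
Local Notation leb := (@lebesgue_measure R).
Local Notation I01 := (`[0, 1]%classic : set R).

Lemma SM_fst {V : normedModType R} (e : V) g : SM e g -> SM (e, 0 : R) (fun z => g z.1).
Proof.
move=> sg n; move: (sg n) => {sg}; elim: n g => [|n IH] g [cg H]; split=> //.
- by move=> z; apply: continuous_comp; [exact: cvg_fst|exact: cg].
- by move=> z; apply: continuous_comp; [exact: cvg_fst|exact: cg].
- case: H => g1 dg g1n; exists (fun z => g1 z.1); last exact: IH.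
  move=> z; apply/is_derive_line; have := dg z.1; move/is_derive_line.
  by rewrite (_ : (fun t : R => g (z.1 + _)) = (fun t : R => g (z + t *: (e, 0 : R)).1)).
Qed.

Lemma SM_snd {V : normedModType R} (e : V) g : continuous g ->
  SM (e, 0 : R) (fun z : V * R => g z.2).
Proof.
move=> cg; apply: (@SM_intro _ _ _ _ (fun=> 0)); last exact: SM_cst.
- by move=> z; apply: continuous_comp; [exact: cvg_snd|exact: cg].
- move=> z; apply/is_derive_line.
  rewrite (_ : (fun t : R => _) = (fun t : R => g z.2)); first exact: is_derive_cst.
  by apply/funext => t /=; rewrite scaler0 addr0.
Qed.

(** Hadamard's integral form of the divided difference: it is defined on the diagonal too, and
    smoothness across the diagonal follows from [SM_par]. *)
Definition dd (g : R -> R) (a b : R) : R :=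
  \int[leb]_(t in I01) g^`()%classic (t * a + (1 - t) * b).

Lemma SM_derive1 (g : R -> R) : SM (1 : R) g ->
  (forall x, is_derive x (1 : R) g (g^`()%classic x)) /\ SM (1 : R) g^`()%classic.
Proof.
move=> /SM_der[g1 dg sg1]; have -> : g^`()%classic = g1.
  by apply/funext => x; rewrite derive1E; case: (dg x).
by [].
Qed.

Lemma SM_dd {V : normedModType R} (e : V) g (l1 l2 : V -> R) : SM (1 : R) g ->
  SM e l1 -> SM e l2 -> SM e (fun x => dd g (l1 x) (l2 x)).
Proof.
move=> /SM_derive1[_ sg] s1 s2.
pose F (z : V * R) := g^`()%classic (z.2 * l1 z.1 + (1 - z.2) * l2 z.1).
apply: (@SM_par R V 0 1 ltr01 F); apply: SM_comp => //.
have S2 : SM (e, 0 : R) (fun z : V * R => z.2) by apply: (@SM_snd _ _ (fun x => x)) => x; exact: cvg_id.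
by apply: SMD; apply: SMM; rewrite ?SM_fst//; [exact: SM_fst|
  apply: SMB => //; exact: SM_cst|exact: SM_fst].
Qed.

Lemma dd_sub g (a b : R) : SM (1 : R) g -> (a - b) * dd g a b = g a - g b.
Proof.
move=> /SM_derive1[dg sg]; rewrite /dd.
have L t : t * a + (1 - t) * b = b + t * (a - b) by ring.
have cl : continuous (fun t : R => g^`()%classic (t * a + (1 - t) * b)).
  have H : SM (1 : R) (fun t => g^`()%classic (t * a + (1 - t) * b)).
    apply: SM_comp => //; apply: SMD; apply: SMM; try exact: SM_cst; try exact: SM_id.
    by apply: SMB; [exact: SM_cst|exact: SM_id].
  exact: SM_cont H.
rewrite -RintegralZl//; last first.
  by apply: continuous_compact_integrable; [exact: segment_compact|exact: continuous_subspaceT].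
have H1 t : is_derive t (1 : R) (fun t => g (t * a + (1 - t) * b)) ((a - b) * g^`()%classic (t * a + (1 - t) * b)).
  under eq_fun do rewrite L; rewrite mulrC L.
  have H2 : is_derive t (1 : R) (fun x => b + x * (a - b)) (a - b) by exact: is_derive_lin.
  exact: (is_derive_chain (dg _) H2).
apply: (etrans (FTC01 H1 _)).
  by move=> t; apply: cvgM; [exact: cvg_cst|exact: cl].
by rewrite !mul1r !mul0r subrr subr0 mul0r addr0 mul1r add0r.
Qed.

Lemma dd_diag g (a : R) : dd g a a = g^`()%classic a.
Proof.
rewrite /dd; under eq_Rintegral => t _.
  have -> : t * a + (1 - t) * a = a by ring.
  over.
exact: int01_cst.
Qed.

Lemma dd_exp_neq0 (a b : R) : dd expR a b != 0.
Proof.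
have [->|ab] := eqVneq a b.
  by rewrite dd_diag derive1E; have [_ ->] := is_derive_expR b; rewrite gt_eqF ?expR_gt0.
have := dd_sub a b (@SM_expR R); apply: contra_eq_neq => ->.
rewrite mulr0 eq_sym subr_eq0; apply: contra ab => /eqP ab.
by apply/eqP/(can_inj (@expRK R)).
Qed.

Definition cSM {V : normedModType R} (e : V) (f : V -> R[i]) : Prop :=
  SM e (fun x => complex.Re (f x)) /\ SM e (fun x => complex.Im (f x)).

Section Closure.
Context {V : normedModType R} (e : V).
Implicit Types f g : V -> R[i].

Lemma cSM_real (g : V -> R) : SM e g -> cSM e (fun x => (g x)%:C).
Proof. by move=> sg; split=> //; exact: SM_cst. Qed.

Lemma cSM_cst z : cSM e (fun=> z). Proof. by split; exact: SM_cst. Qed.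

Lemma cSMD f g : cSM e f -> cSM e g -> cSM e (fun x => f x + g x).
Proof.
by move=> [f1 f2] [g1 g2]; split; [apply: SM_ext (SMD f1 g1)|apply: SM_ext (SMD f2 g2)] => x;
  rewrite ?Re_add ?Im_add.
Qed.

Lemma cSMM f g : cSM e f -> cSM e g -> cSM e (fun x => f x * g x).
Proof.
move=> [f1 f2] [g1 g2]; split.
- by apply: SM_ext (SMB (SMM f1 g1) (SMM f2 g2)) => x; rewrite Re_mul.
- by apply: SM_ext (SMD (SMM f1 g2) (SMM f2 g1)) => x; rewrite Im_mul.
Qed.

Lemma cSMN f : cSM e f -> cSM e (fun x => - f x).
Proof. by move=> [f1 f2]; split; [apply: SM_ext (SMN f1)|apply: SM_ext (SMN f2)] => x;
  rewrite ?Re_opp ?Im_opp. Qed.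

Lemma cSMB f g : cSM e f -> cSM e g -> cSM e (fun x => f x - g x).
Proof. by move=> sf sg; apply: cSMD => //; exact: cSMN. Qed.

Lemma cSM_ext f g : f =1 g -> cSM e f -> cSM e g.
Proof. by move=> /funext ->. Qed.

Lemma cSM_comp (gam : R -> R[i]) (l : V -> R) : cSM (1 : R) gam -> SM e l -> cSM e (fun x => gam (l x)).
Proof. by move=> [g1 g2] sl; split; [exact: (SM_comp g1 sl)|exact: (SM_comp g2 sl)]. Qed.

End Closure.

Lemma exp_derive (f : R -> R) (u : R) : SM (1 : R) (fun x => f (expR x)) -> 0 < u ->
  is_derive u (1 : R) f ((fun x => f (expR x))^`()%classic (ln u) * u^-1).
Proof.
move=> /SM_derive1[dg _] u0; apply: (@near_eq_is_derive _ _ _ (fun v => (fun x => f (expR x)) (ln v))).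
  near=> v; rewrite lnK// posrE; near: v; exact: lt_nbhsr.
by apply: (is_derive_chain (dg (ln u))); exact: is_derive1_ln.
Unshelve. all: by end_near. Qed.

(** In logarithmic coordinates [dquot] is a quotient of two Hadamard integrals, of which the
    denominator, belonging to [expR], never vanishes. Hence the extension of [dquot] to the diagonal
    is smooth. *)
Lemma dquot_expR (f : R -> R) (a b : R) : SM (1 : R) (fun x => f (expR x)) ->
  (if expR a == expR b then derive1 f (expR a) else (f (expR a) - f (expR b)) / (expR a - expR b)) =
  dd (fun x => f (expR x)) a b / dd expR a b.
Proof.
move=> sf; case: eqVneq => [/(can_inj (@expRK R)) <-|ab].
  rewrite !dd_diag derive1E; have [_ ->] := exp_derive sf (expR_gt0 a).
  by rewrite expRK; congr (_ / _); rewrite derive1E; have [_ ->] := is_derive_expR a.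
have ab' : a != b by apply: contraNneq ab => ->.
have s1 := dd_sub a b sf; have s2 := dd_sub a b (@SM_expR R).
rewrite -s1 -s2 -mulf_div mulfV ?mul1r// subr_eq0//.
Qed.

Lemma cSM_dquot {V : normedModType R} (e : V) (T : R -> R[i]) (l1 l2 : V -> R) :
  cSM (1 : R) (fun x => T (expR x)) -> SM e l1 -> SM e l2 ->
  cSM e (fun x => dquot T (expR (l1 x)) (expR (l2 x))).
Proof.
move=> [sr si] s1 s2.
have H (f : R -> R) : SM (1 : R) (fun x => f (expR x)) ->
    SM e (fun x => if expR (l1 x) == expR (l2 x) then derive1 f (expR (l1 x))
      else (f (expR (l1 x)) - f (expR (l2 x))) / (expR (l1 x) - expR (l2 x))).
  move=> sf; apply: SM_ext (_ : SM e (fun x => dd (fun x => f (expR x)) (l1 x) (l2 x) *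
     (dd expR (l1 x) (l2 x))^-1)).
    by move=> x; rewrite dquot_expR.
  apply: SMM; first exact: SM_dd.
  apply: SM_inv; first by move=> x; exact: dd_exp_neq0.
  by apply: SM_dd => //; exact: SM_expR.
have iR (r : R) : r%:C^-1 = r^-1%:C :> R[i] by rewrite fmorphV.
split; [apply: SM_ext (H _ sr)|apply: SM_ext (H _ si)] => x; rewrite /dquot; case: eqP => // _.
- by rewrite iR [in RHS]mulrC Re_real Re_add Re_opp mulrC.
- by rewrite iR [in RHS]mulrC Im_real Im_add Im_opp mulrC.
Qed.

End DividedDifference.

(** * Smoothness of the symbols in logarithmic coordinates *)

Section SymbolSmooth.
Context {R : realType}.
Variables (T : R -> R[i]) (j : R).
Hypothesis smooth_T : smooth_on [set u : R | 0 < u] T.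

Lemma smooth_exp (f : R -> R) : (forall vs (u : R), 0 < u -> differentiable (iter_derive f vs) u) ->
  SM (1 : R) (fun x => f (expR x)).
Proof.
move=> df; pose g m := iter_derive f (nseq m (1 : R)).
have dg m (u : R) : 0 < u -> is_derive u (1 : R) (g m) (g m.+1 u).
  move=> u0; have /derivable1_diffP d := df (nseq m 1) u u0.
  by split.
have dge m x : is_derive x (1 : R) (fun x => g m (expR x)) (g m.+1 (expR x) * expR x).
  by apply: (is_derive_chain (dg m _ (expR_gt0 x))); exact: is_derive_expR.
suff H n m : Cn (1 : R) n (fun x => g m (expR x)) by move=> n; exact: (H n 0%N).
elim: n m => [|n IH] m; split=> //; try exact: is_derive_continuous (dge m).
by exists (fun x => g m.+1 (expR x) * expR x) => //; apply: CnM => //; exact: SM_expR.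
Qed.

Lemma cSM_T : cSM (1 : R) (fun x => T (expR x)).
Proof.
by split; [apply: (@smooth_exp (fun u => complex.Re (T u)))|apply: (@smooth_exp (fun u => complex.Im (T u)))] => vs u u0;
  case: (smooth_T vs u0).
Qed.

Lemma cpow_expR (i x : R) : cpow i (expR x) = (expR (i * x))%:C.
Proof. by rewrite /cpow mulrC expRM. Qed.

Section Exponents.
Context {V : normedModType R} (e : V).

Lemma SM_lin c (l : V -> R) : SM e l -> SM e (fun x => expR (c * l x)).
Proof. by move=> sl; apply: SM_comp; [exact: SM_expR|apply: SMM => //; exact: SM_cst]. Qed.

Lemma cSM_cpow c (l : V -> R) : SM e l -> cSM e (fun x => cpow c (expR (l x))).
Proof.
move=> sl; apply: cSM_ext (cSM_real (SM_lin c sl)) => x; by rewrite cpow_expR.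
Qed.

End Exponents.

Lemma cSM_twist : cSM (1 : R) (fun x => twist T j (expR x)).
Proof.
apply: cSMM; first by apply: cSM_cpow; exact: SM_id.
apply: cSM_ext (_ : cSM _ (fun x => T (expR (- x)))); first by move=> x; rewrite expRN.
by apply: (cSM_comp cSM_T); apply: SMN; exact: SM_id.
Qed.

Lemma cSM_Ifun : cSM (1 : R) (fun x => Ifun T j (expR x)).
Proof. by apply: cSMB; [apply: cSMN; exact: cSM_T|exact: cSM_twist]. Qed.

Lemma cSM_IIfun {V : normedModType R} (e : V) (l1 l2 : V -> R) : SM e l1 -> SM e l2 ->
  cSM e (fun x => IIfun T j (expR (l1 x)) (expR (l2 x))).
Proof.
move=> s1 s2.
have sD : SM e (fun x => l1 x + l2 x) by exact: SMD.
have s0 : SM e (fun=> 0 : R) by exact: SM_cst.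
have S1 : cSM (1 : R) (fun x => cpow j (expR x)) by apply: cSM_cpow; exact: SM_id.
(* All arguments, including 1, are written as exponentials, so that [cSM_dquot] applies to each
   quotient. *)
pose g1 x := T (expR (l1 x)) * dquot (cpow j) (expR (l1 x + l2 x)) (expR 0).
pose g2 x := cpow (j - 1) (expR (l1 x)) * dquot T (expR (- l1 x)) (expR (l2 x)) -
  (expR (l1 x))%:C * cpow (j - 1) (expR (l1 x + l2 x)) * dquot T (expR (- l2 x)) (expR (l1 x)).
pose g3 x := - (dquot (cpow j) (expR (l1 x)) (expR 0) * T (expR (l2 x))) +
  (expR (l2 x))%:C * dquot T (expR (l1 x + l2 x)) (expR (l2 x)) -
  dquot T (expR (l1 x + l2 x)) (expR (l1 x)).
pose g4 x := - (dquot (cpow j) (expR (l1 x)) (expR 0) * cpow j (expR (l2 x)) * T (expR (- l2 x))) -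
  dquot (twist T j) (expR (l1 x + l2 x)) (expR (l1 x)) +
  (expR (l2 x))%:C * dquot (twist T j) (expR (l1 x + l2 x)) (expR (l2 x)).
apply: cSM_ext (_ : cSM e (fun x => g1 x + g2 x + g3 x + g4 x)).
  by move=> x; rewrite /g1 /g2 /g3 /g4 expR0 expRD !expRN.
have sT l : SM e l -> cSM e (fun x => T (expR (l x))) by move=> sl; exact: (cSM_comp cSM_T).
have sR l : SM e l -> cSM e (fun x => (expR (l x))%:C).
  by move=> sl; apply: cSM_real; apply: SM_comp => //; exact: SM_expR.
have dT := cSM_dquot cSM_T; have dt := cSM_dquot cSM_twist; have dj := cSM_dquot S1.
have sN l : SM e l -> SM e (fun x => - l x) by exact: SMN.
have sP := cSM_cpow.
apply: cSMD; first apply: cSMD; first apply: cSMD.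
- by apply: cSMM; [exact: sT|exact: dj].
- apply: cSMB; first by apply: cSMM; [exact: sP|apply: dT => //; exact: sN].
  by apply: cSMM; [apply: cSMM; [exact: sR|exact: sP]|apply: dT => //; exact: sN].
- apply: cSMB; last exact: dT.
  apply: cSMD; last by apply: cSMM; [exact: sR|exact: dT].
  by apply: cSMN; apply: cSMM; [exact: dj|exact: sT].
- apply: cSMD; last by apply: cSMM; [exact: sR|exact: dt].
  apply: cSMB; last exact: dt.
  apply: cSMN; apply: cSMM; last by apply: sT; exact: sN.
  by apply: cSMM; [exact: dj|exact: sP].
Qed.

End SymbolSmooth.

(** * Fourier integrals *)

Section Frechet.
Context {R : realType} {V : normedModType R}.

Lemma diff_quad (g L : V -> R) (x : V) (C : R) : linear L ->
  (forall v, `|L v| <= C * `|v|) ->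
  (forall v, `|g (v + x) - g x - L v| <= C * `|v| ^+ 2) -> differentiable g x.
Proof.
move=> linL bL gL.
pose df : {linear V -> R} := HB.pack L (GRing.isLinear.Build R V R *:%R L linL).
have C0 : 0 <= `|C| + 1 by rewrite addr_ge0.
have cL : continuous df.
  move=> y; apply/cvgrPdist_le => e e0; near=> z.
  rewrite -linearB; apply: le_trans (bL _) _.
  have yz : `|y - z| <= e / (`|C| + 1).
    near: z; apply: (@cvgr_dist_le _ _ _ (nbhs y) _ id y) => //; rewrite ?divr_gt0 ?ltr_wpDl//.
  apply: le_trans (_ : _ <= (`|C| + 1) * `|y - z|) _.
    by rewrite ler_wpM2r//; have := ler_norm C; lra.
  by rewrite -ler_pdivlMl ?ltr_wpDl// mulrC.
have o1 : g \o shift x = cst (g x) + df +o_ 0 id.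
  apply/eqaddoP => e e0; near=> v.
  have -> : (g \o shift x - (cst (g x) + df)) v = g (v + x) - g x - L v.
    by rewrite /= opprD addrA.
  apply: le_trans (gL v) _; rewrite expr2 mulrA ler_wpM2r//.
  have ve : `|v| <= e / (`|C| + 1).
    near: v; apply: (@cvgr0_norm_le _ _ _ (nbhs (0 : V)) _ id) => //; rewrite ?divr_gt0 ?ltr_wpDl//.
  apply: le_trans (_ : _ <= (`|C| + 1) * `|v|) _.
    by rewrite ler_wpM2r//; have := ler_norm C; lra.
  by rewrite -ler_pdivlMl ?ltr_wpDl// mulrC.
by apply/diff_locallyP; rewrite (diff_unique cL o1).
Unshelve. all: by end_near. Qed.

Lemma derive_quad (g L : V -> R) (x v : V) (C : R) : linear L ->
  (forall v, `|g (v + x) - g x - L v| <= C * `|v| ^+ 2) -> is_derive x v g (L v).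
Proof.
move=> linL gL; apply/is_derive_line.
have L0 : L 0 = 0 by have := linL 1 0 0; rewrite scaler0 addr0 scale1r => /eqP; rewrite -subr_eq0 opprD addNKr oppr_eq0 => /eqP.
have LZ (t : R) : L (t *: v) = t * L v by rewrite -[_ *: v]addr0 linL L0 addr0.
apply: (@is_derive_quad _ _ _ _ (C * `|v| ^+ 2)) => t _; rewrite add0r scale0r addr0.
have := gL (t *: v); rewrite LZ [x + _]addrC normrZ exprMn real_normK ?num_real//.
by rewrite [t ^+ 2 * _]mulrC mulrA.
Qed.

End Frechet.

(** * Fourier integrals with a phase linear in the parameter *)

Section FourierGeneric.
Context {R : realType} d (T : measurableType d) (mu : {measure set T -> \bar R}).
Context {V : normedModType R}.
Variables (psi : T -> V -> R) (w : T -> R).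
Hypotheses (psiD : forall t u v, psi t (u + v) = psi t u + psi t v).
Hypotheses (psiZ : forall t (s : R) v, psi t (s *: v) = s * psi t v).
Hypotheses (psiw : forall t v, `|psi t v| <= w t * `|v|).
Hypotheses (psim : forall v, measurable_fun setT (psi ^~ v)).
Hypotheses (w_ge0 : forall t, 0 <= w t).
Implicit Types (b : T -> R[i]) (x v : V).

(** Taylor's formula for $|h|\le1$; for $|h|>1$ each term is at most a constant times $h^2$. *)
Lemma expi_taylor : exists2 C : R, 0 <= C & forall s h : R,
  cabs (expi (s + h) - expi s - (0 +i* h) * expi s) <= C * h ^+ 2.
Proof.
exists (4 * expR 1 + 3); first by rewrite addr_ge0 ?mulr_ge0 ?expR_ge0.
move=> s h; have -> : expi (s + h) - expi s - (0 +i* h) * expi s = (expi h - 1 - (0 +i* h)) * expi s.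
  by rewrite expiD; ring.
rewrite cabsM cabs_expi mulr1.
have ch : cabs (0 +i* h) = `|h|.
  apply/eqP; rewrite eq_le -[leLHS]ger0_norm ?cabs_ge0//.
  have := cabs_le_ReIm (0 +i* h); have := Im_le_cabs (0 +i* h); rewrite /= normr0 add0r => -> H.
  by rewrite ger0_norm ?cabs_ge0// H.
have h2 : `|h| ^+ 2 = h ^+ 2 by rewrite real_normK ?num_real.
have E0 := @expR_ge0 R 1; have H0 := sqr_ge0 h.
have [h1|h1] := leP `|h| 1.
  rewrite -cexp_imag; apply: le_trans (cexp_taylor2 _) _; rewrite ch h2.
  have : expR `|h| <= expR 1 by rewrite ler_expR.
  move: (expR _) (expR 1) => X Y XY; have := ler_wpM2l H0 XY.
  by move: (h ^+ 2) H0 => W W0 H; lra.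
apply: le_trans (cabsB _ _) _; rewrite ch.
apply: le_trans (lerD (cabsB _ _) (lexx _)) _; rewrite cabs_expi cabs1.
have : `|h| <= h ^+ 2 by rewrite -h2 expr2 ler_peMl// ltW.
have : 0 <= 4 * expR 1 * h ^+ 2 by rewrite mulr_ge0// mulr_ge0.
move: h1; move: (expR 1) (`|h|) (h ^+ 2) => X Z W; lra.
Qed.

Definition rapid b : Prop := cmeas setT b /\
  forall n : nat, exists2 g : T -> R, mu.-integrable setT (EFin \o g) &
    forall t, (1 + w t) ^+ n * cabs (b t) <= g t.

(** The phase is left general in order to cover both signs, the phase shifted by [y] in [J_mul], and
    the plane. *)
Definition FT b x : R[i] := cI mu setT (fun t => b t * expi (psi t x)).

Definition dFT b v : T -> R[i] := fun t => b t * (0 +i* psi t v).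

Lemma cmeas_expi (f : T -> R) : measurable_fun setT f -> cmeas setT (fun t => expi (f t)).
Proof.
move=> mf; split; apply: measurableT_comp => //; apply: continuous_measurable_fun.
- exact: continuous_cos.
- exact: continuous_sin.
Qed.

Lemma rapid_intg b x : rapid b -> cintg mu setT (fun t => b t * expi (psi t x)).
Proof.
move=> [mb /(_ 0%N)[g ig bg]]; apply: cintg_dom ig => //.
  by apply: cmeasM => //; apply: cmeas_expi.
by move=> t _; rewrite cabsM cabs_expi mulr1; have := bg t; rewrite expr0 mul1r.
Qed.

Lemma cabs_imag (h : R) : cabs (0 +i* h) = `|h|.
Proof.
apply/eqP; rewrite eq_le -[leLHS]ger0_norm ?cabs_ge0//.
have := cabs_le_ReIm (0 +i* h); have := Im_le_cabs (0 +i* h); rewrite /= normr0 add0r => -> H.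
by rewrite ger0_norm ?cabs_ge0// H.
Qed.

Lemma rapid_dFT b v : rapid b -> rapid (dFT b v).
Proof.
move=> [mb hb]; split.
  by apply: cmeasM => //; split; [exact: measurable_cst|exact: psim].
move=> n; have [g ig bg] := hb n.+1; exists (fun t => `|v| * g t); first exact: intgZl.
move=> t; rewrite /dFT cabsM cabs_imag.
apply: le_trans (_ : _ <= (1 + w t) ^+ n * (cabs (b t) * ((1 + w t) * `|v|))) _.
  rewrite ler_wpM2l ?exprn_ge0 ?addr_ge0// ler_wpM2l ?cabs_ge0//.
  by apply: le_trans (psiw t v) _; rewrite ler_wpM2r// lerDr.
have := ler_wpM2l (normr_ge0 v) (bg t); apply: le_trans.
by rewrite le_eqVlt exprS; apply/orP; left; apply/eqP; ring.
Qed.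

Lemma FT_le b : rapid b -> exists C, forall x, cabs (FT b x) <= C.
Proof.
move=> [mb /(_ 0%N)[g ig bg]]; exists (2 * \int[mu]_(t in setT) g t) => x.
apply: cI_le ig => //; first by apply: cmeasM => //; apply: cmeas_expi.
by move=> t _; rewrite cabsM cabs_expi mulr1; have := bg t; rewrite expr0 mul1r.
Qed.

Lemma FT_quad b : rapid b -> exists C, forall x v,
  cabs (FT b (v + x) - FT b x - FT (dFT b v) x) <= C * `|v| ^+ 2.
Proof.
move=> rb; have [mb /(_ 2%N)[g ig bg]] := rb; have [C0 C00 HC] := expi_taylor.
exists (2 * (C0 * \int[mu]_(t in setT) g t)) => x v.
have i1 := rapid_intg (v + x) rb; have i2 := rapid_intg x rb.
have i3 := rapid_intg x (rapid_dFT v rb).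
have -> : FT b (v + x) - FT b x - FT (dFT b v) x = cI mu setT (fun t =>
    b t * expi (psi t (v + x)) + (-1) * (b t * expi (psi t x)) + (-1) * (dFT b v t * expi (psi t x))).
  rewrite cI_D//; [|by apply: cintgD => //; exact: cintgZ|exact: cintgZ].
  by rewrite cI_D//; [rewrite !cI_Z// !mulN1r|exact: cintgZ].
have -> : 2 * (C0 * \int[mu]_(t in setT) g t) * `|v| ^+ 2 =
    2 * \int[mu]_(t in setT) (`|v| ^+ 2 * (C0 * g t)).
  by rewrite !RintegralZl//; [ring|exact: intgZl].
apply: cI_le => //; last by do 2 apply: intgZl => //.
  apply: (@cintg_cmeas _ _ _ mu); apply: cintgD => //; last exact: cintgZ.
  by apply: cintgD => //; exact: cintgZ.
move=> t _; rewrite psiD addrC.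
have -> : (-1) * (dFT b v t * expi (psi t x)) + (b t * expi (psi t v + psi t x) +
    (-1) * (b t * expi (psi t x))) = b t * (expi (psi t x + psi t v) - expi (psi t x) -
      (0 +i* psi t v) * expi (psi t x)).
  by rewrite /dFT [psi t v + _]addrC; ring.
rewrite cabsM; apply: le_trans (ler_wpM2l (cabs_ge0 _) (HC _ _)) _.
rewrite [leRHS]mulrA [_ * C0]mulrC -mulrA mulrCA ler_wpM2l//.
have := ler_wpM2l (sqr_ge0 `|v|) (bg t); apply: le_trans.
rewrite [leRHS]mulrA [leRHS]mulrC; apply: ler_wpM2l; first exact: cabs_ge0.
rewrite -(real_normK (num_real (psi t v))) -exprMn ler_sqr ?nnegrE ?mulr_ge0 ?addr_ge0//.
by apply: le_trans (psiw t v) _; rewrite mulrC ler_wpM2l// lerDr.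
Qed.

Lemma FT_lin b x : rapid b -> forall (s : R) u v,
  FT (dFT b (s *: u + v)) x = s%:C * FT (dFT b u) x + FT (dFT b v) x.
Proof.
move=> rb s u v.
have i1 := rapid_intg x (rapid_dFT u rb); have i2 := rapid_intg x (rapid_dFT v rb).
rewrite /FT -cI_Z// -cI_D//; last exact: cintgZ.
apply: cI_eq => t _; rewrite /dFT psiD psiZ.
have -> : (0 +i* (s * psi t u + psi t v)) = s%:C * (0 +i* psi t u) + (0 +i* psi t v).
  by apply: complex_eq; rewrite ?Re_add ?Im_add ?Re_real ?Im_real /= ?mulr0 ?addr0.
ring.
Qed.

Lemma dFT_bound b x : rapid b -> exists C, forall v, cabs (FT (dFT b v) x) <= C * `|v|.
Proof.
move=> rb; have [mb /(_ 1%N)[g ig bg]] := rb.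
exists (2 * \int[mu]_(t in setT) g t) => v.
have -> : 2 * \int[mu]_(t in setT) g t * `|v| = 2 * \int[mu]_(t in setT) (`|v| * g t).
  by rewrite RintegralZl//; ring.
apply: cI_le => //; last exact: intgZl.
  apply: cmeasM; last exact: cmeas_expi.
  by have [] := rapid_dFT v rb.
move=> t _; rewrite cabsM cabs_expi mulr1 /dFT cabsM cabs_imag.
have := ler_wpM2l (normr_ge0 v) (bg t); apply: le_trans.
rewrite expr1 mulrA [leRHS]mulrC ler_wpM2l ?cabs_ge0//.
by apply: le_trans (psiw t v) _; rewrite mulrC ler_wpM2l// lerDr.
Qed.

Lemma linear_part (f : R[i] -> R) b x : rapid b ->
  (forall z z', f (z + z') = f z + f z') -> (forall (s : R) z, f (s%:C * z) = s * f z) ->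
  linear (fun v => f (FT (dFT b v) x)).
Proof. by move=> rb fD fZ s u v; rewrite FT_lin// fD fZ. Qed.

Lemma FT_diff b x : rapid b ->
  differentiable (fun y => complex.Re (FT b y)) x /\ differentiable (fun y => complex.Im (FT b y)) x.
Proof.
move=> rb; have [C HC] := FT_quad rb; have [C' HC'] := dFT_bound x rb.
have CC z (v : V) : cabs z <= C * `|v| ^+ 2 -> cabs z <= Num.max C C' * `|v| ^+ 2.
  by move/le_trans; apply; rewrite ler_wpM2r ?sqr_ge0// le_max lexx.
have CC' z (v : V) : cabs z <= C' * `|v| -> cabs z <= Num.max C C' * `|v|.
  by move/le_trans; apply; rewrite ler_wpM2r// le_max lexx orbT.
split; [apply: (@diff_quad _ _ _ (fun v => complex.Re (FT (dFT b v) x)) _ (Num.max C C'))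
  |apply: (@diff_quad _ _ _ (fun v => complex.Im (FT (dFT b v) x)) _ (Num.max C C'))].
- exact: (linear_part x rb (@Re_add R) (@Re_real R)).
- by move=> v; apply: le_trans (Re_le_cabs _) (CC' _ _ (HC' v)).
- by move=> v; rewrite -!Re_opp -!Re_add; apply: le_trans (Re_le_cabs _) (CC _ _ (HC x v)).
- exact: (linear_part x rb (@Im_add R) (@Im_real R)).
- by move=> v; apply: le_trans (Im_le_cabs _) (CC' _ _ (HC' v)).
- by move=> v; rewrite -!Im_opp -!Im_add; apply: le_trans (Im_le_cabs _) (CC _ _ (HC x v)).
Qed.

Lemma FT_derive b x v : rapid b ->
  is_derive x v (fun y => complex.Re (FT b y)) (complex.Re (FT (dFT b v) x)) /\
  is_derive x v (fun y => complex.Im (FT b y)) (complex.Im (FT (dFT b v) x)).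
Proof.
move=> rb; have [C HC] := FT_quad rb.
split; [apply: (@derive_quad _ _ _ (fun v => complex.Re (FT (dFT b v) x)) _ _ C)
  |apply: (@derive_quad _ _ _ (fun v => complex.Im (FT (dFT b v) x)) _ _ C)].
- exact: (linear_part x rb (@Re_add R) (@Re_real R)).
- by move=> u; rewrite -!Re_opp -!Re_add; apply: le_trans (Re_le_cabs _) (HC x u).
- exact: (linear_part x rb (@Im_add R) (@Im_real R)).
- by move=> u; rewrite -!Im_opp -!Im_add; apply: le_trans (Im_le_cabs _) (HC x u).
Qed.

Lemma FT_iter b (vs : seq V) : rapid b ->
  iter_derive (fun y => complex.Re (FT b y)) vs =
    (fun y => complex.Re (FT (foldr (fun v c => dFT c v) b vs) y)) /\
  iter_derive (fun y => complex.Im (FT b y)) vs =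
    (fun y => complex.Im (FT (foldr (fun v c => dFT c v) b vs) y)).
Proof.
move=> rb; have rv us : rapid (foldr (fun v c => dFT c v) b us).
  by elim: us => //= u us IH; exact: rapid_dFT.
elim: vs => [|v vs [IH1 IH2]] //=; rewrite /iter_derive /= in IH1 IH2 *; rewrite IH1 IH2.
by split; apply/funext => x; have [[_ d1] [_ d2]] := FT_derive x v (rv vs).
Qed.

Lemma FT_smooth b : rapid b -> smooth_on setT (FT b).
Proof.
move=> rb vs x _; have rv us : rapid (foldr (fun v c => dFT c v) b us).
  by elim: us => //= u us IH; exact: rapid_dFT.
by have [-> ->] := FT_iter vs rb; exact: FT_diff.
Qed.

(** Derivatives of [FT b] are Fourier integrals of [b] multiplied by the phase; [P] is a class of
    amplitudes closed under this operation on which polynomial decay is already known. *)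
Lemma FT_schwartz (P : (T -> R[i]) -> Prop) b :
  (forall c, P c -> rapid c) -> (forall c v, P c -> P (dFT c v)) ->
  (forall c p, P c -> exists M, forall x, `|x| ^+ p * cabs (FT c x) <= M) -> P b -> schwartz (FT b).
Proof.
move=> Pr Pd Pb bP; split; first by apply: FT_smooth; exact: Pr.
move=> p vs; have Pv us : P (foldr (fun v c => dFT c v) b us).
  by elim: us => //= u us IH; exact: Pd.
have [M HM] := Pb _ p (Pv vs); exists M => x; have [-> ->] := FT_iter vs (Pr _ bP).
by split; apply: le_trans (HM x); rewrite ler_wpM2l ?exprn_ge0// ?Re_le_cabs ?Im_le_cabs.
Qed.

Lemma iter_derive_out (f : V -> R) (A : R) vs x :
  (forall x, A < `|x| -> f x = 0) -> A < `|x| -> iter_derive f vs x = 0.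
Proof.
move=> f0; elim: vs x => [|v vs IH] x Ax; first exact: f0.
rewrite /iter_derive /=; have : is_derive x v (fun=> 0 : R) 0 by exact: is_derive_cst.
move=> H; suff [_ //] : is_derive x v (iter_derive f vs) 0.
apply: (near_eq_is_derive _ H); near=> y; rewrite -/(iter_derive f vs) IH//.
near: y; exact: (cvgr_norm_gt x cvg_id).
Unshelve. all: by end_near. Qed.

Lemma FT_supp_schwartz b (A : R) : rapid b -> (forall x, A < `|x| -> FT b x = 0) -> schwartz (FT b).
Proof.
move=> rb f0; split; first exact: FT_smooth.
move=> p vs; have rv us : rapid (foldr (fun v c => dFT c v) b us).
  by elim: us => //= u us IH; exact: rapid_dFT.
have [C HC] := FT_le (rv vs).
exists (`|A| ^+ p * C) => x; have [xA|xA] := leP `|x| A; last first.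
  have C0 : 0 <= C by apply: le_trans (HC 0); exact: cabs_ge0.
  rewrite !(iter_derive_out _ _ xA) ?normr0 ?mulr0 ?mulr_ge0 ?exprn_ge0//.
  - by move=> y /f0 ->.
  - by move=> y /f0 ->.
have [-> ->] := FT_iter vs rb.
have xp : `|x| ^+ p <= `|A| ^+ p by rewrite lerXn2r ?nnegrE// (le_trans xA)// ler_norm.
by split; apply: ler_pM => //; rewrite ?exprn_ge0//; apply: le_trans (HC x); rewrite ?Re_le_cabs ?Im_le_cabs.
Qed.

End FourierGeneric.

(** * Integration by parts and decay of Fourier integrals on the line *)

Section RealLine.
Context {R : realType}.
Local Notation leb := (@lebesgue_measure R).

Definition W1 (x : R) : R := ((1 + `|x|) ^+ 2)^-1.

Lemma W1_gt0 x : 0 < W1 x.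
Proof. by rewrite invr_gt0 exprn_gt0// ltr_pwDl. Qed.

Lemma continuous_W1 : continuous W1.
Proof.
move=> x; apply: cvgV; first by rewrite gt_eqF// exprn_gt0// ltr_pwDl.
apply: (@cvgM _ _ _ _ (fun x => 1 + `|x|) (fun x => 1 + `|x|));
  apply: cvgD; try exact: cvg_cst; apply: cvg_norm; exact: cvg_id.
Qed.

(** By symmetry it suffices to integrate over the half-line, where $-(1+x)^{-1}$ is a primitive. *)
Lemma W1_intg : leb.-integrable setT (EFin \o W1).
Proof.
have mW : measurable_fun setT (EFin \o W1).
  by apply/measurable_EFinP; apply: continuous_measurable_fun; exact: continuous_W1.
apply/integrableP; split=> //.
have E1 : (\int[leb]_x `|(EFin \o W1) x| = \int[leb]_x (W1 x)%:E)%E.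
  by apply: eq_integral => x _; rewrite /= ger0_norm// ltW// W1_gt0.
rewrite E1 ge0_symfun_integralT; last 3 first.
- by move=> x; rewrite ltW// W1_gt0.
- exact: continuous_W1.
- by move=> x; rewrite /W1 /= normrN.
pose f (x : R) : R := (1 + x)^-1 * (1 + x)^-1; pose F (x : R) : R := - (1 + x)^-1.
have dF (x : R) : 0 <= x -> is_derive x (1 : R) F (f x).
  move=> x0; have x1 : 1 + x != 0 by rewrite gt_eqF// ltr_pwDl.
  have d1 : is_derive x (1 : R) (fun y : R => 1 + y) 1.
    by apply: (is_derive_eq (is_deriveD (is_derive_cst (1 : R) x 1) (is_derive_id x 1))); rewrite add0r.
  apply: (is_derive_eq (is_deriveN (is_derive_inv x1 d1))).
  by rewrite mulN1r opprK.
have := @ge0_continuous_FTC2y _ f F 0 0.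
rewrite set_itvcy => H; rewrite (_ : (\int[leb]_(x in _) _ = 1)%E) ?ltry//.
transitivity (\int[leb]_(x in [set x | 0 <= x]%R) (f x)%:E)%E.
  apply: eq_integral => x; rewrite inE /= => x0; congr (_%:E).
  by rewrite /W1 ger0_norm// /f expr2 invfM.
rewrite H.
- by rewrite -EFinB /F addr0 invr1 sub0r opprK.
- by move=> x x0; rewrite /f mulr_ge0 ?invr_ge0 ?addr_ge0.
- apply: continuous_in_subspaceT => x; rewrite inE /= => x0.
  have x1 : 1 + x != 0 by rewrite gt_eqF// ltr_pwDl.
  by apply: cvgM; apply: cvgV => //; apply: cvgD; [exact: cvg_cst|exact: cvg_id|exact: cvg_cst|exact: cvg_id].
- apply/cvgrPdist_le => e e0; near=> x; have x0 : 0 < x by near: x; exact: nbhs_pinfty_gt.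
  have xe : e^-1 <= x by near: x; apply: nbhs_pinfty_ge; rewrite num_real.
  have x1 : 0 < 1 + x by rewrite addr_gt0.
  rewrite /F sub0r opprK normfV (ger0_norm (ltW x1)).
  by rewrite invf_ple ?posrE//; apply: le_trans xe _; rewrite lerDr.
- by move=> x x0; case: (dF x (ltW x0)).
- apply: cvg_at_right_filter; apply: differentiable_continuous; apply/derivable1_diffP.
  by case: (dF 0 (lexx 0)).
- by move=> x; rewrite in_itv/= andbT => x0; rewrite derive1E; case: (dF x (ltW x0)).
Unshelve. all: by end_near. Qed.

Lemma FTCab (F f : R -> R) (a b : R) : a < b -> (forall t, is_derive t (1 : R) F (f t)) -> continuous f ->
  \int[leb]_(x in `[a, b]) f x = F b - F a.
Proof.
move=> ab Ff cf; rewrite /Rintegral.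
rewrite (@continuous_FTC2 R f F a b)//=.
- exact: continuous_subspaceT.
- split=> [x _|  |]; first by case: (Ff x).
  + apply: cvg_at_right_filter; apply: differentiable_continuous.
    by apply/derivable1_diffP; case: (Ff a).
  + apply: cvg_at_left_filter; apply: differentiable_continuous.
    by apply/derivable1_diffP; case: (Ff b).
- by move=> x _; rewrite derive1E; case: (Ff x).
Qed.

Definition ccont (f : R -> R[i]) : Prop :=
  continuous (fun x => complex.Re (f x)) /\ continuous (fun x => complex.Im (f x)).

Lemma ccont_cmeas D f : measurable D -> ccont f -> @cmeas R _ (measurableTypeR R) D f.
Proof.
move=> mD [cr ci]; split.
- apply: (measurable_funS measurableT) => //; exact: continuous_measurable_fun.
- apply: (measurable_funS measurableT) => //; exact: continuous_measurable_fun.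
Qed.

Lemma int_der_real (F f : R -> R) (g : R -> R) : (forall t, is_derive t (1 : R) F (f t)) ->
  continuous f -> (forall t, `|f t| <= g t) -> leb.-integrable setT (EFin \o g) ->
  F n%:R @[n --> \oo] --> (0 : R) -> F (- n%:R) @[n --> \oo] --> (0 : R) ->
  \int[leb]_(t in setT) f t = 0.
Proof.
move=> Ff cf fg ig F1 F2; pose u (n : nat) t := f t * \1_(`[- n%:R, n%:R]%classic : set R) t.
have mf : measurable_fun setT f by exact: continuous_measurable_fun.
have uE n : \int[leb]_(t in setT) u n.+1 t = F n.+1%:R - F (- n.+1%:R).
  rewrite -(FTCab _ Ff cf); last by rewrite gtrN// ltr0n.
  rewrite [RHS]Rintegral_mkcond; apply: eq_Rintegral => t _.
  by rewrite /u patchE indicE; case: ifP => _; rewrite ?mulr1 ?mulr0.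
have mu n : measurable_fun setT (u n).
  by apply: measurable_funM => //; exact: measurable_indic.
have ug n t : `|u n t| <= g t.
  apply: le_trans (fg t); rewrite /u normrM indicE; case: (_ \in _); rewrite ?normr1 ?mulr1// normr0 mulr0//.
have L : \int[leb]_(t in setT) u n t @[n --> \oo] --> \int[leb]_(t in setT) f t.
  have := @cI_dct R _ _ leb setT (fun n t => (u n t)%:C) (fun t => (f t)%:C) g measurableT.
  have Hm n : cmeas setT (fun t => (u n t)%:C : R[i]) by split=> //=; exact: measurable_cst.
  move=> /(_ Hm) []//.
  - move=> t _; split=> /=; last exact: cvg_cst.
    apply: (cvg_trans (G := (fun _ : nat => f t) @ \oo)); last exact: cvg_cst.
    apply: near_eq_cvg; near=> n; rewrite /u indicE mem_set ?mulr1//= in_itv/= -ler_norml.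
    by near: n; exact: nbhs_infty_ger.
  - by move=> n t _; rewrite cabs_real.
have L' : \int[leb]_(t in setT) u n t @[n --> \oo] --> (0 : R).
  have H0 : F n.+1%:R - F (- n.+1%:R) @[n --> \oo] --> (0 : R) - 0.
    by apply: cvgB; [have := F1|have := F2]; rewrite -cvg_shiftS.
  rewrite subr0 in H0; rewrite -cvg_shiftS; apply: cvg_trans H0.
  by apply: near_eq_cvg; apply: nearW => n /=; rewrite uE.
exact: (cvg_unique _ L L').
Unshelve. all: by end_near. Qed.

(** Integration by parts on the line in the form that a total derivative has integral 0. It yields
    both the decay of Fourier integrals ([iF_derive]) and their inversion ([J_mul]). *)
Lemma int_der (F f : R -> R[i]) (g : R -> R) : (forall t, is_cderive F t (f t)) ->
  ccont f -> (forall t, cabs (f t) <= g t) -> leb.-integrable setT (EFin \o g) ->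
  (exists C, forall t, (1 + `|t|) * cabs (F t) <= C) -> cI leb setT f = 0.
Proof.
move=> dF [cr ci] fg ig [C HC].
have L (s : R) (G : R -> R) : `|s| = 1 -> (forall t, `|G t| <= cabs (F t)) -> G (s * n%:R) @[n --> \oo] --> (0 : R).
  move=> s1 GF; apply/cvgrPdist_le => e e0; near=> n; rewrite sub0r normrN.
  apply: le_trans (GF _) _; have := HC (s * n%:R); rewrite normrM s1 mul1r normr_nat.
  have n0 : 0 < 1 + n%:R :> R by rewrite ltr_pwDl.
  rewrite -ler_pdivlMl// => /le_trans; apply; rewrite ler_pdivrMl// mulrDl mul1r.
  suff : C <= n%:R * e by move=> /le_trans; apply; rewrite lerDr ltW.
  by rewrite -ler_pdivrMr//; near: n; exact: nbhs_infty_ger.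
apply: complex_eq; rewrite /cI /by_parts /=.
- apply: (int_der_real (F := fun t => complex.Re (F t)) (g := g)) => //.
  + by move=> t; case: (dF t).
  + by move=> t; apply: le_trans (Re_le_cabs _) (fg t).
  + by have := L 1 (fun t => complex.Re (F t)) (normr1 _) (fun t => Re_le_cabs _); under eq_fun do rewrite mul1r.
  + by have := L (-1) (fun t => complex.Re (F t)) (normrN1 _) (fun t => Re_le_cabs _); under eq_fun do rewrite mulN1r.
- apply: (int_der_real (F := fun t => complex.Im (F t)) (g := g)) => //.
  + by move=> t; case: (dF t).
  + by move=> t; apply: le_trans (Im_le_cabs _) (fg t).
  + by have := L 1 (fun t => complex.Im (F t)) (normr1 _) (fun t => Im_le_cabs _); under eq_fun do rewrite mul1r.
  + by have := L (-1) (fun t => complex.Im (F t)) (normrN1 _) (fun t => Im_le_cabs _); under eq_fun do rewrite mulN1r.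
Unshelve. all: by end_near. Qed.

Lemma is_cderiveM (f g : R -> R[i]) t a b : is_cderive f t a -> is_cderive g t b ->
  is_cderive (fun s => f s * g s) t (a * g t + f t * b).
Proof.
move=> [fr fi] [gr gi]; split; rewrite ?Re_add ?Im_add ?Re_mul ?Im_mul.
- under eq_fun do rewrite Re_mul.
  apply: (is_derive_eq (is_deriveB (is_derive_prod fr gr) (is_derive_prod fi gi))); ring.
- under eq_fun do rewrite Im_mul.
  apply: (is_derive_eq (is_deriveD (is_derive_prod fr gi) (is_derive_prod fi gr))); ring.
Qed.

Lemma is_cderive_expi (c t : R) : is_cderive (fun s => expi (c * s)) t (expi (c * t) * (0 +i* c)).
Proof.
have H := is_cderive_cexp 0 (0 +i* c) t.
have E (s : R) : cexp (0 + s%:C * (0 +i* c)) = expi (c * s).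
  by rewrite add0r -cexp_imag; congr cexp; apply: complex_eq; rewrite ?Re_real ?Im_real /= ?mulr0 // mulrC.
by rewrite E mulrC in H; move: H; under eq_fun do rewrite E.
Qed.

Definition linewt (w : R -> R) : Prop := exists2 K, 0 <= K & forall t, 0 <= w t <= K * (1 + `|t|).

Lemma rapid_line (w : R -> R) (b : R -> R[i]) : linewt w -> cmeas setT b ->
  (forall n : nat, exists C, forall t, (1 + `|t|) ^+ n * cabs (b t) <= C) -> rapid leb w b.
Proof.
move=> [K K0 wK] mb bn; split=> // n; have [C HC] := bn n.+2.
exists (fun t => (1 + K) ^+ n * C * W1 t); first by apply: intgZl => //; exact: W1_intg.
move=> t; have p0 : 0 < 1 + `|t| by rewrite ltr_pwDl.
have /andP[w0 w1] := wK t.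
apply: le_trans (_ : _ <= ((1 + K) * (1 + `|t|)) ^+ n * cabs (b t)) _.
  rewrite ler_wpM2r ?cabs_ge0// lerXn2r ?nnegrE ?addr_ge0 ?mulr_ge0//; first by rewrite addr_ge0.
  by rewrite mulrDl mul1r lerD// lerDl.
rewrite exprMn -!mulrA ler_wpM2l ?exprn_ge0 ?addr_ge0// ler_pdivlMr ?exprn_gt0//.
by apply: le_trans (HC t); rewrite [leLHS]mulrC mulrA -exprD add2n.
Qed.

(** The Fourier theory is developed for smooth functions of bounded support only, since every symbol
    is multiplied by a cut-off before being represented. *)
Definition cdR (A : R) (f : R -> R[i]) : Prop :=
  cSM (1 : R) f /\ forall x, A < `|x| -> f x = 0.

Lemma cSM_ccont (f : R -> R[i]) : cSM (1 : R) f -> ccont f.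
Proof. by move=> [f1 f2]; split; exact: SM_cont. Qed.

Lemma compact_supp_le (f : R -> R[i]) (A : R) : ccont f -> (forall x, A < `|x| -> f x = 0) ->
  exists2 C, 0 <= C & forall x, cabs (f x) <= C.
Proof.
move=> [cr ci] f0.
have H (u : R -> R) : continuous u -> exists C, forall x, `|x| <= A -> `|u x| <= C.
  move=> cu; have : bounded_set (u @` (`[- A, A]%classic : set R)).
    apply: compact_bounded; apply: continuous_compact; last exact: segment_compact.
    exact: continuous_subspaceT.
  move=> [M [_ HM]]; exists (M + 1) => x xA; apply: (HM (M + 1)); first by rewrite ltrDl.
  by exists x => //=; rewrite in_itv/= -ler_norml.
have [C1 H1] := H _ cr; have [C2 H2] := H _ ci.
exists (`|C1| + `|C2|); first by rewrite addr_ge0.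
move=> x; have [xA|xA] := leP `|x| A; last by rewrite f0// cabs0 addr_ge0.
apply: le_trans (cabs_le_ReIm _) _; apply: lerD.
  exact: le_trans (H1 x xA) (ler_norm _).
exact: le_trans (H2 x xA) (ler_norm _).
Qed.

Lemma cdR_decay A f (n : nat) : cdR A f -> exists C, forall t, (1 + `|t|) ^+ n * cabs (f t) <= C.
Proof.
move=> [/cSM_ccont cf f0]; have [C C0 HC] := compact_supp_le cf f0.
exists ((1 + `|A|) ^+ n * C) => t; have [tA|tA] := leP `|t| A; last first.
  by rewrite f0// cabs0 mulr0 mulr_ge0// exprn_ge0// addr_ge0.
apply: ler_pM; rewrite ?cabs_ge0 ?exprn_ge0 ?addr_ge0//.
by rewrite lerXn2r ?nnegrE ?addr_ge0// lerD2l (le_trans tA)// ler_norm.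
Qed.

Lemma cdR_rapid w A f : linewt w -> cdR A f -> rapid leb w f.
Proof.
move=> lw df; apply: rapid_line => //; last by move=> n; exact: cdR_decay df.
by case: df => /cSM_ccont cf _; exact: ccont_cmeas.
Qed.

Lemma cdR_derive A f : cdR A f -> exists2 f1, (forall t, is_cderive f t (f1 t)) & cdR A f1.
Proof.
move=> [[/SM_der[a da sa] /SM_der[b db sb]] f0].
exists (fun t => a t +i* b t); split=> // t At.
have H (u u1 : R -> R) : (forall x, A < `|x| -> u x = 0) -> (is_derive t (1 : R) u (u1 t)) -> u1 t = 0.
  move=> u0 [_ <-]; have H0 : is_derive t (1 : R) (fun=> 0 : R) 0 by exact: is_derive_cst.
  have [//] : is_derive t (1 : R) u 0.
  apply: (near_eq_is_derive _ H0); near=> y; rewrite u0//.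
  by near: y; exact: (cvgr_norm_gt t cvg_id).
by apply: complex_eq => /=; [apply: (H (fun x => complex.Re (f x)))|apply: (H (fun x => complex.Im (f x)))] => // x /f0 ->.
Unshelve. all: by end_near. Qed.

(** The sign is opposite to the synthesis $\int\beta(\xi)e^{-ix\xi}d\xi$ in [fcalc1_spec], and there
    is no normalization; the missing constant is [kap]. *)
Definition iF (f : R -> R[i]) (xi : R) : R[i] := FT leb (fun t v : R => v * t) f xi.

Lemma linewt_norm : linewt (fun t => `|t|).
Proof. by exists 1 => // t; rewrite normr_ge0 mul1r lerDr ler01. Qed.

Lemma iF_int A f xi : cdR A f -> cintg leb setT (fun t => f t * expi (xi * t)).
Proof.
move=> df; apply: (@rapid_intg _ _ _ leb R (fun t v : R => v * t) (fun t => `|t|)).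
  by move=> v; apply: measurable_funM => //; exact: measurable_cst.
by apply: cdR_rapid df; exact: linewt_norm.
Qed.

Lemma iF_le A f : cdR A f -> exists C, forall xi, cabs (iF f xi) <= C.
Proof.
move=> df; apply: (@FT_le _ _ _ leb R (fun t v : R => v * t) (fun t => `|t|)).
  by move=> v; apply: measurable_funM => //; exact: measurable_cst.
by apply: cdR_rapid df; exact: linewt_norm.
Qed.

Lemma iF_derive A f f1 xi : (forall t, is_cderive f t (f1 t)) -> cdR A f -> cdR A f1 ->
  iF f1 xi = - (0 +i* xi) * iF f xi.
Proof.
move=> d1 df df1; have i0 := iF_int xi df; have i1 := iF_int xi df1.
apply/eqP; rewrite mulNr -subr_eq0 opprK /iF /FT -cI_Z// -cI_D//; last exact: cintgZ.
apply/eqP; have [C0 H0] := cdR_decay 1 df.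
have [C1 H1] := cdR_decay 2 df1; have [C2 H2] := cdR_decay 2 df.
apply: (@int_der (fun t => f t * expi (xi * t)) _ (fun t => (C1 + `|xi| * C2) * W1 t)).
- move=> t; have := is_cderiveM (d1 t) (is_cderive_expi xi t).
  by rewrite mulrA [X in _ + X]mulrC mulrA.
- have E : cSM (1 : R) (fun t => expi (xi * t)).
    have Sl : SM (1 : R) (fun t => xi * t) by apply: SMM; [exact: SM_cst|exact: SM_id].
    have SC : SM (1 : R) (@cos R) /\ SM (1 : R) (@sin R).
      suff H n : Cn (1 : R) n (@cos R) /\ Cn (1 : R) n (@sin R) by split=> n; case: (H n).
      elim: n => [|n [IH1 IH2]].
        by split; split=> //; [exact: continuous_cos|exact: continuous_sin].
      split; split; try exact: continuous_cos; try exact: continuous_sin.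
        by exists (fun x => - sin x); [move=> x; exact: is_derive_cos|exact: CnN].
      by exists (@cos R) => // x; exact: is_derive_sin.
    by case: SC => S1 S2; split; exact: SM_comp.
  case: df df1 => sf _ [sf1 _]; apply: cSM_ccont; apply: cSMD; first exact: cSMM.
  by apply: cSMM; [exact: cSM_cst|exact: cSMM].
- move=> t; have p0 : 0 < (1 + `|t|) ^+ 2 by rewrite exprn_gt0// ltr_pwDl.
  rewrite ler_pdivlMr//; apply: le_trans (ler_wpM2r (ltW p0) (cabsD _ _)) _.
  rewrite mulrDl; apply: lerD; first by rewrite cabsM cabs_expi mulr1 mulrC.
  by rewrite !cabsM cabs_expi mulr1 cabs_imag -mulrA ler_wpM2l// mulrC.
- by apply: intgZl => //; exact: W1_intg.
- by exists C0 => t; rewrite cabsM cabs_expi mulr1 -[1 + _]expr1.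
Qed.

Lemma iF_decay_pow A f (p : nat) : cdR A f -> exists C, forall xi, `|xi| ^+ p * cabs (iF f xi) <= C.
Proof.
elim: p f => [|p IH] f df.
  by have [C HC] := iF_le df; exists C => xi; rewrite expr0 mul1r.
have [f1 d1 df1] := cdR_derive df; have [C HC] := IH _ df1; exists C => xi.
apply: le_trans (HC xi); rewrite (iF_derive _ d1 df df1) mulNr cabsN cabsM cabs_imag exprSr.
by rewrite mulrA.
Qed.

Lemma pow_decay (T : Type) (w h : T -> R) : (forall t, 0 <= w t) -> (forall t, 0 <= h t) ->
  (forall p : nat, exists C, forall t, w t ^+ p * h t <= C) ->
  forall n : nat, exists C, forall t, (1 + w t) ^+ n * h t <= C.
Proof.
move=> w0 h0 hp; elim=> [|n [C HC]].
  by have [C HC] := hp 0%N; exists C => t; have := HC t; rewrite !expr0.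
have [C0 H0] := hp 0%N; have [C' HC'] := hp n.+1.
exists (2 ^+ n.+1 * (C0 + C')) => t.
have Y0 := w0 t.
apply: le_trans (_ : _ <= 2 ^+ n.+1 * (1 + w t ^+ n.+1) * h t) _.
  rewrite ler_wpM2r//; have [t1|t1] := leP (w t) 1.
    apply: le_trans (_ : _ <= 2 ^+ n.+1 * 1) _.
      by rewrite mulr1 lerXn2r ?nnegrE ?addr_ge0//; lra.
    by rewrite ler_wpM2l ?exprn_ge0// lerDl exprn_ge0.
  apply: le_trans (_ : _ <= 2 ^+ n.+1 * w t ^+ n.+1) _.
    by rewrite -exprMn lerXn2r ?nnegrE ?addr_ge0 ?mulr_ge0//; lra.
  by rewrite ler_wpM2l ?exprn_ge0// lerDr.
rewrite -mulrA ler_wpM2l ?exprn_ge0// mulrDl mul1r lerD//.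
by have := H0 t; rewrite expr0 mul1r.
Qed.

Lemma iF_decay A f (n : nat) : cdR A f -> exists C, forall xi, (1 + `|xi|) ^+ n * cabs (iF f xi) <= C.
Proof.
move=> df; apply: (@pow_decay _ (fun t => `|t|)) => [t|t|p]; [exact: normr_ge0|exact: cabs_ge0|exact: iF_decay_pow df].
Qed.

End RealLine.

(** * Fourier inversion *)

Section Inversion.
Context {R : realType}.
Local Notation leb := (@lebesgue_measure R).
Implicit Types (A B y xi : R) (f : R -> R[i]).

Lemma cdR_le A B f : A <= B -> cdR A f -> cdR B f.
Proof. by move=> AB [sf f0]; split=> // x Bx; apply: f0; exact: le_lt_trans AB Bx. Qed.

Lemma cdR_lin A f g z : cdR A f -> cdR A g -> cdR A (fun x => f x + z * g x).
Proof.
move=> [sf f0] [sg g0]; split; first by apply: cSMD => //; apply: cSMM => //; exact: cSM_cst.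
by move=> x Ax; rewrite f0// g0// mulr0 addr0.
Qed.

Lemma iF_lin A f g z xi : cdR A f -> cdR A g ->
  iF (fun x => f x + z * g x) xi = iF f xi + z * iF g xi.
Proof.
move=> df dg; have i1 := iF_int xi df; have i2 := iF_int xi dg.
rewrite /iF /FT -cI_Z// -cI_D//; last exact: cintgZ.
by apply: cI_eq => t _; rewrite mulrDl mulrA.
Qed.

Lemma iF_cont A f : cdR A f -> ccont (iF f).
Proof.
move=> df; have H xi := @FT_diff _ _ _ leb R (fun t v : R => v * t) (fun t => `|t|) _ _ _ _ _ f xi.
split=> xi; apply: differentiable_continuous; case: (H _ _ _ _ _ xi) => //.
all: try by [move=> t u v; rewrite mulrDl|move=> t s v; rewrite -mulrA|
  move=> t v; rewrite normrM mulrC|move=> v; apply: measurable_funM => //; exact: measurable_cst].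
all: by apply: cdR_rapid df; exact: linewt_norm.
Qed.

Lemma iF_rapid w A f : linewt w -> cdR A f -> rapid leb w (iF f).
Proof.
move=> lw df; apply: rapid_line => //; first by apply: ccont_cmeas => //; exact: iF_cont df.
by move=> n; exact: iF_decay df.
Qed.

Definition J (f : R -> R[i]) y : R[i] := FT leb (fun t v : R => - (v * t)) (iF f) y.

Lemma negphase : [/\ forall t u v : R, - ((u + v) * t) = - (u * t) + - (v * t),
  forall t s v : R, - ((s *: v) * t) = s * (- (v * t)),
  forall t v : R, `|- (v * t)| <= `|t| * `|v| &
  forall v : R, measurable_fun setT (fun t : R => - (v * t))].
Proof.
split=> [t u v|t s v|t v|v].
- by rewrite mulrDl opprD.
- by rewrite mulrN mulrA.
- by rewrite normrN normrM mulrC.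
- under eq_fun do rewrite -mulNr.
  by apply: measurable_funM => //; exact: measurable_cst.
Qed.

Lemma J_int A f y : cdR A f -> cintg leb setT (fun xi => iF f xi * expi (- (y * xi))).
Proof.
move=> df; have [_ _ _ p4] := negphase.
apply: (@rapid_intg _ _ _ leb R (fun t v : R => - (v * t)) (fun t => `|t|)) => //.
by apply: iF_rapid df; exact: linewt_norm.
Qed.

Lemma J_lin A f g z y : cdR A f -> cdR A g -> J (fun x => f x + z * g x) y = J f y + z * J g y.
Proof.
move=> df dg; have i1 := J_int y df; have i2 := J_int y dg.
rewrite /J /FT -cI_Z// -cI_D//; last exact: cintgZ.
by apply: cI_eq => t _; rewrite (iF_lin _ _ df dg) mulrDl mulrA.
Qed.

Lemma linewt_shift y : linewt (fun t => `|t| + `|y|).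
Proof.
exists (1 + `|y|); first by rewrite addr_ge0.
by move=> t; rewrite addr_ge0//=; have := mulr_ge0 (normr_ge0 y) (normr_ge0 t); lra.
Qed.

(* [x - y] on the space side is the derivative in [xi] on the Fourier side, so its integral vanishes. *)
Lemma J_mul A g y : cdR A g -> J (fun x => (x - y)%:C * g x) y = 0.
Proof.
move=> dg; pose p (t v : R) : R := v * (t - y); pose w (t : R) : R := `|t| + `|y|.
have pD t (u v : R) : p t (u + v) = p t u + p t v by rewrite /p mulrDl.
have pZ t (s v : R) : p t (s *: v) = s * p t v by rewrite /p -mulrA.
have pw t v : `|p t v| <= w t * `|v|.
  by rewrite normrM mulrC ler_wpM2r// ler_normB.
have pm (v : R) : measurable_fun setT (p ^~ v).
  apply: measurable_funM; first exact: measurable_cst.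
  by apply: measurable_funB; [exact: measurable_id|exact: measurable_cst].
have w0 t : 0 <= w t by rewrite addr_ge0.
have rg : rapid leb w g by apply: cdR_rapid dg; exact: linewt_shift.
have rd := @rapid_dFT R _ _ leb R p w pw pm w0 g 1 rg.
pose u x := (x - y)%:C * g x.
have du : cdR A u.
  case: dg => sg g0; split; last by move=> x /g0; rewrite /u => ->; rewrite mulr0.
  apply: cSMM => //; apply: cSM_real; apply: SMB; [exact: SM_id|exact: SM_cst].
have E (h : R -> R[i]) B xi : cdR B h -> FT leb p h xi = iF h xi * expi (- (y * xi)).
  move=> dh; rewrite mulrC /iF /FT -cI_Z//; last exact: iF_int dh.
  apply: cI_eq => t _; rewrite mulrCA -expiD; congr (_ * expi _); rewrite /p; ring.
have dE : dFT p g 1 = fun t => (0 +i* 1) * u t.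
  apply/funext => t; rewrite /dFT /p /u mul1r.
  have -> : (0 +i* (t - y)) = (0 +i* 1) * (t - y)%:C.
    by apply: complex_eq; rewrite ?Re_mul ?Im_mul /= ?mulr0 ?mul0r ?mul1r ?subr0 ?add0r// addr0.
  ring.
have Hd xi : FT leb p (dFT p g 1) xi = (0 +i* 1) * (iF u xi * expi (- (y * xi))).
  rewrite -(E _ _ _ du) dE /FT -cI_Z//; last first.
    by have := @rapid_intg R _ _ leb R p w pm u xi (cdR_rapid (linewt_shift y) du).
  by apply: cI_eq => t _; rewrite mulrA.
have [C HC] := iF_decay 2 du; have [C' HC'] := iF_decay 1 dg.
have I0 : cI leb setT (fun xi => (0 +i* 1) * (iF u xi * expi (- (y * xi)))) = 0.
  apply: (@int_der _ (FT leb p g) _ (fun t => C * W1 t)).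
  - move=> xi; rewrite -Hd; exact: (@FT_derive R _ _ leb R p w pD pZ pw pm w0 g xi 1 rg).
  - rewrite (_ : (fun xi => _) = FT leb p (dFT p g 1)); last by apply/funext => xi; rewrite Hd.
    have D xi := @FT_diff _ _ _ leb R p w pD pZ pw pm w0 (dFT p g 1) xi rd.
    by split=> xi; apply: differentiable_continuous; case: (D xi).
  - move=> xi; rewrite !cabsM cabs_expi mulr1 cabs_imag normr1 mul1r ler_pdivlMr; last first.
      by rewrite exprn_gt0// ltr_pwDl.
    by rewrite mulrC.
  - by apply: intgZl => //; exact: W1_intg.
  - by exists C' => t; rewrite (E _ _ _ dg) cabsM cabs_expi mulr1 -[1 + _]expr1.
have ii : (0 +i* 1) != 0 :> R[i] by rewrite eq_complex /= negb_and oner_neq0 orbT.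
by move: I0; rewrite cI_Z//; [move/eqP; rewrite mulf_eq0 (negbTE ii) => /eqP|exact: J_int du].
Qed.

Definition bumpC A x : R[i] := (bump A x)%:C.

Lemma cdR_bump A : 0 < A -> cdR (2 * A) (bumpC A).
Proof.
move=> A0; split; first by apply: cSM_real; exact: SM_bump.
by move=> x Ax; rewrite /bumpC bump0// ltW.
Qed.

(** By Hadamard's lemma $f-f(y)\cdot$[bumpC A] equals $(x-y)g$ with [g] smooth; outside the support
    $x\ne y$, so [g] vanishes there as well, and [J_mul] removes the product. *)
Lemma J_bump_factor A f y : 0 < A -> cdR A f -> `|y| <= A -> J f y = f y * J (bumpC A) y.
Proof.
move=> A0 df yA; have A2 : A <= 2 * A by lra.
have db := cdR_bump A0; have df2 := cdR_le A2 df.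
pose u x := f x + (- f y) * bumpC A x.
have du : cdR (2 * A) u by exact: cdR_lin.
have uy : u y = 0 by rewrite /u /bumpC bump1// mulr1 subrr.
pose g x : R[i] := dd (fun x => complex.Re (u x)) x y +i* dd (fun x => complex.Im (u x)) x y.
have gE x : u x = (x - y)%:C * g x.
  case: du => -[s1 s2] _; apply: complex_eq; rewrite ?Re_real ?Im_real /= dd_sub// uy /= subr0//.
have dg : cdR (2 * A) g.
  split.
    case: du => -[s1 s2] _; split => /=; apply: SM_dd => //; try exact: SM_id; exact: SM_cst.
  move=> x Ax; have := gE x; case: du => _ -> //; move/esym/eqP; rewrite mulf_eq0 => /orP[|/eqP//].
  rewrite eq_complex /= eqxx andbT subr_eq0 => /eqP xy; move: Ax; rewrite xy => Ay.
  by have := lt_le_trans Ay yA; rewrite ltNge A2.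
have := J_mul y dg; rewrite -(_ : u = (fun x => (x - y)%:C * g x)); last exact/funext.
by rewrite (J_lin _ _ df2 db) mulNr => /eqP; rewrite subr_eq0 => /eqP.
Qed.

(* kap is 2 pi; only kap != 0 is needed. *)
Definition kap : R[i] := J (bumpC 1) 0.

(** Differentiating [J] in [y] amounts to differentiating the bump under it. Its derivative vanishes
    at [y], where the bump is locally constant, so [J_bump_factor] gives 0. *)
Lemma J_bump_derive A y : 0 < A -> `|y| < A ->
  is_derive y (1 : R) (fun y => complex.Re (J (bumpC A) y)) 0 /\
  is_derive y (1 : R) (fun y => complex.Im (J (bumpC A) y)) 0.
Proof.
move=> A0 yA; have db := cdR_bump A0; have [c1 d1 dc1] := cdR_derive db.
have [p1 p2 p3 p4] := negphase.
have rb : rapid leb (fun t => `|t|) (iF (bumpC A)) by apply: iF_rapid db; exact: linewt_norm.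
have := @FT_derive R _ _ leb R (fun t v : R => - (v * t)) (fun t => `|t|) p1 p2 p3 p4 (fun t => normr_ge0 t) (iF (bumpC A)) y 1 rb.
suff -> : FT leb (fun t v : R => - (v * t)) (dFT (fun t v : R => - (v * t)) (iF (bumpC A)) 1) y = 0 by [].
transitivity (J c1 y).
  apply: cI_eq => xi _; congr (_ * _); rewrite (iF_derive xi d1 db dc1) /dFT mulrC mul1r.
  by congr (_ * _); apply: complex_eq; rewrite ?Re_opp ?Im_opp /= ?oppr0.
have A2 : 0 < 2 * A by rewrite mulr_gt0.
rewrite (J_bump_factor A2 dc1); last by move: yA; lra.
suff -> : c1 y = 0 by rewrite mul0r.
have [e1 e2] := d1 y.
have H (u : R -> R) l : (forall x, `|x| <= A -> u x = u y) -> is_derive y (1 : R) u l -> l = 0.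
  move=> uc [_ <-]; have H0 : is_derive y (1 : R) (fun=> u y) 0 by exact: is_derive_cst.
  have [//] : is_derive y (1 : R) u 0.
  apply: (near_eq_is_derive _ H0); near=> x; rewrite uc// ltW//.
  by near: x; exact: (cvgr_norm_lt y cvg_id).
by apply: complex_eq; [apply: H e1 => x xA|apply: H e2 => x xA]; rewrite /bumpC /= ?bump1// ltW.
Unshelve. all: by end_near. Qed.

Lemma J_bump0 A B : 0 < A -> 2 * A <= B -> J (bumpC A) 0 = J (bumpC B) 0.
Proof.
move=> A0 AB; have B0 : 0 < B by apply: lt_le_trans AB; rewrite mulr_gt0.
rewrite (J_bump_factor B0 (cdR_le AB (cdR_bump A0))) ?normr0 ?ltW//.
by rewrite /bumpC bump1 ?normr0 ?ltW// mul1r.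
Qed.

Lemma J_bump A y : 0 < A -> `|y| < A -> J (bumpC A) y = kap.
Proof.
move=> A0 yA.
have -> : kap = J (bumpC A) 0.
  pose B := 2 * A + 2 * 1.
  rewrite /kap (@J_bump0 1 B) ?(@J_bump0 A B)//; rewrite /B ?lerDl ?lerDr ?mulr_ge0// ltW//.
have sA (s : R) : s \in `[0, 1] -> `|s * y| < A.
  rewrite in_itv/= => /andP[s0 s1]; rewrite normrM ger0_norm//; apply: le_lt_trans yA.
  by rewrite ler_piMl.
have H (G : R -> R) : (forall x, `|x| < A -> is_derive x (1 : R) G 0) -> G y = G 0.
  move=> dG; pose g s := G (s * y).
  have dg (s : R) : s \in `[0, 1] -> is_derive s (1 : R) g 0.
    move=> /sA /dG d; have d2 : is_derive s (1 : R) (fun s : R => s * y) y.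
      by apply: (is_derive_eq (is_derive_prod (is_derive_id s 1) (is_derive_cst y s 1))); rewrite mul1r mulr0 addr0.
    by have := @is_derive_chain _ _ (1 : R) s G (fun s : R => s * y) _ _ d d2; rewrite mul0r.
  have cg : {within `[0, 1], continuous g}.
    by apply: derivable_within_continuous => s /dg[].
  have [c _] := @MVT_segment R g (fun=> 0) 0 1 ler01 (fun x xI => dg x (subset_itv_oo_cc xI)) cg.
  rewrite mul0r /g mul1r mul0r => /eqP; rewrite subr_eq0 => /eqP -> //.
apply: complex_eq; [apply: (H (fun y => complex.Re (J (bumpC A) y)))|apply: (H (fun y => complex.Im (J (bumpC A) y)))] => x xA;
  by case: (J_bump_derive A0 xA).
Qed.

(** A bump wide enough for the support of [f] and for [y] is chosen; its double transform at [y] is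
    the constant [kap], independent of the width. *)
Lemma inversion A f y : cdR A f -> J f y = f y * kap.
Proof.
move=> df; pose B : R := `|A| + `|y| + 1.
have B0 : 0 < B by rewrite ltr_wpDl ?addr_ge0.
have AB : A <= B by apply: le_trans (ler_norm A) _; rewrite /B -addrA lerDl addr_ge0.
have yB : `|y| < B by rewrite /B [`|A| + _]addrC -addrA ltrDl ltr_wpDl.
by rewrite (J_bump_factor B0 (cdR_le AB df) (ltW yB)) J_bump.
Qed.

End Inversion.

(** * Integrals over the plane, the inversion constant, and representation of symbols of one
    variable *)

Section Plane.
Context {R : realType}.
Local Notation leb := (@lebesgue_measure R).
Local Notation leb2 := ((@lebesgue_measure R) \x (@lebesgue_measure R))%E.
Local Notation TR := (measurableTypeR R).

Definition grid_floor (n : nat) (x : R) : R := (Num.floor (x * n.+1%:R))%:~R / n.+1%:R.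

Lemma grid_floor_cvg x : grid_floor n x @[n --> \oo] --> x.
Proof.
apply/cvgrPdist_le => e e0; near=> n.
have n0 : (0 : R) < n.+1%:R by rewrite ltr0n.
have /andP[f1 f2] := floor_itv (x * n.+1%:R); rewrite rmorphD rmorph1 in f2.
have -> : x - grid_floor n x = (x * n.+1%:R - (Num.floor (x * n.+1%:R))%:~R) / n.+1%:R.
  by rewrite /grid_floor mulrBl mulfK ?gt_eqF.
rewrite ger0_norm ?divr_ge0 ?subr_ge0//.
have en : e^-1 <= n%:R by near: n; exact: nbhs_infty_ger.
rewrite ler_pdivrMr//; apply: le_trans (_ : 1 <= _); first by move: f2; lra.
by rewrite -ler_pdivrMl// mulr1 (le_trans en)// ler_nat.
Unshelve. all: by end_near. Qed.

(** Measurability is meant for the product sigma-algebra. Rounding the first coordinate to a grid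
    gives a countable union of rectangles as preimage, and the rounded functions converge pointwise
    by continuity. *)
Lemma measurable_plane (f : R * R -> R) : continuous f ->
  measurable_fun setT (f : TR * TR -> R).
Proof.
move=> cf; apply: (@measurable_fun_cvg _ _ _ _ (fun n (z : TR * TR) => f (grid_floor n z.1, z.2))); last first.
  move=> [x y] _ /=; move: (x : R) (y : R) => {}x {}y.
  have cg : continuous (fun t : R => f (t, y)).
    move=> t; apply: (@continuous_comp _ _ _ (fun t => (t, y)) f); last exact: cf.
    exact: (cvg_pair cvg_id (cvg_cst y)).
  exact: (cvg_comp (fun n => grid_floor n x) (fun t => f (t, y)) (@grid_floor_cvg x) (cg x)).
move=> n _ Y mY; rewrite setTI.
rewrite (_ : _ @^-1` Y = \bigcup_(k : int) ([set x : TR | Num.floor (x * n.+1%:R) = k] `*`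
    [set y : TR | Y (f (k%:~R / n.+1%:R, y))])).
  apply: countable_bigcupT_measurable; first exact: countableP.
  move=> k; apply: measurableX.
    have n0 : (0 : R) < n.+1%:R by rewrite ltr0n.
    rewrite (_ : [set x | _] = `[k%:~R / n.+1%:R, (k + 1)%:~R / n.+1%:R[%classic); first exact: measurable_itv.
    apply/seteqP; split=> x /=; rewrite in_itv/= ler_pdivrMr// ltr_pdivlMr//.
      by move=> <-; exact: floor_itv.
    by move/floor_def.
  have c1 : continuous (fun y : R => f (k%:~R / n.+1%:R, y)).
    move=> y; apply: (@continuous_comp _ _ _ (fun y => (_, y)) f); last exact: cf.
    exact: (cvg_pair (cvg_cst _) cvg_id).
  by have := continuous_measurable_fun c1 measurableT mY; rewrite setTI.
apply/seteqP; split=> [[x y] /= Yf|[x y] [k _ [/= <-]]//].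
by exists (Num.floor (x * n.+1%:R)).
Qed.

Definition ccont2 (F : R * R -> R[i]) : Prop :=
  continuous (fun z => complex.Re (F z)) /\ continuous (fun z => complex.Im (F z)).

Lemma ccont2_cmeas F : ccont2 F -> @cmeas R _ (TR * TR)%type setT F.
Proof. by move=> [cr ci]; split; exact: measurable_plane. Qed.

Definition W2 (z : TR * TR) : R := W1 z.1 * W1 z.2.

Lemma W2_intg : leb2.-integrable setT (EFin \o W2).
Proof.
have mW : measurable_fun setT (EFin \o W2).
  apply/measurable_EFinP; apply: measurable_funM; apply: measurableT_comp => //;
    apply: continuous_measurable_fun; exact: continuous_W1.
apply/integrable12ltyP => //.
rewrite (_ : (\int[leb]_x \int[leb]_y _ = \int[leb]_x ((W1 x)%:E * (\int[leb]_y W1 y)%:E))%E).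
  have iW := intgZl (\int[leb]_y W1 y) measurableT W1_intg.
  case/integrableP: iW => _; apply: le_lt_trans; apply: ge0_le_integral => //=.
  - move=> x _; rewrite -EFinM lee_fin mulr_ge0//; first by rewrite ltW// W1_gt0.
    by apply: Rintegral_ge0 => t _; rewrite ltW// W1_gt0.
  - under eq_fun do rewrite -EFinM; apply/measurable_EFinP; apply: measurable_funM => //.
    by apply: continuous_measurable_fun; exact: continuous_W1.
  - apply/measurable_EFinP; apply: measurableT_comp => //; apply: measurable_funM => //.
    by apply: continuous_measurable_fun; exact: continuous_W1.
  - by move=> x _; rewrite -EFinM lee_fin mulrC ler_norm.
apply: eq_integral => x _; rewrite -EFinM -(@RintegralZl _ _ _ leb)//; last exact: W1_intg.
rewrite /Rintegral fineK; last by apply: integrable_fin_num => //; apply: intgZl => //; exact: W1_intg.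
by apply: eq_integral => y _; rewrite /= /W2 ger0_norm// mulr_ge0 ?ltW ?W1_gt0.
Qed.

Lemma Rfub12 (f : TR * TR -> R) : leb2.-integrable setT (EFin \o f) ->
  (forall x, leb.-integrable setT (EFin \o (fun y => f (x, y)))) ->
  \int[leb]_x (\int[leb]_y f (x, y)) = \int[leb2]_z f z.
Proof.
move=> i2 i1; rewrite /Rintegral -(integral12_prod_meas1 i2); congr fine.
by apply: eq_integral => x _; rewrite fineK //; exact: integrable_fin_num (i1 x).
Qed.

Lemma Rfub21 (f : TR * TR -> R) : leb2.-integrable setT (EFin \o f) ->
  (forall y, leb.-integrable setT (EFin \o (fun x => f (x, y)))) ->
  \int[leb]_y (\int[leb]_x f (x, y)) = \int[leb2]_z f z.
Proof.
move=> i2 i1; rewrite /Rintegral -(integral21_prod_meas1 i2); congr fine.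
by apply: eq_integral => x _; rewrite fineK //; exact: integrable_fin_num (i1 x).
Qed.

Lemma cfub12 (F : TR * TR -> R[i]) : cintg leb2 setT F ->
  (forall x, cintg leb setT (fun y => F (x, y))) ->
  cI leb setT (fun x => cI leb setT (fun y => F (x, y))) = cI leb2 setT F.
Proof.
move=> [ir ii] i1; apply: complex_eq; rewrite /cI /by_parts /=.
- by rewrite (@Rfub12 (fun z => complex.Re (F z)))// => x; case: (i1 x).
- by rewrite (@Rfub12 (fun z => complex.Im (F z)))// => x; case: (i1 x).
Qed.

Lemma cfub21 (F : TR * TR -> R[i]) : cintg leb2 setT F ->
  (forall y, cintg leb setT (fun x => F (x, y))) ->
  cI leb setT (fun y => cI leb setT (fun x => F (x, y))) = cI leb2 setT F.
Proof.
move=> [ir ii] i1; apply: complex_eq; rewrite /cI /by_parts /=.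
- by rewrite (@Rfub21 (fun z => complex.Re (F z)))// => x; case: (i1 x).
- by rewrite (@Rfub21 (fun z => complex.Im (F z)))// => x; case: (i1 x).
Qed.

Lemma cintg_W1 (f : TR -> R[i]) C : cmeas setT f -> (forall t, cabs (f t) <= C * W1 t) -> cintg leb setT f.
Proof.
by move=> mf fC; apply: (@cintg_dom _ _ _ leb setT f (fun t => C * W1 t)) => //; apply: intgZl => //; exact: W1_intg.
Qed.

Lemma cintg_W2 (f : TR * TR -> R[i]) C : cmeas setT f -> (forall t, cabs (f t) <= C * W2 t) -> cintg leb2 setT f.
Proof.
by move=> mf fC; apply: (@cintg_dom _ _ _ leb2 setT f (fun t => C * W2 t)) => //; apply: intgZl => //; exact: W2_intg.
Qed.

Lemma W1_decay (f : R -> R[i]) C t : (1 + `|t|) ^+ 2 * cabs (f t) <= C -> cabs (f t) <= C * W1 t.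
Proof. by move=> H; rewrite ler_pdivlMr ?exprn_gt0 ?ltr_pwDl// mulrC. Qed.

Lemma Rint_pos (h : R -> R) : continuous h -> (forall x, 0 <= h x) ->
  leb.-integrable setT (EFin \o h) -> \int[leb]_(x in setT) h x = 0 -> h 0 = 0.
Proof.
move=> ch h0 ih I0; apply/eqP; rewrite eq_le h0 andbT leNgt; apply/negP => hp.
have /cvgrPdist_le/(_ (h 0 / 2)) := ch 0; rewrite divr_gt0// => /(_ isT) /nbhs_ballP[r r0 Hr].
have hr x : x \in `[0, r / 2] -> h 0 / 2 <= h x.
  rewrite in_itv/= => /andP[x0 xr].
  have : `|h 0 - h x| <= h 0 / 2.
    by apply: Hr; rewrite /ball/= sub0r normrN ger0_norm//; apply: le_lt_trans xr _; rewrite ltr_pdivrMr// ltr_pMr// ltr1n.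
  by move=> /(le_trans (ler_norm _)); lra.
have mI : measurable (`[0, r / 2]%classic : set TR) by [].
have : \int[leb]_(x in `[0, r / 2]) (h 0 / 2) <= \int[leb]_(x in setT) h x.
  rewrite [leLHS]Rintegral_mkcond; apply: le_Rintegral => //.
  - apply: (@intg_dom _ _ _ leb setT _ h) => //.
      apply/(measurable_restrictT _ mI); exact: measurable_cst.
    move=> x _; rewrite patchE; case: ifP; last by rewrite normr0.
    by rewrite inE => xI; rewrite ger0_norm ?divr_ge0//; exact: hr.
  - by move=> x _; rewrite patchE; case: ifP => // /set_mem xI; exact: hr.
rewrite I0 Rintegral_cst//= lebesgue_measure_itv/= lte_fin divr_gt0// -EFinB subr0 /=.
by rewrite leNgt mulr_gt0// divr_gt0.
Qed.

Lemma iF_sym (f : R -> R) xi : cdR 2 (fun x => (f x)%:C) ->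
  iF (fun x => (f x)%:C) xi * iF (fun x => (f x)%:C) (- xi) =
  (cabs (iF (fun x => (f x)%:C) xi) ^+ 2)%:C.
Proof.
move=> df; set X := iF _ xi.
have -> : iF (fun x => (f x)%:C) (- xi) = conjc X.
  apply: complex_eq; rewrite /X /iF /FT /cI /by_parts /=.
  - by apply: eq_Rintegral => x _; rewrite !mul0r !subr0 mulNr cosN.
  - under eq_Rintegral do rewrite mul0r addr0 mulNr sinN mulrN -mulN1r.
    have [_ i2] := iF_int xi df.
    rewrite RintegralZl//; first by rewrite mulN1r; congr (- _); apply: eq_Rintegral => x _; rewrite mul0r addr0.
    by move: i2; under [X in EFin \o X]eq_fun do rewrite Im_real.
by rewrite cabs_sqr; case: X => a b; apply: complex_eq => /=; ring.
Qed.

(** Let [X] be the transform of the real bump. If [kap] were 0, Fubini and inversion would give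
    $\int X(\xi)X(-\xi)d\xi=0$. The integrand is $|X|^2$, so $X(0)$, the integral of the bump, would
    vanish, although the bump is 1 at 0. *)
Lemma kap_neq0 : kap != 0 :> R[i].
Proof.
apply/negP => /eqP k0; pose X : R -> R[i] := iF (bumpC 1).
have db : cdR 2 (bumpC (1 : R)) by have := @cdR_bump R 1 ltr01; rewrite mulr1.
have cX := iF_cont db; have cb := cSM_ccont db.1.
have [C HC] := iF_decay 2 db; have [C' HC'] := cdR_decay 2 db.
have C'0 : 0 <= C' by apply: le_trans (HC' 0); rewrite mulr_ge0 ?cabs_ge0 ?exprn_ge0// addr_ge0.
pose F (z : TR * TR) : R[i] := X z.1 * (bumpC 1 z.2 * expi (- z.1 * z.2)).
have cm (f : R -> R[i]) (p : TR * TR -> TR) : measurable_fun setT p -> ccont f -> cmeas setT (fun z => f (p z)).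
  move=> mp [f1 f2]; split.
      by apply: (@measurableT_comp _ _ _ _ _ _ (fun x : TR => complex.Re (f x)) setT p) => //; exact: continuous_measurable_fun.
    by apply: (@measurableT_comp _ _ _ _ _ _ (fun x : TR => complex.Im (f x)) setT p) => //; exact: continuous_measurable_fun.
have mF : cmeas setT F.
  apply: cmeasM; first exact: cm.
  apply: cmeasM; first exact: cm.
  by apply: cmeas_expi; apply: measurable_funM => //; apply: measurableT_comp.
have iF2 : cintg leb2 setT F.
  apply: (@cintg_W2 _ (C * C')) => // z; rewrite /F !cabsM cabs_expi mulr1 /W2 mulrACA.
  by apply: ler_pM; rewrite ?cabs_ge0//; exact: W1_decay.
have E12 : cI leb2 setT F = cI leb setT (fun xi => X xi * X (- xi)).
  rewrite -(cfub12 iF2) => [|xi].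
    apply: cI_eq => xi _; rewrite /F /= cI_Z//.
    exact: (iF_int (- xi) db).
  by rewrite /F /=; apply: cintgZ => //; exact: (iF_int (- xi) db).
have E21 : cI leb2 setT F = 0.
  rewrite -(cfub21 iF2) => [|x].
    rewrite -[RHS](cI0 leb setT); apply: cI_eq => x _.
    transitivity (bumpC 1 x * J (bumpC 1) x); last by rewrite (inversion x db) k0 !mulr0.
    rewrite /J /FT -cI_Z//; last exact: J_int db.
    by apply: cI_eq => xi _; rewrite /F /= mulrCA mulNr [x * xi]mulrC.
  have := cintgZ (bumpC 1 x) measurableT (J_int x db); rewrite /F /=.
  by under eq_fun do rewrite mulrCA [x * _]mulrC -mulNr.
have S xi : X xi * X (- xi) = (cabs (X xi) ^+ 2)%:C := iF_sym xi db.
have cR : (0 : R) = cabs (X 0) ^+ 2.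
  apply/esym; apply: (@Rint_pos (fun xi => cabs (X xi) ^+ 2)).
  - move=> x; under eq_fun do rewrite cabs_sqr !expr2; case: cX => c1 c2.
    exact: (cvgD (cvgM (c1 x) (c1 x)) (cvgM (c2 x) (c2 x))).
  - by move=> x; exact: sqr_ge0.
  - have [i1 _] : cintg leb setT (fun xi => X xi * X (- xi)).
      apply: (@cintg_W1 _ (C * C)).
        apply: cmeasM; first exact: ccont_cmeas.
        have mo : measurable_fun setT (fun x : TR => - x : TR).
          by apply: continuous_measurable_fun; exact: opp_continuous.
        case: cX => c1 c2; split.
          by apply: (@measurableT_comp _ _ _ _ _ _ (fun x : TR => complex.Re (X x)) setT (fun x : TR => - x : TR)) => //; exact: continuous_measurable_fun.
        by apply: (@measurableT_comp _ _ _ _ _ _ (fun x : TR => complex.Im (X x)) setT (fun x : TR => - x : TR)) => //; exact: continuous_measurable_fun.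
      move=> t; rewrite cabsM; have h1 := W1_decay (HC t); have h2 := HC (- t).
      have C0 : 0 <= C by apply: le_trans (HC 0); rewrite mulr_ge0 ?cabs_ge0 ?exprn_ge0// addr_ge0.
      rewrite mulrC -mulrA; apply: ler_pM; rewrite ?cabs_ge0//.
      apply: le_trans h2; rewrite ler_peMl ?cabs_ge0// exprn_ege1// lerDl//.
    move: i1; congr (_.-integrable _ _); apply/funext => xi; congr (_%:E).
    by rewrite S.
  - have := E12; rewrite E21 => /(congr1 (@complex.Re R)) /esym.
    by rewrite (_ : (fun xi => X xi * X (- xi)) = (fun xi => (cabs (X xi) ^+ 2)%:C)) //; apply/funext => xi; rewrite S.
have X0 : X 0 = 0.
  by apply: cabs0_eq0; apply/eqP; rewrite -sqrf_eq0 -cR.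
have : bump (1 : R) 0 = 0.
  apply: (@Rint_pos (bump 1)).
  - by case: cb.
  - by move=> x; exact: bump_ge0.
  - by have [i1 _] := iF_int 0 db; move: i1; congr (_.-integrable _ _); apply/funext => x /=; rewrite mul0r cos0 sin0 mulr0 subr0 mulr1.
  - have := congr1 (@complex.Re R) X0; rewrite /X /iF /FT /cI /by_parts /= => H.
    by rewrite -[RHS]H; apply: eq_Rintegral => x _; rewrite mul0r cos0 sin0 mulr0 subr0 mulr1.
by rewrite bump1 ?normr0// => /eqP; rewrite oner_eq0.
Qed.

Lemma kap_inv (f : R -> R[i]) A y : cdR A f -> J (fun x => kap^-1 * f x) y = f y.
Proof.
move=> df; have d0 : cdR A (fun=> 0 : R[i]) by split=> //; exact: cSM_cst.
have d1 : cdR A (fun x => kap^-1 * f x).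
  case: df => sf f0; split; first by apply: cSMM => //; exact: cSM_cst.
  by move=> x /f0 ->; rewrite mulr0.
by rewrite (inversion y d1) mulrAC mulVf ?mul1r// kap_neq0.
Qed.

Lemma iF_schwartz (A : R) (f : R -> R[i]) : cdR A f -> schwartz (iF f).
Proof.
move=> df; have wl := @linewt_norm R.
apply: (@FT_schwartz R _ _ leb R (fun t v : R => v * t) (fun t => `|t|) _ _ _ _ _ (fun c => cdR A c)) => //.
- by move=> t u v; rewrite mulrDl.
- by move=> t s v; rewrite -mulrA.
- by move=> t v; rewrite normrM mulrC.
- by move=> v; apply: measurable_funM => //; exact: measurable_cst.
- by move=> c; exact: cdR_rapid.
- move=> c v [sc c0]; split; last by move=> x /c0; rewrite /dFT => ->; rewrite mul0r.
  apply: cSMM => //; split; first exact: SM_cst.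
  by apply: SMM; [exact: SM_cst|exact: SM_id].
- by move=> c p; exact: iF_decay_pow.
Qed.

Lemma fourier1 (K : R -> R[i]) (M : R) : 0 < M -> cSM (1 : R) (fun x => K (expR x)) ->
  exists f beta : R -> R[i], [/\ schwartz f, schwartz beta,
    forall x, `|x| <= M -> f x = K (expR x) &
    forall x, f x = cint1 (fun xi => beta xi * expi (- (x * xi)))].
Proof.
move=> M0 sK; pose f x := K (expR x) * bumpC M x.
have df : cdR (2 * M) f.
  have [sb b0] := cdR_bump M0; split; first exact: cSMM.
  by move=> x /b0; rewrite /f => ->; rewrite mulr0.
have dg : cdR (2 * M) (fun x => kap^-1 * f x).
  case: df => sf f0; split; first by apply: cSMM => //; exact: cSM_cst.
  by move=> x /f0 ->; rewrite mulr0.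
exists f, (iF (fun x => kap^-1 * f x)).
have fE x : f x = FT leb (fun t v : R => - (v * t)) (iF (fun x => kap^-1 * f x)) x.
  by rewrite -[LHS](kap_inv x df).
split=> //.
(* Being a Fourier integral of bounded support, [f] is a Schwartz function in the sense of
   [schwartz]; this passes from [cSM] to [smooth_on]. *)
- rewrite (funext fE); have [p1 p2 p3 p4] := negphase (R := R).
  apply: (@FT_supp_schwartz R _ _ leb R (fun t v : R => - (v * t)) (fun t => `|t|) p1 p2 p3 p4 _ _ (2 * M)) => //.
    by apply: iF_rapid dg; exact: linewt_norm.
  by move=> x Mx; rewrite -fE; case: df => _; exact.
- exact: iF_schwartz dg.
- by move=> x xM; rewrite /f /bumpC bump1// mulr1.
Qed.

End Plane.

(** * Fourier inversion in the plane and representation of symbols of two variables *)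

Section Plane2.
Context {R : realType}.
Local Notation leb := (@lebesgue_measure R).
Local Notation leb2 := ((@lebesgue_measure R) \x (@lebesgue_measure R))%E.
Local Notation TR := (measurableTypeR R).
Local Notation e1 := ((1, 0) : R * R).
Local Notation e2 := ((0, 1) : R * R).
Implicit Types (F G : R * R -> R[i]).

Lemma SM_slice1 (f : R * R -> R) (y : R) : SM e1 f -> SM (1 : R) (fun s => f (s, y)).
Proof.
move=> sf n; move: (sf n) => {sf}; elim: n f => [|n IH] f [cf H].
  split=> // s; apply: (@continuous_comp _ _ _ (fun s => (s, y)) f); last exact: cf.
  exact: (cvg_pair cvg_id (cvg_cst y)).
split; first by move=> s; apply: (@continuous_comp _ _ _ (fun s => (s, y)) f); [exact: (cvg_pair cvg_id (cvg_cst y))|exact: cf].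
case: H => f1 df f1n; exists (fun s => f1 (s, y)); last exact: IH.
move=> s; apply/is_derive_line; have /is_derive_line := df (s, y).
rewrite (_ : (fun t : R => f ((s, y) + _)) = (fun t : R => f (s + t *: (1 : R), y)))//.
by apply/funext => t; congr (f (_, _)); rewrite /= scaler0 addr0.
Qed.

Lemma SM_slice2 (f : R * R -> R) (x : R) : SM e2 f -> SM (1 : R) (fun s => f (x, s)).
Proof.
move=> sf n; move: (sf n) => {sf}; elim: n f => [|n IH] f [cf H].
  split=> // s; apply: (@continuous_comp _ _ _ (fun s => (x, s)) f); last exact: cf.
  exact: (cvg_pair (cvg_cst x) cvg_id).
split; first by move=> s; apply: (@continuous_comp _ _ _ (fun s => (x, s)) f); [exact: (cvg_pair (cvg_cst x) cvg_id)|exact: cf].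
case: H => f1 df f1n; exists (fun s => f1 (x, s)); last exact: IH.
move=> s; apply/is_derive_line; have /is_derive_line := df (x, s).
rewrite (_ : (fun t : R => f ((x, s) + _)) = (fun t : R => f (x, s + t *: (1 : R))))//.
by apply/funext => t; congr (f (_, _)); rewrite /= scaler0 addr0.
Qed.

Definition supp2 (A : R) F : Prop := forall z, A < `|z.1| \/ A < `|z.2| -> F z = 0.

Definition cdP (e : R * R) (A : R) F : Prop := cSM e F /\ supp2 A F.

Lemma cdP_ccont e A F : cdP e A F -> ccont2 F.
Proof. by move=> [[s1 s2] _]; split; [exact: SM_cont s1|exact: SM_cont s2]. Qed.

Lemma cdP_derive e A F : cdP e A F -> exists2 F1, (forall z,
    is_derive z e (fun y => complex.Re (F y)) (complex.Re (F1 z)) /\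
    is_derive z e (fun y => complex.Im (F y)) (complex.Im (F1 z))) & cdP e A F1.
Proof.
move=> [[/SM_der[a da sa] /SM_der[b db sb]] F0].
exists (fun t => a t +i* b t); split=> // z Az.
have near1 : \forall y \near z, A < `|y.1| \/ A < `|y.2|.
  case: Az => Az; near=> y; [left|right]; near: y.
    exact: (cvgr_norm_gt z.1 (@cvg_fst _ _ (nbhs z.1) (nbhs z.2) _)).
  exact: (cvgr_norm_gt z.2 (@cvg_snd _ _ (nbhs z.1) (nbhs z.2) _)).
have H (u u1 : R * R -> R) : (forall x, F x = 0 -> u x = 0) -> (is_derive z e u (u1 z)) -> u1 z = 0.
  move=> u0 [_ <-]; have H0 : is_derive z e (fun=> 0 : R) 0 by exact: is_derive_cst.
  have [//] : is_derive z e u 0.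
  by apply: (near_eq_is_derive _ H0); apply: filterS near1 => y /F0 /u0 ->.
by apply: complex_eq => /=; [apply: (H (fun x => complex.Re (F x)))|apply: (H (fun x => complex.Im (F x)))] => // x ->.
Unshelve. all: by end_near. Qed.

Lemma cdP_bound A F : ccont2 F -> supp2 A F -> exists2 C, 0 <= C & forall z, cabs (F z) <= C.
Proof.
move=> [cr ci] F0.
have H (u : R * R -> R) : continuous u -> exists C, forall z, `|z.1| <= A -> `|z.2| <= A -> `|u z| <= C.
  move=> cu; have : bounded_set (u @` ((`[- A, A]%classic : set R) `*` (`[- A, A]%classic : set R))).
    apply: compact_bounded; apply: continuous_compact; last by apply: compact_setX; exact: segment_compact.
    exact: continuous_subspaceT.
  move=> [M [_ HM]]; exists (M + 1) => x xA yA; apply: (HM (M + 1)); first by rewrite ltrDl.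
  by exists x => //; split; rewrite /= in_itv/= -ler_norml.
have [C1 H1] := H _ cr; have [C2 H2] := H _ ci.
exists (`|C1| + `|C2|); first by rewrite addr_ge0.
move=> z; have [xA|xA] := leP `|z.1| A; last by rewrite F0 ?cabs0 ?addr_ge0//; left.
have [yA|yA] := leP `|z.2| A; last by rewrite F0 ?cabs0 ?addr_ge0//; right.
apply: le_trans (cabs_le_ReIm _) _; apply: lerD.
  exact: le_trans (H1 z xA yA) (ler_norm _).
exact: le_trans (H2 z xA yA) (ler_norm _).
Qed.

Lemma norm_pair (z : R * R) : `|z.1| <= `|z| /\ `|z.2| <= `|z|.
Proof. by rewrite prod_normE; split; rewrite le_max lexx ?orbT. Qed.

Lemma supp2_decay A F (n : nat) : ccont2 F -> supp2 A F ->
  exists C, forall z, (1 + `|z|) ^+ n * cabs (F z) <= C.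
Proof.
move=> cF F0; have [C C0 HC] := cdP_bound cF F0.
exists ((1 + `|A|) ^+ n * C) => z; have [zA|zA] := leP `|z| A; last first.
  rewrite F0 ?cabs0 ?mulr0 ?mulr_ge0 ?exprn_ge0 ?addr_ge0//.
  by move: zA; rewrite prod_normE lt_max => /orP[]; [left|right].
apply: ler_pM; rewrite ?cabs_ge0 ?exprn_ge0 ?addr_ge0//.
by rewrite lerXn2r ?nnegrE ?addr_ge0// lerD2l (le_trans zA)// ler_norm.
Qed.

Lemma W2_decay (b : R * R -> R[i]) C z : (1 + `|z|) ^+ 4 * cabs (b z) <= C -> cabs (b z) <= C * W2 z.
Proof.
move=> H; have [n1 n2] := norm_pair z.
rewrite /W2 /W1 -invfM ler_pdivlMr; last by rewrite mulr_gt0// exprn_gt0// ltr_pwDl.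
apply: le_trans H; rewrite mulrC ler_wpM2r ?cabs_ge0//.
rewrite (_ : 4 = 2 + 2)%N// exprD; apply: ler_pM; rewrite ?exprn_ge0 ?addr_ge0//.
  by rewrite lerXn2r ?nnegrE ?addr_ge0// lerD2l.
by rewrite lerXn2r ?nnegrE ?addr_ge0// lerD2l.
Qed.

(** The plane carries the maximum norm, whence $|v\cdot t|\le2|t||v|$. *)
Definition w2 (z : TR * TR) : R := 2 * `|z : R * R|.

Lemma rapid_plane (b : TR * TR -> R[i]) : cmeas setT b ->
  (forall n : nat, exists C, forall z : R * R, (1 + `|z|) ^+ n * cabs (b z) <= C) -> rapid leb2 w2 b.
Proof.
move=> mb bn; split=> // n; have [C HC] := bn (n + 4)%N.
exists (fun z => 2 ^+ n * C * W2 z); first by apply: intgZl => //; exact: W2_intg.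
move=> z; have z0 : 0 <= `|z : R * R| by [].
apply: le_trans (_ : _ <= (2 * (1 + `|z : R * R|)) ^+ n * cabs (b z)) _.
  rewrite ler_wpM2r ?cabs_ge0// lerXn2r ?nnegrE ?addr_ge0 ?mulr_ge0 ?addr_ge0//.
  by rewrite /w2; lra.
rewrite exprMn -!mulrA ler_wpM2l ?exprn_ge0//.
have := @W2_decay (fun z => (((1 + `|z|) ^+ n)%:C * b z)) C z.
rewrite !cabsM cabs_real ger0_norm ?exprn_ge0 ?addr_ge0//; apply.
by rewrite mulrA -exprD addnC.
Qed.

Lemma cdP_rapid e A F : cdP e A F -> rapid leb2 w2 F.
Proof.
move=> dF; have cF := cdP_ccont dF; apply: rapid_plane; first exact: ccont2_cmeas.
by move=> n; apply: (supp2_decay n cF dF.2).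
Qed.

Definition pp (t v : R * R) : R := v.1 * t.1 + v.2 * t.2.

Lemma pp_phase : [/\ forall (t u v : R * R), pp t (u + v) = pp t u + pp t v,
  forall (t : R * R) (s : R) v, pp t (s *: v) = s * pp t v,
  forall (t : TR * TR) (v : R * R), `|pp t v| <= w2 t * `|v| &
  forall v : R * R, measurable_fun setT (fun t : TR * TR => pp t v)].
Proof.
split=> [t u v|t s v|t v|v].
- by rewrite /pp /=; ring.
- by rewrite /pp /= /GRing.scale /=; ring.
- apply: le_trans (ler_normD _ _) _; rewrite !normrM /w2 -mulrA mulr_natl mulr2n.
  have [t1 t2] := norm_pair t; have [v1 v2] := norm_pair v.
  by apply: lerD; rewrite mulrC ler_pM.
- by apply: measurable_funD; apply: measurable_funM => //; apply: measurableT_comp.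
Qed.

Definition FT2 F : R * R -> R[i] := FT leb2 (fun t v => pp t v) F.

Lemma cdP_slice1 A F (y : R) : cdP e1 A F -> cdR A (fun x => F (x, y)).
Proof.
move=> [[s1 s2] F0]; split; first by split; [exact: (SM_slice1 y s1)|exact: (SM_slice1 y s2)].
by move=> x Ax; apply: F0; left.
Qed.

Lemma cdP_slice2 A F (x : R) : cdP e2 A F -> cdR A (fun y => F (x, y)).
Proof.
move=> [[s1 s2] F0]; split; first by split; [exact: (SM_slice2 x s1)|exact: (SM_slice2 x s2)].
by move=> y Ay; apply: F0; right.
Qed.

Lemma FT2_intg e A F (xi : R * R) : cdP e A F -> cintg leb2 setT (fun t => F t * expi (pp t xi)).
Proof.
move=> dF; have [_ _ _ p4] := pp_phase.
by apply: (@rapid_intg _ _ _ leb2 (R * R)%type (fun t v => pp t v) w2 p4); exact: cdP_rapid dF.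
Qed.

Lemma pp_split (x y : R) (xi : R * R) : expi (pp (x, y) xi) = expi (xi.2 * y) * expi (xi.1 * x) :> R[i].
Proof. by rewrite /pp addrC expiD. Qed.

Lemma FT2_iter12 A F (xi : R * R) : cdP e2 A F ->
  FT2 F xi = cI leb setT (fun x => iF (fun y => F (x, y)) xi.2 * expi (xi.1 * x)).
Proof.
move=> dF; rewrite /FT2 /FT -cfub12; [|exact: FT2_intg dF|].
  apply: cI_eq => x _; rewrite mulrC /iF /FT -cI_Z//; last exact: (iF_int xi.2 (cdP_slice2 x dF)).
  by apply: cI_eq => y _; rewrite pp_split mulrA mulrC.
move=> x; under eq_fun do rewrite pp_split mulrA mulrC.
by apply: cintgZ => //; exact: (iF_int xi.2 (cdP_slice2 x dF)).
Qed.

Lemma FT2_le e A F : cdP e A F -> exists C, forall xi, cabs (FT2 F xi) <= C.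
Proof.
move=> dF; have [_ _ _ p4] := pp_phase.
apply: (@FT_le _ _ _ leb2 (R * R)%type (fun t v => pp t v) w2 p4); exact: cdP_rapid dF.
Qed.

Lemma int_imag_shift e A F F1 (xi : R * R) (s : R) : cdP e A F -> cdP e A F1 ->
  (FT2 F1 xi + (0 +i* s) * FT2 F xi = cI leb2 setT (fun t => (F1 t + (0 +i* s) * F t) * expi (pp t xi))).
Proof.
move=> dF dF1; have i0 := FT2_intg xi dF; have i1 := FT2_intg xi dF1.
rewrite /FT2 /FT -cI_Z// -cI_D//; last exact: cintgZ.
by apply: cI_eq => t _; rewrite mulrDl mulrA.
Qed.

Lemma FT2_derive1 A F F1 (xi : R * R) : cdP e1 A F -> cdP e1 A F1 -> (forall z,
    is_derive z e1 (fun y => complex.Re (F y)) (complex.Re (F1 z)) /\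
    is_derive z e1 (fun y => complex.Im (F y)) (complex.Im (F1 z))) ->
  FT2 F1 xi = - (0 +i* xi.1) * FT2 F xi.
Proof.
move=> dF dF1 D; apply/eqP; rewrite mulNr -subr_eq0 opprK (int_imag_shift _ _ dF dF1); apply/eqP.
have i0 := FT2_intg xi dF; have i1 := FT2_intg xi dF1.
have ii : cintg leb2 setT (fun t => (F1 t + (0 +i* xi.1) * F t) * expi (pp t xi)).
  by under eq_fun do rewrite mulrDl -mulrA; apply: cintgD => //; exact: cintgZ.
have is1 y := iF_int xi.1 (cdP_slice1 y dF1); have is0 y := iF_int xi.1 (cdP_slice1 y dF).
have E x y : (F1 (x, y) + (0 +i* xi.1) * F (x, y)) * expi (pp (x, y) xi) =
   expi (xi.2 * y) * (F1 (x, y) * expi (xi.1 * x) + (0 +i* xi.1) * (F (x, y) * expi (xi.1 * x))).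
  by rewrite pp_split; ring.
have is2 y : cintg leb setT (fun x => F1 (x, y) * expi (xi.1 * x) + (0 +i* xi.1) * (F (x, y) * expi (xi.1 * x))).
  by apply: cintgD => //; exact: cintgZ.
rewrite -(cfub21 ii) => [|y]; last by under eq_fun do rewrite E; exact: cintgZ.
rewrite -[RHS](cI0 leb setT); apply: cI_eq => y _; under [X in cI _ _ X]eq_fun do rewrite E.
rewrite cI_Z// cI_D//; last exact: cintgZ.
rewrite cI_Z//.
have := @iF_derive _ A (fun x => F (x, y)) (fun x => F1 (x, y)) xi.1 _ (cdP_slice1 y dF) (cdP_slice1 y dF1).
rewrite /iF /FT => ->; first by rewrite mulNr addNr mulr0.
move=> x; have [D1 D2] := D (x, y).
have L (f : R * R -> R) l : is_derive (x, y) e1 f l -> is_derive x (1 : R) (fun x => f (x, y)) l.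
  move=> /is_derive_line H; apply/is_derive_line; move: H.
  rewrite (_ : (fun t : R => f ((x, y) + _)) = (fun t : R => f (x + t *: (1 : R), y)))//.
  by apply/funext => t; congr (f (_, _)); rewrite /= scaler0 addr0.
by split; [exact: (L (fun z => complex.Re (F z)))|exact: (L (fun z => complex.Im (F z)))].
Qed.

Lemma FT2_derive2 A F F1 (xi : R * R) : cdP e2 A F -> cdP e2 A F1 -> (forall z,
    is_derive z e2 (fun y => complex.Re (F y)) (complex.Re (F1 z)) /\
    is_derive z e2 (fun y => complex.Im (F y)) (complex.Im (F1 z))) ->
  FT2 F1 xi = - (0 +i* xi.2) * FT2 F xi.
Proof.
move=> dF dF1 D; apply/eqP; rewrite mulNr -subr_eq0 opprK (int_imag_shift _ _ dF dF1); apply/eqP.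
have i0 := FT2_intg xi dF; have i1 := FT2_intg xi dF1.
have ii : cintg leb2 setT (fun t => (F1 t + (0 +i* xi.2) * F t) * expi (pp t xi)).
  by under eq_fun do rewrite mulrDl -mulrA; apply: cintgD => //; exact: cintgZ.
have is1 x := iF_int xi.2 (cdP_slice2 x dF1); have is0 x := iF_int xi.2 (cdP_slice2 x dF).
have E x y : (F1 (x, y) + (0 +i* xi.2) * F (x, y)) * expi (pp (x, y) xi) =
   expi (xi.1 * x) * (F1 (x, y) * expi (xi.2 * y) + (0 +i* xi.2) * (F (x, y) * expi (xi.2 * y))).
  by rewrite pp_split; ring.
have is2 x : cintg leb setT (fun y => F1 (x, y) * expi (xi.2 * y) + (0 +i* xi.2) * (F (x, y) * expi (xi.2 * y))).
  by apply: cintgD => //; exact: cintgZ.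
rewrite -(cfub12 ii) => [|x]; last by under eq_fun do rewrite E; exact: cintgZ.
rewrite -[RHS](cI0 leb setT); apply: cI_eq => x _; under [X in cI _ _ X]eq_fun do rewrite E.
rewrite cI_Z// cI_D//; last exact: cintgZ.
rewrite cI_Z//.
have := @iF_derive _ A (fun y => F (x, y)) (fun y => F1 (x, y)) xi.2 _ (cdP_slice2 x dF) (cdP_slice2 x dF1).
rewrite /iF /FT => ->; first by rewrite mulNr addNr mulr0.
move=> y; have [D1 D2] := D (x, y).
have L (f : R * R -> R) l : is_derive (x, y) e2 f l -> is_derive y (1 : R) (fun y => f (x, y)) l.
  move=> /is_derive_line H; apply/is_derive_line; move: H.
  rewrite (_ : (fun t : R => f ((x, y) + _)) = (fun t : R => f (x, y + t *: (1 : R))))//.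
  by apply/funext => t; congr (f (_, _)); rewrite /= scaler0 addr0.
by split; [exact: (L (fun z => complex.Re (F z)))|exact: (L (fun z => complex.Im (F z)))].
Qed.

Lemma FT2_decay1 A F (p : nat) : cdP e1 A F -> exists C, forall xi, `|xi.1| ^+ p * cabs (FT2 F xi) <= C.
Proof.
elim: p F => [|p IH] F dF.
  by have [C HC] := FT2_le dF; exists C => xi; rewrite expr0 mul1r.
have [F1 d1 dF1] := cdP_derive dF; have [C HC] := IH _ dF1; exists C => xi.
apply: le_trans (HC xi); rewrite (FT2_derive1 xi dF dF1 d1) mulNr cabsN cabsM cabs_imag exprSr.
by rewrite mulrA.
Qed.

Lemma FT2_decay2 A F (p : nat) : cdP e2 A F -> exists C, forall xi, `|xi.2| ^+ p * cabs (FT2 F xi) <= C.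
Proof.
elim: p F => [|p IH] F dF.
  by have [C HC] := FT2_le dF; exists C => xi; rewrite expr0 mul1r.
have [F1 d1 dF1] := cdP_derive dF; have [C HC] := IH _ dF1; exists C => xi.
apply: le_trans (HC xi); rewrite (FT2_derive2 xi dF dF1 d1) mulNr cabsN cabsM cabs_imag exprSr.
by rewrite mulrA.
Qed.

Lemma FT2_decay_pow A F (p : nat) : cdP e1 A F -> cdP e2 A F ->
  exists C, forall xi, `|xi| ^+ p * cabs (FT2 F xi) <= C.
Proof.
move=> d1 d2; have [C1 H1] := FT2_decay1 p d1; have [C2 H2] := FT2_decay2 p d2.
exists (Num.max C1 C2) => xi; rewrite prod_normE le_max.
by case: (leP `|xi.1| `|xi.2|) => _; rewrite ?H1 ?H2 ?orbT.
Qed.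

Lemma FT2_decay A F (n : nat) : cdP e1 A F -> cdP e2 A F ->
  exists C, forall xi, (1 + `|xi|) ^+ n * cabs (FT2 F xi) <= C.
Proof.
move=> d1 d2; apply: (@pow_decay _ _ (fun xi : R * R => `|xi|)) => [t|t|p].
- exact: normr_ge0.
- exact: cabs_ge0.
- exact: (FT2_decay_pow p d1 d2).
Qed.

Lemma FT2_ccont e A F : cdP e A F -> ccont2 (FT2 F).
Proof.
move=> dF; have [p1 p2 p3 p4] := pp_phase.
have H xi := @FT_diff _ _ _ leb2 (R * R)%type (fun t v => pp t v) w2 p1 p2 p3 p4 (fun t => mulr_ge0 (ler0n _ _) (normr_ge0 _)) F xi (cdP_rapid dF).
by split=> xi; apply: differentiable_continuous; case: (H xi).
Qed.

Lemma FT2_rapid A F : cdP e1 A F -> cdP e2 A F -> rapid leb2 w2 (FT2 F).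
Proof.
move=> d1 d2; apply: rapid_plane; first by apply: ccont2_cmeas; exact: FT2_ccont d1.
by move=> n; exact: FT2_decay d1 d2.
Qed.

Lemma SM_coord (e : R * R) : SM e (fun z : R * R => z.1) /\ SM e (fun z : R * R => z.2).
Proof.
split.
- apply: (@SM_intro _ _ _ _ (fun=> e.1)); last exact: SM_cst.
    by move=> z; exact: cvg_fst.
  move=> z; apply/is_derive_line.
  have := is_derive_lin z.1 e.1 0; congr (is_derive _ _ _ _).
- apply: (@SM_intro _ _ _ _ (fun=> e.2)); last exact: SM_cst.
    by move=> z; exact: cvg_snd.
  move=> z; apply/is_derive_line.
  have := is_derive_lin z.2 e.2 0; congr (is_derive _ _ _ _).
Qed.

Lemma FT2_schwartz A F : cdP e1 A F -> cdP e2 A F -> schwartz (FT2 F).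
Proof.
move=> d1 d2; have [p1 p2 p3 p4] := pp_phase.
apply: (@FT_schwartz R _ _ leb2 (R * R)%type (fun t v => pp t v) w2 p1 p2 p3 p4
  (fun t => mulr_ge0 (ler0n _ _) (normr_ge0 _)) (fun c => cdP e1 A c /\ cdP e2 A c)) => //.
- by move=> c [dc _]; exact: cdP_rapid dc.
- move=> c v [[s1 c0] [s2 _]].
  have H e : cSM e c -> cSM e (dFT (fun t v => pp t v) c v).
    move=> sc; apply: cSMM => //; split; first exact: SM_cst.
    have [S1 S2] := SM_coord e.
    by apply: SMD; apply: SMM => //; exact: SM_cst.
  have c0' : supp2 A (dFT (fun t v => pp t v) c v) by move=> z /c0; rewrite /dFT => ->; rewrite mul0r.
  by split; split=> //; exact: H.
- by move=> c p [dc1 dc2]; exact: (FT2_decay_pow p dc1 dc2).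
Qed.

Lemma partial_cdR A F (eta : R) : 0 < A -> cdP e1 A F -> cdP e2 A F ->
  cdR A (fun x => iF (fun y => F (x, y)) eta).
Proof.
move=> A0 d1 d2; split; last first.
  move=> x Ax; rewrite /iF /FT -[RHS](cI0 leb setT); apply: cI_eq => y _.
  by rewrite d1.2 ?mul0r//; left.
have sE : cSM (e1, 0 : R) (fun=> 0 : R[i]) by exact: cSM_cst.
pose F' (z : R * R) := F z * expi (eta * z.2).
have sF : cSM e1 F'.
  apply: cSMM; first exact: d1.1.
  have [_ S2] := SM_coord e1.
  have : cSM e1 (fun z : R * R => cexp (0 +i* (eta * z.2))).
    have Ssc : SM (1 : R) (@cos R) /\ SM (1 : R) (@sin R).
      suff H n : Cn (1 : R) n (@cos R) /\ Cn (1 : R) n (@sin R) by split=> n; case: (H n).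
      elim: n => [|n [IH1 IH2]].
        by split; split=> //; [exact: continuous_cos|exact: continuous_sin].
      split; split; try exact: continuous_cos; try exact: continuous_sin.
        by exists (fun x => - sin x); [move=> x; exact: is_derive_cos|exact: CnN].
      by exists (@cos R) => // x; exact: is_derive_sin.
    under eq_fun do rewrite cexp_imag; case: Ssc => S3 S4.
    by split; apply: SM_comp => //; apply: SMM => //; exact: SM_cst.
  by under eq_fun do rewrite cexp_imag.
(* The bounded support allows the integral to be taken over a compact interval, as [SM_par]
   requires. *)
have AA : - (A + 1) < A + 1 by lra.
have trunc (u : R * R -> R) : (forall z, A < `|z.2| -> u z = 0) ->
    (fun x => \int[leb]_(y in `[- (A + 1), A + 1]) u (x, y)) = (fun x => \int[leb]_(y in setT) u (x, y)).
  move=> u0; apply/funext => x; rewrite Rintegral_mkcond; apply: eq_Rintegral => y _.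
  rewrite patchE; case: ifPn => //; rewrite notin_setE /= in_itv/= -ler_norml => /negP.
  by rewrite -ltNge => yA; rewrite u0//= (lt_trans _ yA)// ltrDl.
have z0 z : A < `|z.2| -> F' z = 0 by move=> Az; rewrite /F' d1.2 ?mul0r//; right.
case: sF => sr si.
have e1E : (e1 : R * R) = ((1 : R), (0 : R)) by [].
have := SM_par AA (F := fun z => complex.Re (F' z)) (e := (1 : R)) sr.
have := SM_par AA (F := fun z => complex.Im (F' z)) (e := (1 : R)) si.
rewrite (trunc (fun z => complex.Im (F' z))) => [H2|z /z0 ->//].
rewrite (trunc (fun z => complex.Re (F' z))) => [H1|z /z0 ->//].
by split.
Qed.

Definition FTm2 (b : R * R -> R[i]) : R * R -> R[i] := FT leb2 (fun t v => - pp t v) b.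

Lemma pp_phaseN : [/\ forall (t u v : R * R), - pp t (u + v) = - pp t u + - pp t v,
  forall (t : R * R) (s : R) v, - pp t (s *: v) = s * (- pp t v),
  forall (t : TR * TR) (v : R * R), `|- pp t v| <= w2 t * `|v| &
  forall v : R * R, measurable_fun setT (fun t : TR * TR => - pp t v)].
Proof.
have [p1 p2 p3 p4] := pp_phase; split=> [t u v|t s v|t v|v].
- by rewrite p1 opprD.
- by rewrite p2 mulrN.
- by rewrite normrN.
- rewrite (_ : (fun t => _) = (fun t : TR * TR => (-1) * pp t v)); last by apply/funext => t; rewrite mulN1r.
  by apply: measurable_funM => //; exact: measurable_cst.
Qed.

(** One-dimensional inversion twice, for the partial transform in the first variable and for the
    slice in the second; each gives one factor [kap]. *)
Lemma inversion2 A F (x : R * R) : 0 < A -> cdP e1 A F -> cdP e2 A F ->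
  FTm2 (FT2 F) x = kap * kap * F x.
Proof.
move=> A0 d1 d2; have [p1 p2 p3 p4] := pp_phaseN; case: x => x y.
have rF := FT2_rapid d1 d2.
have iF2 : cintg leb2 setT (fun t => FT2 F t * expi (- pp t (x, y))).
  exact: (@rapid_intg _ _ _ leb2 (R * R)%type (fun t v => - pp t v) w2 p4 (FT2 F) (x, y) rF).
have df eta := partial_cdR eta A0 d1 d2.
have E xi eta : FT2 F (xi, eta) = iF (fun x => iF (fun y => F (x, y)) eta) xi.
  by rewrite (FT2_iter12 _ d2).
have Ex xi eta : FT2 F (xi, eta) * expi (- pp (xi, eta) (x, y)) =
   expi (- (y * eta)) * (iF (fun x => iF (fun y => F (x, y)) eta) xi * expi (- (x * xi))).
  by rewrite E /pp /= opprD expiD; ring.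
rewrite /FTm2 /FT -(cfub21 iF2) => [|eta]; last first.
  by under eq_fun do rewrite Ex; apply: cintgZ => //; exact: (J_int x (df eta)).
have in1 eta : cI leb setT (fun xi => FT2 F (xi, eta) * expi (- pp (xi, eta) (x, y))) =
    kap * (iF (fun y => F (x, y)) eta * expi (- (y * eta))).
  under [X in cI _ _ X]eq_fun do rewrite Ex.
  rewrite cI_Z//; last exact: (J_int x (df eta)).
  have := inversion x (df eta); rewrite /J /FT => ->; by ring.
under [X in cI _ _ X]eq_fun do rewrite in1.
have dx := cdP_slice2 x d2.
rewrite cI_Z//; last exact: (J_int y dx).
have := inversion y dx; rewrite /J /FT => ->; by ring.
Qed.

Lemma fourier2 (K : R -> R -> R[i]) (M : R) : 0 < M ->
  (forall e : R * R, cSM e (fun z : R * R => K (expR z.1) (expR z.2))) ->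
  exists f beta : R * R -> R[i], [/\ schwartz f, schwartz beta,
    forall z, `|z.1| <= M -> `|z.2| <= M -> f z = K (expR z.1) (expR z.2) &
    forall x, f x = cint2 (fun xi => beta xi * expi (- (x.1 * xi.1 + x.2 * xi.2)))].
Proof.
move=> M0 sK; pose f z := K (expR z.1) (expR z.2) * (bumpC M z.1 * bumpC M z.2).
have M2 : 0 < 2 * M by rewrite mulr_gt0.
have df e c : cdP e (2 * M) (fun z => c * f z).
  have [S1 S2] := SM_coord e; split.
    apply: cSMM; first exact: cSM_cst.
    by apply: cSMM => //; apply: cSMM; apply: cSM_real; apply: SM_comp => //; exact: SM_bump.
  move=> z Mz; suff -> : f z = 0 by rewrite mulr0.
  by rewrite /f /bumpC; case: Mz => Mz; rewrite (bump0 M0 (ltW Mz)) ?mul0r !mulr0.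
pose c : R[i] := (kap * kap)^-1.
exists f, (FT2 (fun z => c * f z)).
have fE x : f x = FTm2 (FT2 (fun z => c * f z)) x.
  rewrite (inversion2 x M2 (df e1 c) (df e2 c)) mulrA mulfV ?mul1r//.
  by rewrite mulf_neq0 ?kap_neq0.
split=> //.
- rewrite (funext fE); have [p1 p2 p3 p4] := pp_phaseN.
  apply: (@FT_supp_schwartz R _ _ leb2 (R * R)%type (fun t v => - pp t v) w2 p1 p2 p3 p4
     (fun t => mulr_ge0 (ler0n _ _) (normr_ge0 _)) _ (2 * M)).
    exact: FT2_rapid (df e1 c) (df e2 c).
  move=> x Mx; rewrite -/(FTm2 _ x) -fE -[f x]mul1r; apply: (df e1 1).2.
  by move: Mx; rewrite prod_normE lt_max => /orP[]; [left|right].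
- exact: FT2_schwartz (df e1 c) (df e2 c).
- by move=> z z1 z2; rewrite /f /bumpC !bump1// !mulr1.
Qed.

End Plane2.

(** * Uniqueness of the modular functional calculus *)

Section Radii.
Context {R : realType} {theta : R}.
Local Notation St := (storus theta).

Definition distinct_grid (c0 c1 c2 : R) : Prop := forall n i j k,
  (i <= n.*2.+1)%N -> (j <= n.*2.+1)%N -> (k <= n.*2.+1)%N ->
  [/\ gridc c0 n.*2.+1 i != gridc c1 n.*2.+1 j, gridc c1 n.*2.+1 j != gridc c2 n.*2.+1 k &
      gridc c2 n.*2.+1 k != gridc c0 n.*2.+1 i].

Definition radius (h : St) (M c : R) : Prop := [/\ 0 < c, c <= M & forall x, l2 (h * x) <= c * l2 x].

(* The radii are proportional to 4m, 4m+1, 4m+2, and the grid points are radius * odd / N,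
   so that points of two grids differ modulo 4. *)
Lemma radii_ex (h : St) (e : R) : 0 < e -> exists c0 c1 c2 : R,
  [/\ radius h (nc_norm theta (sv h) + e) c0, radius h (nc_norm theta (sv h) + e) c1,
      radius h (nc_norm theta (sv h) + e) c2 & distinct_grid c0 c1 c2].
Proof.
move=> e0; set B := nc_norm theta (sv h).
have B0 : 0 <= B := nc_norm_ge0 h.
(* The smallest radius will be $B+e/2=4m\cdot$[kap]; this choice of [m] makes $2\cdot$[kap] at most
   $e/2$, so the largest radius stays within $B+e$. *)
have [m Hm] : exists m : nat, (B + e / 2) / e < m%:R.
  exists (Num.truncn ((B + e / 2) / e)).+1; exact: truncnS_gt.
have m0 : 0 < m%:R :> R.
  by apply: le_lt_trans Hm; rewrite divr_ge0 ?addr_ge0 ?(ltW e0)// divr_ge0 ?(ltW e0).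
have mN : (0 < m)%N by rewrite -(ltr_nat R).
have m4 : 0 < (4 * m)%:R :> R by rewrite ltr0n; lia.
pose kap : R := (B + e / 2) / (4 * m)%:R.
have k0 : 0 < kap by rewrite divr_gt0// ltr_wpDl// divr_gt0.
have k1 : kap * (4 * m)%:R = B + e / 2 by rewrite /kap divfK// gt_eqF.
have k2 : kap * 2 <= e / 2.
  rewrite /kap mulrAC ler_pdivrMr//.
  move: Hm; rewrite ltr_pdivrMr// natrM; lra.
have rad i : (i <= 2)%N -> radius h (B + e) (kap * (4 * m + i)%:R).
  move=> i2; have Hi : B + e / 2 <= kap * (4 * m + i)%:R.
    by rewrite natrD mulrDr k1 lerDl mulr_ge0// ltW.
  split.
  - by rewrite mulr_gt0// ltr0n; lia.
  - rewrite natrD mulrDr k1; have : kap * i%:R <= kap * 2 by rewrite ler_pM2l// ler_nat.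
    lra.
  - move=> x; apply: le_trans (l2_nc_norm h x) _; rewrite ler_wpM2r ?l2_ge0//.
    by apply: le_trans Hi; rewrite lerDl divr_ge0// ltW.
have neq a b n i j : (a <= 2)%N -> (b <= 2)%N -> a != b ->
    (i <= n.*2.+1)%N -> (j <= n.*2.+1)%N ->
    gridc (kap * (4 * m + a)%:R) n.*2.+1 i != gridc (kap * (4 * m + b)%:R) n.*2.+1 j.
  move=> a2 b2 ab hi hj; apply/eqP => H.
  have N0 : (n.*2.+1)%:R != 0 :> R by rewrite pnatr_eq0.
  have : ((4 * m + a)%:Z * ((n.*2.+1)%:Z - 2 * i%:Z) = (4 * m + b)%:Z * ((n.*2.+1)%:Z - 2 * j%:Z))%R.
    apply: (@intr_inj R); rewrite !(rmorphM, rmorphB)/= -!pmulrn.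
    have k0' : kap != 0 by rewrite gt_eqF.
    apply: (mulfI k0'); move: H; rewrite /gridc => /(congr1 (fun x => x * (n.*2.+1)%:R)).
    have F (c k : R) : (c - 2 * c * k / (n.*2.+1)%:R) * (n.*2.+1)%:R = c * ((n.*2.+1)%:R - 2 * k).
      by field.
    by rewrite !F !mulrA.
  move: ab a2 b2; case: a {H} => [|[|[|a]]]; case: b => [|[|[|b]]] //= _ _ _;
    nia.
exists (kap * (4 * m + 0)%:R), (kap * (4 * m + 1)%:R), (kap * (4 * m + 2)%:R).
split; [exact: rad|exact: rad|exact: rad|].
by move=> n i j k hi hj hk; split; apply: neq.
Qed.

End Radii.

(** * Torus-valued integrals taken coefficientwise, and oscillatory traces *)

Section Coefficients.
Context {R : realType} {theta : R}.
Local Notation leb := (@lebesgue_measure R).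
Local Notation leb2 := ((@lebesgue_measure R) \x (@lebesgue_measure R))%E.
Local Notation TR := (measurableTypeR R).
Local Notation St := (storus theta).

Lemma schwartz_decay (V : normedModType R) (f : V -> R[i]) n : schwartz f ->
  exists C, forall t, (1 + `|t|) ^+ n * cabs (f t) <= C.
Proof.
move=> [_ H]; apply: (@pow_decay R V (fun t => `|t|) (fun t => cabs (f t))) => //.
  by move=> t; exact: cabs_ge0.
move=> p; have [M HM] := H p [::]; exists (M + M) => t; have [H1 H2] := HM t.
apply: le_trans (lerD H1 H2); rewrite -mulrDr; apply: ler_wpM2l; first exact: exprn_ge0.
exact: cabs_le_ReIm.
Qed.

Lemma schwartz_cont (V : normedModType R) (f : V -> R[i]) : schwartz f ->
  continuous (fun x => complex.Re (f x)) /\ continuous (fun x => complex.Im (f x)).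
Proof.
by move=> [H _]; split=> x; have [H1 H2] := H [::] x I; exact: differentiable_continuous.
Qed.

(** Coefficients are traces; identities for traces therefore determine elements of the torus. *)
Lemma sv_trE (x : St) p : sv x p = tr (starS (dl theta p) * x).
Proof.
rewrite star_dl -scalerAl trZ /tr svM nc_mulE (@sumZ2_pt _ _ (- p)).
  rewrite /mterm /dl/= /delta eqxx mulr1 sub0r opprK mulrA -phD.
  rewrite (_ : p.1 * p.2 + - p.2 * p.1 = 0) ?ph0 ?mul1r; last by ring.
  by rewrite (_ : (0, 0) - - p = p)//; case: p => p1 p2; congr (_, _); rewrite /= opprK add0r.
by move=> m mp; rewrite /mterm /dl/= /delta (negbTE mp) mulr0 mul0r.
Qed.

Section Measurable.
Context d (T : measurableType d).
Implicit Types (X Y : T -> St).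

Definition smeas X : Prop := forall p, cmeas setT (fun t => sv (X t) p).

Lemma smeas_cst x : smeas (fun=> x).
Proof. by move=> p; exact: cmeas_cst. Qed.

Lemma smeasM X Y : smeas X -> smeas Y -> smeas (fun t => X t * Y t).
Proof.
move=> mX mY p.
apply: (@cmeas_lim _ _ _ setT (fun N t => \sum_(m <- boxs N) mterm theta (sv (X t)) (sv (Y t)) p m)).
  move=> N; apply: cmeas_sum => m; apply: cmeasM => //; apply: cmeasM => //; exact: cmeas_cst.
by move=> t _; rewrite svM; apply: mul_cvg (snuP 0 _) (snuP 0 _).
Qed.

End Measurable.

Lemma sder_smeas d (T : measurableType d) (X : R -> St) (phi : T -> R) :
  (forall x, exists x', sder X x x') -> measurable_fun setT phi -> smeas (fun t => X (phi t)).
Proof.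
move=> dX mphi p.
have [c1 c2] : cmeas (setT : set TR) (fun x => sv (X x) p).
  by apply: cdiff_cmeas => // x; have [x' Hx] := dX x; eexists; exact: sder_coef Hx.
split.
- exact: (@measurableT_comp _ _ _ _ _ _ (fun x => complex.Re (sv (X x) p)) setT phi c1).
- exact: (@measurableT_comp _ _ _ _ _ _ (fun x => complex.Im (sv (X x) p)) setT phi c2).
Qed.

Lemma imagE (t : R) : 0 +i* t = t%:C * (0 +i* 1) :> R[i].
Proof. by apply: complex_eq; rewrite ?(Re_real, Im_real) /= ?mulr0 ?mulr1. Qed.

Lemma smeas_E d (T : measurableType d) (h : St) z w (phi : T -> R) : measurable_fun setT phi ->
  smeas (fun t => E h (z + (phi t)%:C * w)).
Proof. by move=> mphi; apply: (sder_smeas (X := fun x => E h (z + x%:C * w))) => // x; eexists; exact: sder_E. Qed.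

Lemma smeas_DE d (T : measurableType d) (h a : St) z w (phi : T -> R) : measurable_fun setT phi ->
  smeas (fun t => DE h a (z + (phi t)%:C * w)).
Proof. by move=> mphi; apply: (sder_smeas (X := fun x => DE h a (z + x%:C * w))) => // x; eexists; exact: sder_DE. Qed.

Lemma smeas_Ei d (T : measurableType d) (g : St) z (psi : T -> R) : measurable_fun setT psi ->
  smeas (fun t => E g (z + (0 +i* psi t))).
Proof. by move=> mp; under eq_fun do rewrite imagE; exact: smeas_E. Qed.

Lemma smeas_DEi d (T : measurableType d) (g b : St) z (psi : T -> R) : measurable_fun setT psi ->
  smeas (fun t => DE g b (z + (0 +i* psi t))).
Proof. by move=> mp; under eq_fun do rewrite imagE; exact: smeas_DE. Qed.

Section Representation.
Context d (T : measurableType d) (mu : {measure set T -> \bar R}).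
Variables (b : T -> R[i]) (g : T -> R).
Hypotheses (mb : cmeas setT b) (bg : forall t, cabs (b t) <= g t).
Hypothesis ig : mu.-integrable setT (EFin \o g).

(** The integral [r] is given only by its coefficients and is not known to be rapidly decreasing.
    Uniformly bounded coefficients of [Y] are enough to multiply [r] by smooth elements. *)
Definition rep (Y : T -> St) (r : nctorus R) : Prop :=
  [/\ smeas Y, exists C, forall t p, cabs (sv (Y t) p) <= C &
      forall p, r p = cI mu setT (fun t => b t * sv (Y t) p)].

Lemma rep_intg Y p C : smeas Y -> (forall t p, cabs (sv (Y t) p) <= C) ->
  cintg mu setT (fun t => b t * sv (Y t) p).
Proof.
move=> mY YC; apply: (@cintg_dom _ _ _ mu setT _ (fun t => C * g t)) => //.
- exact: cmeasM.
- by move=> t _; rewrite cabsM mulrC ler_pM ?cabs_ge0.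
- exact: intgZl.
Qed.

(** The convolution is a limit of box sums, and dominated convergence exchanges this limit with the
    integral. *)
Lemma rep_mull X Y r : rep Y r -> rep (fun t => X * Y t) (nc_mul theta (sv X) r).
Proof.
move=> [mY [C YC] rY].
have XYC t p : cabs (sv (X * Y t) p) <= C * snu 0 X.
  rewrite svM nc_mulE; apply: sumZ2_le; apply: sbnd_mterm (YC t).
  exact: sbnd_wabs0 (snuP 0 X).
split; first by apply: smeasM => //; exact: smeas_cst.
  by exists (C * snu 0 X) => t p.
move=> q; rewrite nc_mulE sumZ2E; apply: ccvg_clim.
apply: (@ccvg_eq _ (fun N => cI mu setT (fun t => b t * \sum_(m <- boxs N) mterm theta (sv X) (sv (Y t)) q m))).
  move=> N; pose c m := nc_phase theta (m.2 * (q.1 - m.1)) * sv X m.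
  have -> : \sum_(m <- boxs N) mterm theta (sv X) r q m =
     \sum_(m <- boxs N) cI mu setT (fun t => c m * (b t * sv (Y t) (q - m))).
    apply: eq_bigr => m _; rewrite cI_Z//; last exact: rep_intg mY YC.
    by rewrite /mterm rY.
  rewrite -cI_sum//; last by move=> m; apply: cintgZ => //; exact: rep_intg mY YC.
  apply: cI_eq => t _; rewrite mulr_sumr; apply: eq_bigr => m _.
  by rewrite /mterm /c mulrCA.
apply: (@cI_dct _ _ _ mu setT _ _ (fun t => C * snu 0 X * g t)) => //; last exact: intgZl.
- move=> N; apply: cmeasM => //; apply: cmeas_sum => m; apply: cmeasM => //; exact: cmeas_cst.
- move=> t _; apply: ccvgMl; rewrite svM.
  exact: mul_cvg (snuP 0 _) (snuP 0 _).
- move=> N t _; rewrite cabsM mulrC ler_pM ?cabs_ge0//.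
  apply: le_trans (cabs_sum _ _ _) _.
  have HS : sbnd (fun m => cabs (mterm theta (sv X) (sv (Y t)) q m)) (C * snu 0 X).
    by apply: sbnd_mterm (YC t); exact: sbnd_wabs0 (snuP 0 X).
  exact: HS (boxs_uniq N).
Qed.

Lemma rep_mulr X Y r : rep Y r -> rep (fun t => Y t * X) (nc_mul theta r (sv X)).
Proof.
move=> [mY [C YC] rY].
have XYC t p : cabs (sv (Y t * X) p) <= C * snu 0 X.
  rewrite svM nc_mulE; apply: sumZ2_le; apply: sbnd_mtermr (YC t) _.
  exact: sbnd_wabs0 (snuP 0 X).
split; first by apply: smeasM => //; exact: smeas_cst.
  by exists (C * snu 0 X) => t p.
move=> q; rewrite nc_mulE sumZ2E; apply: ccvg_clim.
apply: (@ccvg_eq _ (fun N => cI mu setT (fun t => b t * \sum_(m <- boxs N) mterm theta (sv (Y t)) (sv X) q m))).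
  move=> N; pose c m := nc_phase theta (m.2 * (q.1 - m.1)) * sv X (q - m).
  have -> : \sum_(m <- boxs N) mterm theta r (sv X) q m =
     \sum_(m <- boxs N) cI mu setT (fun t => c m * (b t * sv (Y t) m)).
    apply: eq_bigr => m _; rewrite cI_Z//; last exact: rep_intg mY YC.
    by rewrite /mterm rY /c mulrAC.
  rewrite -cI_sum//; last by move=> m; apply: cintgZ => //; exact: rep_intg mY YC.
  apply: cI_eq => t _; rewrite mulr_sumr; apply: eq_bigr => m _.
  by rewrite /mterm /c; move: (nc_phase _ _) (sv X _) (b t) (sv (Y t) m) => x1 x2 x3 x4; ring.
apply: (@cI_dct _ _ _ mu setT _ _ (fun t => C * snu 0 X * g t)) => //; last exact: intgZl.
- move=> N; apply: cmeasM => //; apply: cmeas_sum => m; apply: cmeasM; last exact: cmeas_cst.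
  by apply: cmeasM => //; exact: cmeas_cst.
- move=> t _; apply: ccvgMl; rewrite svM.
  exact: mul_cvg (snuP 0 _) (snuP 0 _).
- move=> N t _; rewrite cabsM mulrC ler_pM ?cabs_ge0//.
  apply: le_trans (cabs_sum _ _ _) _.
  have HS : sbnd (fun m => cabs (mterm theta (sv (Y t)) (sv X) q m)) (C * snu 0 X).
    by apply: sbnd_mtermr (YC t) _; exact: sbnd_wabs0 (snuP 0 X).
  exact: HS (boxs_uniq N).
Qed.

Lemma rep_sum n (Y : 'I_n -> T -> St) (r : 'I_n -> nctorus R) : (forall l, rep (Y l) (r l)) ->
  rep (fun t => \sum_(l < n) Y l t) (\sum_(l < n) r l).
Proof.
move=> H; split.
- move=> p; under eq_fun do rewrite sv_sum; apply: cmeas_sum => l; by case: (H l).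
- have /choice[C HC] : forall l, exists c : R, forall t p, cabs (sv (Y l t) p) <= c.
    by move=> l; case: (H l).
  exists (\sum_(l < n) C l) => t p; rewrite sv_sum; apply: le_trans (cabs_sum _ _ _) _.
  exact: ler_sum.
- move=> p; rewrite fct_sumE.
  rewrite (eq_bigr (fun l => cI mu setT (fun t => b t * sv (Y l t) p))); last first.
    by move=> l _; case: (H l) => _ _ ->.
  rewrite -cI_sum//; last by move=> l; case: (H l) => mY [C YC] _; exact: rep_intg mY YC.
  by apply: cI_eq => t _; rewrite sv_sum mulr_sumr.
Qed.

Lemma rep_tr Y r : rep Y r -> phi0 r = cI mu setT (fun t => b t * tr (Y t)).
Proof. by move=> [_ _ H]; exact: H. Qed.

End Representation.

Lemma ymodE (h x : St) (xi : R) :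
  ymod theta (sv h) xi (sv x) = sv (E h (0 +i* xi) * x * E h (0 +i* (- xi))).
Proof. by rewrite /ymod /nc_pow !nc_expE !svM. Qed.

Section Quad.
Variables (h : St).
Hypothesis sa_h : starS h = h.
Variables (c0 c1 c2 M : R).
Hypotheses (h0 : radius h M c0) (h1 : radius h M c1) (h2 : radius h M c2).

Local Notation Q := (Q h c0 c1 c2).

Lemma c0_gt0 : 0 < c0. Proof. by case: h0. Qed.
Lemma c1_gt0 : 0 < c1. Proof. by case: h1. Qed.
Lemma c2_gt0 : 0 < c2. Proof. by case: h2. Qed.
Lemma l2_c0 x : l2 (h * x) <= c0 * l2 x. Proof. by case: h0. Qed.
Lemma l2_c1 x : l2 (h * x) <= c1 * l2 x. Proof. by case: h1. Qed.
Lemma l2_c2 x : l2 (h * x) <= c2 * l2 x. Proof. by case: h2. Qed.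

Lemma Re_imD (z : R[i]) (t : R) : complex.Re (z + (0 +i* t)) = complex.Re z.
Proof. by rewrite Re_add /= addr0. Qed.

Lemma exp3_im (z0 z1 z2 : R[i]) (t0 t1 t2 x0 x1 x2 : R) :
  exp3 (z0 + (0 +i* t0)) (z1 + (0 +i* t1)) (z2 + (0 +i* t2)) x0 x1 x2 =
  exp3 z0 z1 z2 x0 x1 x2 * expi (t0 * x0 + t1 * x1 + t2 * x2).
Proof.
have L (z : R[i]) (t x : R) : cexp ((z + (0 +i* t)) * x%:C) = cexp (z * x%:C) * expi (t * x).
  rewrite mulrDl cexpD -cexp_imag; congr (_ * cexp _).
  by apply: complex_eq; rewrite ?(Re_mul, Im_mul) /=; ring.
by rewrite /exp3 !L !expiD; ring.
Qed.

Lemma B3_im (z0 z1 z2 : R[i]) (t0 t1 t2 : R) :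
  B3 c0 c1 c2 (z0 + (0 +i* t0)) (z1 + (0 +i* t1)) (z2 + (0 +i* t2)) = B3 c0 c1 c2 z0 z1 z2.
Proof. by rewrite /B3 !Re_imD. Qed.

Lemma ddx_diag (s : R[i]) (x : R) : ddx s x x = s * cexp (s * x%:C).
Proof.
rewrite /ddx (_ : (fun t : R => _) = fun=> s * cexp (s * x%:C)); last first.
  by apply/funext => t; congr (_ * cexp (_ * _%:C)); ring.
by apply: complex_eq; rewrite /cI /by_parts /= int01_cst.
Qed.

Section Oscillation.
Context d (T : measurableType d) (mu : {measure set T -> \bar R}).
Variables (b : T -> R[i]) (g : T -> R).
Hypotheses (mb : cmeas setT b) (ig : mu.-integrable setT (EFin \o g)).
Implicit Types psi : T -> R.

Lemma Q_intb (G : T -> R) F V (B : T -> R) x y y' : mu.-integrable setT (EFin \o G) -> (forall t, Q x y y' (F t) (V t) (B t)) ->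
  (forall t, cabs (b t) * B t <= G t) ->
  (forall x0 x1 x2, cmeas setT (fun t => F t x0 x1 x2)) -> cmeas setT V ->
  (exists C, Q x y y' (fun x0 x1 x2 => cI mu setT (fun t => b t * F t x0 x1 x2))
    (cI mu setT (fun t => b t * V t)) C) /\ cintg mu setT (fun t => b t * V t).
Proof.
move=> iG QF Bg mF mV; split; last first.
  apply: (@cintg_dom _ _ _ mu setT _ (fun t => snu 0 x * snu 0 y * snu 0 y' * G t)) => //.
  - exact: cmeasM.
  - move=> t _; rewrite cabsM; apply: le_trans (ler_wpM2l (cabs_ge0 _) (Q_bound (QF t))) _.
    by rewrite mulrCA ler_wpM2l ?mulr_ge0 ?snu_ge0.
  - exact: intgZl.
eexists.
apply: (@Q_int _ _ _ _ _ _ c0_gt0 c1_gt0 c2_gt0 _ _ mu setT (fun t x0 x1 x2 => b t * F t x0 x1 x2)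
  (fun t => b t * V t) G) => //.
- by move=> t _; apply: (Q_le (Bg t)); exact: QZ.
- by move=> x0 x1 x2; exact: cmeasM.
Qed.

(** Imaginary exponents leave the bound [B3] unchanged, so integrability of the amplitude is
    enough. *)
Lemma Q_osc psi0 psi1 psi2 (z0 z1 z2 : R[i]) x y y' :
  measurable_fun setT psi0 -> measurable_fun setT psi1 -> measurable_fun setT psi2 ->
  (forall t, cabs (b t) <= g t) ->
  let V t := tr (x * E h (z0 + (0 +i* psi0 t)) * y * E h (z1 + (0 +i* psi1 t)) * y' *
    E h (z2 + (0 +i* psi2 t))) in
  (exists C, Q x y y' (fun x0 x1 x2 => exp3 z0 z1 z2 x0 x1 x2 *
      cI mu setT (fun t => b t * expi (psi0 t * x0 + psi1 t * x1 + psi2 t * x2)))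
    (cI mu setT (fun t => b t * V t)) C) /\ cintg mu setT (fun t => b t * V t).
Proof.
move=> m0 m1 m2 bg V.
have mV : cmeas setT V.
  have : smeas (fun t => x * E h (z0 + (0 +i* psi0 t)) * y * E h (z1 + (0 +i* psi1 t)) * y' *
      E h (z2 + (0 +i* psi2 t))).
    by apply: smeasM; [apply: smeasM; [apply: smeasM; [apply: smeasM; [apply: smeasM|]|]|]|];
      [exact: smeas_cst|exact: smeas_Ei|exact: smeas_cst|exact: smeas_Ei|exact: smeas_cst|exact: smeas_Ei].
  exact.
have mph x0 x1 x2 : cmeas setT (fun t => expi (psi0 t * x0 + psi1 t * x1 + psi2 t * x2)).
  apply: cmeas_expi; apply: measurable_funD; first apply: measurable_funD;
    by apply: measurable_funM => //; exact: measurable_cst.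
have bg1 t : cabs (b t) * B3 c0 c1 c2 z0 z1 z2 <= g t * B3 c0 c1 c2 z0 z1 z2.
  by rewrite ler_wpM2r// B3_ge0.
have ig' : mu.-integrable setT (EFin \o (fun t => g t * B3 c0 c1 c2 z0 z1 z2)).
  by under eq_fun do rewrite mulrC; exact: intgZl.
have [|||[C HC] iV] := @Q_intb _ (fun t => exp3 (z0 + (0 +i* psi0 t)) (z1 + (0 +i* psi1 t)) (z2 + (0 +i* psi2 t)))
   V (fun=> B3 c0 c1 c2 z0 z1 z2) x y y' ig' _ bg1.
- move=> t; rewrite -(B3_im z0 z1 z2 (psi0 t) (psi1 t) (psi2 t)).
  by apply: (Q_exp sa_h c0_gt0 c1_gt0 c2_gt0 l2_c0 l2_c1 l2_c2).
- move=> x0 x1 x2; under eq_fun do rewrite exp3_im; apply: cmeasM => //; exact: cmeas_cst.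
- exact: mV.
split=> //; exists C; apply: Q_ext HC => x0 x1 x2.
rewrite -cI_Z//; first by apply: cI_eq => t _; rewrite exp3_im mulrCA.
apply: (@cintg_dom _ _ _ mu setT _ g) => //; first exact: cmeasM.
by move=> t _; rewrite cabsM cabs_expi mulr1.
Qed.

Lemma cmeas_ddx (s : R[i]) (sg : T -> R) (x y : R) : measurable_fun setT sg ->
  cmeas setT (fun t => ddx (s + (0 +i* sg t)) x y).
Proof.
move=> ms.
have mE (u : R) : cmeas setT (fun t => cexp ((s + (0 +i* sg t)) * u%:C)).
  have -> : (fun t => cexp ((s + (0 +i* sg t)) * u%:C)) = (fun t => cexp (s * u%:C) * expi (sg t * u)).
    apply/funext => t; rewrite mulrDl cexpD -cexp_imag; congr (_ * cexp _).
    by apply: complex_eq; rewrite ?(Re_mul, Im_mul) /=; ring.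
  apply: cmeasM; first exact: cmeas_cst.
  by apply: cmeas_expi; apply: measurable_funM => //; exact: measurable_cst.
have mI : cmeas setT (fun t => s + (0 +i* sg t)).
  by apply: cmeasD; [exact: cmeas_cst|split => //; exact: measurable_cst].
have [->|xy] := eqVneq x y.
  by under eq_fun do rewrite ddx_diag; exact: cmeasM.
under eq_fun do rewrite ddxE//.
apply: cmeasM; last exact: cmeas_cst.
apply: cmeasD => //; under eq_fun do rewrite -mulN1r.
by apply: cmeasM => //; exact: cmeas_cst.
Qed.

(** By [Q_duhamel] each factor [DE] costs one factor $|s|$, which grows linearly along an affine
    exponent; hence the weighted bound on the amplitude. *)
Lemma Q_dosc (sg0 sg1 sg2 psi0 psi1 psi2 : T -> R) (s0 s1 s2 z0 z1 z2 : R[i]) x y y' :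
  measurable_fun setT sg0 -> measurable_fun setT sg1 -> measurable_fun setT sg2 ->
  measurable_fun setT psi0 -> measurable_fun setT psi1 -> measurable_fun setT psi2 ->
  (forall t, cabs (b t) * (cabs (s0 + (0 +i* sg0 t)) * cabs (s1 + (0 +i* sg1 t)) *
     cabs (s2 + (0 +i* sg2 t))) <= g t) ->
  let V t := tr (DE h x (s0 + (0 +i* sg0 t)) * E h (z0 + (0 +i* psi0 t)) *
       DE h y (s1 + (0 +i* sg1 t)) * E h (z1 + (0 +i* psi1 t)) *
       DE h y' (s2 + (0 +i* sg2 t)) * E h (z2 + (0 +i* psi2 t))) in
  (exists C, Q x y y' (fun x0 x1 x2 => cI mu setT (fun t => b t *
      dd3 (s0 + (0 +i* sg0 t)) (s1 + (0 +i* sg1 t)) (s2 + (0 +i* sg2 t))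
          (z0 + (0 +i* psi0 t)) (z1 + (0 +i* psi1 t)) (z2 + (0 +i* psi2 t)) x0 x1 x2))
    (cI mu setT (fun t => b t * V t)) C) /\ cintg mu setT (fun t => b t * V t).
Proof.
move=> n0 n1 n2 m0 m1 m2 bg V.
have mV : cmeas setT V.
  have : smeas (fun t => DE h x (s0 + (0 +i* sg0 t)) * E h (z0 + (0 +i* psi0 t)) *
       DE h y (s1 + (0 +i* sg1 t)) * E h (z1 + (0 +i* psi1 t)) *
       DE h y' (s2 + (0 +i* sg2 t)) * E h (z2 + (0 +i* psi2 t))).
    by apply: smeasM; [apply: smeasM; [apply: smeasM; [apply: smeasM; [apply: smeasM|]|]|]|];
      [exact: smeas_DEi|exact: smeas_Ei|exact: smeas_DEi|exact: smeas_Ei|exact: smeas_DEi|exact: smeas_Ei].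
  exact.
have mph x0 x1 x2 : cmeas setT (fun t => expi (psi0 t * x0 + psi1 t * x1 + psi2 t * x2)).
  apply: cmeas_expi; apply: measurable_funD; first apply: measurable_funD;
    by apply: measurable_funM => //; exact: measurable_cst.
pose a0 := `|complex.Re s0|; pose a1 := `|complex.Re s1|; pose a2 := `|complex.Re s2|.
pose b0 := `|complex.Re z0|; pose b1 := `|complex.Re z1|; pose b2 := `|complex.Re z2|.
pose N := a0 + a1 + a2 + b0 + b1 + b2.
pose K := 8 * (expR (c0 * N) * expR (c1 * N) * expR (c2 * N)).
have K0 : 0 <= K by rewrite !mulr_ge0 ?expR_ge0.
have ig' : mu.-integrable setT (EFin \o (fun t => K * g t)) by exact: intgZl.
apply: (@Q_intb _ _ _ (fun t => 8 * (cabs (s0 + (0 +i* sg0 t)) * cabs (s1 + (0 +i* sg1 t)) *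
     cabs (s2 + (0 +i* sg2 t)) * (expR (c0 * N) * expR (c1 * N) * expR (c2 * N)))) _ _ _ ig').
- move=> t; have [p0 p1 p2] : [/\ 0 <= a0, 0 <= a1 & 0 <= a2] by rewrite /a0 /a1 /a2 !normr_ge0.
  have [q0 q1 q2] : [/\ 0 <= b0, 0 <= b1 & 0 <= b2] by rewrite /b0 /b1 /b2 !normr_ge0.
  by apply: (Q_duhamel sa_h c0_gt0 c1_gt0 c2_gt0 l2_c0 l2_c1 l2_c2); rewrite !Re_imD /N -/a0 -/a1 -/a2 -/b0 -/b1 -/b2; lra.
- move=> t; apply: le_trans (ler_wpM2l K0 (bg t)); rewrite le_eqVlt; apply/orP; left; apply/eqP.
  by rewrite /K; ring.
- move=> x0 x1 x2; rewrite /dd3.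
  under eq_fun do rewrite exp3_im.
  apply: cmeasM; first by apply: cmeasM; [apply: cmeasM|]; exact: cmeas_ddx.
  by apply: cmeasM => //; exact: cmeas_cst.
- exact: mV.
Qed.

End Oscillation.

End Quad.

Lemma schwartz_W1 (b : R -> R[i]) n : schwartz b -> exists C, forall t,
  (1 + `|t|) ^+ n * cabs (b t) <= C * W1 t.
Proof.
move=> /(schwartz_decay (n + 2))[C HC]; exists C => t.
by rewrite ler_pdivlMr ?exprn_gt0 ?ltr_pwDl// mulrAC -exprD.
Qed.

Lemma schwartz_W2 (b : R * R -> R[i]) : schwartz b -> exists C, forall t, cabs (b t) <= C * W2 t.
Proof. by move=> /(schwartz_decay 4)[C HC]; exists C => t; exact: W2_decay. Qed.

Lemma schwartz_cmeas (b : R -> R[i]) : schwartz b -> cmeas (setT : set TR) b.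
Proof. by move=> /schwartz_cont; exact: ccont_cmeas. Qed.

Lemma schwartz_cmeas2 (b : R * R -> R[i]) : schwartz b -> cmeas (setT : set (TR * TR)%type) b.
Proof. by move=> /schwartz_cont; exact: ccont2_cmeas. Qed.

Lemma W1C_intg (C : R) : leb.-integrable setT (EFin \o (fun t => C * W1 t)).
Proof. by apply: intgZl => //; exact: W1_intg. Qed.

Lemma W2C_intg (C : R) : leb2.-integrable setT (EFin \o (fun t => C * W2 t)).
Proof. by apply: intgZl => //; exact: W2_intg. Qed.

Lemma radius_bound (h : St) M c0 c1 c2 x0 x1 x2 (e : R) : radius h M c0 -> radius h M c1 -> radius h M c2 ->
  2 * M < e -> inbox c0 c1 c2 x0 x1 x2 -> `|x1 - x0| < e /\ `|x2 - x1| < e.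
Proof.
move=> [_ r0 _] [_ r1 _] [_ r2 _] Me [b0 b1 b2].
by have := ler_normB x1 x0; have := ler_normB x2 x1; split; lra.
Qed.

Section Calculus.
Variable h : St.
Hypothesis sa_h : starS h = h.

Lemma exp3_0 x0 x1 x2 : exp3 0 0 0 x0 x1 x2 = 1 :> R[i].
Proof. by rewrite /exp3 !mul0r cexp0 !mul1r. Qed.

(** The coefficient of index [p] is the value assigned to $f(x_1-x_0)$ with the letters
    [starS (dl theta p)], [x] and 1. On the grids two choices of [f] both coincide with
    $K(e^{x_1-x_0})$. *)
Lemma fcalc1_uniq K (x : St) r r' : fcalc1_spec theta (sv h) K (sv x) r ->
  fcalc1_spec theta (sv h) K (sv x) r' -> r = r'.
Proof.
move=> [f [b [_ sb [e e0 fK] fb ->]]] [f' [b' [_ sb' [e' e0' fK'] fb' ->]]].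
(* With radii at most $\|h\|+d$, differences of grid points are at most $2\|h\|+2d<2\|h\|+3d$, which
   lies inside both neighbourhoods. *)
pose d := Num.min e e' / 3.
have d0 : 0 < d by rewrite divr_gt0// lt_min e0 e0'.
have de : 3 * d <= e by rewrite mulrC divfK// ge_min lexx.
have de' : 3 * d <= e' by rewrite mulrC divfK// ge_min lexx orbT.
have [c0 [c1 [c2 [h0 h1 h2 dg]]]] := radii_ex h d0.
have V (f1 b1 : R -> R[i]) p : schwartz b1 ->
    (forall x, f1 x = cint1 (fun xi => b1 xi * expi (- (x * xi)))) -> exists C,
    Q h c0 c1 c2 (starS (dl theta p)) x 1 (fun x0 x1 x2 => f1 (x1 - x0))
      (cint1 (fun xi => b1 xi * ymod theta (sv h) xi (sv x) p)) C.
  move=> s1 fb1; have [C0 HC0] := schwartz_W1 0 s1.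
  have [||||||[C HC] _] := @Q_osc h sa_h c0 c1 c2 _ h0 h1 h2 _ _ leb b1 (fun t => C0 * W1 t)
    _ _ id (fun t => - t) (fun=> 0) 0 0 0 (starS (dl theta p)) x 1.
  - exact: schwartz_cmeas.
  - exact: W1C_intg.
  - exact: measurable_id.
  - exact: measurableT_comp.
  - exact: measurable_cst.
  - by move=> t; have := HC0 t; rewrite expr0 mul1r.
  exists C; move: HC.
  have -> : cI leb setT (fun t => b1 t * tr (starS (dl theta p) * E h (0 + (0 +i* t)) * x *
       E h (0 + (0 +i* - t)) * 1 * E h (0 + (0 +i* 0)))) =
     cint1 (fun xi => b1 xi * ymod theta (sv h) xi (sv x) p).
    apply: cI_eq => t _; rewrite ymodE sv_trE; congr (_ * tr _).
    rewrite !add0r (_ : 0 +i* 0 = 0)// E0.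
    by move: (E h _) (E h _) (starS _) => A B D; rewrite !mulr1 !mulrA.
  apply: Q_ext => x0 x1 x2; rewrite exp3_0 mul1r fb1.
  by apply: cI_eq => t _; congr (_ * expi _); ring.
apply/funext => p.
have [C HC] := V f b p sb fb; have [C' HC'] := V f' b' p sb' fb'.
have p0 : 0 < c0 by case: h0. have p1 : 0 < c1 by case: h1. have p2 : 0 < c2 by case: h2.
apply: (Q_uniq p0 p1 p2 dg _ HC HC') => x0 x1 x2 bx _ _ _.
have [H1 _] := @radius_bound _ _ _ _ _ _ _ _ (2 * nc_norm theta (sv h) + 3 * d) h0 h1 h2 (ltac:(lra)) bx.
by rewrite fK ?fK'//; apply: lt_le_trans H1 _; lra.
Qed.

Lemma fcalc1E K (x : St) r : fcalc1_spec theta (sv h) K (sv x) r -> fcalc1 theta (sv h) K (sv x) = r.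
Proof.
move=> H; apply: (fcalc1_uniq _ H); rewrite /fcalc1.
by case: xgetP => [y -> //|/(_ r)].
Qed.

(** As in [fcalc1_uniq], now with the function $f(x_1-x_0,x_2-x_1)$: the first modular variable
    compares gaps 0 and 1, the second gaps 1 and 2. *)
Lemma fcalc2_uniq K (x y : St) r r' : fcalc2_spec theta (sv h) K (sv x) (sv y) r ->
  fcalc2_spec theta (sv h) K (sv x) (sv y) r' -> r = r'.
Proof.
move=> [f [b [_ sb [e e0 fK] fb ->]]] [f' [b' [_ sb' [e' e0' fK'] fb' ->]]].
pose d := Num.min e e' / 3.
have d0 : 0 < d by rewrite divr_gt0// lt_min e0 e0'.
have de : 3 * d <= e by rewrite mulrC divfK// ge_min lexx.
have de' : 3 * d <= e' by rewrite mulrC divfK// ge_min lexx orbT.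
have [c0 [c1 [c2 [h0 h1 h2 dg]]]] := radii_ex h d0.
have V (f1 b1 : R * R -> R[i]) p : schwartz b1 ->
    (forall x, f1 x = cint2 (fun xi => b1 xi * expi (- (x.1 * xi.1 + x.2 * xi.2)))) -> exists C,
    Q h c0 c1 c2 (starS (dl theta p)) x y (fun x0 x1 x2 => f1 (x1 - x0, x2 - x1))
      (cint2 (fun xi => b1 xi * nc_mul theta (ymod theta (sv h) xi.1 (sv x))
         (ymod theta (sv h) xi.2 (sv y)) p)) C.
  move=> s1 fb1; have [C0 HC0] := schwartz_W2 s1.
  have [||||||[C HC] _] := @Q_osc h sa_h c0 c1 c2 _ h0 h1 h2 _ _ leb2 b1 (fun t => C0 * W2 t)
    _ _ (fun t => t.1) (fun t => t.2 - t.1) (fun t => - t.2) 0 0 0 (starS (dl theta p)) x y.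
  - exact: schwartz_cmeas2.
  - exact: W2C_intg.
  - exact: measurable_fst.
  - by apply: measurable_funB; [exact: measurable_snd|exact: measurable_fst].
  - by apply: measurableT_comp => //; exact: measurable_snd.
  - exact: HC0.
  exists C; move: HC.
  have -> : cI leb2 setT (fun t => b1 t * tr (starS (dl theta p) * E h (0 + (0 +i* t.1)) * x *
       E h (0 + (0 +i* (t.2 - t.1))) * y * E h (0 + (0 +i* - t.2)))) =
     cint2 (fun xi => b1 xi * nc_mul theta (ymod theta (sv h) xi.1 (sv x))
         (ymod theta (sv h) xi.2 (sv y)) p).
    apply: cI_eq => t _; rewrite !ymodE -svM sv_trE; congr (_ * tr _).
    rewrite !add0r (_ : 0 +i* (t.2 - t.1) = 0 +i* (- t.1) + (0 +i* t.2)); last first.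
      by apply: complex_eq; rewrite ?(Re_add, Im_add) /= ?addr0// addrC.
    rewrite E_add; move: (E h _) (E h _) (E h _) (E h _) (starS _) => A B D F G.
    by rewrite !mulrA.
  apply: Q_ext => x0 x1 x2; rewrite exp3_0 mul1r fb1.
  by apply: cI_eq => t _; congr (_ * expi _) => /=; ring.
apply/funext => p.
have [C HC] := V f b p sb fb; have [C' HC'] := V f' b' p sb' fb'.
have p0 : 0 < c0 by case: h0. have p1 : 0 < c1 by case: h1. have p2 : 0 < c2 by case: h2.
apply: (Q_uniq p0 p1 p2 dg _ HC HC') => x0 x1 x2 bx _ _ _.
have [H1 H2] := @radius_bound _ _ _ _ _ _ _ _ (2 * nc_norm theta (sv h) + 3 * d) h0 h1 h2 (ltac:(lra)) bx.
by rewrite fK ?fK'//=; first [apply: lt_le_trans H1 _|apply: lt_le_trans H2 _]; lra.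
Qed.

Lemma fcalc2E K (x y : St) r : fcalc2_spec theta (sv h) K (sv x) (sv y) r ->
  fcalc2 theta (sv h) K (sv x) (sv y) = r.
Proof.
move=> H; apply: (fcalc2_uniq _ H); rewrite /fcalc2.
by case: xgetP => [z -> //|/(_ r)].
Qed.

End Calculus.

End Coefficients.

(** * The identity behind I and II *)

(** [X], [Y], [Z] stand for $e^{x_0},e^{x_1},e^{x_2}$, [Xj], [Yj], [Zj] for their powers of exponent
    $j$, and [t10] for $T(e^{x_1-x_0})$, and so on. The identity is linear in the six values of $T$,
    which are independent variables. *)
Lemma II_field (F : fieldType) (X Y Z Xj Yj Zj t10 t01 t12 t21 t02 t20 : F) :
  X != 0 -> Y != 0 -> Z != 0 -> Xj != 0 -> Yj != 0 -> Zj != 0 -> X - Y != 0 -> Y - Z != 0 -> Z - X != 0 ->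
  (Y - X) * (Z - Y) * (Xj * t10 - Zj * t12) + (Y - X) * (Z - Y) * (Yj * (t01 - t21))
  - (X - Z) * (Z - Y) * (Zj * (t12 - t02)) - (X - Z) * (Y - X) * (Zj * t02 - Yj * t01)
  - (X - Z) * (Z - Y) * (Yj * t21 - Xj * t20) - (X - Z) * (Y - X) * (Xj * (t20 - t10)) =
  (X - Z) * (Y - X) * (Z - Y) * (Xj / X *
   (t10 * ((Zj / Xj - 1) / (Z / X - 1)) +
    (Yj / Y / (Xj / X) * ((t01 - t21) / (X / Y - Z / Y)) -
     Y / X * (Zj / Z / (Xj / X)) * ((t12 - t10) / (Y / Z - Y / X))) +
    (- ((Yj / Xj - 1) / (Y / X - 1) * t21) +
     Z / Y * ((t20 - t21) / (Z / X - Z / Y)) -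
     (t20 - t10) / (Z / X - Y / X)) +
    (- ((Yj / Xj - 1) / (Y / X - 1) * (Zj / Yj) * t12) -
     (Zj / Xj * t02 - Yj / Xj * t01) / (Z / X - Y / X) +
     Z / Y * ((Zj / Xj * t02 - Zj / Yj * t12) / (Z / X - Z / Y))))).
Proof.
move=> X0 Y0 Z0 Xj0 Yj0 Zj0 XY YZ ZX.
have YX : Y - X != 0 by rewrite -opprB oppr_eq0.
have ZY : Z - Y != 0 by rewrite -opprB oppr_eq0.
have XZ : X - Z != 0 by rewrite -opprB oppr_eq0.
(* Once the denominators are written as products, the side conditions of [field] are exactly
   nonvanishing of the letters and of their differences. *)
have d1 : Z / X - 1 = (Z - X) / X by field.
have d2 : X / Y - Z / Y = (X - Z) / Y by field.
have d3 : Y / Z - Y / X = Y * (X - Z) / (X * Z) by field; rewrite ?X0 ?Y0 ?Z0.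
have d4 : Y / X - 1 = (Y - X) / X by field.
have d5 : Z / X - Z / Y = Z * (Y - X) / (X * Y) by field; rewrite ?X0 ?Y0 ?Z0.
have d6 : Z / X - Y / X = (Z - Y) / X by field.
rewrite d1 d2 d3 d4 d5 d6.
field.
by rewrite ?X0 ?Y0 ?Z0 ?Xj0 ?Yj0 ?YX ?XZ ?ZX ?ZY.
Qed.

Section Identity.
Context {R : realType}.
Variables (T : R -> R[i]) (j : R).

Lemma dquotE (g : R -> R[i]) (x y : R) : x != y -> dquot g x y = (g x - g y) / (x%:C - y%:C).
Proof. by move=> xy; rewrite /dquot (negbTE xy) rmorphB. Qed.

Lemma dquot_val (g : R -> R[i]) (x y : R) (gx gy X Y : R[i]) : x != y -> g x = gx -> g y = gy ->
  x%:C = X -> y%:C = Y -> dquot g x y = (gx - gy) / (X - Y).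
Proof. by move=> xy <- <- <- <-; exact: dquotE. Qed.

Lemma expR_diff (x y : R) : (expR (x - y))%:C = (expR x)%:C / (expR y)%:C :> R[i].
Proof. by rewrite expRB rmorphM fmorphV. Qed.

Lemma cpow_diff (i x y : R) : cpow i (expR (x - y)) = (expR (i * x))%:C / (expR (i * y))%:C :> R[i].
Proof. by rewrite cpow_expR mulrBr expR_diff. Qed.

Lemma expRC_neq0 (x : R) : (expR x)%:C != 0 :> R[i].
Proof. by rewrite eq_complex /= negb_and gt_eqF ?expR_gt0. Qed.

Lemma expRC_neq (x y : R) : x != y -> (expR x)%:C - (expR y)%:C != 0 :> R[i].
Proof.
move=> xy; rewrite -rmorphB eq_complex /= negb_and subr_eq0.
by rewrite (contra_neq (@expR_inj R x y)).
Qed.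

Lemma Ifun_exp (x0 x1 : R) : (expR (j * x0))%:C * Ifun T j (expR (x1 - x0)) =
  - ((expR (j * x1))%:C * T (expR (x0 - x1))) - (expR (j * x0))%:C * T (expR (x1 - x0)).
Proof.
rewrite /Ifun cpow_diff -expRN opprB; have := expRC_neq0 (j * x0).
move: (T _) (T _) (expR (j * x0))%:C (expR (j * x1))%:C => A B X Y X0.
by field.
Qed.

(** The left side collects the coefficients produced by [term1] to [term6], those from the third on
    with a minus sign; the right side is that of [term7]. The common factor [vdm] is left out. *)
Lemma IIfun_exp (x0 x1 x2 : R) : x0 != x1 -> x1 != x2 -> x2 != x0 ->
  let X := (expR x0)%:C in let Y := (expR x1)%:C in let Z := (expR x2)%:C in
  let Xj := (expR (j * x0))%:C in let Yj := (expR (j * x1))%:C in let Zj := (expR (j * x2))%:C in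
  let t x y := T (expR (x - y)) in
  (Y - X) * (Z - Y) * (Xj * t x1 x0 - Zj * t x1 x2) + (Y - X) * (Z - Y) * (Yj * (t x0 x1 - t x2 x1))
  - (X - Z) * (Z - Y) * (Zj * (t x1 x2 - t x0 x2)) - (X - Z) * (Y - X) * (Zj * t x0 x2 - Yj * t x0 x1)
  - (X - Z) * (Z - Y) * (Yj * t x2 x1 - Xj * t x2 x0) - (X - Z) * (Y - X) * (Xj * (t x2 x0 - t x1 x0)) =
  (X - Z) * (Y - X) * (Z - Y) * ((expR ((j - 1) * x0))%:C * IIfun T j (expR (x1 - x0)) (expR (x2 - x1))).
Proof.
move=> d01 d12 d20 X Y Z Xj Yj Zj t.
have e1 : (1 : R) = expR (0 : R) by rewrite expR0.
have E20 : expR (x1 - x0) * expR (x2 - x1) = expR (x2 - x0) by rewrite -expRD; congr expR; ring.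
have V10 : (expR (x1 - x0))^-1 = expR (x0 - x1) by rewrite -expRN; congr expR; ring.
have V21 : (expR (x2 - x1))^-1 = expR (x1 - x2) by rewrite -expRN; congr expR; ring.
have V20 : (expR (x2 - x0))^-1 = expR (x0 - x2) by rewrite -expRN; congr expR; ring.
have nq (x y : R) : x != y -> expR x != expR y by apply: contra_neq => /expR_inj.
have n20 : expR (x2 - x0) != 1 by rewrite e1; apply: nq; rewrite subr_eq0.
have n10 : expR (x1 - x0) != 1 by rewrite e1; apply: nq; rewrite subr_eq0 eq_sym.
have m1 : expR (x0 - x1) != expR (x2 - x1) by apply: nq; rewrite (inj_eq (addIr _)) eq_sym.
have m2 : expR (x1 - x2) != expR (x1 - x0) by apply: nq; rewrite (inj_eq (addrI _)) (inj_eq oppr_inj).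
have m3 : expR (x2 - x0) != expR (x2 - x1) by apply: nq; rewrite (inj_eq (addrI _)) (inj_eq oppr_inj).
have m4 : expR (x2 - x0) != expR (x1 - x0) by apply: nq; rewrite (inj_eq (addIr _)) eq_sym.
have P (i x y : R) : cpow i (expR (x - y)) = (expR (i * x))%:C / (expR (i * y))%:C := cpow_diff i x y.
have ED (x y : R) : (expR (x - y))%:C = (expR x)%:C / (expR y)%:C :> R[i] := expR_diff x y.
have c1 : cpow j (1 : R) = 1 by rewrite /cpow powR1.
have J1 (x : R) : (expR ((j - 1) * x))%:C = (expR (j * x))%:C / (expR x)%:C :> R[i].
  by rewrite mulrBl mul1r expR_diff.
have q1 : dquot (cpow j) (expR (x2 - x0)) 1 = (Zj / Xj - 1) / (Z / X - 1).
  by apply: dquot_val.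
have q2 : dquot T (expR (x0 - x1)) (expR (x2 - x1)) = (t x0 x1 - t x2 x1) / (X / Y - Z / Y).
  by apply: dquot_val.
have q3 : dquot T (expR (x1 - x2)) (expR (x1 - x0)) = (t x1 x2 - t x1 x0) / (Y / Z - Y / X).
  by apply: dquot_val.
have q4 : dquot (cpow j) (expR (x1 - x0)) 1 = (Yj / Xj - 1) / (Y / X - 1).
  by apply: dquot_val.
have q5 : dquot T (expR (x2 - x0)) (expR (x2 - x1)) = (t x2 x0 - t x2 x1) / (Z / X - Z / Y).
  by apply: dquot_val.
have q6 : dquot T (expR (x2 - x0)) (expR (x1 - x0)) = (t x2 x0 - t x1 x0) / (Z / X - Y / X).
  by apply: dquot_val.
have q7 : dquot (twist T j) (expR (x2 - x0)) (expR (x1 - x0)) =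
    (Zj / Xj * t x0 x2 - Yj / Xj * t x0 x1) / (Z / X - Y / X).
  by apply: dquot_val => //; rewrite /twist ?V20 ?V10; congr (_ * _).
have q8 : dquot (twist T j) (expR (x2 - x0)) (expR (x2 - x1)) =
    (Zj / Xj * t x0 x2 - Zj / Yj * t x1 x2) / (Z / X - Z / Y).
  by apply: dquot_val => //; rewrite /twist ?V20 ?V21; congr (_ * _).
have I1 : Defs.II1 T j (expR (x1 - x0)) (expR (x2 - x1)) = t x1 x0 * ((Zj / Xj - 1) / (Z / X - 1)).
  by rewrite /Defs.II1 E20 q1.
have I2 : II2 T j (expR (x1 - x0)) (expR (x2 - x1)) =
   (Yj / Y) / (Xj / X) * ((t x0 x1 - t x2 x1) / (X / Y - Z / Y)) -
   (Y / X) * ((Zj / Z) / (Xj / X)) * ((t x1 x2 - t x1 x0) / (Y / Z - Y / X)).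
  by rewrite /II2 E20 V10 V21 q2 q3 (P _ x1) (P _ x2) (J1 x1) (J1 x0) (J1 x2) ED.
have I3 : II3 T j (expR (x1 - x0)) (expR (x2 - x1)) =
   - ((Yj / Xj - 1) / (Y / X - 1) * t x2 x1) + (Z / Y) * ((t x2 x0 - t x2 x1) / (Z / X - Z / Y)) -
   (t x2 x0 - t x1 x0) / (Z / X - Y / X).
  by rewrite /II3 E20 q4 q5 q6 ED.
have I4 : II4 T j (expR (x1 - x0)) (expR (x2 - x1)) =
   - ((Yj / Xj - 1) / (Y / X - 1) * (Zj / Yj) * t x1 x2)
   - (Zj / Xj * t x0 x2 - Yj / Xj * t x0 x1) / (Z / X - Y / X)
   + (Z / Y) * ((Zj / Xj * t x0 x2 - Zj / Yj * t x1 x2) / (Z / X - Z / Y)).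
  by rewrite /II4 E20 V21 q4 q7 q8 P ED.
rewrite /IIfun I1 I2 I3 I4 J1.
by apply: II_field; rewrite ?expRC_neq0 ?expRC_neq// eq_sym.
Qed.

End Identity.

(** * Variation of the functional *)

Section Variation.
Context {R : realType} {theta : R}.
Local Notation leb := (@lebesgue_measure R).
Local Notation TR := (measurableTypeR R).
Local Notation St := (storus theta).

Lemma is_cderive_int d (Y : measurableType d) (mu : {measure set Y -> \bar R})
    (F F' : R -> Y -> R[i]) (G : Y -> R) :
  (forall e y, is_cderive (F ^~ y) e (F' e y)) ->
  (forall e, `|e| <= 1 -> cintg mu setT (F e)) ->
  (forall e y, `|e| <= 1 -> cabs (F' e y) <= G y) ->
  mu.-integrable setT (EFin \o G) ->
  is_cderive (fun e => cI mu setT (F e)) 0 (cI mu setT (F' 0)).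
Proof.
move=> dF iF FG iG.
have HI : (`](-1), 1[%classic : set R) 0 by rewrite /= in_itv/= ltrN10 ltr01.
have sub (s : R) : (`](-1), 1[%classic : set R) s -> `|s| <= 1.
  by rewrite /= in_itv/= ler_norml => /andP[/ltW-> /ltW->].
have G0 y : 0 <= G y by apply: le_trans (cabs_ge0 _) (FG 0 y _); rewrite normr0.
have key (f f' : R -> Y -> R) : (forall e y, is_derive e (1 : R) (f ^~ y) (f' e y)) ->
    (forall e, `|e| <= 1 -> mu.-integrable setT (EFin \o f e)) ->
    (forall e y, `|e| <= 1 -> `|f' e y| <= G y) ->
    is_derive (0 : R) (1 : R) (fun e => \int[mu]_y f e y) (\int[mu]_y f' 0 y).
  move=> df fi fG.
  have D1 e y : partial1of2 f e y = f' e y by rewrite partial1of2E; case: (df e y).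
  have A1 s : (`](-1), 1[%classic : set R) s -> mu.-integrable setT (EFin \o f s) by move=> /sub/fi.
  have A2 s y : (`](-1), 1[%classic : set R) s -> (setT : set Y) y -> derivable (f ^~ y) s 1.
    by move=> _ _; case: (df s y).
  have A5 s y : (`](-1), 1[%classic : set R) s -> (setT : set Y) y -> `|partial1of2 f s y| <= G y.
    by move=> /sub s1 _; rewrite D1 fG.
  split.
  - exact: (@derivable_under_integral _ _ _ mu f setT measurableT 0 (-1) 1 HI A1 A2 _ G0 iG A5).
  - have := @differentiation_under_integral _ _ _ mu f setT measurableT 0 (-1) 1 HI A1 A2 _ G0 iG A5.
    by rewrite derive1E => ->; apply: eq_Rintegral => y _; rewrite D1.
split; apply: (key (fun e y => _ (F e y)) (fun e y => _ (F' e y))).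
- by move=> e y; case: (dF e y).
- by move=> e /iF[].
- by move=> e y e1; apply: le_trans (Re_le_cabs _) (FG e y e1).
- by move=> e y; case: (dF e y).
- by move=> e /iF[].
- by move=> e y e1; apply: le_trans (Im_le_cabs _) (FG e y e1).
Qed.

Lemma sder_shift (f : R -> St) (x : R) f' : sder (fun t => f (x + t)) 0 f' -> sder f x f'.
Proof.
move=> H p; have [C HC] := H p; exists C => t t1.
by have := HC t t1; rewrite add0r addr0.
Qed.

Lemma trM4 (P N Q P' N' Q' : St) :
  tr (((P' * N + P * N') * Q + P * N * Q') * N + P * N * Q * N') =
  tr (P' * N * Q * N) + tr (P * N' * Q * N) + tr (P * N * Q' * N) + tr (P * N * Q * N').
Proof. by rewrite !mulrDl !trD. Qed.

Lemma tr_parts l (D X : St) : tr (nab l D * X) = - tr (D * nab l X).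
Proof. by apply/eqP; rewrite -addr_eq0 -trD -nabM tr_nab. Qed.

Lemma nabM3 l (X Y Z : St) :
  nab l (X * Y * Z) = nab l X * Y * Z + X * nab l Y * Z + X * Y * nab l Z.
Proof. by rewrite !nabM mulrDl. Qed.

Lemma Phi_parts l (P N Q D P' Q' : St) :
  tr (P' * N * Q * N) + tr (P * nab l D * Q * N) + tr (P * N * Q' * N) + tr (P * N * Q * nab l D) =
  tr (P' * 1 * N * Q * N * 1) + tr (Q' * 1 * N * P * N * 1)
  - tr (D * 1 * nab l Q * 1 * N * P) - tr (D * Q * N * 1 * nab l P * 1)
  - tr (D * 1 * nab l P * 1 * N * Q) - tr (D * P * N * 1 * nab l Q * 1)
  - tr (D * Q * nab l N * P * 1 * 1) - tr (D * P * nab l N * Q * 1 * 1).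
Proof.
rewrite !mulr1.
have -> : tr (P * nab l D * Q * N) = - tr (D * nab l (Q * N * P)).
  rewrite -tr_parts -!(mulrA P) trM; congr tr; by rewrite !mulrA.
have -> : tr (P * N * Q * nab l D) = - tr (D * nab l (P * N * Q)).
  by rewrite -tr_parts trM.
have -> : tr (P * N * Q' * N) = tr (Q' * N * P * N).
  by rewrite -(mulrA (P * N)) trM !mulrA.
rewrite !nabM3 !mulrDr !trD !mulrA.
move: (tr _) (tr (Q' * _ * _ * _)) (tr (D * _ * _ * _)) (tr (D * Q * _ * _)) (tr (D * _ * _ * nab l P)).
by move=> *; ring.
Qed.

Variables (h a : St).
Hypotheses (sa_h : starS h = h) (sa_a : starS a = a).
Variable (j : R).

Definition hE (e : R) : St := h + e%:C *: a.
(** As $T(\mathbf y)(\rho)$ is an integral of $k^{i\xi}\rho k^{-i\xi}$ and is preceded by $k^j$, the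
    exponents of $k$ are [wz] and [nz]. Both have the form [z + (0 +i* _)] that [Q_osc] and [Q_dosc]
    expect. *)
Definition wz (xi : R) : R[i] := j%:C + (0 +i* xi).
Definition nz (xi : R) : R[i] := 0 + (0 +i* (- xi)).
Definition NE l e : St := nab l (E (hE e) 1).
Definition Phi l e xi : R[i] := tr (E (hE e) (wz xi) * NE l e * E (hE e) (nz xi) * NE l e).
Definition dPhi l e xi : R[i] :=
  tr (DE (hE e) a (wz xi) * NE l e * E (hE e) (nz xi) * NE l e) +
  tr (E (hE e) (wz xi) * nab l (DE (hE e) a 1) * E (hE e) (nz xi) * NE l e) +
  tr (E (hE e) (wz xi) * NE l e * DE (hE e) a (nz xi) * NE l e) +
  tr (E (hE e) (wz xi) * NE l e * E (hE e) (nz xi) * nab l (DE (hE e) a 1)).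

Lemma star_hE e : starS (hE e) = hE e.
Proof. by rewrite /hE starD starZ sa_h sa_a conjc_real. Qed.

Lemma sder_hE z e : sder (fun t => E (hE t) z) e (DE (hE e) a z).
Proof.
apply: sder_shift; apply: sder_eq (sder_pert (hE e) a z) => t.
by rewrite /hE rmorphD scalerDl addrA.
Qed.

Lemma Phi_der l e xi : is_cderive (Phi l ^~ xi) e (dPhi l e xi).
Proof.
have dN : sder (NE l) e (nab l (DE (hE e) a 1)) by apply: sder_nab; exact: sder_hE.
have := sder_tr (sderM (sderM (sderM (sder_hE (wz xi) e) dN) (sder_hE (nz xi) e)) dN).
by rewrite trM4.
Qed.

Lemma mopp : measurable_fun (setT : set TR) (fun t : TR => - t : TR).
Proof. exact: measurableT_comp. Qed.

Lemma Phi_meas l e : cmeas (setT : set TR) (Phi l e).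
Proof.
have H : smeas (fun xi : TR => E (hE e) (wz xi) * NE l e * E (hE e) (nz xi) * NE l e).
  apply: smeasM; last exact: smeas_cst.
  apply: smeasM; last exact: smeas_Ei mopp.
  by apply: smeasM; [exact: smeas_Ei (@measurable_id _ TR _)|exact: smeas_cst].
exact: H.
Qed.

Lemma snu_hE p e : `|e| <= 1 -> snu p (hE e) <= snu p h + snu p a.
Proof.
move=> e1; apply: le_trans (snuD _ _ _) _; rewrite lerD2l.
by apply: le_trans (snuZle _ _ _) _; rewrite cabs_real ler_piMl ?snu_ge0.
Qed.

Lemma radius_hE e : `|e| <= 1 -> radius (hE e) (snu 0 h + snu 0 a + 1) (snu 0 h + snu 0 a + 1).
Proof.
move=> e1; split=> //; first by rewrite ltr_wpDl// addr_ge0 ?snu_ge0.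
move=> x; apply: le_trans (l2_mul _ _) _; rewrite ler_wpM2r ?l2_ge0//.
by apply: le_trans (snu_hE 0 e1) _; rewrite lerDl.
Qed.

(** Only the bound in [Q] is used, so the three gaps may share one radius; it is chosen uniform in
    [e] for the sake of domination. *)
Lemma tr4_le e (y y' : St) z0 z1 : `|e| <= 1 ->
  cabs (tr (E (hE e) z0 * y * E (hE e) z1 * y')) <= snu 0 y * snu 0 y' *
    expR ((snu 0 h + snu 0 a + 1) * (`|complex.Re z0| + `|complex.Re z1|)).
Proof.
move=> e1; have [c0 _ hc] := radius_hE e1; set c := _ + 1 in c0 hc *.
have := Q_bound (Q_exp (star_hE e) c0 c0 c0 hc hc hc 1 y y' z0 z1 0).
have -> : tr (1 * E (hE e) z0 * y * E (hE e) z1 * y' * E (hE e) 0) =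
          tr (E (hE e) z0 * y * E (hE e) z1 * y').
  have := E0 (hE e); move: (E (hE e) 0) (E (hE e) z0) (E (hE e) z1) => X0 X1 X2 ->.
  by rewrite mul1r mulr1.
move=> H; apply: le_trans H _; rewrite /B3 /= normr0 mulr0 expR0 mulr1 mulrDr expRD.
rewrite ler_wpM2r ?mulr_ge0 ?expR_ge0//.
rewrite -mulrA ler_piMl ?mulr_ge0 ?snu_ge0//; exact: snu1.
Qed.

Lemma trD4_le l e s z : `|e| <= 1 ->
  cabs (tr (DE (hE e) a s * NE l e * E (hE e) z * NE l e)) <=
  snu 0 a * (snu 1 h + snu 1 a) * (snu 1 h + snu 1 a) *
   (8 * (cabs s * expR ((snu 0 h + snu 0 a + 1) * (`|complex.Re s| + 2 + `|complex.Re z|)) ^+ 3)).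
Proof.
move=> e1; have [c0 _ hc] := radius_hE e1; set c := _ + 1 in c0 hc *.
have n1 : `|complex.Re (1 : R[i])| = 1 by rewrite /= normr1.
have n0 : `|complex.Re (0 : R[i])| = 0 by rewrite /= normr0.
have s0 := normr_ge0 (complex.Re s); have z0 := normr_ge0 (complex.Re z).
set M := `|complex.Re s| + 2 + `|complex.Re z|.
have H1 : `|complex.Re s| + `|complex.Re (1 : R[i])| + `|complex.Re (0 : R[i])| <= M by rewrite n1 n0 /M; lra.
have H2 : `|complex.Re (1 : R[i])| + `|complex.Re (1 : R[i])| + `|complex.Re z| <= M by rewrite n1 /M; lra.
have H3 : `|complex.Re (1 : R[i])| + `|complex.Re s| + `|complex.Re (0 : R[i])| <= M by rewrite n1 n0 /M; lra.
have := Q_bound (Q_duhamel (star_hE e) c0 c0 c0 hc hc hc a (nab l (hE e)) (nab l (hE e)) H1 H2 H3).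
have -> : tr (DE (hE e) a s * E (hE e) 0 * DE (hE e) (nab l (hE e)) 1 * E (hE e) z *
    DE (hE e) (nab l (hE e)) 1 * E (hE e) 0) = tr (DE (hE e) a s * NE l e * E (hE e) z * NE l e).
  have := nab_E (hE e) l 1; rewrite -/(NE l e) => <-.
  have := E0 (hE e); move: (E (hE e) 0) (DE _ _ _) (NE l e) (E (hE e) z) => X0 X1 X2 X3 ->.
  by rewrite !mulr1.
move=> H; apply: le_trans H _; rewrite cabs1 !mulr1.
have e0 : 0 <= expR (c * M) by exact: expR_ge0.
have -> : expR (c * M) * expR (c * M) * expR (c * M) = expR (c * M) ^+ 3 by rewrite !exprS expr0 mulr1 mulrA.
apply: ler_wpM2r; first by rewrite mulr_ge0// mulr_ge0 ?cabs_ge0// exprn_ge0.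
have Hn : snu 0 (nab l (hE e)) <= snu 1 h + snu 1 a.
  by apply: le_trans (snu_nab _ _ _) _; exact: snu_hE.
rewrite -!mulrA ler_wpM2l ?snu_ge0//; apply: ler_pM; rewrite ?snu_ge0//.
Qed.

Lemma Re_wz xi : complex.Re (wz xi) = j. Proof. by rewrite /wz Re_add /= addr0. Qed.
Lemma Re_nz xi : complex.Re (nz xi) = 0. Proof. by rewrite /nz Re_add /= addr0. Qed.

Lemma cabs_wz xi : cabs (wz xi) <= (1 + `|j|) * (1 + `|xi|).
Proof.
apply: le_trans (cabsD _ _) _; rewrite cabs_real cabs_imag.
have := normr_ge0 j; have := normr_ge0 xi; nra.
Qed.

Lemma cabs_nz xi : cabs (nz xi) <= (1 + `|j|) * (1 + `|xi|).
Proof.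
rewrite /nz add0r cabs_imag normrN.
have := normr_ge0 j; have := normr_ge0 xi; nra.
Qed.

(** Bounds uniform in $|e|\le1$ and of at most linear growth in $\xi$: these dominate the difference
    quotients when the integral over $\xi$ is differentiated. The linear growth comes from the terms
    in which a power of $k$ is varied. *)
Lemma Phi_le l : exists2 C, 0 <= C & forall e xi, `|e| <= 1 ->
  cabs (Phi l e xi) <= C /\ cabs (dPhi l e xi) <= C * (1 + `|xi|).
Proof.
pose c := snu 0 h + snu 0 a + 1; pose H1 := snu 1 h + snu 1 a.
pose KN := expR H1; pose KD := expR (2 * (H1 + snu 1 a + 1)).
pose K := expR (c * (`|j| + 2)).
have c0 : 0 <= c by rewrite /c !addr_ge0 ?snu_ge0.
have H10 : 0 <= H1 by rewrite /H1 !addr_ge0 ?snu_ge0.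
have K0 : 0 <= K := expR_ge0 _.
have j0 := normr_ge0 j.
have nN e : `|e| <= 1 -> snu 0 (NE l e) <= KN.
  move=> e1; apply: le_trans (snu_nab _ _ _) _; apply: le_trans (E_le _ _ _) _.
  by rewrite cabs1 mul1r ler_expR; exact: snu_hE.
have nD e : `|e| <= 1 -> snu 0 (nab l (DE (hE e) a 1)) <= KD.
  move=> e1; apply: le_trans (snu_nab _ _ _) _; apply: le_trans (DE_le _ _ _ _) _.
  rewrite cabs1 mul1r ler_expR ler_pM2l// !lerD2r; exact: snu_hE.
have B4 e y y' z0 z1 k k' : `|e| <= 1 -> snu 0 y <= k -> snu 0 y' <= k' ->
    `|complex.Re z0| + `|complex.Re z1| <= `|j| + 2 ->
    cabs (tr (E (hE e) z0 * y * E (hE e) z1 * y')) <= k * k' * K.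
  move=> e1 yk yk' zz; apply: le_trans (tr4_le _ _ _ _ e1) _.
  apply: ler_pM; rewrite ?mulr_ge0 ?snu_ge0 ?expR_ge0//; first by apply: ler_pM; rewrite ?snu_ge0.
  by rewrite ler_expR; apply: ler_wpM2l.
pose A := snu 0 a * H1 * H1 * (8 * ((1 + `|j|) * K ^+ 3)).
have A0 : 0 <= A.
  rewrite /A; apply: mulr_ge0; first by rewrite !mulr_ge0 ?snu_ge0.
  by apply: mulr_ge0 => //; apply: mulr_ge0; [rewrite addr_ge0|exact: exprn_ge0].
have BD e s z (xi : R) : `|e| <= 1 -> `|complex.Re s| + `|complex.Re z| <= `|j| ->
    cabs s <= (1 + `|j|) * (1 + `|xi|) ->
    cabs (tr (DE (hE e) a s * NE l e * E (hE e) z * NE l e)) <= A * (1 + `|xi|).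
  move=> e1 sz sx; apply: le_trans (trD4_le _ _ _ e1) _.
  have -> : A * (1 + `|xi|) = snu 0 a * H1 * H1 * (8 * ((1 + `|j|) * (1 + `|xi|) * K ^+ 3)) by rewrite /A; ring.
  rewrite ler_wpM2l ?mulr_ge0 ?snu_ge0// ler_wpM2l//.
  apply: ler_pM; rewrite ?cabs_ge0 ?exprn_ge0 ?expR_ge0//.
  rewrite lerXn2r ?nnegrE ?expR_ge0// ler_expR ler_wpM2l//; lra.
have Rw xi : `|complex.Re (wz xi)| + `|complex.Re (nz xi)| <= `|j| by rewrite Re_wz Re_nz normr0 addr0.
have Rw' xi : `|complex.Re (wz xi)| + `|complex.Re (nz xi)| <= `|j| + 2 by have := Rw xi; lra.
have PN : 0 <= KN * KN * K by rewrite !mulr_ge0 ?expR_ge0.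
have PD : 0 <= KD * KN * K by rewrite !mulr_ge0 ?expR_ge0.
have PD' : 0 <= KN * KD * K by rewrite !mulr_ge0 ?expR_ge0.
exists (KN * KN * K + (A + KD * KN * K + A + KN * KD * K)).
  by apply: addr_ge0 => //; apply: addr_ge0 => //; apply: addr_ge0 => //; exact: addr_ge0.
move=> e xi e1; have x0 := normr_ge0 xi.
split.
  apply: le_trans (B4 e _ _ _ _ KN KN e1 (nN e e1) (nN e e1) (Rw' xi)) _; lra.
have Q1 := BD e (wz xi) (nz xi) xi e1 (Rw xi) (cabs_wz xi).
have Q2 := B4 e _ _ _ _ KD KN e1 (nD e e1) (nN e e1) (Rw' xi).
have Q3 : cabs (tr (E (hE e) (wz xi) * NE l e * DE (hE e) a (nz xi) * NE l e)) <= A * (1 + `|xi|).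
  have -> : tr (E (hE e) (wz xi) * NE l e * DE (hE e) a (nz xi) * NE l e) =
            tr (DE (hE e) a (nz xi) * NE l e * E (hE e) (wz xi) * NE l e).
    move: (E _ _) (DE _ _ _) (NE l e) => X1 X2 X3.
    by rewrite -(mulrA (X1 * X3)) trM !mulrA.
  by apply: BD e1 _ (cabs_nz xi); rewrite addrC; exact: Rw.
have Q4 := B4 e _ _ _ _ KN KD e1 (nN e e1) (nD e e1) (Rw' xi).
rewrite /dPhi; apply: le_trans (cabsD _ _) _; apply: le_trans (lerD (cabsD _ _) Q4) _.
apply: le_trans (lerD (lerD (cabsD _ _) Q3) (lexx _)) _.
apply: le_trans (lerD (lerD (lerD Q1 Q2) (lexx _)) (lexx _)) _.
clear Q1 Q2 Q3 Q4 BD; clearbody A; move: PN PD PD' A0 x0; move: (KN * KN * K) (KD * KN * K) (KN * KD * K) A `|xi| => p1 p2 p3 q x p10 p20 p30 q0 x0.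
have [m1 m2 m3] : [/\ 0 <= p1 * x, 0 <= p2 * x & 0 <= p3 * x] by rewrite !mulr_ge0.
lra.
Qed.

End Variation.

(** * Comparison of the two sides *)

Section Terms.
Context {R : realType}.
Variable j : R.
Implicit Types (t x : R).

Lemma cexp_wz t x : cexp (wz j t * x%:C) = (expR (j * x))%:C * expi (t * x).
Proof.
rewrite /wz mulrDl cexpD -cexp_imag -rmorphM cexp_real; congr (_ * cexp _).
by apply: complex_eq; rewrite ?(Re_mul, Im_mul) /=; ring.
Qed.

Lemma cexp_nz t x : cexp (nz t * x%:C) = expi (- (t * x)).
Proof.
rewrite /nz add0r -cexp_imag; congr cexp.
by apply: complex_eq; rewrite ?(Re_mul, Im_mul) /=; ring.
Qed.

Lemma cexp_1 x : cexp (1 * x%:C) = (expR x)%:C.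
Proof. by rewrite mul1r cexp_real. Qed.

Lemma cexp_0 x : cexp (0 * x%:C) = 1.
Proof. by rewrite mul0r cexp0. Qed.

Lemma expi_sub t x y : expi (- ((x - y) * t)) = expi (t * y) * expi (- (t * x)).
Proof. by rewrite -expiD; congr expi; ring. Qed.

Variables x0 x1 x2 : R.
Hypotheses (d01 : x0 != x1) (d12 : x1 != x2) (d20 : x2 != x0).
Local Notation X := (expR x0)%:C.
Local Notation Y := (expR x1)%:C.
Local Notation Z := (expR x2)%:C.
Local Notation Xj := (expR (j * x0))%:C.
Local Notation Yj := (expR (j * x1))%:C.
Local Notation Zj := (expR (j * x2))%:C.

(** The denominators of the three divided differences do not involve the exponents; they are a
    common factor of all terms and leave only numerators to compare. *)
Definition vdm : R[i] := ((x0 - x2)%:C)^-1 * ((x1 - x0)%:C)^-1 * ((x2 - x1)%:C)^-1.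

Lemma dd3E s0 s1 s2 z0 z1 z2 : dd3 s0 s1 s2 z0 z1 z2 x0 x1 x2 = vdm *
  ((cexp (s0 * x0%:C) - cexp (s0 * x2%:C)) * (cexp (s1 * x1%:C) - cexp (s1 * x0%:C)) *
   (cexp (s2 * x2%:C) - cexp (s2 * x1%:C)) *
   (cexp (z0 * x0%:C) * cexp (z1 * x1%:C) * cexp (z2 * x2%:C))).
Proof.
rewrite /dd3 (ddxE s0 (_ : x0 != x2)) 1?eq_sym// (ddxE s1 (_ : x1 != x0)) 1?eq_sym//.
rewrite (ddxE s2 (_ : x2 != x1)) 1?eq_sym// /exp3 /vdm.
move: (cexp (s0 * x0%:C)) (cexp (s0 * x2%:C)) (cexp (s1 * x1%:C)) (cexp (s1 * x0%:C))
  (cexp (s2 * x2%:C)) (cexp (s2 * x1%:C)) (cexp (z0 * x0%:C)) (cexp (z1 * x1%:C)) (cexp (z2 * x2%:C)).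
move: ((x0 - x2)%:C)^-1 ((x1 - x0)%:C)^-1 ((x2 - x1)%:C)^-1 => *; ring.
Qed.

Ltac term := rewrite dd3E ?cexp_wz ?cexp_nz ?cexp_1 ?cexp_0 ?expi_sub;
  move: vdm X Y Z Xj Yj Zj (expi _) (expi _) (expi _) => *; ring.

(** In each of [term1] to [term6] the parameter [t] occurs in one divided difference and in one
    exponential, hence with two frequencies, both differences of two points. Integration against [b]
    then evaluates [f] at these differences. *)
Lemma term1 t : dd3 (wz j t) 1 1 0 (nz t) 0 x0 x1 x2 =
  (vdm * ((Y - X) * (Z - Y) * Xj)) * expi (- ((x1 - x0) * t)) +
  (- (vdm * ((Y - X) * (Z - Y) * Zj))) * expi (- ((x1 - x2) * t)).
Proof. term. Qed.

Lemma term2 t : dd3 (nz t) 1 1 0 (wz j t) 0 x0 x1 x2 =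
  (vdm * ((Y - X) * (Z - Y) * Yj)) * expi (- ((x0 - x1) * t)) +
  (- (vdm * ((Y - X) * (Z - Y) * Yj))) * expi (- ((x2 - x1) * t)).
Proof. term. Qed.

Lemma term3 t : dd3 1 (nz t) 1 0 0 (wz j t) x0 x1 x2 =
  (vdm * ((X - Z) * (Z - Y) * Zj)) * expi (- ((x1 - x2) * t)) +
  (- (vdm * ((X - Z) * (Z - Y) * Zj))) * expi (- ((x0 - x2) * t)).
Proof. term. Qed.

Lemma term4 t : dd3 1 1 (wz j t) (nz t) 0 0 x0 x1 x2 =
  (vdm * ((X - Z) * (Y - X) * Zj)) * expi (- ((x0 - x2) * t)) +
  (- (vdm * ((X - Z) * (Y - X) * Yj))) * expi (- ((x0 - x1) * t)).
Proof. term. Qed.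

Lemma term5 t : dd3 1 (wz j t) 1 0 0 (nz t) x0 x1 x2 =
  (vdm * ((X - Z) * (Z - Y) * Yj)) * expi (- ((x2 - x1) * t)) +
  (- (vdm * ((X - Z) * (Z - Y) * Xj))) * expi (- ((x2 - x0) * t)).
Proof. term. Qed.

Lemma term6 t : dd3 1 1 (nz t) (wz j t) 0 0 x0 x1 x2 =
  (vdm * ((X - Z) * (Y - X) * Xj)) * expi (- ((x2 - x0) * t)) +
  (- (vdm * ((X - Z) * (Y - X) * Xj))) * expi (- ((x1 - x0) * t)).
Proof. term. Qed.

Lemma term7 t t' : dd3 1 1 1 (wz (j - 1) t) (0 + (0 +i* (t' - t))) (nz t') x0 x1 x2 =
  (vdm * ((X - Z) * (Y - X) * (Z - Y) * (expR ((j - 1) * x0))%:C)) *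
  expi (- ((x1 - x0) * t + (x2 - x1) * t')).
Proof.
have C u : cexp ((0 + (0 +i* (t' - t))) * u%:C) = expi (t' * u) * expi (- (t * u)).
  rewrite -expiD -cexp_imag add0r; congr cexp.
  by apply: complex_eq; rewrite ?(Re_mul, Im_mul) /=; ring.
have -> : expi (- ((x1 - x0) * t + (x2 - x1) * t')) = expi (t * x0) * (expi (t' * x1) * expi (- (t * x1))) * expi (- (t' * x2)).
  by rewrite -!expiD; congr expi; ring.
rewrite dd3E C cexp_nz !cexp_1 (_ : cexp (wz (j - 1) t * x0%:C) = (expR ((j - 1) * x0))%:C * expi (t * x0)); last first.
  rewrite /wz mulrDl cexpD -cexp_imag -rmorphM cexp_real; congr (_ * cexp _).
  by apply: complex_eq; rewrite ?(Re_mul, Im_mul) /=; ring.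
move: vdm X Y Z (expR ((j - 1) * x0))%:C (expi _) (expi _) (expi _) (expi _) => *; ring.
Qed.

End Terms.

(** * Matching the varied traces with I and II *)

Section Match.
Context {R : realType} {theta : R}.
Local Notation leb := (@lebesgue_measure R).
Local Notation leb2 := ((@lebesgue_measure R) \x (@lebesgue_measure R))%E.
Local Notation TR := (measurableTypeR R).
Local Notation St := (storus theta).

(** Affine exponents with imaginary slope: constants, [wz] and [nz] are of this form, so [Q_line]
    serves all six terms of [match_II]. *)
Definition lin (S : R -> R[i]) : Prop := exists z k, S = fun t => z + (0 +i* (k * t)).

Lemma im0 (z : R[i]) : z + (0 +i* 0) = z.
Proof. by apply: complex_eq; rewrite ?(Re_add, Im_add) /= addr0. Qed.

Lemma lin_cst z : lin (fun=> z).
Proof. by exists z, 0; apply/funext => t; rewrite mul0r im0. Qed.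

Lemma lin_wz j : lin (wz j).
Proof. by exists j%:C, 1; apply/funext => t; rewrite mul1r. Qed.

Lemma lin_nz : lin (@nz R).
Proof. by exists 0, (-1); apply/funext => t; rewrite mulN1r. Qed.

Lemma lin_le S : lin S -> exists2 C, 0 <= C & forall t, cabs (S t) <= C * (1 + `|t|).
Proof.
move=> [z [k ->]]; exists (cabs z + `|k|); first by rewrite addr_ge0 ?cabs_ge0.
move=> t; apply: le_trans (cabsD _ _) _; rewrite cabs_imag normrM.
have := cabs_ge0 z; have := normr_ge0 k; have := normr_ge0 t; nra.
Qed.

Variables (h : St).
Hypothesis sa_h : starS h = h.
Variables (c0 c1 c2 M : R).
Hypotheses (h0 : radius h M c0) (h1 : radius h M c1) (h2 : radius h M c2).
Hypothesis dg : distinct_grid c0 c1 c2.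
Local Notation Q := (Q h c0 c1 c2).

Lemma Q_opp x y y' f v B : Q x y y' f v B -> Q x y y' (fun x0 x1 x2 => - f x0 x1 x2) (- v) (cabs (-1 : R[i]) * B).
Proof.
move=> /(QZ (-1)) H; have e : -1 * v = - v by rewrite mulN1r.
by apply: (Q_val e); apply: Q_ext H => x0 x1 x2; rewrite mulN1r.
Qed.

Lemma Q_sub x y y' f g v w B B' : Q x y y' f v B -> Q x y y' g w B' ->
  Q x y y' (fun x0 x1 x2 => f x0 x1 x2 - g x0 x1 x2) (v - w) (B + cabs (-1 : R[i]) * B').
Proof. by move=> H /Q_opp; exact: QD. Qed.

Section Line.
Variables (b : R -> R[i]) (f : R -> R[i]).
Hypotheses (sb : schwartz b) (fb : forall x, f x = cint1 (fun xi => b xi * expi (- (x * xi)))).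

Lemma mlin k : measurable_fun (setT : set TR) (fun t : TR => k * t : TR).
Proof. by apply: measurable_funM; [exact: measurable_cst|exact: measurable_id]. Qed.

Lemma Q_line (S0 S1 S2 Z0 Z1 Z2 : R -> R[i]) x y y' :
  lin S0 -> lin S1 -> lin S2 -> lin Z0 -> lin Z1 -> lin Z2 ->
  let V t := tr (DE h x (S0 t) * E h (Z0 t) * DE h y (S1 t) * E h (Z1 t) * DE h y' (S2 t) * E h (Z2 t)) in
  (exists C, Q x y y' (fun x0 x1 x2 => cI leb setT (fun t => b t *
     dd3 (S0 t) (S1 t) (S2 t) (Z0 t) (Z1 t) (Z2 t) x0 x1 x2)) (cI leb setT (fun t => b t * V t)) C) /\
  cintg leb setT (fun t => b t * V t).
Proof.
move=> l0 l1 l2 m0 m1 m2.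
have [C0 C00 H0] := lin_le l0; have [C1 C10 H1] := lin_le l1; have [C2 C20 H2] := lin_le l2.
have [C HC] := schwartz_W1 3 sb.
have HB t : cabs (b t) * (cabs (S0 t) * cabs (S1 t) * cabs (S2 t)) <= C0 * C1 * C2 * C * W1 t.
  have t0 : 0 <= 1 + `|t| by rewrite addr_ge0.
  apply: (@le_trans _ _ (cabs (b t) * (C0 * (1 + `|t|) * (C1 * (1 + `|t|)) * (C2 * (1 + `|t|))))).
    apply: ler_wpM2l; first exact: cabs_ge0.
    apply: ler_pM => //; rewrite ?mulr_ge0 ?cabs_ge0//.
    by apply: ler_pM => //; rewrite ?cabs_ge0.
  have -> : cabs (b t) * (C0 * (1 + `|t|) * (C1 * (1 + `|t|)) * (C2 * (1 + `|t|))) =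
    C0 * C1 * C2 * ((1 + `|t|) ^+ 3 * cabs (b t)) by ring.
  by rewrite -[leRHS]mulrA; apply: ler_wpM2l; [rewrite !mulr_ge0|exact: HC].
move: HB; case: l0 => a0 [k0 ->]; case: l1 => a1 [k1 ->]; case: l2 => a2 [k2 ->].
case: m0 => w0 [j0 ->]; case: m1 => w1 [j1 ->]; case: m2 => w2 [j2 ->] HB.
have := @Q_dosc R theta h sa_h c0 c1 c2 M h0 h1 h2 _ _ leb b (fun t => C0 * C1 * C2 * C * W1 t)
  (schwartz_cmeas sb) (W1C_intg _) (fun t => k0 * t) (fun t => k1 * t) (fun t => k2 * t)
  (fun t => j0 * t) (fun t => j1 * t) (fun t => j2 * t) a0 a1 a2 w0 w1 w2 x y y'
  (mlin k0) (mlin k1) (mlin k2) (mlin j0) (mlin j1) (mlin j2) HB.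
exact.
Qed.

Lemma eval2 (F : R -> R[i]) A B u v : (forall t, F t = A * expi (- (u * t)) + B * expi (- (v * t))) ->
  cI leb setT (fun t => b t * F t) = A * f u + B * f v.
Proof.
move=> FE; have [C HC] := schwartz_W1 0 sb.
have iU w : cintg leb setT (fun t => b t * expi (- (w * t))).
  apply: (@cintg_W1 _ _ C).
    apply: cmeasM; first exact: schwartz_cmeas.
    by apply: cmeas_expi; apply: measurableT_comp => //; exact: mlin.
  by move=> t; rewrite cabsM cabs_expi mulr1; have := HC t; rewrite expr0 mul1r.
rewrite !fb -[cint1 (fun xi => b xi * expi (- (u * xi)))]/(cI leb setT _).
rewrite -[cint1 (fun xi => b xi * expi (- (v * xi)))]/(cI leb setT _).
rewrite -!cI_Z// -cI_D//; [|exact: cintgZ|exact: cintgZ].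
by apply: cI_eq => t _; rewrite FE; ring.
Qed.

End Line.

Variables (T : R -> R[i]) (j : R).
Variables (b f : R -> R[i]) (bI fI : R -> R[i]) (b2 f2 : R * R -> R[i]).
Hypotheses (sb : schwartz b) (fb : forall x, f x = cint1 (fun xi => b xi * expi (- (x * xi)))).
Hypotheses (sbI : schwartz bI) (fbI : forall x, fI x = cint1 (fun xi => bI xi * expi (- (x * xi)))).
Hypotheses (sb2 : schwartz b2)
  (fb2 : forall x, f2 x = cint2 (fun xi => b2 xi * expi (- (x.1 * xi.1 + x.2 * xi.2)))).
Hypotheses (fT : forall x, `|x| <= 2 * M -> f x = T (expR x)).
Hypotheses (fIT : forall x, `|x| <= 2 * M -> fI x = Ifun T j (expR x)).
Hypotheses (f2T : forall z, `|z.1| <= 2 * M -> `|z.2| <= 2 * M -> f2 z = IIfun T j (expR z.1) (expR z.2)).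

Lemma inbox_diff x0 x1 x2 : inbox c0 c1 c2 x0 x1 x2 ->
  [/\ `|x1 - x0| <= 2 * M, `|x0 - x1| <= 2 * M, `|x2 - x1| <= 2 * M, `|x1 - x2| <= 2 * M &
      `|x2 - x0| <= 2 * M /\ `|x0 - x2| <= 2 * M].
Proof.
case: h0 => _ r0 _; case: h1 => _ r1 _; case: h2 => _ r2 _ [i0 i1 i2].
have := ler_normB x1 x0; have := ler_normB x2 x1; have := ler_normB x2 x0.
rewrite (distrC x0 x1) (distrC x1 x2) (distrC x0 x2) => *.
by split; [| | | |split]; lra.
Qed.

(** In the terms with $\nabla_l^2k$ the elements [D] and [N] stay whole and serve as letters; two
    gaps carry exponentials, and the comparison is [Ifun_exp]. *)
Lemma match_I (D N : St) :
  - cI leb setT (fun t => b t * tr (D * E h (nz t) * N * E h (wz j t) * 1 * 1))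
  - cI leb setT (fun t => b t * tr (D * E h (wz j t) * N * E h (nz t) * 1 * 1)) =
  cI leb setT (fun t => bI t * tr (D * E h (wz j t) * N * E h (nz t) * 1 * 1)) /\
  (cintg leb setT (fun t => b t * tr (D * E h (nz t) * N * E h (wz j t) * 1 * 1)) /\
   cintg leb setT (fun t => b t * tr (D * E h (wz j t) * N * E h (nz t) * 1 * 1))) /\
   cintg leb setT (fun t => bI t * tr (D * E h (wz j t) * N * E h (nz t) * 1 * 1)).
Proof.
have p0 := c0_gt0 h0; have p1 := c1_gt0 h1; have p2 := c2_gt0 h2.
have G (b' : R -> R[i]) : schwartz b' -> exists2 g, cmeas (setT : set TR) b' /\ leb.-integrable setT (EFin \o g) &
    forall t, cabs (b' t) <= g t.
  move=> s; have [C HC] := schwartz_W1 0 s; exists (fun t => C * W1 t).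
    by split; [exact: schwartz_cmeas|exact: W1C_intg].
  by move=> t; have := HC t; rewrite expr0 mul1r.
have E01 : E h (0 + (0 +i* 0)) = 1 by rewrite im0 E0.
have QNZ (b' f' : R -> R[i]) : schwartz b' -> (forall x, f' x = cint1 (fun xi => b' xi * expi (- (x * xi)))) ->
    (exists C, Q D N 1 (fun x0 x1 x2 => (expR (j * x1))%:C * f' (x0 - x1))
     (cI leb setT (fun t => b' t * tr (D * E h (nz t) * N * E h (wz j t) * 1 * 1))) C) /\
    cintg leb setT (fun t => b' t * tr (D * E h (nz t) * N * E h (wz j t) * 1 * 1)).
  move=> s' fb'; have [g [mb ig] bg] := G _ s'.
  have := @Q_osc R theta h sa_h c0 c1 c2 M h0 h1 h2 _ _ leb b' g mb ig (fun t => - t) id (fun=> 0)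
    0 j%:C 0 D N 1 (@mopp R) (@measurable_id _ TR _) (@measurable_cst _ _ _ _ _ _) bg.
  rewrite E01 => -[[C HC] iV]; split=> //; exists C; apply: Q_ext HC => x0 x1 x2.
  rewrite /exp3 !mul0r cexp0 mul1r mulr1 -rmorphM cexp_real fb'; congr (_ * _).
  by apply: cI_eq => t _; congr (_ * expi _); ring.
have QP (b' f' : R -> R[i]) : schwartz b' -> (forall x, f' x = cint1 (fun xi => b' xi * expi (- (x * xi)))) ->
    (exists C, Q D N 1 (fun x0 x1 x2 => (expR (j * x0))%:C * f' (x1 - x0))
     (cI leb setT (fun t => b' t * tr (D * E h (wz j t) * N * E h (nz t) * 1 * 1))) C) /\
    cintg leb setT (fun t => b' t * tr (D * E h (wz j t) * N * E h (nz t) * 1 * 1)).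
  move=> s' fb'; have [g [mb ig] bg] := G _ s'.
  have := @Q_osc R theta h sa_h c0 c1 c2 M h0 h1 h2 _ _ leb b' g mb ig id (fun t => - t) (fun=> 0)
    j%:C 0 0 D N 1 (@measurable_id _ TR _) (@mopp R) (@measurable_cst _ _ _ _ _ _) bg.
  rewrite E01 => -[[C HC] iV]; split=> //; exists C; apply: Q_ext HC => x0 x1 x2.
  rewrite /exp3 !mul0r cexp0 !mulr1 -rmorphM cexp_real fb'; congr (_ * _).
  by apply: cI_eq => t _; congr (_ * expi _); ring.
have [[A HA] i1] := QNZ b f sb fb; have [[B HB] i2] := QP b f sb fb; have [[C HC] i3] := QP bI fI sbI fbI.
split; last exact (conj (conj i1 i2) i3).
have HL := Q_sub (Q_opp HA) HB.
apply: (Q_uniq p0 p1 p2 dg _ HL HC) => x0 x1 x2 /inbox_diff[d10 d01 _ _ _] _ _ _.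
by rewrite /= (fT d01) (fT d10) (fIT d10) Ifun_exp; ring.
Qed.

(** Here $\delta_ak$ and $\nabla_lk$ are opened by Duhamel's formula, so the letters are [a] and
    twice $n=\nabla_lh$. Both sides become functions on the same grids, to be compared by
    [IIfun_exp]. *)
Lemma match_II (a n : St) :
  let V1 t := tr (DE h a (wz j t) * E h 0 * DE h n 1 * E h (nz t) * DE h n 1 * E h 0) in
  let V2 t := tr (DE h a (nz t) * E h 0 * DE h n 1 * E h (wz j t) * DE h n 1 * E h 0) in
  let V3 t := tr (DE h a 1 * E h 0 * DE h n (nz t) * E h 0 * DE h n 1 * E h (wz j t)) in
  let V4 t := tr (DE h a 1 * E h (nz t) * DE h n 1 * E h 0 * DE h n (wz j t) * E h 0) in
  let V5 t := tr (DE h a 1 * E h 0 * DE h n (wz j t) * E h 0 * DE h n 1 * E h (nz t)) in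
  let V6 t := tr (DE h a 1 * E h (wz j t) * DE h n 1 * E h 0 * DE h n (nz t) * E h 0) in
  let V7 t := tr (DE h a 1 * E h (wz (j - 1) t.1) * DE h n 1 * E h (0 + (0 +i* (t.2 - t.1))) *
     DE h n 1 * E h (nz t.2)) in
  let I V := cI leb setT (fun t => b t * V t) in
  let i V := cintg leb setT (fun t => b t * V t) in
  [/\ I V1 + I V2 - I V3 - I V4 - I V5 - I V6 = cI leb2 setT (fun t => b2 t * V7 t),
      [/\ i V1, i V2 & i V3], [/\ i V4, i V5 & i V6] & cintg leb2 setT (fun t => b2 t * V7 t)].
Proof.
move=> V1 V2 V3 V4 V5 V6 V7 I i.
have p0 := c0_gt0 h0; have p1 := c1_gt0 h1; have p2 := c2_gt0 h2.
have L0 := lin_cst 0; have L1 := lin_cst 1; have Lw := lin_wz j; have Ln := lin_nz.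
have [[C1 Q1] i1] := Q_line sb a n n Lw L1 L1 L0 Ln L0.
have [[C2 Q2] i2] := Q_line sb a n n Ln L1 L1 L0 Lw L0.
have [[C3 Q3] i3] := Q_line sb a n n L1 Ln L1 L0 L0 Lw.
have [[C4 Q4] i4] := Q_line sb a n n L1 L1 Lw Ln L0 L0.
have [[C5 Q5] i5] := Q_line sb a n n L1 Lw L1 L0 L0 Ln.
have [[C6 Q6] i6] := Q_line sb a n n L1 L1 Ln Lw L0 L0.
have [[C7 Q7] i7] : (exists C, Q a n n (fun x0 x1 x2 => cI leb2 setT (fun t => b2 t *
     dd3 1 1 1 (wz (j - 1) t.1) (0 + (0 +i* (t.2 - t.1))) (nz t.2) x0 x1 x2))
     (cI leb2 setT (fun t => b2 t * V7 t)) C) /\ cintg leb2 setT (fun t => b2 t * V7 t).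
  have [C HC] := schwartz_W2 sb2.
  have := @Q_dosc R theta h sa_h c0 c1 c2 M h0 h1 h2 _ _ leb2 b2 (fun t => C * W2 t)
    (schwartz_cmeas2 sb2) (W2C_intg _) (fun=> 0) (fun=> 0) (fun=> 0)
    (fun t => t.1) (fun t => t.2 - t.1) (fun t => - t.2) 1 1 1 (j - 1)%:C 0 0 a n n
    (@measurable_cst _ _ _ _ _ _) (@measurable_cst _ _ _ _ _ _) (@measurable_cst _ _ _ _ _ _)
    (@measurable_fst _ _ TR TR).
  rewrite im0; apply.
  - by apply: measurable_funB; [exact: measurable_snd|exact: measurable_fst].
  - by apply: measurableT_comp => //; exact: measurable_snd.
  - by move=> t; rewrite cabs1 !mulr1.
split; [|exact (And3 i1 i2 i3)|exact (And3 i4 i5 i6)|exact i7].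
have HL := Q_sub (Q_sub (Q_sub (Q_sub (QD Q1 Q2) Q3) Q4) Q5) Q6.
apply: (Q_uniq p0 p1 p2 dg _ HL Q7) => x0 x1 x2 /inbox_diff[e10 e01 e21 e12 [e20 e02]] d01 d12 d20.
rewrite (eval2 sb fb (term1 j d01 d12 d20)) (eval2 sb fb (term2 j d01 d12 d20)).
rewrite (eval2 sb fb (term3 j d01 d12 d20)) (eval2 sb fb (term4 j d01 d12 d20)).
rewrite (eval2 sb fb (term5 j d01 d12 d20)) (eval2 sb fb (term6 j d01 d12 d20)).
rewrite (fT e10) (fT e01) (fT e21) (fT e12) (fT e20) (fT e02).
have -> : cI leb2 setT (fun t => b2 t * dd3 1 1 1 (wz (j - 1) t.1) (0 + (0 +i* (t.2 - t.1))) (nz t.2) x0 x1 x2) =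
   vdm x0 x1 x2 * (((expR x0)%:C - (expR x2)%:C) * ((expR x1)%:C - (expR x0)%:C) * ((expR x2)%:C - (expR x1)%:C) *
     ((expR ((j - 1) * x0))%:C * IIfun T j (expR (x1 - x0)) (expR (x2 - x1)))).
  rewrite -(f2T (z := (x1 - x0, x2 - x1)))// fb2 -[cint2 _]/(cI leb2 setT _) !mulrA.
  rewrite -cI_Z//.
    by apply: cI_eq => t _; rewrite (term7 j d01 d12 d20); move: (expi _) => w; ring.
  have [C HC] := schwartz_W2 sb2; apply: (@cintg_W2 _ _ C).
    apply: cmeasM; first exact: schwartz_cmeas2.
    apply: cmeas_expi; apply: measurableT_comp => //; apply: measurable_funD;
      apply: measurable_funM; try exact: measurable_cst; [exact: measurable_fst|exact: measurable_snd].
  by move=> t; rewrite cabsM cabs_expi mulr1.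
rewrite -(IIfun_exp T j d01 d12 d20).
move: (vdm _ _ _) (T _) (T _) (T _) (T _) (T _) (T _) => *; ring.
Qed.

End Match.

(** * The functional calculus and the variation as integrals of traces *)

Section Assembly.
Context {R : realType} {theta : R}.
Local Notation leb := (@lebesgue_measure R).
Local Notation leb2 := ((@lebesgue_measure R) \x (@lebesgue_measure R))%E.
Local Notation TR := (measurableTypeR R).
Local Notation St := (storus theta).

Lemma snu_dl m : snu 0 (dl theta m) <= 1.
Proof.
apply: nu_le => s us.
apply: (@le_trans _ _ (\sum_(k <- s) if k == m then 1 else 0)).
  apply: ler_sum => k _; rewrite /wabs expr0 mul1r /dl /= /delta.
  by case: (k == m); rewrite ?cabs1 ?cabs0.
rewrite -big_mkcond/= big_const_seq iter_addr_0.
by rewrite (eq_count (a2 := pred1 m))// count_uniq_mem// -[leRHS]/(1%:R) ler_nat leq_b1.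
Qed.

Lemma radius_snu (g : St) : radius g (snu 0 g + 1) (snu 0 g + 1).
Proof.
split=> //; first by rewrite ltr_wpDl// snu_ge0.
by move=> x; apply: le_trans (l2_mul _ _) _; rewrite ler_wpM2r ?l2_ge0// lerDl.
Qed.

(** Independence of the imaginary exponents provides the uniform bound on coefficients required by
    [rep]. *)
Lemma coef_le (g x y : St) (t0 t1 t2 : R) p : starS g = g ->
  cabs (sv (E g (0 + (0 +i* t0)) * x * E g (0 + (0 +i* t1)) * y * E g (0 + (0 +i* t2))) p) <=
  snu 0 x * snu 0 y.
Proof.
move=> sg; have [c0 _ hc] := radius_snu g; rewrite sv_trE.
have := Q_bound (Q_exp sg c0 c0 c0 hc hc hc (starS (dl theta p)) x y
  (0 + (0 +i* t0)) (0 + (0 +i* t1)) (0 + (0 +i* t2))).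
rewrite B3_im /B3 /= normr0 !mulr0 !expR0 !mulr1.
have A5 (a1 a2 a3 a4 a5 a6 : St) : a1 * a2 * a3 * a4 * a5 * a6 = a1 * (a2 * a3 * a4 * a5 * a6) by rewrite !mulrA.
move=> H; rewrite -A5; apply: le_trans H _; rewrite -mulrA ler_piMl ?mulr_ge0 ?snu_ge0//.
exact: le_trans (snu_star _ _) (snu_dl _).
Qed.

Section One.
Variables (g : St) (b f : R -> R[i]) (K : R -> R[i]).
Hypotheses (sa_g : starS g = g) (sf : schwartz f) (sb : schwartz b)
  (fK : forall x, `|x| < 2 * nc_norm theta (sv g) + 1 -> f x = K (expR x))
  (fb : forall x, f x = cint1 (fun xi => b xi * expi (- (x * xi)))).

Lemma rep_fcalc1 (x : St) : rep leb b (fun t => E g (0 + (0 +i* t)) * x * E g (nz t))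
  (fcalc1 theta (sv g) K (sv x)).
Proof.
have -> := fcalc1E sa_g (_ : fcalc1_spec theta (sv g) K (sv x) (fun p => cint1 (fun xi => b xi * ymod theta (sv g) xi (sv x) p))).
  split.
  - apply: smeasM; last exact: smeas_Ei (@mopp R).
    by apply: smeasM; [exact: smeas_Ei (@measurable_id _ TR _)|exact: smeas_cst].
  - exists (snu 0 x * snu 0 (1 : St)) => t p.
    have := coef_le x 1 t (- t) 0 p sa_g.
    have E00 : E g (0 + (0 +i* 0)) = 1 by rewrite im0 E0.
    by rewrite E00 !mulr1.
  - by move=> p; apply: cI_eq => t _; rewrite ymodE /nz !add0r.
by exists f, b; split=> //; exists 1.
Qed.

End One.

Section Two.
Variables (g : St) (b f : R * R -> R[i]) (K : R -> R -> R[i]).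
Hypotheses (sa_g : starS g = g) (sf : schwartz f) (sb : schwartz b)
  (fK : forall x, `|x.1| < 2 * nc_norm theta (sv g) + 1 -> `|x.2| < 2 * nc_norm theta (sv g) + 1 ->
     f x = K (expR x.1) (expR x.2))
  (fb : forall x, f x = cint2 (fun xi => b xi * expi (- (x.1 * xi.1 + x.2 * xi.2)))).

Lemma rep_fcalc2 (x y : St) : rep leb2 b
  (fun t => E g (0 + (0 +i* t.1)) * x * E g (0 + (0 +i* (t.2 - t.1))) * y * E g (nz t.2))
  (fcalc2 theta (sv g) K (sv x) (sv y)).
Proof.
have -> := fcalc2E sa_g (_ : fcalc2_spec theta (sv g) K (sv x) (sv y)
  (fun p => cint2 (fun xi => b xi * nc_mul theta (ymod theta (sv g) xi.1 (sv x)) (ymod theta (sv g) xi.2 (sv y)) p))).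
  split.
  - apply: smeasM; last by apply: smeas_Ei; apply: measurableT_comp => //; exact: measurable_snd.
    apply: smeasM; last exact: smeas_cst.
    apply: smeasM; last by apply: smeas_Ei; apply: measurable_funB; [exact: measurable_snd|exact: measurable_fst].
    by apply: smeasM; [apply: smeas_Ei; exact: measurable_fst|exact: smeas_cst].
  - by exists (snu 0 x * snu 0 y) => t p; exact: coef_le.
  - move=> p; apply: cI_eq => t _; rewrite !ymodE -svM /nz !add0r.
    have e1 : 0 +i* (t.2 - t.1) = 0 +i* (- t.1) + (0 +i* t.2).
      by apply: complex_eq; rewrite ?(Re_add, Im_add) /= ?addr0// addrC.
    have A6 (A B D F : St) : A * x * B * (D * y * F) = A * x * (B * D) * y * F by rewrite !mulrA.
    have e2 : E g (0 +i* t.1) * x * E g (0 +i* (- t.1)) * (E g (0 +i* t.2) * y * E g (0 +i* (- t.2))) =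
       E g (0 +i* t.1) * x * E g (0 +i* (t.2 - t.1)) * y * E g (0 +i* (- t.2)).
      rewrite e1 (E_add g (0 +i* (- t.1)) (0 +i* t.2)); exact: A6.
    exact: (congr1 (fun V : St => b t * sv V p) e2).
by exists f, b; split=> //; exists 1.
Qed.

End Two.

Lemma nc_exp1 (g : St) : nc_exp theta (sv g) = sv (E g 1).
Proof. by rewrite -(nc_expE g 1); congr nc_exp; apply/funext => p; rewrite -[RHS]/(1 * sv g p) mul1r. Qed.

Lemma nabla_exp l (g : St) : nabla l (nc_exp theta (sv g)) = sv (nab l (E g 1)).
Proof. by rewrite nc_exp1. Qed.

Lemma sv_hE (h a : St) (e : R) : sv h + e%:C *: sv a = sv (hE h a e).
Proof. by apply/funext => p; rewrite svD svZ. Qed.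

Lemma is_cderiveD (u v : R -> R[i]) (x : R) u' v' : is_cderive u x u' -> is_cderive v x v' ->
  is_cderive (fun t => u t + v t) x (u' + v').
Proof.
move=> [u1 u2] [v1 v2]; split.
- by rewrite Re_add; under eq_fun do rewrite Re_add; exact: is_deriveD.
- by rewrite Im_add; under eq_fun do rewrite Im_add; exact: is_deriveD.
Qed.

Lemma is_cderive_sum n (u : 'I_n -> R -> R[i]) (x : R) (u' : 'I_n -> R[i]) :
  (forall l, is_cderive (u l) x (u' l)) -> is_cderive (fun t => \sum_(l < n) u l t) x (\sum_(l < n) u' l).
Proof.
elim: n u u' => [|n IH] u u' H.
  under eq_fun do rewrite big_ord0; rewrite big_ord0.
  by split => /=; exact: is_derive_cst.
under eq_fun do rewrite big_ord_recr /=; rewrite big_ord_recr /=.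
by apply: is_cderiveD => //; apply: IH.
Qed.

Lemma delta_kE (h a : St) : delta_k theta (sv h) (sv a) = sv (DE h a 1).
Proof.
apply/funext => p; rewrite /delta_k /cderive /by_parts.
have H (c : R[i] -> R) : (fun eps : R => c (nc_exp theta (sv h + eps%:C *: sv a) p)) =
    fun eps => c (sv (E (h + eps%:C *: a) 1) p).
  by apply/funext => e; rewrite sv_hE nc_exp1.
have [D1 D2] := sder_coef p (sder_pert h a 1).
rewrite (H (@complex.Re R)) (H (@complex.Im R)).
by apply: complex_eq; rewrite /= !derive1E; [case: D1 => _ ->|case: D2 => _ ->].
Qed.

Lemma hE0 (h a : St) : hE h a 0 = h.
Proof. by rewrite /hE rmorph0 scale0r addr0. Qed.

(** The pieces of [Phi_parts] become variables tied by equations: $\nabla_lk$ and 1 must appear as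
    [DE h (nab l h) 1] and [E h 0] in the six terms of [match_II], but stay as they are in the two
    terms of [match_I]. *)
Lemma Phi_parts_gen l (P N Q D P' Q' dP dQ N' one : St) :
  nab l P = dP -> nab l Q = dQ -> N = N' -> one = 1 ->
  tr (P' * N * Q * N) + tr (P * nab l D * Q * N) + tr (P * N * Q' * N) + tr (P * N * Q * nab l D) =
  tr (P' * one * N' * Q * N' * one) + tr (Q' * one * N' * P * N' * one)
  - tr (D * one * dQ * one * N' * P) - tr (D * Q * N' * one * dP * one)
  - tr (D * one * dP * one * N' * Q) - tr (D * P * N' * one * dQ * one)
  - tr (D * Q * nab l N * P * 1 * 1) - tr (D * P * nab l N * Q * 1 * 1).
Proof. by move=> <- <- <- ->; exact: Phi_parts. Qed.

Lemma dPhi0 (h a : St) (j : R) l t : dPhi h a j l 0 t =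
  tr (DE h a (wz j t) * E h 0 * DE h (nab l h) 1 * E h (nz t) * DE h (nab l h) 1 * E h 0) +
  tr (DE h a (nz t) * E h 0 * DE h (nab l h) 1 * E h (wz j t) * DE h (nab l h) 1 * E h 0) -
  tr (DE h a 1 * E h 0 * DE h (nab l h) (nz t) * E h 0 * DE h (nab l h) 1 * E h (wz j t)) -
  tr (DE h a 1 * E h (nz t) * DE h (nab l h) 1 * E h 0 * DE h (nab l h) (wz j t) * E h 0) -
  tr (DE h a 1 * E h 0 * DE h (nab l h) (wz j t) * E h 0 * DE h (nab l h) 1 * E h (nz t)) -
  tr (DE h a 1 * E h (wz j t) * DE h (nab l h) 1 * E h 0 * DE h (nab l h) (nz t) * E h 0) -
  tr (DE h a 1 * E h (nz t) * nab l (nab l (E h 1)) * E h (wz j t) * 1 * 1) -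
  tr (DE h a 1 * E h (wz j t) * nab l (nab l (E h 1)) * E h (nz t) * 1 * 1).
Proof.
rewrite /dPhi /NE hE0.
exact: (Phi_parts_gen (DE h a 1) (DE h a (wz j t)) (DE h a (nz t)) (nab_E h l (wz j t)) (nab_E h l (nz t)) (nab_E h l 1) (E0 h)).
Qed.

End Assembly.

(** * The derivative of the functional and its value *)

Section Final.
Context {R : realType} {theta : R}.
Local Notation leb := (@lebesgue_measure R).
Local Notation leb2 := ((@lebesgue_measure R) \x (@lebesgue_measure R))%E.
Local Notation TR := (measurableTypeR R).
Local Notation St := (storus theta).

Section Split.
Context d (Y : measurableType d) (mu : {measure set Y -> \bar R}).
Implicit Types F G : Y -> R[i].

Lemma cintgB F G : cintg mu setT F -> cintg mu setT G -> cintg mu setT (fun x => F x - G x).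
Proof.
move=> iF /(cintgZ (-1) measurableT) iG; under eq_fun do rewrite -mulN1r; exact: cintgD.
Qed.

Lemma cI_B F G : cintg mu setT F -> cintg mu setT G ->
  cI mu setT (fun x => F x - G x) = cI mu setT F - cI mu setT G.
Proof.
move=> iF iG; rewrite -mulN1r -cI_Z// -cI_D//; last exact: cintgZ.
by apply: cI_eq => x _; rewrite mulN1r.
Qed.

Lemma cI_split (b : Y -> R[i]) V1 V2 V3 V4 V5 V6 U1 U2 :
  let I V := cI mu setT (fun t => b t * V t) in
  let i V := cintg mu setT (fun t => b t * V t) in
  i V1 -> i V2 -> i V3 -> i V4 -> i V5 -> i V6 -> i U1 -> i U2 ->
  I (fun t => V1 t + V2 t - V3 t - V4 t - V5 t - V6 t - U1 t - U2 t) =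
  I V1 + I V2 - I V3 - I V4 - I V5 - I V6 + (- I U1 - I U2).
Proof.
move=> I i i1 i2 i3 i4 i5 i6 i7 i8.
have j2 := cintgD measurableT i1 i2; have j3 := cintgB j2 i3; have j4 := cintgB j3 i4.
have j5 := cintgB j4 i5; have j6 := cintgB j5 i6; have j7 := cintgB j6 i7.
rewrite addrA -(cI_D measurableT i1 i2) -(cI_B j2 i3) -(cI_B j3 i4) -(cI_B j4 i5) -(cI_B j5 i6).
rewrite -(cI_B j6 i7) -(cI_B j7 i8); apply: cI_eq => t _ /=.
move: (b t) (V1 t) (V2 t) (V3 t) (V4 t) (V5 t) (V6 t) (U1 t) (U2 t) => *; ring.
Qed.

End Split.

Variables (h a : St).
Hypotheses (sa_h : starS h = h) (sa_a : starS a = a).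
Variables (j : R) (T : R -> R[i]).
Variables (b f bI fI : R -> R[i]) (b2 f2 : R * R -> R[i]) (M : R).
Hypotheses (M_ge : 2 * (snu 0 h + snu 0 a) + 2 <= M).
Hypotheses (sf : schwartz f) (sb : schwartz b) (fb : forall x, f x = cint1 (fun xi => b xi * expi (- (x * xi)))).
Hypotheses (sfI : schwartz fI) (sbI : schwartz bI) (fbI : forall x, fI x = cint1 (fun xi => bI xi * expi (- (x * xi)))).
Hypotheses (sf2 : schwartz f2) (sb2 : schwartz b2)
  (fb2 : forall x, f2 x = cint2 (fun xi => b2 xi * expi (- (x.1 * xi.1 + x.2 * xi.2)))).
Hypotheses (fT : forall x, `|x| <= M -> f x = T (expR x)).
Hypotheses (fIT : forall x, `|x| <= M -> fI x = Ifun T j (expR x)).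
Hypotheses (f2T : forall z, `|z.1| <= M -> `|z.2| <= M -> f2 z = IIfun T j (expR z.1) (expR z.2)).

(** The eight traces of [dPhi0] are integrated: the six with two first derivatives go to [match_II],
    the two with $\nabla_l^2k$ to [match_I]. Radii within 1 of the norm suffice, by the choice of
    [M]. *)
Lemma dPhi_match l :
  cI leb setT (fun t => b t * dPhi h a j l 0 t) =
  cI leb setT (fun t => bI t * tr (DE h a 1 * E h (wz j t) * nab l (nab l (E h 1)) * E h (nz t) * 1 * 1)) +
  cI leb2 setT (fun t => b2 t * tr (DE h a 1 * E h (wz (j - 1) t.1) * DE h (nab l h) 1 *
     E h (0 + (0 +i* (t.2 - t.1))) * DE h (nab l h) 1 * E h (nz t.2))) /\
  cintg leb setT (fun t => bI t * tr (DE h a 1 * E h (wz j t) * nab l (nab l (E h 1)) * E h (nz t) * 1 * 1)) /\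
  cintg leb2 setT (fun t => b2 t * tr (DE h a 1 * E h (wz (j - 1) t.1) * DE h (nab l h) 1 *
     E h (0 + (0 +i* (t.2 - t.1))) * DE h (nab l h) 1 * E h (nz t.2))).
Proof.
have [c0 [c1 [c2 [r0 r1 r2 dg]]]] := radii_ex h ltr01.
have M2 (x : R) : `|x| <= 2 * (nc_norm theta (sv h) + 1) -> `|x| <= M.
  by move=> H; have := nc_norm_le h; have := snu_ge0 0 a; move: M_ge; lra.
have [mI [[iU1 iU2] iI]] := match_I sa_h r0 r1 r2 dg sb fb sbI fbI (fun x H => fT (M2 x H))
  (fun x H => fIT (M2 x H)) (DE h a 1) (nab l (nab l (E h 1))).
have [mII [i1 i2 i3] [i4 i5 i6] iII] := match_II sa_h r0 r1 r2 dg sb fb sb2 fb2 (fun x H => fT (M2 x H))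
  (fun z H1 H2 => f2T (M2 _ H1) (M2 _ H2)) a (nab l h).
split; last exact (conj iI iII).
have S := cI_split i1 i2 i3 i4 i5 i6 iU1 iU2.
have e := etrans S (congr2 +%R mII mI).
apply: etrans (etrans e (addrC _ _)).
by apply: cI_eq => t _; congr (b t * _); exact: dPhi0.
Qed.

Definition functional (g : nctorus R) : R[i] :=
  phi0 (nc_mul theta (nc_pow theta g j%:C)
    (\sum_(l < 2) nc_mul theta (fcalc1 theta g T (nabla l (nc_exp theta g))) (nabla l (nc_exp theta g)))).

Lemma decay_line (b' : R -> R[i]) : schwartz b' -> exists2 g : TR -> R, cmeas (setT : set TR) b' /\
  leb.-integrable setT (EFin \o g) & forall t, cabs (b' t) <= g t.
Proof.
move=> s; have [C HC] := schwartz_W1 0 s; exists (fun t => C * W1 t).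
  by split; [exact: schwartz_cmeas|exact: W1C_intg].
by move=> t; have := HC t; rewrite expr0 mul1r.
Qed.

Lemma E_wz (g : St) (i t : R) : E g (wz i t) = E g i%:C * E g (0 + (0 +i* t)).
Proof. by rewrite (add0r (0 +i* t)); exact: E_add. Qed.

(** The calculus in the functional depends on [e], but [M] covers the window $2\|h+ea\|+1$ for all
    $|e|\le1$. Hence one amplitude [b] serves them all, and only the integrand varies with [e]. *)
Lemma functional_eq e : `|e| <= 1 ->
  functional (sv h + e%:C *: sv a) = cI leb setT (fun t => b t * \sum_(l < 2) Phi h a j l e t).
Proof.
move=> e1; rewrite sv_hE; set g := hE h a e.
have sg : starS g = g := star_hE sa_h sa_a e.
have [bd [mb ig] bg] := decay_line sb.
have fK x : `|x| < 2 * nc_norm theta (sv g) + 1 -> f x = T (expR x).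
  move=> H; apply: fT; have := nc_norm_le g; have := snu_hE h a 0 e1; rewrite -/g.
  by move: M_ge; lra.
have rl l : rep leb b (fun t => E g (0 + (0 +i* t)) * nab l (E g 1) * E g (nz t) * nab l (E g 1))
    (nc_mul theta (fcalc1 theta (sv g) T (nabla l (nc_exp theta (sv g)))) (nabla l (nc_exp theta (sv g)))).
  rewrite nabla_exp; apply: (rep_mulr mb bg ig).
  exact: (rep_fcalc1 sg sf sb fK fb).
have := rep_tr (rep_mull mb bg ig (E g j%:C) (rep_sum mb bg ig rl)).
rewrite /functional /nc_pow nc_expE => ->.
apply: cI_eq => t _; congr (b t * _).
rewrite mulr_sumr tr_sum; apply: eq_bigr => l _; rewrite /Phi /NE -/g.
have A5 (A B N C : St) : tr (A * (B * N * C * N)) = tr (A * B * N * C * N) by rewrite !mulrA.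
apply: (etrans (A5 _ _ _ _)).
exact: (congr1 (fun V : St => tr (V * nab l (E g 1) * E g (nz t) * nab l (E g 1))) (esym (E_wz g j t))).
Qed.

Lemma functional_der :
  is_cderive (fun e => functional (sv h + e%:C *: sv a)) 0
    (cI leb setT (fun t => b t * \sum_(l < 2) dPhi h a j l 0 t)).
Proof.
have [C HC] := schwartz_W1 1 sb.
have /choice[B HB] : forall l, exists B, 0 <= B /\ forall e xi, `|e| <= 1 ->
    cabs (Phi h a j l e xi) <= B /\ cabs (dPhi h a j l e xi) <= B * (1 + `|xi|).
  by move=> l; have [B B0 HB] := Phi_le sa_h sa_a j l; exists B.
pose BB := \sum_(l < 2) B l.
have B0 : 0 <= BB by apply: sumr_ge0 => l _; case: (HB l).
have S1 e xi : `|e| <= 1 -> cabs (\sum_(l < 2) Phi h a j l e xi) <= BB.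
  move=> e1; apply: le_trans (cabs_sum _ _ _) _; apply: ler_sum => l _.
  by have [_ H] := HB l; case: (H e xi e1).
have S2 e xi : `|e| <= 1 -> cabs (\sum_(l < 2) dPhi h a j l e xi) <= BB * (1 + `|xi|).
  move=> e1; apply: le_trans (cabs_sum _ _ _) _; rewrite mulr_suml; apply: ler_sum => l _.
  by have [_ H] := HB l; case: (H e xi e1).
have [mb1 _ ] : cmeas (setT : set TR) b /\ True by split=> //; exact: schwartz_cmeas.
have b1 xi : cabs (b xi) <= C * W1 xi.
  apply: le_trans (HC xi); rewrite expr1 ler_peMl ?cabs_ge0// lerDl.
  exact: normr_ge0.
have D : is_cderive (fun e => cI leb setT (fun t => b t * \sum_(l < 2) Phi h a j l e t)) 0
    (cI leb setT (fun t => b t * \sum_(l < 2) dPhi h a j l 0 t)).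
  apply: (@is_cderive_int _ _ _ leb (fun e t => b t * \sum_(l < 2) Phi h a j l e t)
    (fun e t => b t * \sum_(l < 2) dPhi h a j l e t) (fun t => BB * C * W1 t)).
  - move=> e t; apply: is_cderiveZ; apply: is_cderive_sum => l; exact: Phi_der.
  - move=> e e1; apply: (@cintg_W1 _ _ (BB * C)).
      by apply: cmeasM => //; apply: cmeas_sum => l; exact: Phi_meas.
    move=> t; rewrite cabsM mulrC -mulrA; apply: ler_pM; rewrite ?cabs_ge0//; exact: S1.
  - move=> e t e1; rewrite cabsM mulrC.
    apply: le_trans (ler_wpM2r (cabs_ge0 _) (S2 e t e1)) _.
    by rewrite -!mulrA ler_wpM2l//; have := HC t; rewrite expr1.
  - exact: W1C_intg.
(* The integral formula holds for $|e|\le1$, and agreement near 0 determines the derivative. *)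
have N : \forall e \near (0 : R), cI leb setT (fun t => b t * \sum_(l < 2) Phi h a j l e t) =
    functional (sv h + e%:C *: sv a).
  apply/nbhs_ballP; exists 1 => //= e; rewrite /ball /= sub0r normrN => /ltW e1.
  by rewrite functional_eq.
by case: D => D1 D2; split; [apply: near_eq_is_derive D1|apply: near_eq_is_derive D2];
  apply: filterS N => e ->.
Qed.

Lemma dPhi_meas l e : cmeas (setT : set TR) (dPhi h a j l e).
Proof.
have mE z (psi : TR -> TR) : measurable_fun setT psi -> smeas (fun t : TR => E (hE h a e) (z + (0 +i* psi t))).
  by move=> ?; exact: smeas_Ei.
have mD z (psi : TR -> TR) : measurable_fun setT psi -> smeas (fun t : TR => DE (hE h a e) a (z + (0 +i* psi t))).
  by move=> ?; exact: smeas_DEi.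
have W := @measurable_id _ TR setT; have O := @mopp R.
have P4 (X1 X2 X3 X4 : TR -> St) : smeas X1 -> smeas X2 -> smeas X3 -> smeas X4 ->
    cmeas setT (fun t => tr (X1 t * X2 t * X3 t * X4 t)).
  by move=> m1 m2 m3 m4; exact: (smeasM (smeasM (smeasM m1 m2) m3) m4 (0, 0)).
have mw : smeas (fun t : TR => E (hE h a e) (wz j t)) := mE j%:C _ W.
have mn : smeas (fun t : TR => E (hE h a e) (nz t)) := mE 0 _ O.
have dw : smeas (fun t : TR => DE (hE h a e) a (wz j t)) := mD j%:C _ W.
have dn : smeas (fun t : TR => DE (hE h a e) a (nz t)) := mD 0 _ O.
have cN : smeas (fun _ : TR => NE h a l e) := smeas_cst _ _.
have cD : smeas (fun _ : TR => nab l (DE (hE h a e) a 1)) := smeas_cst _ _.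
exact: (cmeasD (cmeasD (cmeasD (P4 _ _ _ _ dw cN mn cN) (P4 _ _ _ _ mw cD mn cN))
  (P4 _ _ _ _ mw cN dn cN)) (P4 _ _ _ _ mw cN mn cD)).
Qed.

Lemma dk_pow z : nc_mul theta (delta_k theta (sv h) (sv a)) (nc_pow theta (sv h) z) = sv (DE h a 1 * E h z).
Proof. by rewrite delta_kE /nc_pow nc_expE svM. Qed.

(** [dPhi_match] summed over [l], with its right side read back through [rep_fcalc1] and
    [rep_fcalc2] as the functional calculus at [h]. *)
Lemma value_eq : cI leb setT (fun t => b t * \sum_(l < 2) dPhi h a j l 0 t) =
  phi0 (nc_mul theta (nc_mul theta (delta_k theta (sv h) (sv a)) (nc_pow theta (sv h) j%:C))
    (fcalc1 theta (sv h) (Ifun T j) (\sum_(l < 2) nabla l (nabla l (nc_exp theta (sv h)))))) +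
  phi0 (nc_mul theta (nc_mul theta (delta_k theta (sv h) (sv a)) (nc_pow theta (sv h) (j - 1)%:C))
    (\sum_(l < 2) fcalc2 theta (sv h) (IIfun T j) (nabla l (nc_exp theta (sv h))) (nabla l (nc_exp theta (sv h))))).
Proof.
have nh : 2 * nc_norm theta (sv h) + 1 <= M.
  by have := nc_norm_le h; have := snu_ge0 0 a; move: M_ge; lra.
have [gI [mbI igI] bgI] := decay_line sbI.
have [C2 HC2] := schwartz_W2 sb2; have mb2 := schwartz_cmeas2 sb2.
have ig2 : leb2.-integrable setT (EFin \o (fun t => C2 * W2 t)) := W2C_intg C2.
have -> : \sum_(l < 2) nabla l (nabla l (nc_exp theta (sv h))) = sv (\sum_(l < 2) nab l (nab l (E h 1))).
  by apply/funext => p; rewrite fct_sumE sv_sum; apply: eq_bigr => l _; rewrite nc_exp1.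
rewrite (dk_pow j%:C) (dk_pow (j - 1)%:C).
have fKI x : `|x| < 2 * nc_norm theta (sv h) + 1 -> fI x = Ifun T j (expR x).
  by move=> H; apply: fIT; apply: le_trans (ltW H) nh.
have fK2 z : `|z.1| < 2 * nc_norm theta (sv h) + 1 -> `|z.2| < 2 * nc_norm theta (sv h) + 1 ->
    f2 z = IIfun T j (expR z.1) (expR z.2).
  by move=> H1 H2; apply: f2T; [apply: le_trans (ltW H1) nh|apply: le_trans (ltW H2) nh].
have e1 := rep_tr (rep_mull mbI bgI igI (DE h a 1 * E h j%:C)
  (rep_fcalc1 sa_h sfI sbI fKI fbI (\sum_(l < 2) nab l (nab l (E h 1))))).
have r2 (l : 'I_2) : rep leb2 b2
    (fun t => E h (0 + (0 +i* t.1)) * nab l (E h 1) * E h (0 + (0 +i* (t.2 - t.1))) * nab l (E h 1) * E h (nz t.2))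
    (fcalc2 theta (sv h) (IIfun T j) (nabla l (nc_exp theta (sv h))) (nabla l (nc_exp theta (sv h)))).
  rewrite nabla_exp; exact: (rep_fcalc2 sa_h sf2 sb2 fK2 fb2).
have e2 := rep_tr (rep_mull mb2 HC2 ig2 (DE h a 1 * E h (j - 1)%:C) (rep_sum mb2 HC2 ig2 r2)).
have HL : cI leb setT (fun t => b t * \sum_(l < 2) dPhi h a j l 0 t) =
    \sum_(l < 2) cI leb setT (fun t => b t * dPhi h a j l 0 t).
  rewrite -cI_sum//.
    by apply: cI_eq => t _; rewrite mulr_sumr.
  move=> l; have [B B0 HB] := Phi_le sa_h sa_a j l; have [C HC] := schwartz_W1 1 sb.
  apply: (@cintg_W1 _ _ (B * C)).
    apply: cmeasM; first exact: schwartz_cmeas.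
    exact: dPhi_meas.
  move=> t; rewrite cabsM mulrC; have [_ H] : cabs (Phi h a j l 0 t) <= B /\ cabs (dPhi h a j l 0 t) <= B * (1 + `|t|).
    by apply: HB; rewrite normr0.
  apply: le_trans (ler_wpM2r (cabs_ge0 _) H) _.
  by rewrite -!mulrA ler_wpM2l//; have := HC t; rewrite expr1.
apply: (etrans HL).
rewrite (eq_bigr _ (fun l _ => (dPhi_match l).1)) big_split /=; congr (_ + _).
- rewrite -cI_sum//; last by move=> l; case: (dPhi_match l) => _ [].
  apply: (etrans _ (esym e1)); apply: cI_eq => t _; rewrite -mulr_sumr; congr (bI t * _).
  have A1 (D P S V : St) (X : 'I_2 -> St) : \sum_l tr (D * (P * S) * X l * V * 1 * 1) =
      tr (D * P * (S * (\sum_l X l) * V)).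
    rewrite mulr_sumr mulr_suml mulr_sumr tr_sum; apply: eq_bigr => l _.
    by rewrite !mulr1 !mulrA.
  apply: (etrans _ (A1 _ _ _ _ _)); apply: eq_bigr => l _.
  exact: (congr1 (fun V : St => tr (DE h a 1 * V * nab l (nab l (E h 1)) * E h (nz t) * 1 * 1)) (E_wz h j t)).
- rewrite -cI_sum//; last by move=> l; case: (dPhi_match l) => _ [].
  apply: (etrans _ (esym e2)); apply: cI_eq => t _; rewrite -mulr_sumr; congr (b2 t * _).
  have A2 (D P S V W : St) (X : 'I_2 -> St) : \sum_l tr (D * (P * S) * X l * V * X l * W) =
      tr (D * P * (\sum_l S * X l * V * X l * W)).
    by rewrite mulr_sumr tr_sum; apply: eq_bigr => l _; rewrite !mulrA.
  apply: (etrans _ (A2 _ _ _ _ _ _)); apply: eq_bigr => l _.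
  apply: (etrans (congr1 (fun V : St => tr (DE h a 1 * V * DE h (nab l h) 1 * E h (0 + (0 +i* (t.2 - t.1))) *
    DE h (nab l h) 1 * E h (nz t.2))) (E_wz h (j - 1) t.1))).
  exact: (congr1 (fun V : St => tr (DE h a 1 * (E h (j - 1)%:C * E h (0 + (0 +i* t.1))) * V *
    E h (0 + (0 +i* (t.2 - t.1))) * V * E h (nz t.2))) (esym (nab_E h l 1))).
Qed.

End Final.

Theorem theorem3p10 (R : realType) (theta : R) (h a : nctorus R) (j : R)
    (T : R -> R[i])
    (irr_theta : irrational theta)
    (smooth_h : nc_smooth h) (sa_h : nc_star theta h = h)
    (smooth_a : nc_smooth a) (sa_a : nc_star theta a = a)
    (smooth_T : smooth_on [set u : R | 0 < u] T) :
  let k := nc_exp theta h in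
  let dk := delta_k theta h a in
  is_variation h a
    (fun g => let kg := nc_exp theta g in
      phi0 (nc_pow theta g j%:C **[theta]
        (\sum_(l < 2) fcalc1 theta g T (nabla l kg) **[theta] nabla l kg)))
    (phi0 (dk **[theta] nc_pow theta h j%:C **[theta]
       fcalc1 theta h (Ifun T j) (\sum_(l < 2) nabla l (nabla l k)))
     + phi0 (dk **[theta] nc_pow theta h (j - 1)%:C **[theta]
       (\sum_(l < 2) fcalc2 theta h (IIfun T j) (nabla l k) (nabla l k)))).
Proof.
move=> k dk.
pose hS := mkS theta ((smthP h).1 smooth_h); pose aS := mkS theta ((smthP a).1 smooth_a).
have sa_hS : starS hS = hS by apply: st_eq => m; exact: (congr1 (fun g : nctorus R => g m) sa_h).
have sa_aS : starS aS = aS by apply: st_eq => m; exact: (congr1 (fun g : nctorus R => g m) sa_a).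
pose M := 2 * (snu 0 hS + snu 0 aS) + 2.
have M0 : 0 < M by rewrite ltr_wpDl// mulr_ge0// addr_ge0 ?snu_ge0.
have [f [b [sf sb fT fb]]] := fourier1 M0 (cSM_T smooth_T).
have [fI [bI [sfI sbI fIT fbI]]] := fourier1 M0 (cSM_Ifun j smooth_T).
have [f2 [b2 [sf2 sb2 f2T fb2]]] := fourier2 M0 (fun e => cSM_IIfun j smooth_T (SM_coord e).1 (SM_coord e).2).
have D := functional_der sa_hS sa_aS j (lexx M) sf sb fb fT.
have V := value_eq sa_hS sa_aS (lexx M) sb fb sfI sbI fbI sf2 sb2 fb2 fT fIT f2T.
rewrite V in D; exact: D.
Qed.
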